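(* The map $\Phi\colon \mathrm{Con}^{\bar\mu}_{\bar\nu}(\mathbb{P}^1,D)\longrightarrow \mathrm{Con}^{\boldsymbol\mu}_{\boldsymbol\nu}(C,T)$ is symplectic up to a factor of $2$: $$\Phi^*\omega_C^{AB}=2\,\omega_{\mathbb{P}^1}^{AB}.$$
   Context: Let $\lambda\in\mathbb{C}\setminus\{0,1\}$, let $C\subset\mathbb{P}^2$ be the elliptic curve with affine equation $y^2=x(x-1)(x-\lambda)$, and $\pi\colon C\to\mathbb{P}^1$, $(x,y)\mapsto x$, with ramification points $\mathbf{w}_0,\mathbf{w}_1,\mathbf{w}_\lambda,\mathbf{w}_\infty$ over $x=0,1,\lambda,\infty$. Let $t\in\mathbb{P}^1\setminus\{0,1,\lambda,\infty\}$, $\pi^{-1}(t)=\{\mathbf{t}_1,\mathbf{t}_2\}$, $W=0+1+\lambda+\infty$, $D=W+t$, $\mathbf{W}=\mathbf{w}_0+\mathbf{w}_1+\mathbf{w}_\lambda+\mathbf{w}_\infty$, $T=\mathbf{t}_1+\mathbf{t}_2$. Fix $\nu\in\mathbb{C}$ with $2\nu\notin\mathbb{Z}$ and a real number $0<\mu<1$. Parabolic connections. A rank 2 parabolic bundle on a marked curve $(X,Z)$ is a rank 2 bundle $E$ with a line $\ell_p\subset E|_p$ for each $p\in Z$ and weights $\mu_p\in[0,1]$. Given residual eigenvalues $\nu_p^{\pm}$, a parabolic connection $(E,\nabla,\bar\ell)$ is a parabolic bundle with a logarithmic connection $\nabla\colon E\to E\otimes\Omega^1_X(Z)$ whose residue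 at $p$ has eigenvalues $\nu_p^\pm$ and acts on $\ell_p$ by $\nu_p^+$. Throughout, bundles have trivial determinant and connections zero trace. On $(\mathbb{P}^1,D)$: $\bar\nu=(\pm\frac14,\pm\frac14,\pm\frac14,\pm\frac14,\pm\nu)$, $\bar\mu=(\frac12,\frac12,\frac12,\frac12,\mu)$ at $(0,1,\lambda,\infty,t)$. On $(C,T)$: $\boldsymbol\nu=(\pm\nu,\pm\nu)$, $\boldsymbol\mu=(\mu,\mu)$. The parabolic degree of a line subbundle $L\subset E$ is $\deg E-2\deg L+\sum_{\ell_p\not\subset L}\mu_p-\sum_{\ell_p\subset L}\mu_p$; a parabolic connection is semistable if this is $\ge0$ for every $\nabla$-invariant $L$. $\mathrm{Con}^{\bar\mu}_{\bar\nu}(\mathbb{P}^1,D)$ and $\mathrm{Con}^{\boldsymbol\mu}_{\boldsymbol\nu}(C,T)$ are the (GIT) moduli spaces of semistable parabolic connections; in the latter, reducible connections are identified with their diagonal reductions ($s$-equivalence). Elementary transformations. The negative elementary transformation of $(E,\bar\ell)$ at $p$ is $E^-=\ker(E\to E|_p/\ell_p)$ with new line $\ker(E^-|_p\to E|_p)$; the positive one is the twist by $\mathcal{O}(p)$ followed by the negative one (with the induced connection, $(\nu^+,\nu^-)\mapsto(\nu^-,\nu^+-1)$). The map $\Phi$. Given $(E,\nabla,\bar\ell)$ on $(\mathbb{P}^1,D)$: (i) pull back by $\pi$; (ii) perform a positive elementary transformation at each point of $\mathbf{W}$; (iii) tensor with $(\mathcal{O}_C(-2\mathbf{w}_\infty),\xi)$,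 where $\xi$ is the pullback of the rank 1 connection on $\mathcal{O}_{\mathbb{P}^1}(-\infty)$ given by $\mathrm{d}+\frac14\frac{\mathrm{d}P}{P}$, $P=x(x-1)(x-\lambda)$; (iv) the result is holomorphic at $\mathbf{W}$, so forget $\mathbf{W}$. The result represents $\Phi(\nabla)$. Symplectic forms. $\omega^{AB}_{\mathbb{P}^1}$ and $\omega^{AB}_C$ are the Atiyah--Bott symplectic structures on the two moduli spaces of connections; they are the pullbacks, under the Riemann--Hilbert (monodromy) map, of the Goldman--Iwasaki forms on spaces of $\mathrm{SL}_2(\mathbb{C})$-representations $\rho$ of the fundamental group of the punctured curve $S$ with fixed local conjugacy classes, given by $\omega^{\mathrm{IG}}(\alpha,\beta)=\int_S\mathrm{tr}(\alpha\wedge\beta)$ for tangent vectors $\alpha,\beta$ in the subspace of $H^1_{\mathrm{dR}}(S,E_\rho)$ of classes represented by compactly supported closed forms, $E_\rho$ being the flat $\mathfrak{sl}_2(\mathbb{C})$-bundle with monodromy $\mathrm{Ad}_\rho$. *)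

(* Defs.v *)
From HB Require Import structures.
From mathcomp Require Import all_boot all_order all_algebra.
From mathcomp Require Import complex.
From mathcomp Require Import all_classical all_reals all_analysis.

Set Implicit Arguments.
Unset Strict Implicit.
Unset Printing Implicit Defensive.

Import Order.TTheory GRing.Theory Num.Theory.
Import numFieldNormedType.Exports.

Local Open Scope classical_set_scope.
Local Open Scope ring_scope.
Local Open Scope complex_scope.

(** Conventions.

    A compact Riemann surface over the x-line (here P^1 or C) is given by its
    points, its neighbourhoods and a local parameter at every point.  Functions
    on it are total functions whose values at finitely many points carry no
    information: a germ at p is always read on a punctured neighbourhood of p.

    A vector bundle of rank 2 is given by its generic fibre, trivialized by
    rational sections, and by its stalks: the stalk at p is spanned by the
    columns of a matrix [g p] of rational functions (the local frame at p), and
    [g p] is a basis of the standard stalk for all but finitely many p.  A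
    parabolic line at p is recorded by choosing [g p] adapted to it: the line is
    spanned by the first column.  A connection is d + A dx. *)

(** ** Smooth functions of two real variables *)

Section Smooth.
Variable R : realType.

Definition pd1 (u : R * R -> R) (z : R * R) : R := derive1 (fun s => u (s, z.2)) z.1.
Definition pd2 (u : R * R -> R) (z : R * R) : R := derive1 (fun s => u (z.1, s)) z.2.

(** [w] lists the successive partial derivatives. *)
Definition smooth_on (U : set (R * R)) (u : R * R -> R) : Prop :=
  forall w : seq bool,
    let v := foldr (fun b f => if b then pd1 f else pd2 f) u w in
    forall z, U z ->
      [/\ {for z, continuous v},
          derivable (fun s => v (s, z.2)) z.1 1 &
          derivable (fun s => v (z.1, s)) z.2 1].

Definition csmooth_on (U : set (R * R)) (F : R * R -> R[i]) : Prop :=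
  smooth_on U (fun z => complex.Re (F z)) /\
  smooth_on U (fun z => complex.Im (F z)).

Definition toC (z : R * R) : R[i] := z.1 +i* z.2.
Definition ofC (z : R[i]) : R * R := (complex.Re z, complex.Im z).

Definition cpd1 (F : R * R -> R[i]) (z : R * R) : R[i] :=
  pd1 (fun a => complex.Re (F a)) z +i* pd1 (fun a => complex.Im (F a)) z.
Definition cpd2 (F : R * R -> R[i]) (z : R * R) : R[i] :=
  pd2 (fun a => complex.Re (F a)) z +i* pd2 (fun a => complex.Im (F a)) z.

Definition plane_integral (F : R * R -> R[i]) : R[i] :=
  let leb2 := (@lebesgue_measure R \x @lebesgue_measure R)%E in
  Rintegral leb2 setT (fun z => complex.Re (F z)) +i*
  Rintegral leb2 setT (fun z => complex.Im (F z)).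

End Smooth.

(** ** Curves over the x-line *)

(** - [points]: the points of the curve, inside the ambient type [pt];
    - [ball p e]: basic neighbourhoods of p, for real e > 0;
    - [unif p]: a local parameter at p;
    - [lift q u]: for all but finitely many q, the point near q whose
      x-coordinate is x(q) + u, for small u;
    - [sheets x]: for all but finitely many complex x, the points above x;
    - [rational]: the field of rational functions. *)
Record curve (R : realType) := Curve {
  pt : choiceType;
  points : set pt;
  ball : pt -> R[i] -> set pt;
  unif : pt -> pt -> R[i];
  lift : pt -> R[i] -> pt;
  sheets : R[i] -> seq pt;
  rational : (pt -> R[i]) -> Prop
}.

Definition P1 (R : realType) : curve R := {|
  pt := option R[i];
  points := setT;
  ball := fun p e q =>
    match p, q with
    | Some a, Some x => `|x - a| < e
    | Some _, None => False
    | None, Some x => e^-1 < `|x|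
    | None, None => True
    end;
  unif := fun p q =>
    match p, q with
    | Some a, Some x => x - a
    | None, Some x => x^-1
    | _, None => 0
    end;
  lift := fun q u => omap (fun x => x + u) q;
  sheets := fun x => [:: Some x];
  rational := fun f => exists n d : {poly R[i]}, d != 0 /\
    forall x, d.[x] != 0 -> f (Some x) = n.[x] / d.[x]
|}.

Definition legendre (R : realType) (lam : R[i]) : {poly R[i]} :=
  'X * ('X - 1) * ('X - lam%:P).

(** The curve y^2 = x(x-1)(x-lam).  Its point at infinity is [None].  The local
    parameter is y at the three finite branch points and x/y at infinity.
    [sqrtc] is the principal square root, so that [lift] is holomorphic in u
    near 0 whenever y <> 0. *)
Definition ell (R : realType) (lam : R[i]) : curve R :=
  let P := legendre lam in {|
  pt := option (R[i] * R[i])%type;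
  points := [set q | if q is Some (x, y) then y ^+ 2 = P.[x] else True];
  ball := fun p e q =>
    match p, q with
    | Some (a, b), Some (x, y) => `|x - a| < e /\ `|y - b| < e
    | Some _, None => False
    | None, Some (x, _) => e^-1 < `|x|
    | None, None => True
    end;
  unif := fun p q =>
    match p, q with
    | Some (a, b), Some (x, y) => if b == 0 then y else x - a
    | None, Some (x, y) => x / y
    | _, None => 0
    end;
  lift := fun q u =>
    omap (fun xy => (xy.1 + u, xy.2 * sqrtc (P.[xy.1 + u] / P.[xy.1]))) q;
  sheets := fun x => [:: Some (x, sqrtc P.[x]); Some (x, - sqrtc P.[x])];
  rational := fun f => exists n1 n2 d : {poly R[i]}, d != 0 /\
    forall x y, y ^+ 2 = P.[x] -> d.[x] != 0 ->
      f (Some (x, y)) = (n1.[x] + n2.[x] * y) / d.[x]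
|}.

Section Curve.
Variables (R : realType) (X : curve R).
Local Notation C := (R[i]).
Local Notation pt := (pt X).
Local Notation fct := (pt -> C).
Local Notation mfct := (pt -> 'M[C]_2).
Local Notation z := (@unif R X).

Definition off_finite (Q : pt -> Prop) : Prop :=
  exists s : seq pt, forall q, points q -> q \notin s -> Q q.

(** punctured neighbourhoods *)
Definition around (p : pt) (Q : pt -> Prop) : Prop :=
  exists2 e : C, 0 < e & forall q, points q -> ball p e q -> q != p -> Q q.

Definition tends (p : pt) (f : fct) (c : C) : Prop :=
  forall e : C, 0 < e -> around p (fun q => `|f q - c| < e).
Definition mtends (p : pt) (M : mfct) (N : 'M[C]_2) : Prop :=
  forall i j, tends p (fun q => M q i j) (N i j).

(** A rational function is regular at p iff it has a finite limit there. *)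
Definition mregular (p : pt) (M : mfct) : Prop := exists N, mtends p M N.

Definition mrational (M : mfct) : Prop :=
  forall i j, rational (fun q => M q i j).

(** d f = (del f) dx + (dbar f) d(conj x) *)
Definition del (f : fct) (q : pt) : C :=
  let F u := f (lift q (toC u)) in
  (cpd1 F (0, 0) - 'i * cpd2 F (0, 0)) / 2%:R.
Definition dbar (f : fct) (q : pt) : C :=
  let F u := f (lift q (toC u)) in
  (cpd1 F (0, 0) + 'i * cpd2 F (0, 0)) / 2%:R.
Definition mdel (M : mfct) : mfct :=
  fun q => \matrix_(i, j) del (fun q' => M q' i j) q.
Definition mdbar (M : mfct) : mfct :=
  fun q => \matrix_(i, j) dbar (fun q' => M q' i j) q.

(** a dx = (a * dxdz p) d(z p) *)
Definition dxdz (p : pt) (q : pt) : C := (del (z p) q)^-1.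

Definition smooth_at (p : pt) (f : fct) : Prop :=
  exists (F : R * R -> C) (U : set (R * R)),
    [/\ open U, U (0, 0), csmooth_on U F &
        around p (fun q => U (ofC (z p q)) /\ f q = F (ofC (z p q)))].
Definition msmooth_at (p : pt) (M : mfct) : Prop :=
  forall i j, smooth_at p (fun q => M q i j).

(** ** Parabolic connections *)

Record pconn := PConn { cA : mfct; cg : pt -> mfct }.

(** endomorphisms and connection matrices read in the frame at p *)
Definition in_frame (E : pconn) (p : pt) (M : mfct) : mfct :=
  fun q => invmx (cg E p q) *m M q *m cg E p q.
Definition conn_in_frame (E : pconn) (p : pt) : mfct :=
  fun q => invmx (cg E p q) *m (cA E q *m cg E p q + mdel (cg E p) q).

Definition is_bundle (E : pconn) : Prop :=
  [/\ forall p, points p -> mrational (cg E p),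
      forall p, points p -> off_finite (fun q => \det (cg E p q) != 0) &
      off_finite (fun p =>
        exists2 N : 'M[C]_2, mtends p (cg E p) N & \det N != 0)].

(** (det E, tr nabla) is isomorphic to the trivial bundle with connection d:
    [delta] is a horizontal generator of det E. *)
Definition trivial_det (E : pconn) : Prop :=
  exists delta : fct,
    [/\ rational delta,
        off_finite (fun q => delta q != 0),
        forall p, points p -> exists2 c : C, c != 0 &
          tends p (fun q => \det (cg E p q) / delta q) c &
        off_finite (fun q => del delta q + \tr (cA E q) * delta q = 0)].

(** Logarithmic poles on D; at p in D the residue has eigenvalues nu p, - nu p
    and acts on the parabolic line (the first frame vector) by nu p. *)
Definition is_log_conn (D : seq pt) (nu : pt -> C) (E : pconn) : Prop :=
  [/\ mrational (cA E),
      forall p, points p -> p \notin D ->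
        mregular p (fun q => dxdz p q *: conn_in_frame E p q) &
      forall p, p \in D -> exists N : 'M[C]_2,
        [/\ mtends p (fun q => (z p q * dxdz p q) *: conn_in_frame E p q) N,
            N 0 0 = nu p, N 1 1 = - nu p & N 1 0 = 0]].

(** A nonzero rational section s spans generically a line subbundle L.  Its order
    at p is [n p], and [v p] is the value at p of z^(- n p) s in the frame
    at p, which spans the fibre of L at p; deg L is the sum of the [n p]. *)
Definition section_data (E : pconn) (s : pt -> 'cV[C]_2)
    (n : pt -> int) (v : pt -> 'cV[C]_2) : Prop :=
  (forall i, rational (fun q => s q i 0)) /\
  forall p, points p -> v p != 0 /\
    forall i, tends p
      (fun q => (z p q) ^ (- n p) * (invmx (cg E p q) *m s q) i 0) (v p i 0).

Definition invariant_section (E : pconn) (s : pt -> 'cV[C]_2) : Prop :=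
  off_finite (fun q => exists c : C,
    (\col_i del (fun q' => s q' i 0) q) + cA E q *m s q = c *: s q).

(** deg E = 0 since det E is trivial. *)
Definition semistable (D : seq pt) (mu : pt -> R) (E : pconn) : Prop :=
  forall s n v, section_data E s n v -> invariant_section E s ->
    let deg_L : int := \sum_(p \in @points R X) n p in
    0 <= - (2%:R * deg_L%:~R)
         + \sum_(p <- D) (if v p 1 0 == 0 then - mu p else mu p).

(** The objects parametrized by the moduli space Con^mu_nu(X, D). *)
Definition Con (D : seq pt) (nu : pt -> C) (mu : pt -> R) (E : pconn) : Prop :=
  [/\ is_bundle E, trivial_det E, is_log_conn D nu E & semistable D mu E].

(** ** Tangent vectors and the Atiyah--Bott form *)

(** First order deformation, over C[eps] with eps^2 = 0: the connection is
    d + (A + eps B) dx and the frame at p is (1 + eps h_p) g_p. *)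
Record deformation := Deformation { dB : mfct; dh : pt -> mfct }.

Definition deform (s : C) (E : pconn) (v : deformation) : pconn :=
  PConn (fun q => cA E q + s *: dB v q)
        (fun p q => (1%:M + s *: dh v p q) *m cg E p q).

Definition comm (M N : 'M[C]_2) : 'M[C]_2 := M *m N - N *m M.

(** covariant derivative of a section f of End E *)
Definition nabla10 (E : pconn) (f : mfct) : mfct :=
  fun q => mdel f q + comm (cA E q) (f q).

(** The eps-part of the connection matrix in the frame (1 + eps h_p) g_p is
    g_p^-1 (B + nabla h_p) g_p.  At p in D the residue stays upper triangular
    with the same diagonal, so its eps-part is strictly upper triangular. *)
Definition is_deformation (D : seq pt) (E : pconn) (v : deformation) : Prop :=
  let M p q := in_frame E p (fun q' => dB v q' + nabla10 E (dh v p) q') q in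
  [/\ mrational (dB v) /\ (forall p, points p -> mrational (dh v p)),
      off_finite (fun q => \tr (dB v q) = 0) /\
        (forall p, points p -> off_finite (fun q => \tr (dh v p q) = 0)),
      off_finite (fun p => mregular p (in_frame E p (dh v p))),
      forall p, points p -> p \notin D ->
        mregular p (fun q => dxdz p q *: M p q) &
      forall p, p \in D -> exists N : 'M[C]_2,
        [/\ mtends p (fun q => (z p q * dxdz p q) *: M p q) N,
            N 0 0 = 0, N 1 1 = 0 & N 1 0 = 0]].

(** The 1-form a dx + b d(conj x) is [(a, b)]. *)
Definition form1 : Type := (mfct * mfct)%type.

Definition form_smooth_at (E : pconn) (p : pt) (a : form1) : Prop :=
  msmooth_at p (fun q => dxdz p q *: in_frame E p a.1 q) /\
  msmooth_at p (fun q => conjc (dxdz p q) *: in_frame E p a.2 q).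

(** Smooth closed 1-forms with values in End_0 E on S = X \ D, with compact
    support in S. *)
Definition closed_cs_form (D : seq pt) (E : pconn) (a : form1) : Prop :=
  [/\ forall p, points p -> p \notin D -> form_smooth_at E p a,
      off_finite (fun q => \tr (a.1 q) = 0 /\ \tr (a.2 q) = 0),
      off_finite (fun q => nabla10 E a.2 q - mdbar a.1 q = 0) &
      forall p, p \in D -> around p (fun q => a.1 q = 0 /\ a.2 q = 0)].

(** [a] represents the class of v in H^1_dR(S, End_0 E), which is the image of v
    under the differential of the monodromy map: if f - h_p is smooth at every p
    in S, then 1 + eps f is a smooth isomorphism from E to its deformation on S,
    and it pulls the deformed connection back to nabla + eps (B dx + nabla f). *)
Definition represents (D : seq pt) (E : pconn) (v : deformation) (a : form1) :
    Prop :=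
  exists f : mfct,
    [/\ off_finite (fun q => \tr (f q) = 0),
        forall p, points p -> p \notin D ->
          msmooth_at p (in_frame E p (fun q => f q - dh v p q)) &
        off_finite (fun q =>
          a.1 q = dB v q + nabla10 E f q /\ a.2 q = mdbar f q)].

(** Tangent vectors are the deformations whose class in H^1_dR(S, End_0 E) is
    represented by a compactly supported closed form. *)
Definition tangent (D : seq pt) (E : pconn) (v : deformation) : Prop :=
  is_deformation D E v /\
  exists a, closed_cs_form D E a /\ represents D E v a.

(** The integral of tr(a /\ b) over S, computed on the x-plane;
    dx /\ d(conj x) = - 2 i dx_1 dx_2. *)
Definition int_tr_wedge (a b : form1) : C :=
  plane_integral (fun u => \sum_(q <- sheets X (toC u))
    (- 2%:R * 'i) * \tr (a.1 q *m b.2 q - a.2 q *m b.1 q)).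

(** By Stokes the integral only depends on the classes, so the set below is a
    singleton when v and w are tangent vectors. *)
Definition omegaAB (D : seq pt) (E : pconn) (v w : deformation) : C :=
  xget 0 [set c | exists a b,
    [/\ closed_cs_form D E a, represents D E v a,
        closed_cs_form D E b, represents D E w b & c = int_tr_wedge a b]].

(** ** Elementary transformations and twists *)

(** E^- = span (e_1, z e_2), with new line spanned by z e_2. *)
Definition elem_neg (p : pt) (E : pconn) : pconn :=
  PConn (cA E) (fun p' q =>
    if p' == p then
      cg E p q *m \matrix_(i, j) (if (i == 0) && (j == 1) then 1
                                  else if (i == 1) && (j == 0) then z p q
                                  else 0)
    else cg E p' q).

(** tensor product with O(p), and the connection d on O(p) *)
Definition twist_point (p : pt) (E : pconn) : pconn :=
  PConn (cA E) (fun p' q =>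
    if p' == p then (z p q)^-1 *: cg E p q else cg E p' q).

Definition elem_pos (p : pt) (E : pconn) : pconn :=
  elem_neg p (twist_point p E).

(** rank 1 connections d + la dx, with frame [lg p] at p *)
Record lconn := LConn { la : fct; lg : pt -> fct }.

Definition tensor (E : pconn) (L : lconn) : pconn :=
  PConn (fun q => cA E q + (la L q)%:M) (fun p q => lg L p q *: cg E p q).

End Curve.

(** ** The map Phi *)

Section Phi.
Variables (R : realType) (lam : R[i]).
Local Notation C := (R[i]).
Local Notation EC := (ell lam).
Local Notation L1 := (P1 R).

Definition piC : pt EC -> pt L1 := omap (fun xy : C * C => xy.1).

Definition pullback (E : pconn L1) : pconn EC :=
  PConn (X := EC) (fun q => cA E (piC q)) (fun p q => cg E (piC p) (piC q)).

Definition lpullback (L : lconn L1) : lconn EC :=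
  LConn (X := EC) (fun q => la L (piC q)) (fun p q => lg L (piC p) (piC q)).

(** O(-infty) on P^1 with the connection d + (1/4) dP/P *)
Definition xi0 : lconn L1 :=
  LConn (X := L1)
    (fun q => if q is Some x
              then 4%:R^-1 * ((deriv (legendre lam)).[x] / (legendre lam).[x])
              else 0)
    (fun p q => if p is None then unif (c := L1) None q else 1).

Definition Wpts : seq (pt EC) :=
  [:: Some (0, 0); Some (1, 0); Some (lam, 0); None].

(** Forgetting the parabolic structure over W leaves the data unchanged: the
    markings are the argument [D] of the predicates above. *)
Definition Phi (E : pconn L1) : pconn EC :=
  tensor (foldr (@elem_pos R EC) (pullback E) Wpts) (lpullback xi0).

(** Frames of [Phi E] are frames of E composed with piC and multiplied on the
    right by matrices independent of E, whence the differential of Phi. *)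
Definition dPhi (v : deformation L1) : deformation EC :=
  Deformation (X := EC) (fun q => dB v (piC q))
                        (fun p q => dh v (piC p) (piC q)).

Lemma Phi_deform (s : C) (E : pconn L1) (v : deformation L1) :
  Phi (deform s E v) = deform s (Phi E) (dPhi v).
Proof.
have neg p F w : elem_neg p (deform s F w) = deform s (elem_neg p F) w
    :> pconn EC.
  rewrite /elem_neg /deform /=; congr PConn.
  apply/funext => p'; apply/funext => q.
  by case: eqP => // ->; rewrite mulmxA.
have tw p F w : twist_point p (deform s F w) = deform s (twist_point p F) w
    :> pconn EC.
  rewrite /twist_point /deform /=; congr PConn.
  apply/funext => p'; apply/funext => q.
  by case: eqP => // ->; rewrite scalemxAr.
have pos p F w : elem_pos p (deform s F w) = deform s (elem_pos p F) w
    :> pconn EC by rewrite /elem_pos tw neg.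
rewrite /Phi /= -[pullback (deform s E v)]/(deform s (pullback E) (dPhi v)).
rewrite !pos /tensor /deform; congr PConn.
  by apply/funext => q; rewrite /= addrAC.
by apply/funext => p; apply/funext => q; rewrite -scalemxAr.
Qed.

(** markings, exponents and weights *)
Section Data.
Variables (t nu : C) (mu : R).

Definition D_P1 : seq (pt L1) := [:: Some 0; Some 1; Some lam; None; Some t].
Definition nu_P1 (p : pt L1) : C := if p == Some t then nu else 4%:R^-1.
Definition mu_P1 (p : pt L1) : R := if p == Some t then mu else 2%:R^-1.

Definition T_C : seq (pt EC) := sheets EC t.

End Data.
End Phi.

(* Main.v *)
Require Import Defs.
From HB Require Import structures.
From mathcomp Require Import all_boot all_order all_algebra.
From mathcomp Require Import complex.
From mathcomp Require Import all_classical all_reals all_analysis.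
From mathcomp Require Import measurable_realfun.
From mathcomp Require Import ring lra.

(** The symplectic form pairs two classes through the integral of tr(a /\ b), and
    away from the ramification points [Phi] is the pullback along the double cover:
    the elementary transformations only change frames over W, and the twist only adds
    a scalar matrix to the connection, which does not act on endomorphisms.  So if [a]
    and [b] represent the classes of [v] and [w], their pullbacks should represent the
    images of these classes, and the integral doubles because a point of the line has
    two preimages ([int_pull]).  Two points need an argument.

    First, the ramification points are no longer marked on the curve.  The pulled back
    primitive [f] of [a] must therefore be smooth there, in the new frames, although
    nothing is asked of [f] at the branch points below ([represents_pull]).  Near a
    branch point [a] vanishes, so [f] solves a linear differential equation with
    logarithmic pole and exponents 1/4 and -1/4.  Since these differ by 1/2, the
    equation has no singularity left in the coordinate of the double cover, after the
    elementary transformation ([cover_removal], [frame_removal]).  By Gronwall's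
    inequality a single-valued solution on a punctured disc is then bounded, the
    equation bounds its derivatives of all orders, and it extends over the centre
    ([ode_removal]).  The coordinate change is the small root of an equation
    H1(u) = s^2 H2(u) ([implicit_root]).  Before this, isolated wrong values of [f],
    which may accumulate at a branch point, are replaced by limits ([repair]).

    Second, the form is defined by choosing representatives, so the integral on the
    curve must not depend on them ([wedge_unique]).  Two representatives of a class
    differ by the covariant derivative of an endomorphism [ph], and the trace of the
    product of this derivative with a closed form [b] is the differential of the
    1-form tr(ph b), which vanishes near T ([wedge_class]).  Its integral, computed in
    the x-plane, is zero by Fubini's theorem and the fundamental theorem of calculus on
    almost every horizontal and vertical line ([stokes1], [stokes2], [stokes_ell]).
    What makes this legitimate is a dominating sum of translates of k(x_1) k(x_2) with
    [k] integrable on the line, which controls the derivatives of the local parameters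
    near the branch points and near infinity ([kk], [branch_bound], [inf_bound]);
    compactness of the curve makes the local bounds uniform ([ell_uniform]). *)

Set Implicit Arguments.
Unset Strict Implicit.
Unset Printing Implicit Defensive.

Import Order.TTheory GRing.Theory Num.Theory.
Import numFieldNormedType.Exports.

Local Open Scope classical_set_scope.
Local Open Scope ring_scope.
Local Open Scope complex_scope.

(** * Dominated functions on the plane *)

Section Plane.
Variable R : realType.
Local Notation leb := (@lebesgue_measure R).
Local Notation leb2 := (leb \x leb)%E.

Definition boxopen (U : set (R * R)) := forall z, U z -> exists2 d : R, 0 < d &
  forall w, `|w.1 - z.1| < d -> `|w.2 - z.2| < d -> U w.

Lemma ratr_near (x d : R) : 0 < d -> exists p q : rat, [/\ ratr p < x, x < ratr q &
  forall y : R, ratr p < y -> y < ratr q -> `|y - x| < d].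
Proof.
move=> d0; have [p /itvP px] : exists p : rat, ratr p \in `]x - d, x[ by apply: rat_in_itvoo; rewrite ltrBlDr ltrDl.
have [q /itvP qx] : exists q : rat, ratr q \in `]x, x + d[ by apply: rat_in_itvoo; rewrite ltrDl.
exists p, q; split; rewrite ?px ?qx// => y py yq.
by rewrite ltr_distl (lt_trans _ py) ?px// (lt_trans yq) ?qx.
Qed.

(** Each point lies in a box with rational sides inside the set, and there are only
    countably many of these. *)
Lemma boxopen_measurable U : boxopen U -> measurable U.
Proof.
move=> oU.
pose F (i : (rat * rat) * (rat * rat)) : set (R * R) :=
  if pselect (`]ratr i.1.1, ratr i.1.2[ `*` `]ratr i.2.1, ratr i.2.2[ `<=` U) then
    `]ratr i.1.1, ratr i.1.2[ `*` `]ratr i.2.1, ratr i.2.2[ else set0.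
have -> : U = \bigcup_i F i.
  apply/seteqP; split => [z Uz|z [i _]]; last by rewrite /F; case: pselect => // sub /sub.
  have [d d0 H] := oU _ Uz.
  have [p1 [q1 [p1z q1z H1]]] := ratr_near z.1 d0; have [p2 [q2 [p2z q2z H2]]] := ratr_near z.2 d0.
  exists ((p1, q1), (p2, q2)) => //; rewrite /F /=; case: pselect => [bU|nb].
    by split; rewrite /= in_itv /= ?p1z ?q1z ?p2z ?q2z.
  by exfalso; apply: nb => w [/= +]; rewrite !in_itv /= => /andP[a1 a2] /andP[b1 b2]; apply: H; [exact: H1|exact: H2].
apply: countable_bigcupT_measurable => // i; rewrite /F; case: pselect => [bU|nb]; last exact: measurable0.
by apply: measurableX; exact: measurable_itv.
Qed.

Definition pcont (h : R * R -> R) (z : R * R) := forall e : R, 0 < e -> exists2 d : R, 0 < d &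
  forall w, `|w.1 - z.1| < d -> `|w.2 - z.2| < d -> `|h w - h z| < e.

Lemma pcont_measurable (V : set (R * R)) h : boxopen V -> (forall z, V z -> pcont h z) ->
  measurable_fun V h.
Proof.
move=> oV ch; apply: (measurability _ (RGenOInfty.measurableE R)).
move=> /= _ [_ [a ->]] <-; apply: boxopen_measurable => z [Vz].
rewrite /= in_itv /= andbT => az.
have [d d0 H] := oV _ Vz; have [d' d'0 H'] := ch _ Vz (h z - a) ltac:(by rewrite subr_gt0).
exists (Num.min d d'); first by rewrite lt_min d0.
move=> w; rewrite !lt_min => /andP[w1 w2] /andP[w3 w4]; split; first exact: H.
rewrite /= in_itv /= andbT; have := H' w w2 w4; rewrite ltr_distl => /andP[+ _].
by rewrite opprB addrCA subrr addr0.
Qed.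

Lemma pcontD h h' z : pcont h z -> pcont h' z -> pcont (fun z => h z + h' z) z.
Proof.
move=> c c' e e0; have e2 : 0 < e / 2 by rewrite divr_gt0.
have [d d0 H] := c _ e2; have [d' d'0 H'] := c' _ e2.
exists (Num.min d d'); first by rewrite lt_min d0.
move=> w; rewrite !lt_min => /andP[w1 w2] /andP[w3 w4].
rewrite opprD addrACA (le_lt_trans (ler_normD _ _))// [e]splitr ltrD//; [exact: H|exact: H'].
Qed.

Lemma pcontZ (k : R) h z : pcont h z -> pcont (fun z => k * h z) z.
Proof.
move=> c e e0; have k1 : 0 < `|k| + 1 by rewrite ltr_wpDl.
have [d d0 H] := c (e / (`|k| + 1)) ltac:(by rewrite divr_gt0).
exists d => // w w1 w2; rewrite -mulrBr normrM.
apply: (@le_lt_trans _ _ ((`|k| + 1) * `|h w - h z|)); first by rewrite ler_wpM2r// lerDl.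
by rewrite mulrC -ltr_pdivlMr//; exact: H.
Qed.

(** ** A dominating function *)

Definition q4 (t : R) := t `^ 4^-1.
(** This is the derivative of -4 / (1 + t^(1/4)), hence integrable.  It behaves like
    t^(-3/4) at 0 and like t^(-5/4) at infinity, so that its square has the order of
    the second derivative of the local parameters of the curve: |x - w|^(-3/2) near
    a branch point w and |x|^(-5/2) near infinity.  Writing the inverse as the power
    -1 makes measurability immediate. *)
Definition kk (t : R) := (q4 t ^+ 3 * (1 + q4 t) ^+ 2) `^ (-1).

Lemma q4_ge0 t : 0 <= q4 t. Proof. exact: powR_ge0. Qed.

Lemma q4X t : 0 <= t -> q4 t ^+ 4 = t.
Proof. by move=> t0; rewrite -powR_mulrn ?q4_ge0// /q4 -powRrM mulVf// powRr1. Qed.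

Lemma q4_gt0 t : 0 < t -> 0 < q4 t. Proof. exact: powR_gt0. Qed.

Lemma kkE t : kk t = (q4 t ^+ 3 * (1 + q4 t) ^+ 2)^-1.
Proof. by rewrite /kk powR_inv1// mulr_ge0// exprn_ge0// ?addr_ge0// q4_ge0. Qed.

Lemma kk_ge0 t : 0 <= kk t. Proof. exact: powR_ge0. Qed.

Lemma kk_measurable : measurable_fun setT kk.
Proof.
have mq : measurable_fun setT q4 by exact: measurable_powR.
rewrite /kk; apply: (measurableT_comp (measurable_powR (-1))).
apply: measurable_funM; first exact: measurable_funX.
by apply: measurable_funX; exact: measurable_funD.
Qed.

Lemma is_derive_q4 (t : R) : 0 < t -> is_derive t 1 q4 (4^-1 / q4 t ^+ 3).
Proof.
move=> t0; have H := is_derive1_powR 4^-1 t0.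
suff -> : 4^-1 / q4 t ^+ 3 = 4^-1 * t `^ (4^-1 - 1) by [].
congr (_ * _); rewrite powRB ?(gt_eqF t0)// ?powRr1 ?ltW ?implybT//.
  rewrite -/(q4 t) -{3}(q4X (ltW t0)); have := q4_gt0 t0; move: (q4 t) => q q0.
  by field; rewrite gt_eqF.
Qed.

Definition Kint (t : R) := - 4 * (1 + q4 t)^-1.

Lemma is_derive_Kint (t : R) : 0 < t -> is_derive t 1 Kint (kk t).
Proof.
move=> t0; have dq := is_derive_q4 t0; have q0 := q4_gt0 t0.
have n0 : 1 + q4 t != 0 by rewrite gt_eqF// addr_gt0.
have d1 : is_derive t 1 (fun t => 1 + q4 t) (4^-1 / q4 t ^+ 3).
  by have := is_deriveD (is_derive_cst (1 : R) t 1) dq; rewrite add0r.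
have d2 := is_deriveV (f := fun s => 1 + q4 s) n0 d1.
have := is_deriveZ (- 4) d2; rewrite kkE => H.
suff -> : (q4 t ^+ 3 * (1 + q4 t) ^+ 2)^-1 = - 4 *: (- (1 + q4 t) ^- 2 *: (4^-1 / q4 t ^+ 3)) by [].
rewrite /GRing.scale /=; move: (q4 t) q0 n0 => q q0 n0.
by field; rewrite n0 gt_eqF.
Qed.

Lemma Kint_bound t : `|Kint t| <= 4.
Proof.
have s0 : 0 <= 1 + q4 t by rewrite addr_ge0 ?q4_ge0.
have -> : `|Kint t| = 4 * (1 + q4 t)^-1.
  by rewrite /Kint mulNr normrN ger0_norm// mulr_ge0// invr_ge0.
by rewrite ler_piMr// invf_le1 ?lerDl ?q4_ge0// ltr_wpDr ?q4_ge0.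
Qed.

Lemma kk_cont (t : R) : 0 < t -> {for t, continuous kk}.
Proof.
move=> t0; have q0 := q4_gt0 t0.
have cq : {for t, continuous q4}.
  have [d _] := is_derive_q4 t0; exact/differentiable_continuous/derivable1_diffP.
have -> : kk = fun t => (q4 t ^+ 3 * (1 + q4 t) ^+ 2)^-1 by apply/funext => s; exact: kkE.
apply: cvgV; first by rewrite mulf_neq0// expf_neq0// gt_eqF// addr_gt0.
apply: cvgM; first exact: (cvg_comp _ _ cq (@exprn_continuous R 3 (q4 t))).
apply: (cvg_comp (fun t => 1 + q4 t) (fun s => s ^+ 2) _ (@exprn_continuous R 2 (1 + q4 t))).
by apply: cvgD => //; exact: cvg_cst.
Qed.

(** By monotone convergence: on each segment the integral is an increment of the
    bounded primitive [F]. *)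
Lemma mono_integral (F f : R -> R) (a b : nat -> R) (M : R) :
  (forall n, a n < b n) -> (forall n, a n.+1 <= a n) -> (forall n, b n <= b n.+1) ->
  (forall t, `|F t| <= M) ->
  (forall n t, t \in `[a n, b n] -> [/\ is_derive t 1 F (f t), {for t, continuous f} & 0 <= f t]) ->
  (\int[leb]_(x in \bigcup_n `[a n, b n]%classic) (f x)%:E <= (2 * M)%:E)%E.
Proof.
move=> ab aS bS FM H.
have cf n : {within `[a n, b n], continuous f}.
  by apply: continuous_in_subspaceT => t /set_mem /= /H[].
have dF n t : t \in `[a n, b n] -> derivable F t 1 by move=> /H[[]].
have FF n : {within `[a n, b n], continuous F}.
  apply: derivable_within_continuous => t tn; exact: dF tn.
have E n : (\int[leb]_(x in `[a n, b n]) (f x)%:E = (F (b n))%:E - (F (a n))%:E)%E.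
  apply: continuous_FTC2 => //.
    have /(continuous_within_itvP _ (ab n))[_ c1 c2] := FF n.
    split => // t tn; apply: (dF n); exact: subset_itv_oo_cc.
  move=> t tn; rewrite derive1E; have [d _ _] := H n t (subset_itv_oo_cc tn).
  exact: derive_val.
have sub : {homo (fun n => `[a n, b n]%classic) : n m / (n <= m)%N >-> (n <= m)%O}.
  apply/nondecreasing_seqP => n; apply/subsetPset => t /=; rewrite !in_itv /= => /andP[h1 h2].
  by rewrite (le_trans (aS n))// (le_trans h2).
have cv := @ge0_nondecreasing_set_cvg_integral _ (measurableTypeR R) R (fun n => `[a n, b n]%classic)
  (EFin \o f) leb sub (fun n => measurable_itv _).
apply: (@cvge_le _ _ _ _ _ _ _ _ (cv _ _)); last 2 first.
- move=> n; apply/measurable_EFinP; apply: subspace_continuous_measurable_fun => //; exact: cf.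
- by move=> n t /= /H[_ _]; rewrite lee_fin.
apply: nearW => n; rewrite E -EFinB lee_fin.
apply: le_trans (ler_norm _) _; apply: le_trans (ler_normB _ _) _.
by rewrite mulr_natl mulr2n lerD.
Qed.

Lemma Kint_shift (c t : R) : 0 < t - c -> [/\ is_derive t 1 (fun t : R => Kint (t - c)) (kk `|t - c|),
  {for t, continuous (fun t : R => kk `|t - c|)} & 0 <= kk `|t - c|].
Proof.
move=> tc.
have ds : is_derive t 1 (fun t : R => t - c) 1.
  by have := is_deriveB (is_derive_id t (1 : R)) (is_derive_cst c t (1 : R)); rewrite subr0.
split; last exact: kk_ge0.
  have := @is_derive1_comp R Kint (fun t => t - c) t _ _ (is_derive_Kint tc) ds.
  by rewrite mulr1 gtr0_norm.
apply: (cvg_comp (fun t : R => `|t - c|) kk _ (_ : kk x @[x --> `|t - c|] --> kk `|t - c|)).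
  by apply: cvg_norm; apply: cvgB => //; exact: cvg_cst.
by apply: kk_cont; rewrite gtr0_norm.
Qed.

Lemma Kint_reflect (c t : R) : 0 < c - t -> [/\ is_derive t 1 (fun t : R => - Kint (c - t)) (kk `|t - c|),
  {for t, continuous (fun t : R => kk `|t - c|)} & 0 <= kk `|t - c|].
Proof.
move=> tc.
have ds : is_derive t 1 (fun t : R => c - t) (-1).
  by have := is_deriveB (is_derive_cst c t (1 : R)) (is_derive_id t (1 : R)); rewrite sub0r.
split; last exact: kk_ge0.
  have := is_deriveN (@is_derive1_comp R Kint (fun t => c - t) t _ _ (is_derive_Kint tc) ds).
  by rewrite mulrN1 opprK distrC gtr0_norm.
apply: (cvg_comp (fun t : R => `|t - c|) kk _ (_ : kk x @[x --> `|t - c|] --> kk `|t - c|)).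
  by apply: cvg_norm; apply: cvgB => //; exact: cvg_cst.
by apply: kk_cont; rewrite distrC gtr0_norm.
Qed.

Lemma kk_integral c : (\int[leb]_t (kk `|t - c|)%:E <= (2 * 4 + 2 * 4)%:E)%E.
Proof.
have mf : measurable_fun setT (fun t : R => kk `|t - c|).
  apply: (measurableT_comp kk_measurable); apply: measurableT_comp => //.
  exact: measurable_funB.
have e0 n : 0 < n.+1%:R^-1 :> R by rewrite invr_gt0.
have e1 n : n.+1%:R^-1 <= 1 :> R by rewrite invf_le1// ler1n.
have eS n : n.+2%:R^-1 <= n.+1%:R^-1 :> R by rewrite lef_pV2 ?posrE// ler_nat.
have n1 n : 1 < n.+2%:R :> R by rewrite ltr1n.
have nS n : n.+2%:R <= n.+3%:R :> R by rewrite ler_nat.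
pose A := \bigcup_n `[c + n.+1%:R^-1, c + n.+2%:R]%classic.
pose B := \bigcup_n `[c - n.+2%:R, c - n.+1%:R^-1]%classic.
have arch (u : R) : 0 < u -> exists n, n.+1%:R^-1 <= u /\ u <= n.+2%:R.
  move=> u0; have ui : 0 <= u^-1 by rewrite invr_ge0 ltW.
  have n1' := archi_boundP ui; have m1 := archi_boundP (ltW u0).
  set n := Num.bound u^-1 in n1'; set m := Num.bound u in m1.
  have nm k : (k <= n + m)%N -> k%:R <= (n + m).+1%:R :> R by move=> h; rewrite ler_nat ltnW.
  exists (n + m)%N; split.
    rewrite invf_ple ?posrE// (le_trans (ltW n1'))// nm// leq_addr//.
  rewrite (le_trans (ltW m1))// (le_trans (nm _ (leq_addl _ _)))// ler_nat//.
have AB : setT `\ c = A `|` B.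
  apply/seteqP; split => [t [_ /= tc]|t [] [n _] /=]; rewrite ?in_itv /=.
  - have [lt|lt|/esym//] := ltgtP c t.
      have [|n [n1' n2]] := arch (t - c); first by rewrite subr_gt0.
      by left; exists n => //=; rewrite in_itv /= -lerBrDl n1' -lerBlDl n2.
    have [|n [n1' n2]] := arch (c - t); first by rewrite subr_gt0.
    by right; exists n => //=; rewrite in_itv /= lerBlDr -lerBlDl n2 lerBrDr -lerBrDl n1'.
  - move=> /andP[h _]; split => // tc; move: h; rewrite tc gerDl leNgt e0//.
  - move=> /andP[_ h]; split => // tc; move: h; rewrite tc lerBrDr gerDl leNgt e0//.
have mA : measurable A by apply: bigcupT_measurable => n; exact: measurable_itv.
have mB : measurable B by apply: bigcupT_measurable => n; exact: measurable_itv.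
have mfE D : measurable_fun D (fun t : R => (kk `|t - c|)%:E).
  by apply/measurable_EFinP; exact: measurable_funTS.
rewrite -(@integral_setD1 _ _ c setT); last 2 first.
- by rewrite AB; exact: measurableU.
- exact: mfE.
rewrite AB ge0_integral_setU//; last 2 first.
- by move=> t _; rewrite lee_fin kk_ge0.
- apply/disj_set2P; rewrite -subset0 => t [[n _ /=] + [m _ /=]].
  rewrite !in_itv /= => /andP[h _] /andP[_ h'].
  have := le_trans h h'; rewrite leNgt => /negP; apply.
  by rewrite (lt_trans (y := c))// ?gtrBl ?ltrDl.
rewrite EFinD; apply: leeD.
- apply: (@mono_integral (fun t : R => Kint (t - c)) (fun t : R => kk `|t - c|)).
  + by move=> n; rewrite ltrD2l (le_lt_trans (e1 n)).
  + by move=> n; rewrite lerD2l.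
  + by move=> n; rewrite lerD2l.
  + by move=> t; exact: Kint_bound.
  + move=> n t; rewrite in_itv /= => /andP[h _]; apply: Kint_shift.
    by rewrite subr_gt0 (lt_le_trans _ h)// ltrDl.
- apply: (@mono_integral (fun t : R => - Kint (c - t)) (fun t : R => kk `|t - c|)).
  + by move=> n; rewrite ltrD2l ltrN2 (le_lt_trans (e1 n)).
  + by move=> n; rewrite lerD2l lerN2.
  + by move=> n; rewrite lerD2l lerN2.
  + by move=> t; rewrite normrN; exact: Kint_bound.
  + move=> n t; rewrite in_itv /= => /andP[_ h]; apply: Kint_reflect.
    by rewrite subr_gt0 (le_lt_trans h)// gtrBl.
exact: mfE.
Qed.

Definition kk2 (c z : R * R) := kk `|z.1 - c.1| * kk `|z.2 - c.2|.

Lemma kk2_ge0 c z : 0 <= kk2 c z. Proof. by rewrite mulr_ge0 ?kk_ge0. Qed.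

(** By Tonelli's theorem, from [kk_integral] in each variable. *)
Lemma kk2_integrable c : leb2.-integrable setT (fun z => (kk2 c z)%:E).
Proof.
have mf d : measurable_fun setT (fun t : R => kk `|t - d|).
  apply: (measurableT_comp kk_measurable); apply: measurableT_comp => //.
  exact: measurable_funB.
have mfe d : measurable_fun setT (fun t : R => (kk `|t - d|)%:E) by apply/measurable_EFinP; exact: mf.
have m2 : measurable_fun setT (fun z => (kk2 c z)%:E).
  apply/measurable_EFinP; apply: measurable_funM.
    exact: (measurableT_comp (mf c.1) measurable_fst).
  exact: (measurableT_comp (mf c.2) measurable_snd).
apply/integrable12ltyP => //.
have E x : (\int[leb]_y `|(kk2 c (x, y))%:E| = (kk `|x - c.1|)%:E * \int[leb]_y (kk `|y - c.2|)%:E)%E.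
  rewrite -ge0_integralZl//=.
  - by apply: eq_integral => y _; rewrite ger0_norm ?kk2_ge0.
  - exact: mfe.
  - by move=> y _; rewrite lee_fin kk_ge0.
  - by rewrite lee_fin kk_ge0.
under eq_integral do rewrite E.
have I0 d : (0 <= \int[leb]_y (kk `|y - d|)%:E)%E by apply: integral_ge0 => y _; rewrite lee_fin kk_ge0.
have Ifin d : (\int[leb]_y (kk `|y - d|)%:E)%E \is a fin_num.
  by rewrite ge0_fin_numE//; apply: le_lt_trans (kk_integral d) _; rewrite ltry.
have Ir d : exists r : R, (\int[leb]_y (kk `|y - d|)%:E)%E = r%:E.
  by exists (fine (\int[leb]_y (kk `|y - d|)%:E)%E); rewrite fineK.
have [r1 E1] := Ir c.1; have [r2 E2] := Ir c.2.
have r20 : 0 <= r2 by rewrite -lee_fin -E2.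
rewrite E2; under eq_integral do rewrite muleC.
rewrite ge0_integralZl//=.
- by apply: (@eq_ind_r _ r1%:E (fun I => (r2%:E * I < +oo)%E) _ _ E1); rewrite -EFinM ltry.
- exact: mfe.
- by move=> y _; rewrite lee_fin kk_ge0.
Qed.

(** ** Functions that are continuous off a finite grid and dominated *)

Variable ws : seq (R * R).
Definition kap z := \sum_(c <- ws) kk2 c z.

Lemma kap_integrable : leb2.-integrable setT (fun z => (kap z)%:E).
Proof.
have -> : (fun z => (kap z)%:E) = (fun z => \sum_(c <- ws) (kk2 c z)%:E).
  by apply/funext => z; rewrite /kap sumEFin.
by apply: integrable_sum => // c _; exact: kk2_integrable.
Qed.

Definition ongrid (s : seq R) (z : R * R) := (z.1 \in s) && (z.2 \in s).

(** Continuity fails at most at the points of a finite grid, and the bound at most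
    on the lines through them.  The latter is forced by [kk], which vanishes at 0 as
    a total function and so gives no bound there. *)
Definition tame (h : R * R -> R) := exists (s : seq R) (C : R),
  (forall z, ~~ ongrid s z -> pcont h z) /\
  (forall z, z.1 \notin s -> z.2 \notin s -> `|h z| <= C * kap z).

Lemma sep_seq (s : seq R) (x : R) : x \notin s -> exists2 d : R, 0 < d & forall y, `|y - x| < d -> y \notin s.
Proof.
elim: s => [_|a s IH]; first by exists 1.
rewrite in_cons negb_or => /andP[xa /IH[d d0 H]].
exists (Num.min d `|a - x|); first by rewrite lt_min d0 normr_gt0 subr_eq0 eq_sym.
move=> y; rewrite lt_min => /andP[/H ys h]; rewrite in_cons negb_or ys andbT.
by apply: contraTneq h => ->; rewrite ltxx.
Qed.

Lemma offgrid_open s : boxopen [set z | ~~ ongrid s z].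
Proof.
move=> z /=; rewrite /ongrid negb_and => /orP[] /sep_seq[d d0 H]; exists d => // w w1 w2.
  by rewrite negb_and H.
by rewrite negb_and (H w.2)// orbT.
Qed.

Lemma grid_finite_measurable (s : seq R) (A : set (R * R)) : A `<=` [set z | ongrid s z] -> measurable A.
Proof.
move=> As; have fA : finite_set A.
  apply: sub_finite_set As _.
  apply: (@sub_finite_set _ _ ([set` s] `*` [set` s])); first by move=> z /= /andP[].
  by apply: finite_setX; exact: finite_seq.
have -> : A = \bigcup_(z in A) [set z]
  by apply/seteqP; split => z; [move=> Az; exists z|move=> [w Aw ->]].
apply: fin_bigcup_measurable => // -[a b] _.
have -> : [set (a, b)] = [set a] `*` [set b] by apply/seteqP; split => -[x y] /= [-> ->].
by apply: measurableX; exact: measurable_set1.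
Qed.

Lemma offgrid_measurable s h : (forall z, ~~ ongrid s z -> pcont h z) -> measurable_fun setT h.
Proof.
move=> ch; have -> : setT = [set z | ~~ ongrid s z] `|` [set z | ongrid s z].
  by apply/seteqP; split => z //= _; case: (ongrid s z); [right|left].
apply/measurable_funU.
- by apply: boxopen_measurable; exact: offgrid_open.
- exact: (@grid_finite_measurable s).
split; first by apply: pcont_measurable => //; exact: offgrid_open.
by move=> _ Y mY; apply: (@grid_finite_measurable s) => z [].
Qed.

Definition lines (s : seq R) : set (R * R) := ([set` s] `*` setT) `|` (setT `*` [set` s]).

Lemma seq_measurable (s : seq R) : measurable [set` s].
Proof. by apply: countable_measurable; [exact: measurable_set1|apply: finite_set_countable; exact: finite_seq]. Qed.

Lemma seq_null (s : seq R) : leb [set` s] = 0%E.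
Proof. by apply: countable_lebesgue_measure0; apply: finite_set_countable; exact: finite_seq. Qed.

Lemma lines_measurable s : measurable (lines s).
Proof. by apply: measurableU; apply: measurableX => //; exact: seq_measurable. Qed.

Lemma lines_null s : leb2 (lines s) = 0%E.
Proof.
have m1 : measurable ([set` s] `*` [set: R]) by apply: measurableX => //; exact: seq_measurable.
have m2 : measurable ([set: R] `*` [set` s]) by apply: measurableX => //; exact: seq_measurable.
apply/eqP; rewrite eq_le measure_ge0 andbT.
apply: (@le_trans _ _ (leb2 ([set` s] `*` [set: R]) + leb2 ([set: R] `*` [set` s]))%E).
  exact: measureU2.
have -> : leb2 ([set` s] `*` [set: R]) = 0%E.
  transitivity (0 * leb [set: R])%E; last by rewrite mul0e.
  rewrite product_measure1E//; last exact: seq_measurable.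
  by congr (_ * _)%E; exact: seq_null.
have -> : leb2 ([set: R] `*` [set` s]) = 0%E; last by rewrite adde0.
transitivity (leb [set: R] * 0)%E; last by rewrite mule0.
rewrite product_measure1E//; last exact: seq_measurable.
by congr (_ * _)%E; exact: seq_null.
Qed.

Lemma tame_integrable h : tame h -> leb2.-integrable setT (EFin \o h).
Proof.
move=> [s [C [ch bh]]]; have mh := offgrid_measurable ch.
apply/(@negligible_integrable _ _ R leb2 setT _ _ (lines_measurable s)) => //.
- exact/measurable_EFinP.
- exact: lines_null.
have mD : measurable (setT `\` lines s) by apply: measurableD => //; exact: lines_measurable.
apply: (@le_integrable _ _ R leb2 _ mD _ (fun z => (C%:E * (kap z)%:E)%E)) => //.
- by apply/measurable_EFinP; exact: measurable_funTS.
- move=> z [_ zl]; rewrite /= lee_fin.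
  apply: le_trans (bh z _ _) (ler_norm _); apply/negP => zs; apply: zl; [by left|by right].
- apply: integrableZl => //; apply: integrableS (kap_integrable) => //.
Qed.

Lemma tame_eq_integral h h' s : tame h -> tame h' -> (forall z, ~~ ongrid s z -> h z = h' z) ->
  Rintegral leb2 setT h = Rintegral leb2 setT h'.
Proof.
move=> /tame_integrable ih /tame_integrable ih' hh; rewrite /Rintegral; congr fine.
apply: ae_eq_integral => //; try exact: measurable_int ih; try exact: measurable_int ih'.
exists (lines s); split; [exact: lines_measurable|exact: lines_null|].
move=> z /= nz; apply: contrapT => nl; apply: nz => _; congr EFin; apply: hh.
by apply/negP => /andP[h1 h2]; apply: nl; left.
Qed.

Lemma ongrid_cat s s' z : ~~ ongrid (s ++ s') z -> ~~ ongrid s z /\ ~~ ongrid s' z.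
Proof.
rewrite /ongrid !mem_cat => h; split; apply: contra h => /andP[-> ->] //; by rewrite !orbT.
Qed.

Lemma tameD h h' : tame h -> tame h' -> tame (fun z => h z + h' z).
Proof.
move=> [s [C [ch bh]]] [s' [C' [ch' bh']]]; exists (s ++ s'), (C + C'); split => z.
  by move=> /ongrid_cat[g g']; apply: pcontD; [exact: ch|exact: ch'].
rewrite !mem_cat !negb_or => /andP[z1 z1'] /andP[z2 z2'].
by rewrite (le_trans (ler_normD _ _))// mulrDl lerD ?bh ?bh'.
Qed.

Lemma tameZ (k : R) h : tame h -> tame (fun z => k * h z).
Proof.
move=> [s [C [ch bh]]]; exists s, (`|k| * C); split => z; first by move=> /ch; exact: pcontZ.
by move=> z1 z2; rewrite normrM -mulrA ler_wpM2l// bh.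
Qed.

Lemma tame_intD h h' : tame h -> tame h' ->
  Rintegral leb2 setT (fun z => h z + h' z) = Rintegral leb2 setT h + Rintegral leb2 setT h'.
Proof. by move=> /tame_integrable i /tame_integrable i'; rewrite RintegralD. Qed.

Lemma tame_intZ (k : R) h : tame h -> Rintegral leb2 setT (fun z => k * h z) = k * Rintegral leb2 setT h.
Proof. by move=> /tame_integrable i; rewrite RintegralZl. Qed.

(** ** Integrals of derivatives *)

(** The integral over [-n, n] is F(n) - F(-n), which tends to 0. *)
Lemma line_int0 (F f : R -> R) : (forall t : R, is_derive t 1 F (f t)) -> continuous f ->
  leb.-integrable setT (EFin \o f) ->
  (forall e : R, 0 < e -> exists A : R, forall t, A < `|t| -> `|F t| < e) ->
  (\int[leb]_t (f t)%:E = 0)%E.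
Proof.
move=> dF cf intf F0.
pose S n := `[- n.+1%:R, n.+1%:R]%classic : set R.
pose u n : \bar R := (\int[leb]_(t in S n) (f t)%:E)%E.
have n0 n : - n.+1%:R < n.+1%:R :> R by rewrite (lt_trans (y := 0))// oppr_lt0.
have uE n : u n = (F n.+1%:R - F (- n.+1%:R))%:E.
  rewrite EFinB; apply: continuous_FTC2 => //.
  - by apply: continuous_in_subspaceT => t _; exact: cf.
  - have FF : {within `[- n.+1%:R, n.+1%:R], continuous F}.
      apply: derivable_within_continuous => t _; by have [] := dF t.
    have /(continuous_within_itvP _ (n0 n))[_ c1 c2] := FF.
    by split => // t _; have [] := dF t.
  - by move=> t _; rewrite derive1E; have [_ ->] := dF t.
have u0 : u n @[n --> \oo] --> 0%E.
  have -> : u = fun n => (F n.+1%:R - F (- n.+1%:R))%:E by apply/funext => n; exact: uE.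
  apply: cvg_EFin; first exact: nearW.
  apply/cvgrPdist_lt => e e0; have e2 : 0 < e / 2 by rewrite divr_gt0.
  have [A HA] := F0 _ e2; have := archi_boundP (normr_ge0 A); set N := Num.bound _ => AN.
  exists N => // n /= Nn; rewrite sub0r normrN.
  have An : A < n.+1%:R.
    apply: le_lt_trans (ler_norm A) _; apply: lt_le_trans AN _; rewrite ler_nat; exact: leqW.
  rewrite (le_lt_trans (ler_normB _ _))// [e]splitr ltrD//; apply: HA; rewrite ?normrN ger0_norm//.
have := @dominated_convergence _ (measurableTypeR R) R leb setT measurableT
  (fun n => (EFin \o f) \_ `[- n.+1%:R, n.+1%:R]%classic) (EFin \o f) (abse \o (EFin \o f)).
case=> //.
- move=> n; have mf := measurable_int _ intf.
  have mS : measurable (S n) by exact: measurable_itv.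
  exact: (iffLR (@measurable_restrictT _ _ (measurableTypeR R) _ (S n) (EFin \o f) mS) (measurable_funTS mf)).
- exact: measurable_int intf.
- apply: aeW => t _; apply: cvg_near_cst.
  have := archi_boundP (normr_ge0 t); set N := Num.bound _ => tN.
  exists N => // n /= Nn; rewrite patchE mem_set//= in_itv /= -ler_norml.
  by apply: le_trans (ltW tN) _; rewrite ler_nat leqW.
- exact: integrable_abse.
- apply: aeW => t n _ /=; rewrite patchE; case: ifP => // _; by rewrite abse0.
move=> _ _ cv; have <- : (\int[leb]_(x in setT) (EFin \o f) x)%E = 0%E => //.
apply: (cvg_unique _ cv) => //; apply: cvg_trans u0; apply: near_eq_cvg; apply: nearW => n.
by rewrite /u integral_mkcond.
Qed.

Lemma pcont_line1 h z : pcont h z -> {for z.1, continuous (fun t => h (t, z.2))}.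
Proof.
move=> c; apply/cvgrPdist_lt => e e0; have [d d0 H] := c _ e0.
apply/nbhs_ballP; exists d => // t /= td.
rewrite distrC; case: z td c H => x y /= td c H; by apply: H => //=; rewrite ?subrr ?normr0// distrC.
Qed.

Lemma pcont_line2 h z : pcont h z -> {for z.2, continuous (fun t => h (z.1, t))}.
Proof.
move=> c; apply/cvgrPdist_lt => e e0; have [d d0 H] := c _ e0.
apply/nbhs_ballP; exists d => // t /= td.
rewrite distrC; case: z td c H => x y /= td c H; by apply: H => //=; rewrite ?subrr ?normr0// distrC.
Qed.

Definition vanishes (g : R * R -> R) := forall e : R, 0 < e -> exists A : R,
  forall z, A < `|z.1| \/ A < `|z.2| -> `|g z| < e.

Lemma ae_off (Q : R -> Prop) (F F' : R -> \bar R) (s : seq R) : {ae leb, forall t, Q t} ->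
  (forall t, t \notin s -> Q t -> F t = F' t) -> ae_eq leb setT F F'.
Proof.
move=> [N [mN N0 sub]] H; exists (N `|` [set` s]); split.
- by apply: measurableU => //; exact: seq_measurable.
- apply/eqP; rewrite eq_le measure_ge0 andbT.
  apply: (@le_trans _ _ (leb N + leb [set` s])%E); first by apply: measureU2 => //; exact: seq_measurable.
  by rewrite N0 seq_null adde0.
- move=> t /= nt; have [ts|ts] := boolP (t \in s); first by right.
  by left; apply: sub => /= Qt; apply: nt => _; exact: H.
Qed.

(** On almost every line the function is integrable and the line avoids the grid, so
    [line_int0] applies. *)
Lemma stokes1 g h s : tame h -> (forall z, ~~ ongrid s z -> pcont h z /\ is_derive z.1 1 (fun t => g (t, z.2)) (h z)) ->
  vanishes g -> Rintegral leb2 setT h = 0.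
Proof.
move=> th H g0; have ih := tame_integrable th.
rewrite /Rintegral -(integral21_prod_meas1 ih).
rewrite (@ae_eq_integral _ _ R leb setT (fun=> 0%E)) ?integral0//.
  exact: (measurable_fubini_G ih).
apply: (ae_off (ae_integrable2 ih) (s := s)) => y ys iy.
apply: (line_int0 (F := fun t => g (t, y))) => //.
- by move=> t; have [] := H (t, y) ltac:(by rewrite /ongrid negb_and ys orbT).
- by move=> t; have [c _] := H (t, y) ltac:(by rewrite /ongrid negb_and ys orbT); exact: (pcont_line1 c).
- by move=> e /g0[A HA]; exists A => t tA; apply: HA; left.
Qed.

Lemma stokes2 g h s : tame h -> (forall z, ~~ ongrid s z -> pcont h z /\ is_derive z.2 1 (fun t => g (z.1, t)) (h z)) ->
  vanishes g -> Rintegral leb2 setT h = 0.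
Proof.
move=> th H g0; have ih := tame_integrable th.
rewrite /Rintegral -(integral12_prod_meas1 ih).
rewrite (@ae_eq_integral _ _ R leb setT (fun=> 0%E)) ?integral0//.
  exact: (measurable_fubini_F ih).
apply: (ae_off (ae_integrable1 ih) (s := s)) => x xs ix.
apply: (line_int0 (F := fun t => g (x, t))) => //.
- by move=> t; have [] := H (x, t) ltac:(by rewrite /ongrid negb_and xs).
- by move=> t; have [c _] := H (x, t) ltac:(by rewrite /ongrid negb_and xs); exact: (pcont_line2 c).
- by move=> e /g0[A HA]; exists A => t tA; apply: HA; right.
Qed.
End Plane.

Import Normc.

(** * Norms and Wirtinger derivatives *)

Section Norm.
Variable R : realType.
Local Notation C := R[i].
Implicit Types z w : C.

Lemma normc_real z : `|z| = (normc z)%:C.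
Proof. by case: z. Qed.

Lemma normc_ge0 z : 0 <= normc z.
Proof. by case: z => a b; rewrite sqrtr_ge0. Qed.

Lemma normc_gt0 z : (0 < normc z) = (z != 0).
Proof.
rewrite lt_neqAle normc_ge0 andbT eq_sym; congr (~~ _).
by apply/eqP/eqP => [/eq0_normc//|->]; rewrite normc0.
Qed.

Lemma normc_eq0 z : (normc z == 0) = (z == 0).
Proof. by apply/eqP/eqP => [/eq0_normc//|->]; rewrite normc0. Qed.

Lemma normcB z w : normc (z - w) = normc (w - z).
Proof. by rewrite -normcN opprB. Qed.

Lemma ler_normcB z w : normc (z - w) <= normc z + normc w.
Proof. by rewrite -(normcN w) le_normcD. Qed.

Lemma ler_distc z w : normc z - normc w <= normc (z - w).
Proof. by rewrite lerBlDr -{1}(subrK w z) le_normcD. Qed.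

Lemma normcX z n : normc (z ^+ n) = normc z ^+ n.
Proof. by elim: n => [|n IH]; rewrite ?expr0 ?normc1// !exprS normcM IH. Qed.

Lemma normc_conj z : normc z^*%C = normc z.
Proof. by case: z => a b /=; rewrite sqrrN. Qed.

Lemma normcR (a : R) : normc a%:C = `|a|.
Proof. by rewrite /= expr0n addr0 sqrtr_sqr. Qed.

Lemma normci : normc ('i%C : C) = 1.
Proof. by rewrite /= expr0n expr1n add0r sqrtr1. Qed.

Lemma normcn n : normc (n%:R : C) = n%:R.
Proof. by rewrite -[n%:R](rmorph_nat (real_complex R)) normcR ger0_norm. Qed.

Lemma Re_le z : `|complex.Re z| <= normc z.
Proof.
by case: z => a b /=; rewrite -sqrtr_sqr ler_wsqrtr// lerDl sqr_ge0.
Qed.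

Lemma Im_le z : `|complex.Im z| <= normc z.
Proof.
by case: z => a b /=; rewrite -sqrtr_sqr ler_wsqrtr// lerDr sqr_ge0.
Qed.

Lemma normc_le z : normc z <= `|complex.Re z| + `|complex.Im z|.
Proof.
rewrite {1}[z]complexE; apply: le_trans (le_normcD _ _) _.
by rewrite normcM normci mul1r !normcR.
Qed.

Lemma ltcRE (z : C) (e : R) : (`|z| < e%:C) = (normc z < e).
Proof. by rewrite normc_real ltcR. Qed.

Lemma gt0_Re (e : C) : 0 < e -> exists2 r : R, 0 < r & e = r%:C.
Proof.
case: e => a b; rewrite ltcE /= => /andP[/eqP-> a0]; exists a => //.
Qed.

Lemma ReM_real (a : R) z : complex.Re (a%:C * z) = a * complex.Re z.
Proof. by case: z => x y /=; rewrite mul0r subr0. Qed.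

Lemma ImM_real (a : R) z : complex.Im (a%:C * z) = a * complex.Im z.
Proof. by case: z => x y /=; rewrite mul0r addr0. Qed.

Lemma ReD z w : complex.Re (z + w) = complex.Re z + complex.Re w.
Proof. by case: z w => a b []. Qed.
Lemma ImD z w : complex.Im (z + w) = complex.Im z + complex.Im w.
Proof. by case: z w => a b []. Qed.
Lemma ReN z : complex.Re (- z) = - complex.Re z.
Proof. by case: z. Qed.
Lemma ImN z : complex.Im (- z) = - complex.Im z.
Proof. by case: z. Qed.
Lemma ReB z w : complex.Re (z - w) = complex.Re z - complex.Re w.
Proof. by rewrite ReD ReN. Qed.
Lemma ImB z w : complex.Im (z - w) = complex.Im z - complex.Im w.
Proof. by rewrite ImD ImN. Qed.
Lemma ReMi z : complex.Re ('i * z) = - complex.Im z.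
Proof. by case: z => a b /=; rewrite mul0r mul1r sub0r. Qed.
Lemma ImMi z : complex.Im ('i * z) = complex.Re z.
Proof. by case: z => a b /=; rewrite mul0r mul1r add0r. Qed.

End Norm.

Section RDiff.
Variable R : realType.
Local Notation C := R[i].
Implicit Types (F G : C -> C) (x p q : C).

(** The differential is [p dz + q d(conj z)], and holomorphy is the case [q = 0]:
    one predicate serves the smooth and the holomorphic functions. *)
Definition rdiff F x p q := forall e : R, 0 < e -> exists2 d : R, 0 < d &
  forall h, normc h < d -> normc (F (x + h) - F x - (p * h + q * h^*%C)) <= e * normc h.

Definition near_eq x F G := exists2 d : R, 0 < d & forall h, normc h < d -> F (x + h) = G (x + h).

Lemma rdiff_near x F G p q : near_eq x F G -> rdiff F x p q -> rdiff G x p q.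
Proof.
move=> [d d0 FG] dF e e0; have [d' d'0 H] := dF e e0.
exists (Num.min d d') => [|h]; first by rewrite lt_min d0.
rewrite lt_min => /andP[hd hd']; rewrite -FG// -(addr0 x) -FG ?normc0//.
by rewrite addr0; exact: H.
Qed.

Lemma rdiff_ext F G x p q : (forall z, F z = G z) -> rdiff F x p q -> rdiff G x p q.
Proof. by move=> FG; apply: rdiff_near; exists 1. Qed.

Lemma rdiff_cst c x : rdiff (fun=> c) x 0 0.
Proof.
by move=> e e0; exists 1 => // h _; rewrite !mul0r addr0 !subrr normc0 mulr_ge0 ?normc_ge0 ?ltW.
Qed.

Lemma rdiff_id x : rdiff id x 1 0.
Proof.
move=> e e0; exists 1 => // h _.
by rewrite mul1r mul0r addr0 [x + h]addrC addrK subrr normc0 mulr_ge0 ?normc_ge0 ?ltW.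
Qed.

Lemma rdiffD F G x p q p' q' : rdiff F x p q -> rdiff G x p' q' ->
  rdiff (fun z => F z + G z) x (p + p') (q + q').
Proof.
move=> dF dG e e0; have e2 : 0 < e / 2 by rewrite divr_gt0.
have [d d0 Hd] := dF _ e2; have [d' d'0 Hd'] := dG _ e2.
exists (Num.min d d') => [|h]; first by rewrite lt_min d0.
rewrite lt_min => /andP[hd hd'].
rewrite [X in normc X](_ : _ = (F (x + h) - F x - (p * h + q * h^*%C)) +
   (G (x + h) - G x - (p' * h + q' * h^*%C))); last by ring.
apply: le_trans (le_normcD _ _) _; rewrite [e]splitr mulrDl lerD//; [exact: Hd|exact: Hd'].
Qed.

Lemma rdiff_lip F x p q : rdiff F x p q -> exists2 M : R, 0 < M & exists2 d : R, 0 < d &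
  forall h, normc h < d -> normc (F (x + h) - F x) <= M * normc h.
Proof.
move=> dF; have [d d0 H] := dF 1 ltr01.
exists (1 + normc p + normc q); first by rewrite ltr_wpDr ?normc_ge0// ltr_wpDr ?normc_ge0.
exists d => // h hd; rewrite -(subrK (p * h + q * h^*%C) (F (x + h) - F x)).
apply: le_trans (le_normcD _ _) _; rewrite -[1 + _ + _]addrA !(mulrDl _ _ (normc h)); apply: lerD; first exact: H.
by apply: le_trans (le_normcD _ _) _; rewrite !normcM normc_conj.
Qed.

Lemma rdiffM F G x p q p' q' : rdiff F x p q -> rdiff G x p' q' ->
  rdiff (fun z => F z * G z) x (p * G x + F x * p') (q * G x + F x * q').
Proof.
move=> dF dG e e0; have [M M0 [d d0 Hd]] := rdiff_lip dF.
have [M' M'0 [d' d'0 Hd']] := rdiff_lip dG.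
pose A := 1 + normc (F x) + normc (G x).
have A0 : 0 < A by rewrite /A ltr_wpDr ?normc_ge0// ltr_wpDr ?normc_ge0.
have e3 : 0 < e / 3 / A by rewrite !divr_gt0.
have [d1 d10 H1] := dF _ e3; have [d2 d20 H2] := dG _ e3.
pose D := e / 3 / (M * M').
have D0 : 0 < D by rewrite !divr_gt0 ?mulr_gt0.
exists (Num.min (Num.min d d') (Num.min D (Num.min d1 d2))) => [|h].
  by rewrite !lt_min d0 d'0 D0 d10.
rewrite !lt_min => /andP[/andP[hd hd'] /andP[hD /andP[hd1 hd2]]].
rewrite [X in normc X](_ : _ = (F (x + h) - F x - (p * h + q * h^*%C)) * G x +
   F x * (G (x + h) - G x - (p' * h + q' * h^*%C)) +
   (F (x + h) - F x) * (G (x + h) - G x)); last by ring.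
have Hh := normc_ge0 h.
have i1 : normc ((F (x + h) - F x - (p * h + q * h^*%C)) * G x) <= e / 3 * normc h.
  rewrite normcM (le_trans (ler_wpM2r (normc_ge0 _) (H1 _ hd1)))//.
  rewrite mulrAC ler_wpM2r// mulrAC ler_pdivrMr// ler_wpM2l ?divr_ge0 ?(ltW e0)//.
  by rewrite /A lerDr addr_ge0 ?normc_ge0.
have i2 : normc (F x * (G (x + h) - G x - (p' * h + q' * h^*%C))) <= e / 3 * normc h.
  rewrite normcM mulrC (le_trans (ler_wpM2r (normc_ge0 _) (H2 _ hd2)))//.
  rewrite mulrAC ler_wpM2r// mulrAC ler_pdivrMr// ler_wpM2l ?divr_ge0 ?(ltW e0)//.
  by rewrite /A [1 + _]addrC -addrA lerDl addr_ge0 ?normc_ge0.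
have i3 : normc ((F (x + h) - F x) * (G (x + h) - G x)) <= e / 3 * normc h.
  rewrite normcM (le_trans (ler_pM (normc_ge0 _) (normc_ge0 _) (Hd _ hd) (Hd' _ hd')))//.
  rewrite mulrACA mulrA ler_wpM2r// mulrC -ler_pdivlMr ?mulr_gt0//.
  exact: ltW.
apply: le_trans (le_normcD _ _) _; have := le_normcD ((F (x + h) - F x - (p * h + q * h^*%C)) * G x)
  (F x * (G (x + h) - G x - (p' * h + q' * h^*%C))).
lra.
Qed.

Lemma rdiff_eqpq F x p q p' q' : p = p' -> q = q' -> rdiff F x p q -> rdiff F x p' q'.
Proof. by move=> -> ->. Qed.

Lemma rdiffZ (c : C) F x p q : rdiff F x p q -> rdiff (fun z => c * F z) x (c * p) (c * q).
Proof.
by move=> dF; apply: rdiff_eqpq (rdiffM (rdiff_cst c x) dF); rewrite mul0r add0r.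
Qed.

Lemma rdiffN F x p q : rdiff F x p q -> rdiff (fun z => - F z) x (- p) (- q).
Proof.
move=> dF; rewrite -[- p]mulN1r -[- q]mulN1r.
by apply: rdiff_ext (rdiffZ (-1) dF) => z; rewrite mulN1r.
Qed.

Lemma rdiffB F G x p q p' q' : rdiff F x p q -> rdiff G x p' q' ->
  rdiff (fun z => F z - G z) x (p - p') (q - q').
Proof. by move=> dF dG; exact: rdiffD dF (rdiffN dG). Qed.

Lemma rdiffJ F x p q : rdiff F x p q -> rdiff (fun z => (F z)^*%C) x q^*%C p^*%C.
Proof.
move=> dF e e0; have [d d0 H] := dF e e0; exists d => // h /H; rewrite -normc_conj.
by congr (normc _ <= _); rewrite !rmorphB !rmorphD !rmorphM /= conjcK; ring.
Qed.

Lemma rdiff_comp F G x p q a b : rdiff F x a b -> rdiff G (F x) p q ->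
  rdiff (fun z => G (F z)) x (p * a + q * b^*%C) (p * b + q * a^*%C).
Proof.
move=> dF dG e e0; have [M M0 [d d0 Hd]] := rdiff_lip dF.
pose A := 1 + normc p + normc q.
have A0 : 0 < A by rewrite /A ltr_wpDr ?normc_ge0// ltr_wpDr ?normc_ge0.
have [d1 d10 H1] := dF (e / 2 / A) ltac:(by rewrite !divr_gt0).
have [d2 d20 H2] := dG (e / 2 / M) ltac:(by rewrite !divr_gt0).
exists (Num.min (Num.min d d1) (d2 / M)) => [|h].
  by rewrite !lt_min d0 d10 divr_gt0.
rewrite !lt_min => /andP[/andP[hd hd1]]; rewrite ltr_pdivlMr// => hd2.
pose k := F (x + h) - F x; pose r := k - (a * h + b * h^*%C).
have kM : normc k <= M * normc h by exact: Hd.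
have kd : normc k < d2 by apply: le_lt_trans kM _; rewrite mulrC.
have := H2 _ kd; rewrite {1}/k [F x + _]addrC subrK => H3.
have := H1 _ hd1; rewrite -/k -/r => H4.
rewrite [X in normc X](_ : _ = (G (F (x + h)) - G (F x) - (p * k + q * k^*%C)) +
   (p * r + q * r^*%C)); last first.
  rewrite /r !rmorphB !rmorphD !rmorphM /= conjcK; ring.
apply: le_trans (le_normcD _ _) _; rewrite [e]splitr mulrDl lerD//.
  apply: le_trans H3 _; rewrite mulrAC ler_pdivrMr// -[e / 2 * _ * M]mulrA ler_wpM2l ?divr_ge0 ?(ltW e0)//.
  by rewrite mulrC.
apply: le_trans (le_normcD _ _) _; rewrite !normcM normc_conj -mulrDl.
apply: le_trans (_ : A * normc r <= _).
  by rewrite ler_wpM2r ?normc_ge0// /A -addrA lerDr.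
rewrite mulrC; apply: le_trans (ler_wpM2r (ltW A0) H4) _.
by rewrite mulrAC divfK// gt_eqF.
Qed.

Lemma rdiff_holcomp F G x p a : rdiff F x a 0 -> rdiff G (F x) p 0 ->
  rdiff (fun z => G (F z)) x (p * a) 0.
Proof.
by move=> dF dG; apply: rdiff_eqpq (rdiff_comp dF dG); rewrite !(mul0r, mulr0, addr0).
Qed.

Lemma rdiff_continuous F x p q : rdiff F x p q -> forall e : R, 0 < e ->
  exists2 d : R, 0 < d & forall h, normc h < d -> normc (F (x + h) - F x) < e.
Proof.
move=> /rdiff_lip[M M0 [d d0 H]] e e0; exists (Num.min d (e / M)).
  by rewrite lt_min d0 divr_gt0.
move=> h; rewrite lt_min => /andP[/H hd]; rewrite ltr_pdivlMr// mulrC.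
exact: le_lt_trans.
Qed.

Lemma rdiff_inv x : x != 0 -> rdiff (fun z => z^-1) x (- x ^- 2) 0.
Proof.
move=> x0 e e0; have nx : 0 < normc x by rewrite normc_gt0.
pose D := e * normc x ^+ 3 / 2.
have D0 : 0 < D by rewrite !mulr_gt0 ?invr_gt0 ?exprn_gt0.
exists (Num.min (normc x / 2) D) => [|h]; first by rewrite lt_min D0 divr_gt0.
rewrite lt_min => /andP[h1 h2].
have nxh : normc x / 2 < normc (x + h).
  have := ler_distc x (- h); rewrite opprK normcN; move: h1.
  by rewrite ltr_pdivlMr//; lra.
have xh : x + h != 0 by rewrite -normc_gt0 (lt_trans _ nxh)// divr_gt0.
rewrite mul0r addr0 [X in normc X](_ : _ = h ^+ 2 / (x ^+ 2 * (x + h))); last first.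
  by field; rewrite x0 xh.
rewrite normcM normcX normcV normcM expr2 -mulrA mulrC.
rewrite ler_wpM2r ?normc_ge0// ler_pdivrMr; last by rewrite normcX mulr_gt0 ?exprn_gt0// normc_gt0.
apply: ltW; apply: lt_le_trans h2 _; rewrite /D -mulrA ler_wpM2l ?(ltW e0)//.
rewrite normcX exprSr -mulrA ler_wpM2l ?exprn_ge0 ?normc_ge0//; exact: ltW.
Qed.

Lemma rdiffV F x p : F x != 0 -> rdiff F x p 0 -> rdiff (fun z => (F z)^-1) x (- p / F x ^+ 2) 0.
Proof.
move=> Fx dF; apply: rdiff_eqpq (rdiff_holcomp dF (rdiff_inv Fx)) => //.
by rewrite mulrC mulrN mulNr.
Qed.

Lemma rdiff_poly (P : {poly C}) x : rdiff (fun z => P.[z]) x P^`().[x] 0.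
Proof.
elim/poly_ind: P => [|P c IH].
  by rewrite deriv0 horner0; apply: rdiff_ext (rdiff_cst 0 x) => z; rewrite horner0.
have := rdiffD (rdiffM IH (rdiff_id x)) (rdiff_cst c x).
move=> /(rdiff_ext (G := fun z => (P * 'X + c%:P).[z])) H.
apply: rdiff_eqpq (H _) => [||z].
- by rewrite derivD derivM derivX derivC addr0 mulr1 !hornerE.
- by rewrite !mul0r mulr0 !addr0.
- by rewrite !hornerE.
Qed.

Lemma is_derive_eps (f : R -> R) (t l : R) :
  (forall e : R, 0 < e -> exists2 d : R, 0 < d &
    forall s, `|s| < d -> `|f (t + s) - f t - l * s| <= e * `|s|) ->
  is_derive t 1 f l.
Proof.
move=> H.
have cl : (fun h => h^-1 *: ((f \o shift t) (h *: 1) - f t)) @ 0^' --> l.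
  apply/cvgrPdist_le => e e0; have [d d0 Hd] := H e e0.
  near=> h.
  have hd : `|h| < d by near: h; exact: dnbhs0_lt.
  have h0 : h != 0 by near: h; exact: nbhs_dnbhs_neq.
  rewrite distrC /= [h *: 1]mulr1 [h + t]addrC.
  rewrite -(ler_pM2r (_ : 0 < `|h|)) ?normr_gt0// -normrM mulrBl.
  by rewrite [_ *: _ * h]mulrAC mulVf// mul1r; exact: Hd.
apply: DeriveDef; first by apply/cvg_ex; exists l.
exact: cvg_lim cl.
Unshelve. all: by end_near. Qed.

Lemma rdiff_line F x v p q (t : R) : rdiff F (x + t%:C * v) p q ->
  is_derive t 1 (fun s : R => complex.Re (F (x + s%:C * v))) (complex.Re (p * v + q * v^*%C)).
Proof.
move=> dF; apply: is_derive_eps => e e0.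
have v1 : 0 < 1 + normc v by rewrite ltr_wpDr ?normc_ge0.
have [d d0 H] := dF _ (divr_gt0 e0 v1).
exists (d / (1 + normc v)); first by rewrite divr_gt0.
move=> s; rewrite ltr_pdivlMr// => sd.
have nsv : normc (s%:C * v) = `|s| * normc v by rewrite normcM normcR.
have sv : normc (s%:C * v) <= `|s| * (1 + normc v).
  by rewrite nsv ler_wpM2l// lerDr.
have := H _ (le_lt_trans sv sd).
rewrite -[x + _ + _]addrA -mulrDl -rmorphD => H1.
rewrite [complex.Re _ * s]mulrC -ReM_real -!ReB.
apply: le_trans (Re_le _) _.
have -> : s%:C * (p * v + q * v^*%C) = p * (s%:C * v) + q * (s%:C * v)^*%C.
  have -> : (s%:C * v)^*%C = s%:C * v^*%C.
    by rewrite rmorphM; congr (_ * _); exact: conjc_real.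
  by ring.
apply: le_trans H1 _; apply: le_trans (ler_wpM2l _ sv) _.
  by rewrite divr_ge0 ?ltW.
by rewrite mulrC -mulrA [_ * (e / _)]mulrC divfK ?gt_eqF// mulrC.
Qed.

Lemma rdiff_lineIm F x v p q (t : R) : rdiff F (x + t%:C * v) p q ->
  is_derive t 1 (fun s : R => complex.Im (F (x + s%:C * v))) (complex.Im (p * v + q * v^*%C)).
Proof.
move=> /(rdiffZ (- 'i)) /rdiff_line.
have RI (z : C) : complex.Re (- 'i * z) = complex.Im z.
  by case: z => a b /=; rewrite oppr0 mul0r mulN1r sub0r opprK.
rewrite -!mulrA -mulrDr RI; congr is_derive.
by apply/funext => s; rewrite RI.
Qed.

Lemma rdiff_cpd F (x p q : C) : rdiff F x p q ->
  cpd1 (fun u => F (x + toC u)) (0, 0) = p + q /\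
  cpd2 (fun u => F (x + toC u)) (0, 0) = 'i * (p - q).
Proof.
move=> dF; have dF0 v : rdiff F (x + (0 : R)%:C * v) p q by rewrite mul0r addr0.
rewrite /cpd1 /cpd2 /pd1 /pd2 /=; split.
  have E s : toC (s, 0 : R) = s%:C * 1 by rewrite mulr1.
  under eq_fun do rewrite E; under [X in _ +i* derive1 X _]eq_fun do rewrite E.
  have /@derive_val := rdiff_line (dF0 1); have /@derive_val := rdiff_lineIm (dF0 1).
  by rewrite !derive1E => -> ->; rewrite conjc1 !mulr1; case: (p + q).
have E s : toC (0 : R, s) = s%:C * 'i by rewrite /toC; simpc.
under eq_fun do rewrite E; under [X in _ +i* derive1 X _]eq_fun do rewrite E.
have /@derive_val := rdiff_line (dF0 'i); have /@derive_val := rdiff_lineIm (dF0 'i).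
rewrite !derive1E => -> ->.
rewrite (_ : p * 'i + q * 'i^*%C = 'i * (p - q)); last first.
  by rewrite (_ : ('i)^*%C = - 'i) ?mulrN 1?mulrC; [ring|simpc].
by case: ('i * (p - q)).
Qed.

(** The values of the total operators [del] and [dbar] at a point of
    differentiability. *)
Lemma rdiff_wirtinger F (x p q : C) : rdiff F x p q ->
  (cpd1 (fun u => F (x + toC u)) (0, 0) - 'i * cpd2 (fun u => F (x + toC u)) (0, 0)) / 2%:R = p /\
  (cpd1 (fun u => F (x + toC u)) (0, 0) + 'i * cpd2 (fun u => F (x + toC u)) (0, 0)) / 2%:R = q.
Proof.
move=> /rdiff_cpd[-> ->]; rewrite mulrA -expr2 sqr_i.
by split; rewrite mulN1r; apply: (mulIf (_ : 2%:R != 0)); rewrite ?pnatr_eq0// divfK ?pnatr_eq0//; ring.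
Qed.

Lemma rdiff_uniq F x p q p' q' : rdiff F x p q -> rdiff F x p' q' -> p = p' /\ q = q'.
Proof. by move=> /rdiff_wirtinger[<- <-] /rdiff_wirtinger[<- <-]. Qed.
End RDiff.

Section C1.
Variable R : realType.
Local Notation C := R[i].

Lemma mean_value (f df : R -> R) (a h : R) :
  (forall s, `|s - a| <= `|h| -> is_derive s 1 f (df s)) ->
  exists2 s, `|s - a| <= `|h| & f (a + h) - f a = df s * h.
Proof.
move=> H.
have der (x y : R) : x <= y -> (forall s, s \in `[x, y] -> is_derive s 1 f (df s)) ->
    exists2 s, s \in `[x, y] & f y - f x = df s * (y - x).
  move=> xy D.
  have D1 s : s \in `]x, y[ -> is_derive s 1 f (df s) by move=> /subset_itv_oo_cc; exact: D.
  have cf : {within `[x, y], continuous f}.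
    by apply: derivable_within_continuous => s /D[].
  have [s sxy E] := MVT_segment xy D1 cf.
  by exists s.
case: (leP 0 h) => [h0|h0].
- have [|s sab E] := der a (a + h) ltac:(by rewrite lerDl).
    move=> s; rewrite in_itv /= => /andP[s1 s2]; apply: H.
    by rewrite !ger0_norm ?subr_ge0// lerBlDl.
  exists s; last by rewrite E [a + h]addrC addrK.
  move: sab; rewrite in_itv /= => /andP[s1 s2].
  by rewrite !ger0_norm ?subr_ge0// lerBlDl.
- have nab s : s \in `[a + h, a] -> `|s - a| <= `|h|.
    rewrite in_itv /= => /andP[s1 s2].
    by rewrite ler0_norm ?subr_le0// ltr0_norm// lerN2 lerBrDl.
  have [|s /nab sab E] := der (a + h) a ltac:(by rewrite gerDl ltW).
    by move=> s /nab/H.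
  by exists s => //; rewrite -[LHS]opprB E -mulrN opprB [a + h]addrC addrK.
Qed.

(** Move along one axis, then along the other, and apply the mean value theorem to
    both steps. *)
Lemma pd_diff (u : R * R -> R) (U : set (R * R)) (z : R * R) (e : R) :
  open U -> U z ->
  (forall w, U w -> derivable (fun s => u (s, w.2)) w.1 1 /\
                    derivable (fun s => u (w.1, s)) w.2 1) ->
  {for z, continuous (pd1 u)} -> {for z, continuous (pd2 u)} -> 0 < e ->
  exists2 d : R, 0 < d & forall h k, `|h| < d -> `|k| < d ->
    `|u (z.1 + h, z.2 + k) - u z - (pd1 u z * h + pd2 u z * k)| <= e * (`|h| + `|k|).
Proof.
case: z => a b oU Uz dU c1 c2 e0.
have : \forall w \near (a, b), [/\ U w, `|pd1 u (a, b) - pd1 u w| < e &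
                                 `|pd2 u (a, b) - pd2 u w| < e].
  have n1 := (cvgrPdist_lt _ _).1 c1 _ e0; have n2 := (cvgrPdist_lt _ _).1 c2 _ e0.
  have n0 : nbhs (a, b) U by exact: open_nbhs_nbhs.
  have {}n1 := n1 (nbhs_filter _); have {}n2 := n2 (nbhs_filter _).
  by apply: filterS3 n0 n1 n2 => w.
move=> /nbhs_ballP[d /= d0 Hd]; exists d => // h k hd kd.
have H1 s t : `|s - a| <= `|h| -> `|t - b| <= `|k| ->
    [/\ U (s, t), `|pd1 u (a, b) - pd1 u (s, t)| < e &
                                 `|pd2 u (a, b) - pd2 u (s, t)| < e].
  by move=> sh tk; apply: Hd; split => /=; rewrite /ball /= distrC;
    [apply: le_lt_trans sh hd | apply: le_lt_trans tk kd].
have kk : `|b + k - b| <= `|k| by rewrite [b + k]addrC addrK.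
have aa : `|a - a| <= `|h| by rewrite subrr normr0.
have [s1 s1h E1] : exists2 s, `|s - a| <= `|h| & u (a + h, b + k) - u (a, b + k) = pd1 u (s, b + k) * h.
  apply: (@mean_value (fun s => u (s, b + k)) (fun s => pd1 u (s, b + k))) => s sh.
  have [Us _ _] := H1 _ _ sh kk; have [D _] := dU _ Us.
  by rewrite /pd1 derive1E; exact: derivableP.
have [s2 s2k E2] : exists2 s, `|s - b| <= `|k| & u (a, b + k) - u (a, b) = pd2 u (a, s) * k.
  apply: (@mean_value (fun s => u (a, s)) (fun s => pd2 u (a, s))) => s sk.
  have [Us _ _] := H1 _ _ aa sk; have [_ D] := dU _ Us.
  by rewrite /pd2 derive1E; exact: derivableP.
have [_ e1 _] := H1 _ _ s1h kk; have [_ _ e2] := H1 _ _ aa s2k.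
rewrite /= (_ : _ - _ = (pd1 u (s1, b + k) - pd1 u (a, b)) * h +
   (pd2 u (a, s2) - pd2 u (a, b)) * k); last first.
  rewrite -[u (a + h, b + k)](subrK (u (a, b + k))) E1.
  have /eqP := E2; rewrite subr_eq => /eqP ->; ring.
apply: le_trans (ler_normD _ _) _; rewrite mulrDr !normrM.
by apply: lerD; rewrite ler_wpM2r// distrC ltW.
Qed.

Lemma ofCK (z : C) : toC (ofC z) = z. Proof. by case: z. Qed.

Lemma wirtinger_lin (A B h : C) : (A - 'i * B) / 2%:R * h + (A + 'i * B) / 2%:R * h^*%C
  = (complex.Re h)%:C * A + (complex.Im h)%:C * B.
Proof.
have -> : h^*%C = (complex.Re h)%:C - 'i * (complex.Im h)%:C.
  by case: h => a b; simpc.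
have {1}-> : h = (complex.Re h)%:C + 'i * (complex.Im h)%:C.
  by case: h => a b; simpc.
move: (complex.Re h)%:C (complex.Im h)%:C => x y.
have : ('i%R : C) ^+ 2 = -1 by exact: sqrCi.
move: ('i%R : C) => j j2.
transitivity (x * A - j ^+ 2 * y * B); last by rewrite j2; ring.
by field.
Qed.

Lemma csmooth_rdiff (F : R * R -> C) (U : set (R * R)) (z : C) :
  open U -> U (ofC z) -> csmooth_on U F ->
  rdiff (fun x => F (ofC x)) z ((cpd1 F (ofC z) - 'i * cpd2 F (ofC z)) / 2%:R)
    ((cpd1 F (ofC z) + 'i * cpd2 F (ofC z)) / 2%:R).
Proof.
move=> oU Uz [sR sI].
have key (u : R * R -> R) (e : R) : smooth_on U u -> 0 < e ->
    exists2 d : R, 0 < d & forall h, normc h < d ->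
    `|u (ofC (z + h)) - u (ofC z) - (pd1 u (ofC z) * complex.Re h + pd2 u (ofC z) * complex.Im h)|
       <= e * normc h.
  move=> su e0; have e2 : 0 < e / 2 by rewrite divr_gt0.
  have [d d0 H] := pd_diff oU Uz (fun w Uw => let: And3 _ a b := su [::] w Uw in conj a b)
    (let: And3 a _ _ := su [:: true] _ Uz in a) (let: And3 a _ _ := su [:: false] _ Uz in a) e2.
  exists d => // h hd.
  have := H (complex.Re h) (complex.Im h) (le_lt_trans (Re_le _) hd) (le_lt_trans (Im_le _) hd).
  rewrite -ReD -ImD => H1; apply: le_trans H1 _.
  have := Re_le h; have := Im_le h; nra.
move=> e e0; have e2 : 0 < e / 2 by rewrite divr_gt0.
have [d d0 H] := key _ _ sR e2; have [d' d'0 H'] := key _ _ sI e2.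
exists (Num.min d d') => [|h]; first by rewrite lt_min d0.
rewrite lt_min => /andP[/H h1 /H' h2].
rewrite wirtinger_lin.
apply: le_trans (normc_le _) _; rewrite [e]splitr (mulrDl _ _ (normc h)); apply: lerD.
  apply: le_trans h1; rewrite le_eqVlt; apply/orP; left; apply/eqP; congr (`| _ |).
  by rewrite !(ReB, ReD, ImB, ImD) !ReM_real mulrC [_ * complex.Im _]mulrC.
apply: le_trans h2; rewrite le_eqVlt; apply/orP; left; apply/eqP; congr (`| _ |).
by rewrite !(ReB, ReD, ImB, ImD) !ImM_real mulrC [_ * complex.Im _]mulrC.
Qed.

End C1.

(** * Functions on a punctured disc *)

Section Segments.
Variable R : realType.
Local Notation C := R[i].

Definition seg (a b : C) (t : R) : C := a + t%:C * (b - a).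

Lemma seg0 a b : seg a b 0 = a. Proof. by rewrite /seg mul0r addr0. Qed.
Lemma seg1 a b : seg a b 1 = b. Proof. by rewrite /seg mul1r addrC subrK. Qed.

Lemma seg_disc (c a b : C) (r t : R) : 0 <= t <= 1 ->
  normc (a - c) <= r -> normc (b - c) <= r -> normc (seg a b t - c) <= r.
Proof.
move=> /andP[t0 t1] ar br.
have -> : seg a b t - c = (1 - t)%:C * (a - c) + t%:C * (b - c).
  by rewrite /seg rmorphB rmorph1; ring.
apply: le_trans (le_normcD _ _) _; rewrite !normcM !normcR !ger0_norm ?subr_ge0//.
apply: le_trans (_ : (1 - t) * r + t * r <= r); last by rewrite -mulrDl subrK mul1r.
by apply: lerD; apply: ler_wpM2l; rewrite ?subr_ge0.
Qed.

Lemma lip01 (f df : R -> R) (B : R) :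
  (forall s : R, 0 <= s <= 1 -> is_derive s 1 f (df s) /\ `|df s| <= B) ->
  `|f 1 - f 0| <= B.
Proof.
move=> H.
have D1 (s : R) : s \in `]0, 1[ -> is_derive s 1 f (df s).
  by rewrite in_itv /= => /andP[s0 s1]; apply: (H _ _).1; rewrite !ltW.
have cf : {within `[0, 1], continuous f}.
  by apply: derivable_within_continuous => s; rewrite in_itv /= => /H[[]].
have [s s01 ->] := MVT_segment ler01 D1 cf.
by move: s01; rewrite in_itv /= subr0 mulr1 => /H[].
Qed.

(** The factor 2 comes from the real and the imaginary part, each of which satisfies
    a mean value theorem. *)
Lemma seg_bound (v v' : C -> C) (a b : C) (B : R) :
  (forall t : R, 0 <= t <= 1 -> rdiff v (seg a b t) (v' (seg a b t)) 0 /\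
                        normc (v' (seg a b t)) <= B) ->
  normc (v b - v a) <= 2 * B * normc (b - a).
Proof.
move=> H; rewrite -mulrA mulr_natl mulr2n.
apply: le_trans (normc_le _) _; rewrite ReB ImB.
have h1 : `|complex.Re (v (seg a b 1)) - complex.Re (v (seg a b 0))| <= B * normc (b - a).
  apply: (@lip01 (fun t => complex.Re (v (seg a b t)))
    (fun t => complex.Re (v' (seg a b t) * (b - a)))) => s /H[D Bd]; split.
    by have := rdiff_line D; rewrite mul0r addr0.
  by apply: le_trans (Re_le _) _; rewrite normcM ler_wpM2r ?normc_ge0.
have h2 : `|complex.Im (v (seg a b 1)) - complex.Im (v (seg a b 0))| <= B * normc (b - a).
  apply: (@lip01 (fun t => complex.Im (v (seg a b t)))
    (fun t => complex.Im (v' (seg a b t) * (b - a)))) => s /H[D Bd]; split.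
    by have := rdiff_lineIm D; rewrite mul0r addr0.
  by apply: le_trans (Im_le _) _; rewrite normcM ler_wpM2r ?normc_ge0.
by move: h1 h2; rewrite seg1 seg0 => h1 h2; apply: lerD.
Qed.

Definition pdisc (c : C) (e : R) : set C := [set s | 0 < normc (s - c) < e].

Lemma pdisc_neq c e s : pdisc c e s -> s != c.
Proof. by move=> /andP[]; rewrite normc_gt0 subr_eq0. Qed.

(** A segment that meets the centre is replaced by two that avoid it, through a
    quarter turn of the starting point. *)
Lemma pdisc_path (c : C) (a b : C) : a != c -> b != c ->
  (forall t : R, 0 <= t <= 1 -> seg a b t != c) \/
  ((forall t : R, 0 <= t <= 1 -> seg a (c + 'i * (a - c)) t != c) /\
   (forall t : R, 0 <= t <= 1 -> seg (c + 'i * (a - c)) b t != c)).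
Proof.
move=> ac bc; have [H|] := pselect (forall t : R, 0 <= t <= 1 -> seg a b t != c); first by left.
move=> /existsNP[t /not_implyP[t01 /negP/negPn/eqP tc]]; right.
have ac0 : a - c != 0 by rewrite subr_eq0.
have i0 : ('i%R : C) ^+ 2 = -1 by exact: sqrCi.
have e1 : (1 - t)%:C * (a - c) = - (t%:C * (b - c)).
  apply/eqP; rewrite -subr_eq0 opprK; apply/eqP.
  transitivity (seg a b t - c); last by rewrite tc subrr.
  by rewrite /seg rmorphB rmorph1; ring.
have t0 : t != 0.
  by apply: contra_neq ac0 => t0; move: e1; rewrite t0 subr0 mul1r mul0r oppr0.
pose r := (1 - t) / t.
have r0 : 0 <= r by move/andP: t01 => [h1 h2]; rewrite divr_ge0// subr_ge0.
have bE : b - c = - (r%:C * (a - c)).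
  have tC : t%:C != 0 by rewrite (inj_eq (@complexI _)).
  apply: (mulfI tC); rewrite mulrN mulrA -rmorphM /r [t * _]mulrC divfK// e1 opprK//.
clearbody r.
have re_neq (x y : R) : (x != 0) || (y != 0) -> x%:C + 'i * y%:C != 0.
  apply: contraTN => /eqP/(congr1 (fun z => (complex.Re z, complex.Im z))).
  by rewrite ReD ImD ReMi ImMi /= => -[]; rewrite oppr0 addr0 add0r => -> ->; rewrite eqxx.
split => s /andP[s0 s1].
  rewrite -subr_eq0 (_ : _ - c = (a - c) * ((1 - s)%:C + 'i * s%:C)); last first.
    by rewrite /seg rmorphB rmorph1; ring.
  rewrite mulf_neq0// re_neq//; have [->|//] := eqVneq s 0; rewrite ?subr0 ?oner_eq0//.
  by rewrite orbT.
rewrite -subr_eq0 (_ : _ - c = (a - c) * ((- (s * r))%:C + 'i * (1 - s)%:C)); last first.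
  transitivity ((1 - s)%:C * 'i * (a - c) + s%:C * (b - c)).
    by rewrite /seg rmorphB rmorph1; ring.
  by rewrite bE rmorphN rmorphM; ring.
rewrite mulf_neq0// re_neq//.
have [s1E|] := eqVneq s 1; last by rewrite eq_sym -subr_eq0 => ->; rewrite orbT.
rewrite s1E mul1r oppr_eq0; suff -> : r != 0 by [].
apply: contra_neq bc => rE; apply/eqP; rewrite -subr_eq0 bE rE mul0r oppr0//.
Qed.

Lemma normcI (a : C) : normc ('i * a) = normc a.
Proof. by rewrite normcM (_ : normc _ = 1) ?mul1r// -[RHS](@normci R). Qed.

Lemma path_bound (v v' : C -> C) (c : C) (e rho B : R) :
  rho < e -> (forall s, pdisc c e s -> rdiff v s (v' s) 0) ->
  (forall s, s != c -> normc (s - c) <= rho -> normc (v' s) <= B) ->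
  forall a b, a != c -> b != c -> normc (a - c) <= rho -> normc (b - c) <= rho ->
    normc (v a - v b) <= 8 * B * rho.
Proof.
move=> re dv Bv a b ac bc ar br.
have B0 : 0 <= B by apply: le_trans (Bv _ ac ar); exact: normc_ge0.
have r0 : 0 <= rho by apply: le_trans ar; exact: normc_ge0.
have one x y : (forall t : R, 0 <= t <= 1 -> seg x y t != c) -> normc (x - c) <= rho ->
    normc (y - c) <= rho -> normc (v y - v x) <= 4 * B * rho.
  move=> xy xr yr.
  have H : normc (v y - v x) <= 2 * B * normc (y - x).
    apply: (@seg_bound v v') => t t01.
    have sr := seg_disc t01 xr yr; split; last by apply: Bv => //; exact: xy.
    apply: dv; rewrite /pdisc /= normc_gt0 subr_eq0 xy//=.
    exact: le_lt_trans sr re.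
  apply: le_trans H _.
  have h : normc (y - x) <= 2 * rho.
    rewrite (_ : y - x = (y - c) - (x - c)); last by ring.
    by apply: le_trans (ler_normcB _ _) _; rewrite mulr_natl mulr2n lerD.
  by apply: le_trans (ler_wpM2l _ h) _; rewrite ?mulr_ge0// le_eqVlt; apply/orP; left; apply/eqP; ring.
have [H|[H1 H2]] := pdisc_path ac bc.
  rewrite normcB; apply: le_trans (one _ _ H ar br) _.
  by rewrite !ler_wpM2r// ler_nat.
pose m := c + 'i * (a - c).
have mr : normc (m - c) <= rho by rewrite /m [c + _]addrC addrK normcI.
rewrite (_ : v a - v b = - (v m - v a) - (v b - v m)); last by ring.
apply: le_trans (ler_normcB _ _) _; rewrite normcN.
have := one _ _ H1 ar mr; have := one _ _ H2 mr br; rewrite -/m; lra.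
Qed.

(** The limit is the supremum of the lower bounds [g s - K |s - c|]; this gives the
    rate of convergence at once. *)
Lemma limit_real (g : C -> R) (D : set C) (c : C) (K : R) : D !=set0 ->
  (forall s1 s2, D s1 -> D s2 -> `|g s1 - g s2| <= K * (normc (s1 - c) + normc (s2 - c))) ->
  exists l : R, forall s, D s -> `|g s - l| <= K * normc (s - c).
Proof.
move=> [s0 Ds0] H; pose A := [set g s - K * normc (s - c) | s in D].
have ubA s : D s -> ubound A (g s + K * normc (s - c)).
  move=> Ds _ [s1 Ds1 <-]; have := H _ _ Ds1 Ds; rewrite ler_norml => /andP[_]; lra.
have hA : has_sup A.
  by split; [exists (g s0 - K * normc (s0 - c)); exists s0|exists (g s0 + K * normc (s0 - c)); exact: ubA].
exists (sup A) => s Ds; rewrite ler_distl; apply/andP; split.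
  rewrite lerBlDr; apply: ge_sup; [by case: hA|exact: ubA].
have : g s - K * normc (s - c) <= sup A by apply: ub_le_sup; [by case: hA|exists s].
lra.
Qed.

Lemma limit_cplx (v : C -> C) (D : set C) (c : C) (K : R) : D !=set0 ->
  (forall s1 s2, D s1 -> D s2 -> normc (v s1 - v s2) <= K * (normc (s1 - c) + normc (s2 - c))) ->
  exists l : C, forall s, D s -> normc (v s - l) <= 2 * K * normc (s - c).
Proof.
move=> D0 H.
have hR (s1 s2 : C) : D s1 -> D s2 ->
    `|complex.Re (v s1) - complex.Re (v s2)| <= K * (normc (s1 - c) + normc (s2 - c)).
  by move=> h1 h2; rewrite -ReB; apply: le_trans (Re_le _) (H _ _ h1 h2).
have hI (s1 s2 : C) : D s1 -> D s2 ->
    `|complex.Im (v s1) - complex.Im (v s2)| <= K * (normc (s1 - c) + normc (s2 - c)).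
  by move=> h1 h2; rewrite -ImB; apply: le_trans (Im_le _) (H _ _ h1 h2).
have [a Ha] := limit_real D0 hR; have [b Hb] := limit_real D0 hI.
exists (a +i* b) => s Ds; apply: le_trans (normc_le _) _.
by rewrite ReB ImB /=; have := Ha _ Ds; have := Hb _ Ds; lra.
Qed.

Lemma pdisc_nonempty c (e : R) : 0 < e -> pdisc c e !=set0.
Proof.
move=> e0; exists (c + (e / 2)%:C); rewrite /pdisc /= [c + _]addrC addrK normcR.
by rewrite ger0_norm ?divr_ge0 ?ltW//; apply/andP; split; lra.
Qed.

(** A bounded derivative makes [v] Lipschitz along the paths of [pdisc_path], so
    that it has a limit at the centre. *)
Lemma pdisc_limit (v v' : C -> C) (c : C) (e B : R) : 0 < e ->
  (forall s, pdisc c e s -> rdiff v s (v' s) 0) ->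
  (forall s, pdisc c e s -> normc (v' s) <= B) ->
  exists l, forall s, pdisc c e s -> normc (v s - l) <= 16 * B * normc (s - c).
Proof.
move=> e0 dv Bv.
have [l Hl] : exists l : C, forall s, pdisc c e s -> normc (v s - l) <= 2 * (8 * B) * normc (s - c).
  apply: limit_cplx; first exact: pdisc_nonempty.
  move=> s1 s2 D1 D2.
  have B0 : 0 <= B by apply: le_trans (Bv _ D1); exact: normc_ge0.
  pose rho := Num.max (normc (s1 - c)) (normc (s2 - c)).
  have re : rho < e by rewrite gt_max; case/andP: D1 => _ ->; case/andP: D2 => _ ->.
  have := @path_bound v v' c e rho B re dv _ s1 s2 (pdisc_neq D1) (pdisc_neq D2).
  rewrite !le_max !lexx ?orbT => H; apply: le_trans (H _ _ _) _ => //.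
    move=> s sc sr; apply: Bv; rewrite /pdisc /= normc_gt0 subr_eq0 sc/=.
    exact: le_lt_trans sr re.
  rewrite ler_wpM2l ?mulr_ge0// ge_max lerDl lerDr !normc_ge0//.
by exists l => s /Hl; congr (_ <= _ * _); ring.
Qed.

(** The difference of [v] and its expected tangent has derivative O(|s - c|), hence
    is O(|s - c|^2) along the paths of [pdisc_path]. *)
Lemma pdisc_extend (v v' : C -> C) (c l l' : C) (e B B' : R) : 0 < e ->
  (forall s, pdisc c e s -> rdiff v s (v' s) 0) ->
  (forall s, pdisc c e s -> normc (v s - l) <= B * normc (s - c)) ->
  (forall s, pdisc c e s -> normc (v' s - l') <= B' * normc (s - c)) ->
  rdiff (fun s => if s == c then l else v s) c l' 0.
Proof.
move=> e0 dv Bv Bv'.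
pose w s := v s - l' * (s - c).
have dw s : pdisc c e s -> rdiff w s (v' s - l') 0.
  move=> Ds; have := rdiffB (dv _ Ds) (rdiffZ l' (rdiffB (rdiff_id s) (rdiff_cst c s))).
  by apply: rdiff_eqpq; rewrite !subr0 ?mulr1 ?mulr0 ?subr0.
have quad s : pdisc c e s -> normc (v s - l - l' * (s - c)) <= 8 * B' * normc (s - c) ^+ 2.
  move=> Ds; have /andP[s0 se] := Ds; set rho := normc (s - c) in s0 se *.
  have B'0 : 0 <= B'.
    by have := le_trans (normc_ge0 _) (Bv' _ Ds); rewrite pmulr_lge0.
  have B0 : 0 <= B.
    by have := le_trans (normc_ge0 _) (Bv _ Ds); rewrite pmulr_lge0.
  apply/ler_addgt0Pr => x x0.
  pose y := Num.min rho (x / (B + normc l' + 1)).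
  have A0 : 0 < B + normc l' + 1 by rewrite ltr_wpDl// addr_ge0 ?normc_ge0.
  have y0 : 0 < y by rewrite lt_min s0 divr_gt0.
  have yr : y <= rho by rewrite ge_min lexx.
  have yx : y * (B + normc l' + 1) <= x by rewrite -ler_pdivlMr// ge_min lexx orbT.
  pose s2 := c + y%:C.
  have s2c : normc (s2 - c) = y by rewrite /s2 [c + _]addrC addrK normcR gtr0_norm.
  have Ds2 : pdisc c e s2 by rewrite /pdisc /= s2c y0 (le_lt_trans yr).
  have h1 : normc (w s - w s2) <= 8 * (B' * rho) * rho.
    apply: (@path_bound w (fun s => v' s - l') c e) => //; rewrite ?s2c//.
    - move=> z zc zr; apply: le_trans (Bv' _ _) _; last by rewrite ler_wpM2l.
      by rewrite /pdisc /= normc_gt0 subr_eq0 zc (le_lt_trans zr).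
    - exact: pdisc_neq Ds.
    - exact: pdisc_neq Ds2.
  have h2 : normc (w s2 - l) <= B * y + normc l' * y.
    rewrite (_ : w s2 - l = (v s2 - l) - l' * (s2 - c)); last by rewrite /w; ring.
    by apply: le_trans (ler_normcB _ _) _; rewrite normcM s2c lerD2r -s2c; exact: Bv.
  rewrite (_ : v s - l - _ = (w s - w s2) + (w s2 - l)); last by rewrite /w; ring.
  apply: le_trans (le_normcD _ _) _.
  apply: lerD; first by apply: le_trans h1 _; rewrite expr2 !mulrA.
  apply: le_trans h2 (le_trans _ yx); rewrite -mulrDl mulrC ler_wpM2l ?(ltW y0)//.
  by rewrite lerDl.
move=> x x0; have [s1 Ds1] := pdisc_nonempty c e0.
have B'0 : 0 <= B'.
  have := le_trans (normc_ge0 _) (Bv' _ Ds1).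
  by rewrite pmulr_lge0//; case/andP: Ds1.
exists (Num.min e (x / (8 * B' + 1))).
  by rewrite lt_min e0 divr_gt0// ltr_wpDl// mulr_ge0.
move=> h; rewrite lt_min eqxx => /andP[he hx].
rewrite mul0r addr0; have [h0|h0] := eqVneq (c + h) c.
  move/eqP: h0; rewrite -subr_eq0 [c + h]addrC addrK => /eqP->.
  by rewrite mulr0 !subrr normc0 mulr0.
have h0' : 0 < normc h by move: h0; rewrite -subr_eq0 [c + h]addrC addrK normc_gt0.
have := quad (c + h); rewrite /pdisc /= [c + h]addrC addrK h0' he => /(_ isT) H.
apply: le_trans H _; rewrite expr2 mulrA ler_wpM2r ?normc_ge0//.
move: hx; rewrite ltr_pdivlMr ?ltr_wpDl ?mulr_ge0//; have := normc_ge0 h; nra.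
Qed.

End Segments.

(** * Gronwall's inequality on a punctured disc *)

Section Gronwall.
Variable R : realType.
Local Notation C := R[i].

Lemma gronwall01 (n dn : R -> R) (M : R) :
  (forall t : R, 0 <= t <= 1 -> is_derive t 1 n (dn t) /\ dn t <= M * n t) ->
  n 1 <= expR M * n 0.
Proof.
move=> H; pose g t := expR (- M * t) * n t.
have dg (t : R) : 0 <= t <= 1 -> is_derive t 1 g (expR (- M * t) * (dn t - M * n t)).
  move=> /H[D _].
  have DM : is_derive t 1 (fun s : R => - M * s) (- M).
    have := is_deriveZ (- M) (is_derive_id t (1 : R)).
    by rewrite [_%:A]mulr1.
  have De := is_derive1_comp (is_derive_expR (- M * t)) DM.
  have := is_deriveM De D.
  by congr is_derive; rewrite /= /GRing.scale /=; ring.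
have cg : {within `[0, 1], continuous g}.
  by apply: derivable_within_continuous => s; rewrite in_itv /= => /dg[].
have g10 : g 1 <= g 0.
  apply: (@ler0_derive1_nincr _ g 0 1) => //.
  - by move=> x; rewrite in_itv /= => /andP[x0 x1]; have [] := dg x ltac:(by rewrite !ltW).
  - move=> x; rewrite in_itv /= => /andP[x0 x1]; have x01 : 0 <= x <= 1 by rewrite !ltW.
    rewrite derive1E; have /@derive_val -> := dg x x01.
    by rewrite pmulr_rle0 ?expR_gt0// subr_le0; have [] := H x x01.
move: g10; rewrite /g mulr0 expR0 mul1r mulr1 expRN.
by rewrite mulrC ler_pdivrMr ?expR_gt0// mulrC.
Qed.

Lemma is_derive_bigsum (I : Type) (r : seq I) (f : I -> R -> R) (df : I -> R) (t : R) :
  (forall i, is_derive t 1 (f i) (df i)) ->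
  is_derive t 1 (fun s => \sum_(i <- r) f i s) (\sum_(i <- r) df i).
Proof.
move=> H; elim: r => [|i r IH].
  under eq_fun do rewrite big_nil.
  by rewrite big_nil; exact: is_derive_cst.
under eq_fun do rewrite big_cons.
by rewrite big_cons; exact: is_deriveD.
Qed.

(** Gronwall's inequality is applied to the sum of squared norms, which is
    differentiable where the norms are not; the summand 1 absorbs the inhomogeneous
    part. *)
Lemma gronwall_seg (I : finType) (y y' : I -> C -> C) (a b : C) (K r : R) : 0 <= K ->
  normc (b - a) <= r ->
  (forall (t : R) i, 0 <= t <= 1 -> rdiff (y i) (seg a b t) (y' i (seg a b t)) 0 /\
     normc (y' i (seg a b t)) <= K * (1 + \sum_k normc (y k (seg a b t)))) ->
  forall i, normc (y i b) <=
    1 + expR (4 * r * K * (#|I|%:R + 1) ^+ 2) * (1 + \sum_k normc (y k a) ^+ 2).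
Proof.
move=> K0 br H.
pose m : R := #|I|%:R.
pose n (t : R) := 1 + \sum_i (complex.Re (y i (seg a b t)) ^+ 2 + complex.Im (y i (seg a b t)) ^+ 2).
pose dn (t : R) := \sum_i (2 * complex.Re (y i (seg a b t)) * complex.Re (y' i (seg a b t) * (b - a)) +
   2 * complex.Im (y i (seg a b t)) * complex.Im (y' i (seg a b t) * (b - a))).
pose M := 4 * r * K * (m + 1) ^+ 2.
have nsq (z : C) : complex.Re z ^+ 2 + complex.Im z ^+ 2 = normc z ^+ 2.
  by case: z => u v /=; rewrite sqr_sqrtr ?addr_ge0 ?sqr_ge0.
have r0 : 0 <= r by apply: le_trans br; exact: normc_ge0.
have m0 : 0 <= m by rewrite /m ler0n.
have key (t : R) : 0 <= t <= 1 -> is_derive t 1 n (dn t) /\ dn t <= M * n t.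
  move=> t01; split.
    rewrite -[dn t]add0r; apply: is_deriveD; apply: is_derive_bigsum => i.
    have [D _] := H t i t01.
    have D1 := rdiff_line D; have D2 := rdiff_lineIm D.
    rewrite !mul0r !addr0 in D1 D2.
    have := is_deriveD (is_deriveX 2 D1) (is_deriveX 2 D2).
    by congr is_derive; rewrite /= /GRing.scale /= !expr1.
  set q := fun i => normc (y i (seg a b t)).
  have q0 i : 0 <= q i by exact: normc_ge0.
  pose S := \sum_i q i.
  have S0 : 0 <= S by apply: sumr_ge0.
  pose Q := \sum_i q i ^+ 2.
  have Q0 : 0 <= Q by apply: sumr_ge0 => i _; exact: sqr_ge0.
  have nE : n t = 1 + Q by rewrite /n; congr (_ + _); apply: eq_bigr => i _; rewrite nsq.
  have SQ : S <= m + Q.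
    rewrite /S /m -sumr_const -big_split /=; apply: ler_sum => i _.
    have := q0 i; have := sqr_ge0 (q i - 1); nra.
  have S2 : S ^+ 2 <= m * Q.
    have E i : \sum_j (q i ^+ 2 + q j ^+ 2) = m * q i ^+ 2 + Q.
      by rewrite big_split /= sumr_const -mulr_natl.
    have : 2 * (S * S) <= \sum_i \sum_j (q i ^+ 2 + q j ^+ 2).
      rewrite {1}/S mulr_suml mulr_sumr; apply: ler_sum => i _.
      rewrite /S !mulr_sumr; apply: ler_sum => j _.
      have := sqr_ge0 (q i - q j); nra.
    under [X in _ <= X]eq_bigr do rewrite E.
    rewrite big_split /= -mulr_sumr sumr_const -[Q *+ _]mulr_natl -/Q -/m expr2; lra.
  have B1 : dn t <= 4 * r * K * (S * (1 + S)).
    rewrite /dn.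
    apply: le_trans (_ : \sum_i (4 * r * K * (q i * (1 + S))) <= _); last first.
      by rewrite -mulr_sumr -mulr_suml.
    apply: ler_sum => i _; have [_ B] := H t i t01.
    have p1 : `|complex.Re (y' i (seg a b t) * (b - a))| <= K * (1 + S) * r.
      apply: le_trans (Re_le _) _; rewrite normcM; apply: ler_pM => //; exact: normc_ge0.
    have p2 : `|complex.Im (y' i (seg a b t) * (b - a))| <= K * (1 + S) * r.
      apply: le_trans (Im_le _) _; rewrite normcM; apply: ler_pM => //; exact: normc_ge0.
    have u1 : complex.Re (y i (seg a b t)) * complex.Re (y' i (seg a b t) * (b - a)) <= q i * (K * (1 + S) * r).
      apply: le_trans (ler_norm _) _; rewrite normrM; apply: ler_pM => //; exact: Re_le.
    have u2 : complex.Im (y i (seg a b t)) * complex.Im (y' i (seg a b t) * (b - a)) <= q i * (K * (1 + S) * r).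
      apply: le_trans (ler_norm _) _; rewrite normrM; apply: ler_pM => //; exact: Im_le.
    rewrite -!mulrA; move: u1 u2; set X := _ * _; set X2 := _ * complex.Im _; lra.
  apply: le_trans B1 _; rewrite /M nE -!mulrA; do 3 (apply: ler_wpM2l => //).
  nra.
have G := gronwall01 key.
rewrite /= -/m -/M; have n0E : n 0 = 1 + \sum_k normc (y k a) ^+ 2.
  by rewrite /n; congr (_ + _); apply: eq_bigr => i _; rewrite nsq seg0.
rewrite -n0E.
move=> i; have : normc (y i b) ^+ 2 <= n 1.
  rewrite /n seg1 (bigD1 i) //= nsq.
  have : 0 <= \sum_(k | k != i) (complex.Re (y k b) ^+ 2 + complex.Im (y k b) ^+ 2).
    by apply: sumr_ge0 => k _; rewrite addr_ge0 ?sqr_ge0.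
  lra.
move=> /le_trans /(_ G); have := normc_ge0 (y i b); nra.
Qed.

(** Two base points a quarter turn apart suffice: every point of the punctured disc
    is joined to one of them by a segment that avoids the centre. *)
Lemma gronwall_pdisc (I : finType) (y y' : I -> C -> C) (c : C) (e K : R) : 0 < e -> 0 <= K ->
  (forall s i, pdisc c e s -> rdiff (y i) s (y' i s) 0 /\
     normc (y' i s) <= K * (1 + \sum_k normc (y k s))) ->
  exists B : R, forall s i, pdisc c e s -> normc (y i s) <= B.
Proof.
move=> e0 K0 H.
pose s1 := c + (e / 2)%:C; pose s2 := c + 'i * (s1 - c).
have n1 : normc (s1 - c) = e / 2 by rewrite /s1 [c + _]addrC addrK normcR ger0_norm ?divr_ge0 ?ltW.
have n2 : normc (s2 - c) = e / 2 by rewrite /s2 [c + _]addrC addrK normcI.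
have e2 : 0 < e / 2 < e by apply/andP; split; lra.
have D1 : pdisc c e s1 by rewrite /pdisc /= n1.
have D2 : pdisc c e s2 by rewrite /pdisc /= n2.
pose A a := 1 + expR (4 * (2 * e) * K * (#|I|%:R + 1) ^+ 2) * (1 + \sum_k normc (y k a) ^+ 2).
have step a b i : pdisc c e a -> pdisc c e b -> (forall t : R, 0 <= t <= 1 -> seg a b t != c) ->
    normc (y i b) <= A a.
  move=> /andP[a0 ae] /andP[b0 be] ab; apply: (@gronwall_seg I y y') => //.
    rewrite (_ : b - a = (b - c) - (a - c)); last by ring.
    by apply: le_trans (ler_normcB _ _) _; rewrite mulr_natl mulr2n lerD// ltW.
  move=> t k t01; apply: H; rewrite /pdisc /= normc_gt0 subr_eq0 ab//=.
  have m : Num.max (normc (a - c)) (normc (b - c)) < e by rewrite gt_max ae be.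
  by apply: le_lt_trans m; apply: seg_disc => //; rewrite le_max lexx ?orbT.
exists (Num.max (A s1) (A s2)) => s i Ds.
have [h|[_ h]] := pdisc_path (pdisc_neq D1) (pdisc_neq Ds).
  by rewrite le_max (step s1 s).
by rewrite le_max (step s2 s) ?orbT.
Qed.
End Gronwall.

(** * Bounded derivatives and linear differential equations *)

Section Nice.
Variable R : realType.
Local Notation C := R[i].
Implicit Types (D : set C) (u v : C -> C) (k : nat).

(** Boundedness is required at every order: on a punctured disc this is what allows
    the extension over the centre, and a linear differential equation passes it on
    from one order to the next. *)
Fixpoint nice D k u : Prop :=
  (exists B : R, forall s, D s -> normc (u s) <= B) /\
  (if k is k'.+1 then exists u', (forall s, D s -> rdiff u s (u' s) 0) /\ nice D k' u'
   else True).

Definition opened D := forall s, D s -> exists2 d : R, 0 < d & forall h, normc h < d -> D (s + h).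

Lemma nice_bound D k u : nice D k u -> exists B : R, forall s, D s -> normc (u s) <= B.
Proof. by case: k => [|k] []. Qed.

Lemma niceW D k u : nice D k.+1 u -> nice D k u.
Proof.
elim: k u => [|k IH] u [Bu [u' [du nu]]]; first by split.
by split=> //; exists u'; split => //; exact: IH.
Qed.

Lemma nice_sub D D' k u : D' `<=` D -> nice D k u -> nice D' k u.
Proof.
move=> DD; elim: k u => [|k IH] u [[B Bu] H]; split => //; try by exists B => s /DD; exact: Bu.
by case: H => u' [du /IH nu]; exists u'; split => // s /DD; exact: du.
Qed.

Lemma nice_eq D k u v : opened D -> (forall s, D s -> u s = v s) -> nice D k u -> nice D k v.
Proof.
move=> oD; elim: k u v => [|k IH] u v uv [[B Bu] H]; (split; first by
  exists B => s Ds; rewrite -uv//; exact: Bu) => //.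
case: H => u' [du nu]; exists u'; split => // s Ds; apply: rdiff_near (du s Ds).
by have [d d0 Hd] := oD _ Ds; exists d => // h /Hd; exact: uv.
Qed.

Lemma nice_cst D k c : nice D k (fun=> c).
Proof.
elim: k c => [|k IH] c; (split; first by exists (normc c)) => //.
by exists (fun=> 0); split => // s _; exact: rdiff_cst.
Qed.

Lemma nice_id D k (B : R) : (forall s, D s -> normc s <= B) -> nice D k id.
Proof.
move=> DB; case: k => [|k]; (split; first by exists B) => //.
by exists (fun=> 1); split; [move=> s _; exact: rdiff_id|exact: nice_cst].
Qed.

Lemma niceD D k u v : nice D k u -> nice D k v -> nice D k (fun s => u s + v s).
Proof.
elim: k u v => [|k IH] u v [[B Bu] H] [[B' Bv] H']; (split; first by
  exists (B + B') => s Ds; apply: le_trans (le_normcD _ _) _; rewrite lerD ?Bu ?Bv) => //.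
case: H => u' [du nu]; case: H' => v' [dv nv]; exists (fun s => u' s + v' s); split.
  by move=> s Ds; rewrite -[0]addr0; apply: rdiffD; [exact: du|exact: dv].
exact: IH.
Qed.

Lemma niceM D k u v : nice D k u -> nice D k v -> nice D k (fun s => u s * v s).
Proof.
elim: k u v => [|k IH] u v Hu Hv; have [B Bu] := nice_bound Hu; have [B' Bv] := nice_bound Hv;
  (split; first by
  exists (B * B') => s Ds; rewrite normcM ler_pM ?normc_ge0 ?Bu ?Bv) => //.
have nu := niceW Hu; have nv := niceW Hv.
case: Hu => _ [u' [du nu']]; case: Hv => _ [v' [dv nv']].
exists (fun s => u' s * v s + u s * v' s); split.
  move=> s Ds; apply: rdiff_eqpq (rdiffM (du s Ds) (dv s Ds)) => //.
  by rewrite mul0r mulr0 addr0.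
by apply: niceD; apply: IH.
Qed.

Lemma niceZ D k c u : nice D k u -> nice D k (fun s => c * u s).
Proof. exact: niceM (nice_cst D k c). Qed.

Lemma niceN D k u : opened D -> nice D k u -> nice D k (fun s => - u s).
Proof. by move=> oD /(niceZ (-1)); apply: nice_eq => // s _; rewrite mulN1r. Qed.

Lemma niceB D k u v : opened D -> nice D k u -> nice D k v -> nice D k (fun s => u s - v s).
Proof. by move=> oD Hu Hv; apply: niceD => //; exact: niceN. Qed.

Lemma niceV D k u (b : R) : 0 < b -> (forall s, D s -> b <= normc (u s)) ->
  nice D k u -> nice D k (fun s => (u s)^-1).
Proof.
move=> b0 Hb; have u0 s : D s -> u s != 0.
  by move=> /Hb/(lt_le_trans b0); rewrite normc_gt0.
elim: k => [|k IH] Hu; (split; first by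
  exists b^-1 => s Ds; rewrite normcV lef_pV2 ?posrE ?Hb// (lt_le_trans b0)// Hb) => //.
have nu := niceW Hu; case: Hu => _ [u' [du nu']].
exists (fun s => (-1 * u' s) * ((u s)^-1 * (u s)^-1)); split.
  move=> s Ds; apply: rdiff_eqpq (rdiffV (u0 _ Ds) (du _ Ds)) => //.
  by rewrite mulN1r -invfM -expr2.
apply: niceM; first exact: niceZ.
by apply: niceM; exact: IH.
Qed.

Lemma nice_poly D k (P : {poly C}) u : opened D -> nice D k u -> nice D k (fun s => P.[u s]).
Proof.
move=> oD nu; elim/poly_ind: P => [|P c IH].
  by apply: nice_eq (nice_cst D k 0) => // s _; rewrite horner0.
apply: nice_eq (niceD (niceM IH nu) (nice_cst D k c)) => // s _.
by rewrite !hornerE.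
Qed.

Lemma nice_sum D k (I : Type) (r : seq I) (u : I -> C -> C) : opened D ->
  (forall i, nice D k (u i)) -> nice D k (fun s => \sum_(i <- r) u i s).
Proof.
move=> oD H; elim: r => [|i r IH].
  by apply: nice_eq (nice_cst D k 0) => // s _; rewrite big_nil.
by apply: nice_eq (niceD (H i) IH) => // s _; rewrite big_cons.
Qed.

Lemma pdisc_open c (e : R) : opened (pdisc c e).
Proof.
move=> s /andP[s0 se]; exists (Num.min (normc (s - c)) (e - normc (s - c))).
  by rewrite lt_min s0 subr_gt0.
move=> h; rewrite lt_min => /andP[h1 h2]; rewrite /pdisc /=.
rewrite (_ : s + h - c = (s - c) + h); last by ring.
apply/andP; split.
  by apply: lt_le_trans (_ : normc (s - c) - normc h <= _); [rewrite subr_gt0|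
    rewrite -(normcN h) -{2}[h]opprK; exact: ler_distc].
by apply: le_lt_trans (le_normcD _ _) _; rewrite addrC -ltrBrDr.
Qed.

End Nice.

(** * Removable singularities of linear differential equations *)

Section Removal.
Variable R : realType.
Local Notation C := R[i].

(** The chain of derivatives is part of the definition, since the iterated partial
    derivatives of a smooth function are read off from it. *)
Definition holo (c : C) (e : R) (F : C -> C) := exists G : nat -> C -> C,
  G 0%N = F /\ forall n s, normc (s - c) < e -> rdiff (G n) s (G n.+1 s) 0.

Definition der (u : C -> C) (s : C) : C :=
  (cpd1 (fun z => u (s + toC z)) (0, 0) - 'i * cpd2 (fun z => u (s + toC z)) (0, 0)) / 2%:R.

Lemma derE (u : C -> C) s p q : rdiff u s p q -> der u s = p.
Proof. by move=> /rdiff_wirtinger[]. Qed.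

Lemma nice_der (D : set C) (u : C -> C) : opened D -> (forall k, nice D k u) ->
  (forall s, D s -> rdiff u s (der u s) 0) /\ forall k, nice D k (der u).
Proof.
move=> oD nu; split.
  by move=> s Ds; have [_ [u' [du _]]] := nu 1%N; rewrite (derE (du _ Ds)); exact: du.
move=> k; have [_ [u' [du nu']]] := nu k.+1.
by apply: nice_eq nu' => // s Ds; rewrite (derE (du _ Ds)).
Qed.

Lemma cchoice (A B : Type) (P : A -> B -> Prop) :
  (forall a, exists b, P a b) -> exists f, forall a, P a (f a).
Proof. by move=> /boolp.choice[f Hf]; exists f. Qed.

(** Each derivative has itself a bounded derivative, so it has a limit by
    [pdisc_limit]; by [pdisc_extend] the extensions form again a chain of
    derivatives. *)
Lemma nice_extend (c : C) (e : R) (u : C -> C) : 0 < e ->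
  (forall k, nice (pdisc c e) k u) ->
  exists F, (forall s, pdisc c e s -> F s = u s) /\ holo c e F.
Proof.
move=> e0 nu; have oD := @pdisc_open R c e.
pose U n := iter n der u.
have nU n : forall k, nice (pdisc c e) k (U n).
  by elim: n => [//|n IH] /=; have [] := nice_der oD IH.
have dU n s : pdisc c e s -> rdiff (U n) s (U n.+1 s) 0.
  by move=> Ds; have [+ _] := nice_der oD (nU n); exact.
have [l Hl] : exists l : nat -> C, forall n, exists B, forall s, pdisc c e s ->
    normc (U n s - l n) <= B * normc (s - c).
  apply: (@cchoice nat C (fun n l => exists B, forall s, pdisc c e s ->
    normc (U n s - l) <= B * normc (s - c))) => n.
  have [B HB] := nice_bound (nU n.+1 0%N).
  have [l Hl] := pdisc_limit e0 (dU n) HB.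
  by exists l, (16 * B).
pose G n s := if s == c then l n else U n s.
exists (G 0%N); split => [s Ds|]; first by rewrite /G (negbTE (pdisc_neq Ds)).
exists G; split => // n s se.
have [->|sc] := eqVneq s c.
  have [B HB] := Hl n; have [B' HB'] := Hl n.+1.
  by rewrite {2}/G eqxx; exact: pdisc_extend e0 (dU n) HB HB'.
have Ds : pdisc c e s by rewrite /pdisc /= normc_gt0 subr_eq0 sc.
rewrite {2}/G (negbTE sc); apply: rdiff_near (dU n s Ds).
have [d d0 H] := oD _ Ds; exists d => // h /H/pdisc_neq hc.
by rewrite /G (negbTE hc).
Qed.

Definition mnice D k (M : C -> 'M[C]_2) := forall i j, nice D k (fun s => M s i j).

Lemma mnice_mul D k M N : opened D -> mnice D k M -> mnice D k N ->
  mnice D k (fun s => M s *m N s).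
Proof.
move=> oD HM HN i j.
have := @nice_sum R D k _ (index_enum 'I_2) (fun l s => M s i l * N s l j) oD
   (fun l => niceM (HM i l) (HN l j)).
by apply: nice_eq => // s _; rewrite mxE.
Qed.

Lemma mnice_comm_ode D k (Y N L : C -> 'M[C]_2) : opened D ->
  mnice D k Y -> mnice D k N -> mnice D k L ->
  mnice D k (fun s => N s + (Y s *m L s - L s *m Y s)).
Proof.
move=> oD HY HN HL i j.
have := niceD (HN i j) (niceB oD (mnice_mul oD HY HL i j) (mnice_mul oD HL HY i j)).
by apply: nice_eq => // s _; rewrite !mxE.
Qed.

(** A single-valued solution of a linear differential equation on a punctured disc
    extends over the centre as soon as the coefficients do: by Gronwall's inequality
    it is bounded, and the equation then bounds its derivatives one by one. *)
Lemma ode_removal (c : C) (e : R) (Y N L : C -> 'M[C]_2) : 0 < e ->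
  (forall k, mnice (pdisc c e) k N) -> (forall k, mnice (pdisc c e) k L) ->
  (forall s i j, pdisc c e s -> rdiff (fun z => Y z i j) s
     ((N s + (Y s *m L s - L s *m Y s)) i j) 0) ->
  forall i j, exists F, (forall s, pdisc c e s -> F s = Y s i j) /\ holo c e F.
Proof.
move=> e0 nN nL dY.
have oD := @pdisc_open R c e.
have mb M : mnice (pdisc c e) 0 M -> exists2 B : R, 0 <= B & forall s i j, pdisc c e s -> normc (M s i j) <= B.
  move=> H; have [f Hf] : exists f : 'I_2 * 'I_2 -> R, forall ij s, pdisc c e s -> normc (M s ij.1 ij.2) <= f ij.
    apply: (@cchoice _ R (fun ij B => forall s, pdisc c e s -> normc (M s ij.1 ij.2) <= B)) => ij.
    exact: (nice_bound (H ij.1 ij.2)).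
  exists (\sum_ij `|f ij|) => [|s i j Ds]; first by apply: sumr_ge0.
  apply: le_trans (Hf (i, j) s Ds) _; rewrite (bigD1 (i, j)) //=.
  by apply: le_trans (ler_norm _) _; rewrite lerDl sumr_ge0.
have [BN BN0 HN] := mb _ (nN 0%N); have [BL BL0 HL] := mb _ (nL 0%N).
pose y (ij : 'I_2 * 'I_2) s := Y s ij.1 ij.2.
pose y' (ij : 'I_2 * 'I_2) s := (N s + (Y s *m L s - L s *m Y s)) ij.1 ij.2.
have [B HB] : exists B : R, forall s i, pdisc c e s -> normc (y i s) <= B.
  apply: (@gronwall_pdisc R _ y y' c e (BN + 2 * BL)) => //.
    by rewrite addr_ge0// mulr_ge0.
  move=> s [i j] Ds; split; first exact: dY.
  have ySle (k l : 'I_2) : normc (Y s k l) <= \sum_ij normc (y ij s).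
    by rewrite (bigD1 (k, l)) //= lerDl sumr_ge0// => *; exact: normc_ge0.
  set S := \sum_ij _ in ySle *.
  have S0 : 0 <= S by apply: sumr_ge0 => *; exact: normc_ge0.
  rewrite /y' /= !mxE !big_ord_recl !big_ord0 !addr0.
  have Yl k l : normc (Y s k l * L s l j) <= normc (Y s k l) * BL.
    by rewrite normcM ler_wpM2l ?normc_ge0 ?HL.
  have Lr k l : normc (L s i k * Y s k l) <= BL * normc (Y s k l).
    by rewrite normcM ler_wpM2r ?normc_ge0 ?HL.
  have two (k l : 'I_2 * 'I_2) : k != l -> normc (y k s) + normc (y l s) <= S.
    move=> kl; rewrite /S (bigD1 k) //= (bigD1 l) 1?eq_sym //= addrA lerDl.
    by rewrite sumr_ge0// => *; exact: normc_ge0.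
  have h1 := HN s i j Ds.
  have t1 : normc (y (i, ord0) s) + normc (y (i, lift ord0 ord0) s) <= S.
    by apply: two; rewrite xpair_eqE eqxx.
  have t2 : normc (y (ord0, j) s) + normc (y (lift ord0 ord0, j) s) <= S.
    by apply: two; rewrite xpair_eqE negb_and.
  rewrite /y /= in t1 t2.
  apply: le_trans (le_normcD _ _) _; rewrite mulrDr mulr1 [BN + _ + _]addrAC -addrA.
  apply: lerD => //.
  apply: le_trans (ler_normcB _ _) _.
  have u1 := le_normcD (Y s i ord0 * L s ord0 j) (Y s i (lift ord0 ord0) * L s (lift ord0 ord0) j).
  have u2 := le_normcD (L s i ord0 * Y s ord0 j) (L s i (lift ord0 ord0) * Y s (lift ord0 ord0) j).
  have := Yl i ord0; have := Yl i (lift ord0 ord0).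
  have := Lr ord0 j; have := Lr (lift ord0 ord0) j.
  have m1 : BL * (normc (Y s i ord0) + normc (Y s i (lift ord0 ord0))) <= BL * S by rewrite ler_wpM2l.
  have m2 : BL * (normc (Y s ord0 j) + normc (Y s (lift ord0 ord0) j)) <= BL * S by rewrite ler_wpM2l.
  have m3 : 0 <= BN * S by rewrite mulr_ge0.
  move: u1 u2 m1 m2 m3; set a1 := normc (_ + _); set a2 := normc (_ + _).
  move: (normc (Y s i _ * _)) (normc (Y s i _ * _)) (normc (L s i _ * _)) (normc (L s i _ * _)) => ? ? ? ?.
  nra.
have nY k : mnice (pdisc c e) k Y.
  elim: k => [|k IH] i j; (split; first by exists B => s Ds; exact: (HB s (i, j))) => //.
  exists (fun s => (N s + (Y s *m L s - L s *m Y s)) i j); split; first by move=> s; exact: dY.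
  exact: mnice_comm_ode.
by move=> i j; apply: nice_extend => // k; exact: nY.
Qed.

Lemma opened_open (D : set C) : opened D -> open [set z : R * R | D (toC z)].
Proof.
move=> oD; rewrite openE => z Dz; have [d d0 H] := oD _ Dz.
rewrite /interior; apply/nbhs_ballP; exists (d / 2); first by rewrite /= divr_gt0.
move=> w [/= h1 h2]; rewrite /ball /= in h1 h2.
have -> : toC w = toC z + (toC w - toC z) by ring.
apply: H; apply: le_lt_trans (normc_le _) _.
rewrite ReB ImB /= distrC [X in _ + X]distrC; lra.
Qed.

Lemma disc_opened (c : C) (e : R) : opened [set s | normc (s - c) < e].
Proof.
move=> s /= se; exists (e - normc (s - c)); first by rewrite subr_gt0.
move=> h hs; rewrite (_ : s + h - c = (s - c) + h); last by ring.
by apply: le_lt_trans (le_normcD _ _) _; rewrite addrC -ltrBrDr.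
Qed.

Lemma rdiff_cvg (F : C -> C) (z : R * R) p q : rdiff F (toC z) p q ->
  {for z, continuous (fun w : R * R => complex.Re (F (toC w)))}.
Proof.
move=> dF; apply/cvgrPdist_lt => e e0; have [d d0 H] := rdiff_continuous dF e0.
suff : nbhs z [set w | `|complex.Re (F (toC z)) - complex.Re (F (toC w))| < e] by [].
apply/nbhs_ballP; exists (d / 2); first by rewrite /= divr_gt0.
move=> w [/= h1 h2]; rewrite /ball /= in h1 h2.
rewrite distrC -ReB; apply: le_lt_trans (Re_le _) _.
have -> : toC w = toC z + (toC w - toC z) by ring.
apply: H; apply: le_lt_trans (normc_le _) _.
rewrite ReB ImB /= distrC [X in _ + X]distrC; lra.
Qed.

(** Each iterated partial derivative is the real part of a constant times a member
    of the chain. *)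
Lemma holo_smooth (e : R) (F : C -> C) : 0 < e -> holo 0 e F ->
  csmooth_on [set z | normc (toC z) < e] (fun z => F (toC z)).
Proof.
move=> e0 [G [G0 dG]].
pose D : set C := [set s | normc (s - 0) < e].
pose U : set (R * R) := [set z | D (toC z)].
have UE : [set z : R * R | normc (toC z) < e] = U
  by apply/funext => z; rewrite /U /D /mkset subr0.
have oU : open U by apply: opened_open; exact: disc_opened.
rewrite UE.
have toC1 (z : R * R) (s : R) : toC (s, z.2) = toC (0, z.2) + s%:C * 1.
  by rewrite mulr1 /toC; simpc.
have toC2 (z : R * R) (s : R) : toC (z.1, s) = toC (z.1, 0) + s%:C * 'i.
  by rewrite /toC; simpc.
have dRe c n (z : R * R) : U z ->
    is_derive z.1 1 (fun s => complex.Re (c * G n (toC (s, z.2)))) (complex.Re (c * G n.+1 (toC z))) /\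
    is_derive z.2 1 (fun s => complex.Re (c * G n (toC (z.1, s)))) (complex.Re (c * 'i * G n.+1 (toC z))).
  move=> Uz; have D1 := rdiffZ c (dG n _ Uz); split.
    under eq_fun do rewrite toC1.
    have E := toC1 z z.1; rewrite -surjective_pairing in E.
    rewrite E in D1.
    by have := rdiff_line D1; rewrite mulr0 mul0r addr0 mulr1 -E.
  under eq_fun do rewrite toC2.
  have E := toC2 z z.2; rewrite -surjective_pairing in E.
  rewrite E in D1.
  by have := rdiff_line D1; rewrite mulr0 mul0r addr0 -E mulrAC.
have near1 (v w : R * R -> R) z : U z -> (forall x, U x -> v x = w x) ->
    \forall s \near z.1, v (s, z.2) = w (s, z.2).
  move=> Uz vw; have /nbhs_ballP[d /= d0 H] : nbhs z U by exact: open_nbhs_nbhs.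
  apply/nbhs_ballP; exists d => // s sd; apply: vw; apply: H; split => //=; exact: ballxx.
have near2 (v w : R * R -> R) z : U z -> (forall x, U x -> v x = w x) ->
    \forall s \near z.2, v (z.1, s) = w (z.1, s).
  move=> Uz vw; have /nbhs_ballP[d /= d0 H] : nbhs z U by exact: open_nbhs_nbhs.
  apply/nbhs_ballP; exists d => // s sd; apply: vw; apply: H; split => //=; exact: ballxx.
suff key c : smooth_on U (fun z => complex.Re (c * F (toC z))).
  split; first by have := key 1; congr smooth_on; apply/funext => z; rewrite mul1r.
  have := key (- 'i); congr smooth_on; apply/funext => z.
  by case: (F (toC z)) => a b /=; rewrite oppr0 mul0r mulN1r sub0r opprK.
move=> w; cbv zeta; set v := foldr _ _ _.
have [c' [n vE]] : exists c' n, forall z, U z -> v z = complex.Re (c' * G n (toC z)).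
  rewrite /v; elim: w {v} => [|b w [c' [n IH]]] /=; first by exists c, 0%N; rewrite G0.
  case: b.
    exists c', n.+1 => z Uz; rewrite /pd1 derive1E.
    have [D1 _] := dRe c' n z Uz.
    by have /@derive_val := near_eq_is_derive (near1 _ _ z Uz (fun x Ux => esym (IH x Ux))) D1.
  exists (c' * 'i), n.+1 => z Uz; rewrite /pd2 derive1E.
  have [_ D1] := dRe c' n z Uz.
  by have /@derive_val := near_eq_is_derive (near2 _ _ z Uz (fun x Ux => esym (IH x Ux))) D1.
move=> z Uz; split.
- have C1 := rdiff_cvg (rdiffZ c' (dG n _ Uz)).
  suff : v x @[x --> z] --> v z by [].
  rewrite (vE _ Uz); apply: cvg_trans C1.
  apply: near_eq_cvg; have nU : nbhs z U by exact: open_nbhs_nbhs.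
  by apply: filterS nU => x Ux; rewrite vE.
- have [D1 _] := dRe c' n z Uz.
  by have [] := near_eq_is_derive (near1 _ _ z Uz (fun x Ux => esym (vE x Ux))) D1.
- have [_ D1] := dRe c' n z Uz.
  by have [] := near_eq_is_derive (near2 _ _ z Uz (fun x Ux => esym (vE x Ux))) D1.
Qed.

End Removal.

(** * The small root of H1(X) = s^2 H2(X) *)

Section Implicit.
Variable R : realType.
Local Notation C := R[i].

Lemma poly_lip (p : {poly C}) : exists2 K : R, 0 <= K & forall x y, normc x <= 1 -> normc y <= 1 ->
  normc (p.[x] - p.[y]) <= K * normc (x - y) /\
  normc (p.[x] - p.[y] - p^`().[0] * (x - y)) <= K * (normc x + normc y) * normc (x - y).
Proof.
elim/poly_ind: p => [|p c [K K0 IH]].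
  exists 0 => // x y _ _; by rewrite deriv0 !horner0 !subrr !mul0r oppr0 addr0 normc0; split.
exists (2 * K + normc p.[0]); first by rewrite addr_ge0 ?mulr_ge0 ?normc_ge0.
move=> x y x1 y1; have [H1 _] := IH x y x1 y1.
have z1 : normc (0 : C) <= 1 by rewrite normc0.
have [H0 _] := IH x 0 x1 z1; rewrite subr0 in H0.
have dE : (p * 'X + c%:P)^`().[0] = p.[0].
  by rewrite derivD derivM derivX derivC addr0 mulr1 !hornerE.
have E : (p * 'X + c%:P).[x] - (p * 'X + c%:P).[y] - p.[0] * (x - y) =
   (p.[x] - p.[0]) * (x - y) + (p.[x] - p.[y]) * y by rewrite !hornerE; ring.
have B : normc ((p * 'X + c%:P).[x] - (p * 'X + c%:P).[y] - p.[0] * (x - y)) <=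
    K * (normc x + normc y) * normc (x - y).
  rewrite E; apply: le_trans (le_normcD _ _) _; rewrite !normcM mulrDr mulrDl; apply: lerD.
    by apply: ler_wpM2r => //; exact: normc_ge0.
  rewrite mulrAC; apply: le_trans (ler_wpM2r (normc_ge0 _) H1) _.
  by rewrite mulrAC.
split; last first.
  rewrite dE; apply: le_trans B _; rewrite -!mulrA; apply: ler_wpM2r.
    by rewrite mulr_ge0 ?addr_ge0 ?normc_ge0.
  by have := normc_ge0 p.[0]; lra.
rewrite -(subrK (p.[0] * (x - y)) (_ - _)).
apply: le_trans (le_normcD _ _) _; rewrite mulrDl normcM lerD2r.
apply: le_trans B _; apply: ler_wpM2r; first exact: normc_ge0.
by rewrite mulrC; apply: ler_wpM2r => //; lra.
Qed.

(** If no root lies in the disc of radius [rho], the logarithmic derivative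
    at the origin is at most [degree / rho]. *)
Lemma small_root (p : {poly C}) (rho : R) : 0 < rho -> p^`().[0] != 0 ->
  (size p)%:R * normc p.[0] < rho * normc p^`().[0] ->
  exists2 x, normc x < rho & p.[x] = 0.
Proof.
move=> rho0 dp small.
have [H|/forallNP H] := pselect (exists x, normc x < rho /\ p.[x] = 0).
  by have [x [x1 x2]] := H; exists x.
exfalso.
have pN0 : p != 0 by apply: contraNneq dp => ->; rewrite deriv0 horner0.
have [rs prs] := closed_field_poly_normal p.
have lc0 : lead_coef p != 0 by rewrite lead_coef_eq0.
have rsr r : r \in rs -> rho <= normc r.
  move=> rrs; rewrite leNgt; apply/negP => rlt; apply: (H r); split => //.
  by apply/eqP; rewrite -/(root p r) prs rootZ// root_prod_XsubC.
have key : forall l : seq C, (forall r, r \in l -> rho <= normc r) ->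
    rho * normc (\prod_(z <- l) ('X - z%:P))^`().[0] <= (size l)%:R * normc (\prod_(z <- l) ('X - z%:P)).[0].
  elim=> [|r l IH] Hl; first by rewrite big_nil derivC horner0 normc0 mulr0 mul0r.
  rewrite big_cons derivM derivXsubC mul1r; set q := \prod_(_ <- _) _ in IH *.
  have -> : (q + ('X - r%:P) * q^`()).[0] = q.[0] + - r * q^`().[0] by rewrite !hornerE; ring.
  have -> : (('X - r%:P) * q).[0] = - r * q.[0] by rewrite !hornerE; ring.
  have rr := Hl r (mem_head _ _).
  have {}IH : rho * normc q^`().[0] <= (size l)%:R * normc q.[0].
    by apply: IH => x xl; apply: Hl; rewrite in_cons xl orbT.
  have := le_normcD q.[0] (- r * q^`().[0]); rewrite !normcM !normcN.
  have -> : (size (r :: l))%:R = 1 + (size l)%:R :> R by rewrite /= -natr1 addrC.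
  move=> h; apply: le_trans (ler_wpM2l (ltW rho0) h) _.
  have n0 := normc_ge0 q.[0]; have nr := normc_ge0 r.
  nra.
move: small; rewrite ltNge => /negP; apply.
have E1 : p^`().[0] = lead_coef p * (\prod_(z <- rs) ('X - z%:P))^`().[0].
  by rewrite {1}prs derivZ hornerZ.
have E2 : p.[0] = lead_coef p * (\prod_(z <- rs) ('X - z%:P)).[0].
  by rewrite {1}prs hornerZ.
rewrite E1 E2 !normcM mulrCA [X in _ <= X]mulrCA.
apply: ler_wpM2l; first exact: normc_ge0.
apply: le_trans (key rs rsr) _; apply: ler_wpM2r; first exact: normc_ge0.
rewrite ler_nat prs size_scale// size_prod_XsubC//.
Qed.

Variables H1 H2 : {poly C}.
Hypothesis H10 : H1.[0] = 0.
Hypothesis dH10 : H1^`().[0] != 0.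

(** Existence comes from [small_root], for each [s]; uniqueness and the Lipschitz
    bound from a lower bound for the difference quotients of H1 - s^2 H2 near 0; the
    derivative from implicit differentiation. *)
Lemma implicit_root : exists (e rho B : R) (xi : C -> C),
  [/\ 0 < e, 0 < rho,
      forall s, normc s < e -> [/\ normc (xi s) < rho, normc (xi s) <= B * normc s &
         H1.[xi s] = s ^+ 2 * H2.[xi s]],
      forall s X, normc s < e -> normc X < rho -> H1.[X] = s ^+ 2 * H2.[X] -> X = xi s &
      [/\ forall s, normc s < e -> rdiff xi s
        (2%:R * s * H2.[xi s] / (H1^`().[xi s] - s ^+ 2 * H2^`().[xi s])) 0,
      forall k, nice [set s | normc (s - 0) < e] k xi &
      exists2 b : R, 0 < b & forall s, normc s < e ->
        b <= normc (H1^`().[xi s] - s ^+ 2 * H2^`().[xi s])]].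
Proof.
pose a := normc H1^`().[0].
have a0 : 0 < a by rewrite normc_gt0.
have [K1 K10 L1] := poly_lip H1; have [K2 K20 L2] := poly_lip H2.
have [K3 K30 L3] := poly_lip H1^`(); have [K4 K40 L4] := poly_lip H2^`().
pose M2 := K2 + normc H2.[0]; pose M4 := K4 + normc H2^`().[0].
have M20 : 0 <= M2 by rewrite addr_ge0 ?normc_ge0.
have M40 : 0 <= M4 by rewrite addr_ge0 ?normc_ge0.
have z1 : normc (0 : C) <= 1 by rewrite normc0.
have B2 x : normc x <= 1 -> normc H2.[x] <= M2.
  move=> x1; have [h _] := L2 x 0 x1 z1; rewrite -(subrK H2.[0] H2.[x]).
  apply: le_trans (le_normcD _ _) _; rewrite lerD2r; apply: le_trans h _.
  by rewrite subr0; apply: ler_piMr.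
have B4 x : normc x <= 1 -> normc H2^`().[x] <= M4.
  move=> x1; have [h _] := L4 x 0 x1 z1; rewrite -(subrK H2^`().[0] H2^`().[x]).
  apply: le_trans (le_normcD _ _) _; rewrite lerD2r; apply: le_trans h _.
  by rewrite subr0; apply: ler_piMr.
(* With these radii the derivative of H1 - s^2 H2 stays of norm at least a / 2. *)
pose rho := Num.min 1 (a / (8 * (K1 + K3 + 1))).
have rho0 : 0 < rho by rewrite lt_min ltr01 divr_gt0// mulr_gt0// ltr_wpDl// addr_ge0.
have rho1 : rho <= 1 by rewrite ge_min lexx.
have rhoK : 8 * (K1 + K3 + 1) * rho <= a.
  rewrite mulrC -ler_pdivlMr; first by rewrite ge_min lexx orbT.
  by rewrite mulr_gt0// ltr_wpDl// addr_ge0.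
pose n : R := (maxn (size H1) (size H2))%:R.
have n0 : 0 <= n by rewrite ler0n.
pose e := Num.min 1 (Num.min (a / (8 * (K2 + M4 + 1))) (a * rho / (4 * (n * M2 + 1)))).
have e0 : 0 < e.
  rewrite !lt_min ltr01 /=; apply/andP; split; rewrite divr_gt0 ?mulr_gt0//.
    by rewrite ltr_wpDl// addr_ge0.
  by rewrite ltr_wpDl// mulr_ge0.
have e1 : e <= 1 by rewrite ge_min lexx.
have eK : 8 * (K2 + M4 + 1) * e <= a.
  rewrite mulrC -ler_pdivlMr; first by rewrite !ge_min lexx ?orbT.
  by rewrite mulr_gt0// ltr_wpDl// addr_ge0.
have en : 4 * (n * M2 + 1) * e <= a * rho.
  rewrite mulrC -ler_pdivlMr; first by rewrite !ge_min lexx ?orbT.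
  by rewrite mulr_gt0// ltr_wpDl// mulr_ge0.
pose p s := H1 - (s ^+ 2) *: H2.
have pE s x : (p s).[x] = H1.[x] - s ^+ 2 * H2.[x] by rewrite !hornerE.
have dpE s x : (p s)^`().[x] = H1^`().[x] - s ^+ 2 * H2^`().[x].
  by rewrite derivB derivZ !hornerE.
have s2 s : normc s < e -> normc (s ^+ 2) <= e.
  move=> se; rewrite normcX expr2; have := normc_ge0 s; move: se e1; clear; nra.
have lower s x y : normc s < e -> normc x <= rho -> normc y <= rho ->
    a / 2 * normc (x - y) <= normc ((p s).[x] - (p s).[y]).
  move=> se xr yr; have x1 := le_trans xr rho1; have y1 := le_trans yr rho1.
  have [_ h1] := L1 x y x1 y1; have [h2 _] := L2 x y x1 y1.
  set d := x - y in h1 h2 *; have d0 := normc_ge0 d.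
  have E : H1^`().[0] * d = ((p s).[x] - (p s).[y]) - (H1.[x] - H1.[y] - H1^`().[0] * d)
      + (H1.[x] - H1.[y] - (H1.[x] - H1.[y])) + 0
      + s ^+ 2 * (H2.[x] - H2.[y]) + 0 * d + (H1^`().[0] * d - H1^`().[0] * d)  by rewrite !pE; ring.
  have := congr1 (@normc R) E; rewrite [in LHS]normcM -/a subrr addr0 addr0 mul0r addr0 subrr addr0 => Ea.
  have t1 := le_normcD ((p s).[x] - (p s).[y] - (H1.[x] - H1.[y] - H1^`().[0] * d)) (s ^+ 2 * (H2.[x] - H2.[y])).
  have t2 := ler_normcB ((p s).[x] - (p s).[y]) (H1.[x] - H1.[y] - H1^`().[0] * d).
  have t3 : normc (s ^+ 2 * (H2.[x] - H2.[y])) <= e * (K2 * normc d).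
    by rewrite normcM; apply: ler_pM; rewrite ?normc_ge0 ?s2.
  have xy : normc x + normc y <= 2 * rho by move: xr yr; clear; lra.
  have t4 : K1 * (normc x + normc y) * normc d <= (K1 * (2 * rho)) * normc d.
    exact: ler_wpM2r d0 _ _ (ler_wpM2l K10 xy).
  have t5 : 0 <= K3 * rho by rewrite mulr_ge0 // ltW.
  have t6 : 0 <= M4 * e by rewrite mulr_ge0 // ltW.
  have t7 : (2 * (K1 * rho) + e * K2) * normc d <= a / 2 * normc d.
    by apply: (ler_wpM2r d0); move: rhoK eK t5 t6 rho0 e0 a0; clear; lra.
  by move: Ea t1 t2 t3 t4 t7 h1; clear; lra.
have dlow s x : normc s < e -> normc x <= rho -> a / 2 <= normc (p s)^`().[x].
  move=> se xr; have x1 := le_trans xr rho1.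
  have [h1 _] := L3 x 0 x1 z1; rewrite subr0 in h1.
  have h2 : normc (s ^+ 2 * H2^`().[x]) <= e * M4 by rewrite normcM; apply: ler_pM; rewrite ?normc_ge0 ?s2 ?B4.
  have E : H1^`().[0] = (p s)^`().[x] - (H1^`().[x] - H1^`().[0]) + s ^+ 2 * H2^`().[x] by rewrite dpE; ring.
  have := congr1 (@normc R) E; rewrite -/a => Ea.
  have t1 := le_normcD ((p s)^`().[x] - (H1^`().[x] - H1^`().[0])) (s ^+ 2 * H2^`().[x]).
  have t2 := ler_normcB (p s)^`().[x] (H1^`().[x] - H1^`().[0]).
  have t3 : K3 * normc x <= K3 * rho by apply: ler_wpM2l.
  have t5 : 0 <= K1 * rho by rewrite mulr_ge0 // ltW.
  have t6 : 0 <= K2 * e by rewrite mulr_ge0 // ltW.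
  by move: Ea t1 t2 t3 h1 h2 rhoK eK t5 t6 rho0 e0 a0; clear; lra.
have sizep s : (size (p s))%:R <= n.
  rewrite ler_nat; apply: leq_trans (size_polyD _ _) _; rewrite size_polyN geq_max leq_maxl.
  by apply: leq_trans (size_scale_leq _ _) _; exact: leq_maxr.
have ex s : normc s < e -> exists2 x, normc x < rho & (p s).[x] = 0.
  move=> se; apply: small_root => //.
    have := dlow s 0 se; rewrite normc0 => /(_ (ltW rho0)) h.
    by rewrite -normc_gt0; apply: lt_le_trans h; rewrite divr_gt0.
  have h := dlow s 0 se; rewrite normc0 in h; have {}h := h (ltW rho0).
  have p0 : normc (p s).[0] <= e * M2.
    rewrite pE H10 sub0r normcN normcM; apply: ler_pM; rewrite ?normc_ge0 ?s2// B2//.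
  have q1 : (size (p s))%:R * normc (p s).[0] <= n * (e * M2).
    by apply: ler_pM => //; exact: normc_ge0.
  have q2 : rho * (a / 2) <= rho * normc (p s)^`().[0] by apply: ler_wpM2l => //; exact: ltW.
  have q3 : 0 <= a * rho by rewrite mulr_ge0 ?ltW.
  apply: le_lt_trans q1 (lt_le_trans _ q2).
  have : 0 <= n * M2 * e by rewrite !mulr_ge0 // ltW.
  by move: en e0 q3; clear; lra.
have [xi Hxi] : exists xi : C -> C, forall s, normc s < e -> normc (xi s) < rho /\ (p s).[xi s] = 0.
  apply: (@cchoice C C (fun s x => normc s < e -> normc x < rho /\ (p s).[x] = 0)) => s.
  have [se|nse] := boolP (normc s < e); last by exists 0.
  by have [x x1 x2] := ex s se; exists x.
have uniq s X : normc s < e -> normc X < rho -> (p s).[X] = 0 -> X = xi s.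
  move=> se Xr pX; have [xr px] := Hxi s se.
  have := lower s X (xi s) se (ltW Xr) (ltW xr); rewrite pX px subrr normc0 => h.
  apply/eqP; rewrite -subr_eq0 -normc_eq0 eq_le normc_ge0 andbT.
  by move: h; rewrite pmulr_rle0// divr_gt0.
have xilip s h : normc s < e -> normc (s + h) < e -> normc (xi (s + h) - xi s) <= 6 * M2 / a * normc h.
  move=> se she; have [xr px] := Hxi s se; have [yr py] := Hxi _ she.
  have := lower s (xi (s + h)) (xi s) se (ltW yr) (ltW xr).
  have E : (p s).[xi (s + h)] - (p s).[xi s] = h * (2%:R * s + h) * H2.[xi (s + h)].
    rewrite px subr0 -[LHS]subr0 -{1}py !pE; ring.
  rewrite E !normcM => h1.
  have h2 : normc (2%:R * s + h) <= 3.
    rewrite (_ : 2%:R * s + h = s + (s + h)); last by ring.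
    apply: le_trans (le_normcD _ _) _; move: se she e1; clear; lra.
  have h3 := B2 _ (le_trans (ltW yr) rho1).
  have hn := normc_ge0 h.
  have h4 : normc h * normc (2%:R * s + h) * normc H2.[xi (s + h)] <= normc h * 3 * M2.
    by apply: ler_pM => //; rewrite ?mulr_ge0 ?normc_ge0//; apply: ler_wpM2l.
  by rewrite mulrAC ler_pdivlMr//; move: h1 h4; clear; lra.
have xi0 : xi 0 = 0.
  apply/esym; apply: uniq; rewrite ?normc0//.
  by rewrite pE H10 expr0n /= mul0r subrr.
exists e, rho, (6 * M2 / a), xi.
have dxi s : normc s < e -> rdiff xi s
        (2%:R * s * H2.[xi s] / (H1^`().[xi s] - s ^+ 2 * H2^`().[xi s])) 0.
  move=> se; rewrite -dpE; have [xr px] := Hxi s se.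
  set D := (p s)^`().[xi s].
  have Dl : a / 2 <= normc D by exact: dlow (ltW xr).
  have D0 : D != 0 by rewrite -normc_gt0; apply: lt_le_trans Dl; rewrite divr_gt0.
  set L := 6 * M2 / a in xilip.
  have L0 : 0 <= L by rewrite /L divr_ge0 ?mulr_ge0 // ltW.
  move=> x x0.
  pose x1 := x * a / 4 / (L + 1).
  have x10 : 0 < x1 by rewrite !divr_gt0 ?mulr_gt0// ltr_wpDl.
  have [d d0 Hd] := rdiff_poly (p s) (xi s) x10.
  pose E := 2 * K2 * L + M2 + 1.
  have E0 : 0 < E by have := mulr_ge0 K20 L0; move: M20; rewrite /E; clear; lra.
  exists (Num.min (e - normc s) (Num.min (d / (L + 1)) (x * a / 4 / E))).
    by rewrite !lt_min subr_gt0 se !divr_gt0 ?mulr_gt0// ltr_wpDl.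
  move=> h; rewrite !lt_min => /andP[h1 /andP[h2 h3]].
  have she : normc (s + h) < e by apply: le_lt_trans (le_normcD _ _) _; rewrite addrC -ltrBrDr.
  have hn := normc_ge0 h.
  set k := xi (s + h) - xi s.
  have kL : normc k <= L * normc h by exact: xilip.
  have kd : normc k < d.
    apply: le_lt_trans kL _; move: h2; rewrite ltr_pdivlMr ?ltr_wpDl//; move: hn; clear; lra.
  have [yr py] := Hxi _ she.
  have := Hd k kd; rewrite /k [xi s + _]addrC subrK px subr0 mul0r addr0 -/k -/D => h4.
  have EQ : (p s).[xi (s + h)] = h * (2%:R * s + h) * H2.[xi (s + h)].
    by rewrite -[LHS]subr0 -{1}py !pE; ring.
  (* First order expansion of H1 - s^2 H2 at xi s, evaluated at xi (s + h). *)
  have KEY : D * (k - 2%:R * s * H2.[xi s] / D * h) =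
      - ((p s).[xi (s + h)] - D * k) + (2%:R * s * h * (H2.[xi (s + h)] - H2.[xi s]) + h ^+ 2 * H2.[xi (s + h)]).
    by rewrite EQ; field.
  rewrite mul0r addr0.
  have [h5 _] := L2 (xi (s + h)) (xi s) (le_trans (ltW yr) rho1) (le_trans (ltW xr) rho1).
  rewrite -/k in h5.
  have h6 := B2 _ (le_trans (ltW yr) rho1).
  have := congr1 (@normc R) KEY; rewrite normcM => KN.
  have t1 := le_normcD (- ((p s).[xi (s + h)] - D * k)) (2%:R * s * h * (H2.[xi (s + h)] - H2.[xi s]) + h ^+ 2 * H2.[xi (s + h)]).
  rewrite normcN in t1.
  have t2 := le_normcD (2%:R * s * h * (H2.[xi (s + h)] - H2.[xi s])) (h ^+ 2 * H2.[xi (s + h)]).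
  have t3 : normc (2%:R * s * h * (H2.[xi (s + h)] - H2.[xi s])) <= 2 * normc h * (K2 * (L * normc h)).
    rewrite 3!normcM normcn; apply: ler_pM; rewrite ?mulr_ge0 ?normc_ge0//.
      by apply: ler_wpM2r => //; rewrite ler_piMr// ltW// (lt_le_trans se).
    by apply: le_trans h5 _; apply: ler_wpM2l.
  have t4 : normc (h ^+ 2 * H2.[xi (s + h)]) <= normc h ^+ 2 * M2.
    by rewrite normcM normcX; apply: ler_pM => //; rewrite ?sqr_ge0 ?normc_ge0.
  have t5 : x1 * normc k <= x * a / 4 * normc h.
    rewrite /x1; apply: le_trans (_ : x * a / 4 / (L + 1) * (L * normc h) <= _).
      by apply: ler_wpM2l => //; exact: ltW.
    rewrite -[_ / _ * _]mulrA ler_wpM2l//; first by rewrite divr_ge0 ?mulr_ge0 ?ltW.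
    rewrite mulrC ler_pdivrMr ?ltr_wpDl//.
    by move: hn; clear; lra.
  have t6 : E * normc h <= x * a / 4.
    by rewrite mulrC -ler_pdivlMr// ltW.
  have t7 : E * normc h * normc h <= x * a / 4 * normc h by apply: ler_wpM2r.
  have t8 : 0 <= normc h * normc h by rewrite mulr_ge0.
  have t9 : a / 2 * normc (k - 2%:R * s * H2.[xi s] / D * h) <= a / 2 * (x * normc h).
    apply: le_trans (ler_wpM2r (normc_ge0 _) Dl) _.
    rewrite KN; move: t1 t2 t3 t4 h4 t5 t7 t8; rewrite /E expr2; clear; lra.
  by move: t9; rewrite ler_pM2l// divr_gt0.
split => //.
- move=> s se; have [h1 /eqP] := Hxi s se; rewrite pE subr_eq0 => /eqP h2; split => //.
  have := xilip 0 s; rewrite add0r xi0 subr0; apply => //; by rewrite normc0.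
- by move=> s X se Xr h; apply: uniq => //; rewrite pE h subrr.
split => //; last first.
  exists (a / 2); first by rewrite divr_gt0.
  by move=> s se; rewrite -dpE; apply: dlow => //; have [/ltW] := Hxi s se.
pose DD : set C := [set s | normc (s - 0) < e].
have oD : opened DD by exact: disc_opened.
have DDe s : DD s -> normc s < e by rewrite /DD /= subr0.
elim=> [|k IH]; (split; first by exists rho => s /DDe/Hxi[/ltW]) => //.
exists (fun s => 2%:R * s * H2.[xi s] * (H1^`().[xi s] - s ^+ 2 * H2^`().[xi s])^-1).
split; first by move=> s /DDe; exact: dxi.
have nid : nice DD k id by apply: (@nice_id R DD k e) => s /DDe/ltW.
have ns2 : nice DD k (fun s => s ^+ 2) by exact: (niceM nid nid).
apply: niceM.
  by apply: niceM; [exact: niceZ|exact: nice_poly].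
apply: (@niceV R DD k _ (a / 2)); first by rewrite divr_gt0.
  by move=> s /DDe se; rewrite -dpE; apply: dlow => //; have [/ltW] := Hxi s se.
by apply: niceB => //; [exact: nice_poly|apply: niceM => //; exact: nice_poly].
Qed.

End Implicit.

Import Defs.

(** * Rational functions on the line *)

Section Curves.
Variables (R : realType) (X : curve R).
Local Notation C := (R[i]).
Implicit Types (p q : pt X) (Q : pt X -> Prop).

Lemma around_mono p Q Q' : (forall q, points q -> q != p -> Q q -> Q' q) -> around p Q -> around p Q'.
Proof. by move=> QQ [e e0 H]; exists e => // q pq bq qp; apply: QQ => //; exact: H. Qed.

Lemma off_finite_and Q Q' : off_finite Q -> off_finite Q' -> off_finite (fun q => Q q /\ Q' q).
Proof.
move=> [s Hs] [s' Hs']; exists (s ++ s') => q pq; rewrite mem_cat negb_or => /andP[h h'].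
by split; [exact: Hs|exact: Hs'].
Qed.

Lemma off_finite_mono Q Q' : (forall q, points q -> Q q -> Q' q) -> off_finite Q -> off_finite Q'.
Proof. by move=> QQ [s H]; exists s => q pq qs; apply: QQ => //; exact: H. Qed.
End Curves.

Section Line.
Variable R : realType.
Local Notation C := (R[i]).
Local Notation L1 := (P1 R).
Implicit Types (p q : pt L1) (f : pt L1 -> C) (Q : pt L1 -> Prop).

Definition chart p (u : C) : pt L1 := if p is Some a then Some (a + u) else Some u^-1.

Lemma unif_chart p u : u != 0 -> unif p (chart p u) = u.
Proof. by case: p => [a|] u0 /=; [rewrite [a + u]addrC addrK|rewrite invrK]. Qed.

(** Neighbourhoods of infinity become discs in the parameter 1/x, so that all points
    of the line can be treated alike. *)
Lemma aroundP p Q : around p Q <->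
  exists2 e : R, 0 < e & forall u, u != 0 -> normc u < e -> Q (chart p u).
Proof.
case: p => [a|]; split.
- move=> [_ /gt0_Re[r r0 ->] H]; exists r => // u u0 ur; apply: H => //=.
    by rewrite ltcRE [a + u]addrC addrK.
  by apply: contra_neq u0 => -[]/eqP; rewrite -subr_eq0 [a + u]addrC addrK => /eqP.
- move=> [r r0 H]; exists r%:C; first by rewrite ltcR.
  case=> [x|//] _ /=; rewrite ltcRE => xr xa.
  rewrite -[x](subrK a) addrC; apply: H => //; rewrite subr_eq0.
  by apply: contra xa => /eqP->.
- move=> [_ /gt0_Re[r r0 ->] H]; exists r => // u u0 ur; apply: H => //=.
  have -> : (r%:C)^-1 = (r^-1)%:C by rewrite fmorphV.
  by rewrite normc_real ltcR normcV ltf_pV2 ?posrE ?normc_gt0.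
- move=> [r r0 H]; exists r%:C; first by rewrite ltcR.
  case=> [x|//] _ /=; rewrite normc_real -fmorphV ltcR => xr _.
  have x0 : x != 0 by rewrite -normc_gt0 (lt_trans _ xr)// invr_gt0.
  rewrite -[x]invrK; apply: H; first by rewrite invr_eq0.
  by rewrite normcV invf_plt ?posrE ?normc_gt0.
Qed.

Lemma around_and p Q Q' : around p Q -> around p Q' -> around p (fun q => Q q /\ Q' q).
Proof.
move=> /aroundP[e e0 H] /aroundP[e' e'0 H']; apply/aroundP.
exists (Num.min e e') => [|u u0]; first by rewrite lt_min e0.
by rewrite lt_min => /andP[ue ue']; split; [exact: H|exact: H'].
Qed.

Lemma around_ex p Q : around p Q -> forall e : R, 0 < e ->
  exists u, [/\ u != 0, normc u < e & Q (chart p u)].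
Proof.
move=> /aroundP[d d0 H] e e0; pose r := Num.min d e / 2.
have r0 : 0 < r by rewrite divr_gt0// lt_min d0.
have re : r < Num.min d e by rewrite /r ltr_pdivrMr// ltr_pMr ?lt_min ?d0// ltr1n.
have nr : normc r%:C = r by rewrite normcR gtr0_norm.
exists r%:C; rewrite nr; move: re; rewrite lt_min => /andP[rd re].
have u0 : r%:C != 0 by rewrite -normc_gt0 nr.
by split => //; apply: H; rewrite ?nr.
Qed.

Lemma around_neq p r : around p (fun q => q != r).
Proof.
have [->|rp] := eqVneq r p; first by exists 1 => // q _ _.
apply/aroundP; case: p r rp => [a|] [b|] // ab.
- exists (normc (b - a)); first by rewrite normc_gt0 subr_eq0; apply: contra ab => /eqP->.
  move=> u u0 ub; apply: contraTneq ub => -[<-].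
  by rewrite [a + u]addrC addrK ltxx.
- by exists 1.
- exists (normc b + 1)^-1; first by rewrite invr_gt0 ltr_wpDl ?normc_ge0.
  move=> u u0 ub; apply: contraTneq ub => -[<-].
  rewrite normcV -leNgt.
  rewrite invf_ple ?posrE ?normc_gt0//; first by rewrite lerDl.
  by rewrite ltr_wpDl ?invr_ge0 ?normc_ge0.
Qed.

Lemma off_finite_around p Q : off_finite Q -> around p Q.
Proof.
move=> [s H]; have : around p (fun q => q \notin s).
  elim: s {H} => [|r s IH]; first by exists 1.
  apply: around_mono (around_and (around_neq p r) IH) => q _ _ [qr qs].
  by rewrite in_cons negb_or qr.
by apply: around_mono => q pq _; exact: H.
Qed.

Lemma off_finiteP Q : off_finite Q <-> exists s : seq C, forall x, x \notin s -> Q (Some x).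
Proof.
split=> [[s H]|[s H]].
  exists (pmap id s) => x xs; apply: H => //; apply: contra xs => xs.
  by rewrite mem_pmap; apply/mapP; exists (Some x).
exists (None :: map Some s) => -[x|] _; last by rewrite mem_head.
by rewrite in_cons /= mem_map; [exact: H|move=> ? ? []].
Qed.

Lemma poly_off_finite (d : {poly C}) : d != 0 -> off_finite (fun q : pt L1 => if q is Some x then d.[x] != 0 else True).
Proof.
move=> d0; apply/off_finiteP; have [rs prs] := closed_field_poly_normal d.
exists rs => x xs; apply: contra xs => dx.
by rewrite -root_prod_XsubC -(@rootZ _ _ (lead_coef d)) ?lead_coef_eq0// -prs.
Qed.

(** ** Stability of rational functions *)

Lemma rational_eq f g : off_finite (fun q => f q = g q) -> rational f -> rational g.
Proof.
move=> /off_finiteP[s H] [n [d [d0 Hd]]].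
pose r := \prod_(a <- s) ('X - a%:P).
have r0 : r != 0 by rewrite monic_neq0// monic_prod_XsubC.
exists (n * r), (d * r); split; first by rewrite mulf_neq0.
move=> x; rewrite !hornerM mulf_eq0 negb_or => /andP[dx rx].
rewrite -H ?Hd//; first by field; rewrite dx rx.
by apply: contra rx => xs; rewrite -/(root r x) root_prod_XsubC.
Qed.

Lemma rational_cst c : rational (fun _ : pt L1 => c).
Proof.
by exists c%:P, 1; split; [exact: oner_neq0|move=> x _; rewrite !hornerE divr1].
Qed.

Lemma rational_x : rational (fun q : pt L1 => if q is Some x then x else 0).
Proof.
by exists 'X, 1; split; [exact: oner_neq0|move=> x _; rewrite !hornerE divr1].
Qed.

Lemma rationalD f g : rational f -> rational g -> rational (fun q => f q + g q).
Proof.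
move=> [n [d [d0 H]]] [n' [d' [d'0 H']]]; exists (n * d' + n' * d), (d * d').
split; first by rewrite mulf_neq0.
move=> x; rewrite !hornerE mulf_eq0 negb_or => /andP[dx d'x].
by rewrite H// H'//; field; rewrite dx d'x.
Qed.

Lemma rationalM f g : rational f -> rational g -> rational (fun q => f q * g q).
Proof.
move=> [n [d [d0 H]]] [n' [d' [d'0 H']]]; exists (n * n'), (d * d').
split; first by rewrite mulf_neq0.
move=> x; rewrite !hornerE mulf_eq0 negb_or => /andP[dx d'x].
by rewrite H// H'//; field; rewrite dx d'x.
Qed.

Lemma rationalN f : rational f -> rational (fun q => - f q).
Proof.
move=> /(rationalM (rational_cst (-1))); apply: rational_eq.
by exists [::] => q _ _; rewrite mulN1r.
Qed.

Lemma rationalV f : rational f -> rational (fun q => (f q)^-1).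
Proof.
move=> [n [d [d0 H]]]; have [n0|n0] := eqVneq n 0.
  by exists 0, d; split => // x dx; rewrite H// n0 !horner0 mul0r invr0.
exists (d * d), (n * d); split; first by rewrite mulf_neq0.
move=> x; rewrite !hornerE mulf_eq0 negb_or => /andP[nx dx].
by rewrite H//; field; rewrite nx dx.
Qed.

Lemma del_rdiff f x (a b : C) : rdiff (fun w => f (Some w)) x a b ->
  del f (Some x : pt L1) = a /\ dbar f (Some x : pt L1) = b.
Proof. exact: rdiff_wirtinger. Qed.

Lemma quot_rdiff (n d : {poly C}) x : d.[x] != 0 ->
  rdiff (fun w => n.[w] / d.[w]) x ((n^`() * d - n * d^`()).[x] / (d ^+ 2).[x]) 0.
Proof.
move=> dx; apply: rdiff_eqpq (rdiffM (rdiff_poly n x) (rdiffV dx (rdiff_poly d x))).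
  have -> : (n^`() * d - n * d^`()).[x] = n^`().[x] * d.[x] - n.[x] * d^`().[x] by rewrite !hornerE.
  by rewrite horner_exp; field.
by rewrite mul0r mulr0 addr0.
Qed.

Lemma poly_near (d : {poly C}) x : d.[x] != 0 -> exists2 e : R, 0 < e &
  forall h, normc h < e -> normc d.[x] / 2 <= normc d.[x + h] /\ d.[x + h] != 0.
Proof.
move=> dx; have dx2 : 0 < normc d.[x] / 2 by rewrite divr_gt0// normc_gt0.
have [e e0 H] := rdiff_continuous (rdiff_poly d x) dx2.
exists e => // h /H; rewrite normcB => h1.
have h2 : normc d.[x] / 2 <= normc d.[x + h].
  by have := ler_distc d.[x] d.[x + h] ; have := ler_normcB (d.[x] - d.[x+h]) (- d.[x+h]);
     rewrite opprK subrK normcN; lra.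
by split => //; rewrite -normc_gt0; apply: lt_le_trans h2.
Qed.

Lemma rational_rdiff f : rational f -> off_finite (fun q => forall x, q = Some x ->
  rdiff (fun w => f (Some w)) x (del f q) 0).
Proof.
move=> [n [d [d0 H]]]; apply: off_finite_mono (poly_off_finite d0) => q _ dq x qx.
rewrite qx in dq *.
have D : rdiff (fun w => f (Some w)) x ((n^`() * d - n * d^`()).[x] / (d ^+ 2).[x]) 0.
  apply: rdiff_near (quot_rdiff n dq); have [e e0 He] := poly_near dq.
  by exists e => // h /He[_ h1]; rewrite H.
by rewrite (del_rdiff D).1.
Qed.

Lemma rational_del f : rational f -> rational (fun q => del f q).
Proof.
move=> [n [d [d0 H]]]; exists (n^`() * d - n * d^`()), (d ^+ 2); split.
  by rewrite expf_neq0.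
move=> x; rewrite horner_exp expf_eq0 /= => dx.
have D : rdiff (fun w => f (Some w)) x ((n^`() * d - n * d^`()).[x] / (d ^+ 2).[x]) 0.
  apply: rdiff_near (quot_rdiff n dx); have [e e0 He] := poly_near dx.
  by exists e => // h /He[_ h1]; rewrite H.
by rewrite (del_rdiff D).1 horner_exp.
Qed.

(** ** Local expansions *)

Lemma rational_chart f p : rational f -> exists n d : {poly C}, d != 0 /\
  around p (fun q => f q = n.[unif p q] / d.[unif p q]).
Proof.
move=> [n [d [d0 H]]]; have dar := off_finite_around p (poly_off_finite d0).
case: p dar => [a|] dar.
  exists (n \Po ('X + a%:P)), (d \Po ('X + a%:P)); split.
    by rewrite -size_poly_eq0 size_comp_poly2 ?size_poly_eq0// size_XaddC.
  case/aroundP: dar => e e0 He; apply/aroundP; exists e => // u u0 ue.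
  rewrite unif_chart//; have /= dx := He u u0 ue.
  by rewrite !horner_comp !hornerE [u + a]addrC H.
pose N := maxn (size n) (size d).
pose rv (p : {poly C}) := \poly_(i < N.+1) p`_(N - i).
have rvE (p : {poly C}) x : (size p <= N)%N -> x != 0 -> (rv p).[x^-1] = p.[x] / x ^+ N.
  move=> sp x0; rewrite horner_poly (@horner_coef_wide _ N.+1 p x (leqW sp)).
  rewrite mulr_suml (reindex_inj rev_ord_inj) /=; apply: eq_bigr => i _.
  rewrite subSS subKn; last by rewrite -ltnS.
  rewrite -mulrA; congr (_ * _).
  have iN : (i <= N)%N by rewrite -ltnS.
  have -> : x ^+ N = x ^+ i * x ^+ (N - i) by rewrite -exprD subnKC.
  by rewrite exprVn; field; rewrite !expf_neq0.
have sn : (size n <= N)%N by exact: leq_maxl.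
have sd : (size d <= N)%N by exact: leq_maxr.
exists (rv n), (rv d); split.
  have [u [u0 _ du]] := around_ex dar ltr01; rewrite /= in du.
  apply: contraNneq du => rd0.
  have := rvE d u^-1 sd; rewrite invr_eq0 invrK rd0 horner0 => /(_ u0)/esym/eqP.
  by rewrite mulf_eq0 invr_eq0 expf_eq0 invr_eq0 (negbTE u0) andbF orbF.
case/aroundP: dar => e e0 He; apply/aroundP; exists e => // u u0 ue.
rewrite unif_chart//; have /= dx := He u u0 ue.
have x0 : u^-1 != 0 by rewrite invr_eq0.
rewrite H// -[u in RHS]invrK !rvE//; set x := u^-1 in dx x0 *.
have xN : x ^+ N != 0 by rewrite expf_neq0.
by field; rewrite dx xN.
Qed.

Lemma poly_order (p : {poly C}) : p != 0 -> exists m (q : {poly C}), p = q * 'X^m /\ q.[0] != 0.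
Proof.
move=> p0; have [m [q]] := multiplicity_XsubC p 0; rewrite p0 /= => q0 pE.
by exists m, q; rewrite -[q.[0] != 0]/(~~ root q 0); split => //; rewrite pE polyC0 subr0.
Qed.

(** A rational function with a limit has no pole: after division by the powers of
    the local parameter, the denominator does not vanish at the point. *)
Lemma rational_local f p c : rational f -> tends p f c -> exists n d : {poly C},
  [/\ d.[0] != 0, n.[0] = c * d.[0] & around p (fun q => f q = n.[unif p q] / d.[unif p q])].
Proof.
move=> rf tf; have [n [d [d0 H]]] := rational_chart p rf.
suff [n' [d' [d'0 H']]] : exists n d : {poly C}, d.[0] != 0 /\
    around p (fun q => f q = n.[unif p q] / d.[unif p q]).
  exists n', d'; split => //.
  have D : rdiff (fun w => n'.[w] / d'.[w]) 0 _ 0 := quot_rdiff n' d'0.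
  suff : n'.[0] / d'.[0] = c by move=> <-; rewrite divfK.
  apply/eqP; rewrite -subr_eq0 -normc_eq0 eq_le normc_ge0 andbT; apply/ler_addgt0Pr => e e0.
  rewrite add0r; have e2 : 0 < e / 2 by rewrite divr_gt0.
  have [r r0 Hr] := rdiff_continuous D e2.
  have := tf (e / 2)%:C; rewrite ltcR => /(_ e2) t1.
  have [u [u0 ur [h1 h2]]] := around_ex (around_and H' t1) r0.
  rewrite h1 unif_chart// ltcRE in h2.
  have := Hr u ur; rewrite add0r => h3.
  have := ler_normcB (n'.[u] / d'.[u] - c) (n'.[u] / d'.[u] - n'.[0] / d'.[0]).
  rewrite (_ : _ - c - _ = n'.[0] / d'.[0] - c); last by ring.
  lra.
have [n0|n0] := eqVneq n 0.
  exists 0, 1; rewrite hornerC oner_neq0; split => //.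
  by apply: around_mono H => q _ _ ->; rewrite n0 !horner0 !mul0r.
have [a [n1 [nE n10]]] := poly_order n0; have [b [d1 [dE d10]]] := poly_order d0.
have unz : around p (fun q => unif p q != 0).
  by apply/aroundP; exists 1 => // u u0 _; rewrite unif_chart.
have [ba|ab] := leqP b a.
  exists (n1 * 'X^(a - b)), d1; split => //.
  apply: around_mono (around_and H unz) => q _ _ [-> u0].
  rewrite nE dE !hornerE -{1}(subnK ba) exprD mulrA -mulf_div divff ?mulr1// expf_neq0//.
exfalso.
(* a pole would contradict the existence of a finite limit *)
have t1 := tf 1 ltr01; pose K := normc c + 1.
have K0 : 0 < K by rewrite ltr_wpDl ?normc_ge0.
have [r r0 Hr] := poly_near n10.
have [r' r'0 Hr'] := rdiff_continuous (rdiff_poly d1 0) ltr01.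
pose M := normc d1.[0] + 1.
have M0 : 0 < M by rewrite ltr_wpDl ?normc_ge0.
have [r2 r20 Hr2] := poly_near d10.
pose m := Num.min (Num.min r2 (Num.min 1 (normc n1.[0] / 2 / (K * M)))) (Num.min r r').
have m0 : 0 < m by rewrite !lt_min r20 ltr01 r0 r'0 !divr_gt0// ?mulr_gt0// normc_gt0.
have [u [u0 um [h1 h2]]] := around_ex (around_and H t1) m0.
move: um; rewrite !lt_min => /andP[/andP[ur2 /andP[u1 uK]] /andP[ur ur']].
rewrite -[1]/(1%:C) ltcRE in h2; rewrite unif_chart// in h1.
have fK : normc (f (chart p u)) <= K.
  by have := le_normcD (f (chart p u) - c) c; rewrite subrK /K; lra.
have [n1u _] := Hr u ur; rewrite add0r in n1u.
have d1u : normc d1.[u] <= M.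
  by have := le_normcD (d1.[0 + u] - d1.[0]) d1.[0]; have := Hr' u ur'; rewrite subrK add0r /M; lra.
have [k bE] : exists k, b = (a + k.+1)%N by exists (b - a).-1; rewrite prednK ?subn_gt0// subnKC// ltnW.
have E : n1.[u] = f (chart p u) * (d1.[u] * u ^+ k.+1).
  have [_] := Hr2 u ur2; rewrite add0r => dz.
  rewrite h1 nE dE !(hornerM, hornerXn) bE exprD.
  have : u ^+ a != 0 by rewrite expf_neq0.
  have : u ^+ k.+1 != 0 by rewrite expf_neq0.
  move: (u ^+ a) (u ^+ k.+1) => x y y0 x0.
  by field; rewrite dz y0 x0.
have := n1u; rewrite E !normcM normcX exprS leNgt => /negP; apply.
have u2 : normc u * normc u ^+ k <= normc u by rewrite ler_piMr ?normc_ge0// exprn_ile1 ?normc_ge0// ltW.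
apply: le_lt_trans (_ : K * (M * normc u) < _).
  apply: ler_pM => //; rewrite ?mulr_ge0 ?exprn_ge0 ?normc_ge0//.
  by apply: ler_pM => //; rewrite ?mulr_ge0 ?exprn_ge0 ?normc_ge0.
by rewrite mulrA mulrC -ltr_pdivlMr// mulr_gt0.
Qed.

End Line.

(** * Connection matrices on the line *)

Section Mat2.
Variable F : fieldType.
Implicit Types M : 'M[F]_2.

Lemma mx2P (M N : 'M[F]_2) : M 0 0 = N 0 0 -> M 0 1 = N 0 1 -> M 1 0 = N 1 0 -> M 1 1 = N 1 1 -> M = N.
Proof.
move=> h00 h01 h10 h11; apply/matrixP => i j.
have E (k : 'I_2) : k = 0 \/ k = 1 by case: k => -[|[|//]] ?; [left|right]; exact: val_inj.
by have [->|->] := E i; have [->|->] := E j.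
Qed.

Lemma mul2E (M N : 'M[F]_2) i j : (M *m N) i j = M i 0 * N 0 j + M i 1 * N 1 j.
Proof.
rewrite mxE !big_ord_recl big_ord0 addr0; congr (_ + M i _ * N _ j); exact: val_inj.
Qed.

Lemma tr2E M : \tr M = M 0 0 + M 1 1.
Proof.
rewrite /mxtrace !big_ord_recl big_ord0 addr0; congr (_ + M _ _); exact: val_inj.
Qed.

Lemma det2E M : \det M = M 0 0 * M 1 1 - M 0 1 * M 1 0.
Proof.
rewrite (expand_det_row _ 0) !big_ord_recl big_ord0 addr0 /cofactor !det_mx11 !mxE.
have -> : fintype.lift ord0 ord0 = 1 :> 'I_2 by exact: val_inj.
have -> : fintype.lift 1 0 = 0 :> 'I_2 by exact: val_inj.
by rewrite expr0 expr1; ring.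
Qed.

Definition adj2 M : 'M[F]_2 := \matrix_(i, j)
  if i == 0 then (if j == 0 then M 1 1 else - M 0 1) else (if j == 0 then - M 1 0 else M 0 0).

Lemma adj2E M : [/\ adj2 M 0 0 = M 1 1, adj2 M 0 1 = - M 0 1, adj2 M 1 0 = - M 1 0 & adj2 M 1 1 = M 0 0].
Proof. by split; rewrite mxE. Qed.

Lemma inv2E M : \det M != 0 -> invmx M = (\det M)^-1 *: adj2 M.
Proof.
move=> dM; have uM : M \in unitmx by rewrite unitmxE unitfE.
have [a00 a01 a10 a11] := adj2E M.
have h : M *m adj2 M = (\det M)%:M.
  by apply: mx2P; rewrite mul2E !mxE ?a00 ?a01 ?a10 ?a11 /= det2E; ring.
by rewrite -[RHS]mul1mx -(mulVmx uM) -mulmxA -scalemxAr h scale_scalar_mx mulVf// mulmx1.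
Qed.
End Mat2.

Section MRdiff.
Variable R : realType.
Local Notation C := (R[i]).

Definition mrdiff (M : C -> 'M[C]_2) (x : C) (M' : 'M[C]_2) :=
  forall i j, rdiff (fun w => M w i j) x (M' i j) 0.

Lemma mrdiff_mul (M N : C -> 'M[C]_2) x M' N' : mrdiff M x M' -> mrdiff N x N' ->
  mrdiff (fun w => M w *m N w) x (M' *m N x + M x *m N').
Proof.
move=> dM dN i j.
have D k := rdiffM (dM i k) (dN k j).
apply: rdiff_ext (rdiff_eqpq _ _ (rdiffD (D 0) (D 1))) => [w||].
- by rewrite mul2E.
- by rewrite mxE !mul2E; ring.
- by rewrite !mul0r !mulr0 !addr0.
Qed.

Lemma mrdiffD (M N : C -> 'M[C]_2) x M' N' : mrdiff M x M' -> mrdiff N x N' ->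
  mrdiff (fun w => M w + N w) x (M' + N').
Proof.
move=> dM dN i j; apply: rdiff_ext (rdiff_eqpq _ _ (rdiffD (dM i j) (dN i j))) => [w||].
- by rewrite mxE.
- by rewrite mxE.
- by rewrite addr0.
Qed.

Lemma mrdiffN (M : C -> 'M[C]_2) x M' : mrdiff M x M' -> mrdiff (fun w => - M w) x (- M').
Proof.
move=> dM i j; apply: rdiff_ext (rdiff_eqpq _ _ (rdiffN (dM i j))) => [w||].
- by rewrite mxE.
- by rewrite mxE.
- by rewrite oppr0.
Qed.

Lemma mrdiff_cst (M : 'M[C]_2) x : mrdiff (fun=> M) x 0.
Proof. by move=> i j; rewrite mxE; exact: rdiff_cst. Qed.

Lemma mrdiff_uniq (M : C -> 'M[C]_2) x M' M'' : mrdiff M x M' -> mrdiff M x M'' -> M' = M''.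
Proof. by move=> d1 d2; apply/matrixP => i j; have [] := rdiff_uniq (d1 i j) (d2 i j). Qed.

End MRdiff.

Section MatLine.
Variable R : realType.
Local Notation C := (R[i]).
Local Notation L1 := (P1 R).
Local Notation mfct := (pt L1 -> 'M[C]_2).
Implicit Types (M N : mfct) (f : pt L1 -> C).

Lemma mdel_mrdiff M x (M' : 'M[C]_2) : mrdiff (fun w => M (Some w)) x M' ->
  mdel M (Some x : pt L1) = M' /\ mdbar M (Some x : pt L1) = 0.
Proof.
by move=> d; split; apply/matrixP => i j; have [h1 h2] := @del_rdiff R (fun q => M q i j) x _ _ (d i j); rewrite !mxE.
Qed.

Lemma mrational_mul M N : mrational M -> mrational N -> mrational (fun q => M q *m N q).
Proof.
move=> rM rN i j; apply: rational_eq (rationalD (rationalM (rM i 0) (rN 0 j)) (rationalM (rM i 1) (rN 1 j))).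
by exists [::] => q _ _; rewrite mul2E.
Qed.

Lemma mrationalD M N : mrational M -> mrational N -> mrational (fun q => M q + N q).
Proof.
move=> rM rN i j; apply: rational_eq (rationalD (rM i j) (rN i j)).
by exists [::] => q _ _; rewrite mxE.
Qed.

Lemma mrationalN M : mrational M -> mrational (fun q => - M q).
Proof.
move=> rM i j; apply: rational_eq (rationalN (rM i j)).
by exists [::] => q _ _; rewrite mxE.
Qed.

Lemma mrationalZ f M : rational f -> mrational M -> mrational (fun q => f q *: M q).
Proof.
move=> rf rM i j; apply: rational_eq (rationalM rf (rM i j)).
by exists [::] => q _ _; rewrite mxE.
Qed.

Lemma mrational_del M : mrational M -> mrational (fun q => mdel M q).
Proof.
move=> rM i j; apply: rational_eq (rational_del (rM i j)).
by exists [::] => q _ _; rewrite mxE.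
Qed.

Lemma rational_det M : mrational M -> rational (fun q => \det (M q)).
Proof.
move=> rM; apply: rational_eq (rationalD (rationalM (rM 0 0) (rM 1 1)) (rationalN (rationalM (rM 0 1) (rM 1 0)))).
by exists [::] => q _ _; rewrite det2E.
Qed.

Lemma mrational_inv M : mrational M -> off_finite (fun q => \det (M q) != 0) ->
  mrational (fun q => invmx (M q)).
Proof.
move=> rM dM i j.
have radj : rational (fun q => adj2 (M q) i j).
  apply: (@rational_eq _ (fun q => if i == 0 then (if j == 0 then M q 1 1 else - M q 0 1)
     else (if j == 0 then - M q 1 0 else M q 0 0))).
    by exists [::] => q _ _; rewrite mxE.
  by case: (i == 0); case: (j == 0) => //; apply: rationalN.
apply: rational_eq (rationalM (rationalV (rational_det rM)) radj).
by apply: off_finite_mono dM => q _ dq; rewrite inv2E// [in RHS]mxE.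
Qed.

Lemma mrational_mrdiff M : mrational M -> off_finite (fun q : pt L1 => forall x, q = Some x ->
  mrdiff (fun w => M (Some w)) x (mdel M q)).
Proof.
move=> rM.
have := off_finite_and (off_finite_and (rational_rdiff (rM 0 0)) (rational_rdiff (rM 0 1)))
  (off_finite_and (rational_rdiff (rM 1 0)) (rational_rdiff (rM 1 1))).
apply: off_finite_mono => q _ [[h1 h2] [h3 h4]] x qx i j; rewrite mxE.
have E (k : 'I_2) : k = 0 \/ k = 1 by case: k => -[|[|//]] ?; [left|right]; exact: val_inj.
have [->|->] := E i; have [->|->] := E j; [exact: h1|exact: h2|exact: h3|exact: h4].
Qed.

Lemma rational_dxdz (p : pt L1) : off_finite (fun q : pt L1 => if q is Some x then dxdz p q = (if p is None then - x ^+ 2 else 1) else True).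
Proof.
apply/off_finiteP; exists [:: 0] => x; rewrite inE => x0.
rewrite /dxdz; case: p => [a|].
  have D := rdiffB (rdiff_id x) (rdiff_cst a x).
  by rewrite (@del_rdiff _ (@unif R L1 (Some a)) x _ _ D).1 subr0 invr1.
have D := rdiff_inv x0.
by rewrite (@del_rdiff _ (@unif R L1 None) x _ _ D).1 invrN invrK.
Qed.

Lemma rational_zdx (p : pt L1) : rational (fun q : pt L1 => unif p q * dxdz p q).
Proof.
case: p => [a|].
  apply: rational_eq (rationalD (rational_x R) (rational_cst (- a))).
  have [s H] := (off_finiteP _).1 (rational_dxdz (Some a)); apply/off_finiteP; exists s => x.
  by move=> /H /= ->; rewrite mulr1.
apply: rational_eq (rationalN (rational_x R)).
have [s H] := (off_finiteP _).1 (rational_dxdz None); apply/off_finiteP; exists (0 :: s) => x.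
rewrite inE negb_or => /andP[x0 /H /= ->].
by rewrite expr2 mulrN mulrA mulVf// mul1r.
Qed.
End MatLine.

(** * Filling in the primitive where the form vanishes *)

Section Repair.
Variable R : realType.
Local Notation C := (R[i]).
Local Notation L1 := (P1 R).
Local Notation mfct := (pt L1 -> 'M[C]_2).

Lemma rdiff_eq_at (F G : C -> C) x (d : R) p q p' q' : 0 < d ->
  (forall s, pdisc x d s -> F s = G s) -> rdiff F x p q -> rdiff G x p' q' -> F x = G x.
Proof.
move=> d0 FG dF dG; apply/eqP; rewrite -subr_eq0 -normc_eq0 eq_le normc_ge0 andbT.
apply/ler_addgt0Pr => e e0; rewrite add0r; have e2 : 0 < e / 2 by rewrite divr_gt0.
have [r r0 Hr] := rdiff_continuous dF e2; have [r' r'0 Hr'] := rdiff_continuous dG e2.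
pose m := Num.min d (Num.min r r') / 2.
have M0 : 0 < Num.min d (Num.min r r') by rewrite !lt_min d0 r0.
have m0 : 0 < m by rewrite divr_gt0.
have : m < Num.min d (Num.min r r') by rewrite /m ltr_pdivrMr// ltr_pMr// ltr1n.
have nm : normc m%:C = m by rewrite normcR gtr0_norm.
rewrite !lt_min => /andP[md /andP[mr mr']].
have := Hr m%:C; rewrite nm => /(_ mr) h1.
have := Hr' m%:C; rewrite nm => /(_ mr'); rewrite -FG; last first.
  by rewrite /pdisc /= [x + _]addrC addrK nm m0.
rewrite [F x - G x](_ : _ = (F (x + m%:C) - G x) - (F (x + m%:C) - F x)); last by ring.
move=> h2; have := ler_normcB (F (x + m%:C) - G x) (F (x + m%:C) - F x); lra.
Qed.

Definition mrd (M : C -> 'M[C]_2) x := forall i j, exists a b, rdiff (fun w => M w i j) x a b.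

Lemma mrd_mul (M N : C -> 'M[C]_2) x : mrd M x -> mrd N x -> mrd (fun w => M w *m N w) x.
Proof.
move=> dM dN i j; have [a [b h1]] := dM i 0; have [a' [b' h1']] := dN 0 j.
have [c [d h2]] := dM i 1; have [c' [d' h2']] := dN 1 j.
have := rdiffD (rdiffM h1 h1') (rdiffM h2 h2').
by move=> /(rdiff_ext (G := fun w => (M w *m N w) i j)) H; do 2 eexists; apply: H => w; rewrite mul2E.
Qed.

Lemma mrdD (M N : C -> 'M[C]_2) x : mrd M x -> mrd N x -> mrd (fun w => M w + N w) x.
Proof.
move=> dM dN i j; have [a [b h1]] := dM i j; have [a' [b' h1']] := dN i j.
have := rdiffD h1 h1'.
by move=> /(rdiff_ext (G := fun w => (M w + N w) i j)) H; do 2 eexists; apply: H => w; rewrite mxE.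
Qed.

Lemma mrdiff_mrd (M : C -> 'M[C]_2) x M' : mrdiff M x M' -> mrd M x.
Proof. by move=> dM i j; do 2 eexists; exact: dM. Qed.

Lemma mrd_near (M N : C -> 'M[C]_2) x (e : R) : 0 < e ->
  (forall h, normc h < e -> M (x + h) = N (x + h)) -> mrd M x -> mrd N x.
Proof.
move=> e0 MN dM i j; have [a [b h]] := dM i j; exists a, b; apply: rdiff_near h.
by exists e => // h /MN->.
Qed.

Lemma mrdiff_near (M N : C -> 'M[C]_2) x (e : R) M' : 0 < e ->
  (forall h, normc h < e -> M (x + h) = N (x + h)) -> mrdiff M x M' -> mrdiff N x M'.
Proof.
by move=> e0 MN dM i j; apply: rdiff_near (dM i j); exists e => // h /MN->.
Qed.

Lemma rational_nice (f : pt L1 -> C) : rational f -> off_finite (fun q : pt L1 => forall x, q = Some x ->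
  exists2 e : R, 0 < e & forall k, nice [set s | normc (s - x) < e] k (fun w => f (Some w))).
Proof.
move=> [n [d [d0 H]]]; have [s Hs] := (off_finiteP _).1 (poly_off_finite d0).
apply/off_finiteP; exists s => x /Hs /= dx _ [<-].
have [e e0 He] := poly_near dx; exists (Num.min e 1) => [|k]; first by rewrite lt_min e0 ltr01.
set D := [set s | _]; have oD : opened D by exact: disc_opened.
have He' w : D w -> normc d.[x] / 2 <= normc d.[w] /\ d.[w] != 0.
  by rewrite /D /= lt_min => /andP[/He + _]; rewrite addrC subrK.
have nid : nice D k id.
  apply: (@nice_id R D k (1 + normc x)) => w; rewrite /D /= lt_min => /andP[_ w1].
  by rewrite -(subrK x w); apply: le_trans (le_normcD _ _) _; rewrite lerD2r ltW.
apply: (@nice_eq R D k (fun w => n.[w] * (d.[w])^-1)) => //.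
  by move=> w /He'[_ dw]; rewrite H.
apply: niceM; first exact: nice_poly.
apply: (@niceV R D k _ (normc d.[x] / 2)); first by rewrite divr_gt0// normc_gt0.
  by move=> w /He'[].
exact: nice_poly.
Qed.

Definition mfall (P : 'I_2 -> 'I_2 -> Prop) : P 0 0 -> P 0 1 -> P 1 0 -> P 1 1 -> forall i j, P i j.
Proof.
move=> h00 h01 h10 h11 i j.
have E (k : 'I_2) : k = 0 \/ k = 1 by case: k => -[|[|//]] ?; [left|right]; exact: val_inj.
by have [->|->] := E i; have [->|->] := E j.
Qed.

Lemma mrational_nice (M : mfct) : mrational M -> off_finite (fun q : pt L1 => forall x, q = Some x ->
  exists2 e : R, 0 < e & forall k, mnice [set s | normc (s - x) < e] k (fun w => M (Some w))).
Proof.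
move=> rM.
have := off_finite_and (off_finite_and (rational_nice (rM 0 0)) (rational_nice (rM 0 1)))
  (off_finite_and (rational_nice (rM 1 0)) (rational_nice (rM 1 1))).
apply: off_finite_mono => q _ [[h1 h2] [h3 h4]] x qx.
have [e1 p1 n1] := h1 x qx; have [e2 p2 n2] := h2 x qx.
have [e3 p3 n3] := h3 x qx; have [e4 p4 n4] := h4 x qx.
pose e := Num.min (Num.min e1 e2) (Num.min e3 e4).
exists e; first by rewrite !lt_min p1 p2 p3 p4.
have sub e' : e <= e' -> [set s | normc (s - x) < e] `<=` [set s | normc (s - x) < e'].
  by move=> ee s /= h; exact: lt_le_trans ee.
move=> k; apply: mfall.
- by apply: nice_sub (n1 k); apply: sub; rewrite !ge_min lexx.
- by apply: nice_sub (n2 k); apply: sub; rewrite !ge_min lexx orbT.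
- by apply: nice_sub (n3 k); apply: sub; rewrite !ge_min lexx !orbT.
- by apply: nice_sub (n4 k); apply: sub; rewrite !ge_min lexx !orbT.
Qed.

Lemma pdisc_sub (x : C) (e e' : R) : e <= e' -> pdisc x e `<=` pdisc x e'.
Proof. by move=> ee s /andP[s0 se]; rewrite /pdisc /= s0 (lt_le_trans se). Qed.

Lemma pdisc_disc (x : C) (e : R) : pdisc x e `<=` [set s | normc (s - x) < e].
Proof. by move=> s /andP[]. Qed.

Lemma around_pdisc x (Q : pt L1 -> Prop) : around (Some x : pt L1) Q ->
  exists2 e : R, 0 < e & forall s, pdisc x e s -> Q (Some s).
Proof.
move=> /aroundP[e e0 H]; exists e => // s /andP[s0 se].
have := H (s - x); rewrite /= (_ : x + (s - x) = s); last by ring.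
apply => //.
by rewrite -normc_gt0.
Qed.

Variables (E : pconn L1) (D : seq (pt L1)) (v : deformation L1) (a : form1 L1) (f : mfct).
Hypothesis infD : (None : pt L1) \in D.
Hypothesis rA : mrational (cA E).
Hypothesis rB : mrational (dB v).
Hypothesis rh : forall p : pt L1, mrational (dh v p).
Hypothesis rg : forall p : pt L1, mrational (cg E p).
Hypothesis dg : forall p : pt L1, off_finite (fun q => \det (cg E p q) != 0).
Hypothesis trf : off_finite (fun q : pt L1 => \tr (f q) = 0).
Hypothesis smf : forall p : pt L1, points p -> p \notin D ->
  msmooth_at p (in_frame E p (fun q => f q - dh v p q)).
Hypothesis eqf : off_finite (fun q : pt L1 =>
  a.1 q = dB v q + nabla10 E f q /\ a.2 q = mdbar f q).

Definition flat (x : C) := exists2 e : R, 0 < e &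
  forall h, normc h < e -> a.1 (Some (x + h)) = 0 /\ a.2 (Some (x + h)) = 0.

(** Read in the frame at [p], the function [f] is the sum of a smooth and of a
    rational function; the frame itself is rational. *)
Lemma represents_rd (p : pt L1) : p \notin D ->
  around p (fun q : pt L1 => forall x, q = Some x -> mrd (fun w => f (Some w)) x).
Proof.
move=> pD; have {pD} [x0 [px0 pD]] : exists x0, p = Some x0 /\ p \notin D.
  by case: p pD => [x0|] pD; [exists x0|rewrite infD in pD].
rewrite {}px0 in pD *; have sm := smf (p := Some x0) I pD.
have a1 : around (Some x0 : pt L1) (fun q => \det (cg E (Some x0) q) != 0).
  exact: off_finite_around (dg _).
have ri := mrational_inv (rg (Some x0)) (dg (Some x0)).
have a2 := off_finite_around (Some x0) (mrational_mrdiff (rg (Some x0))).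
have a3 := off_finite_around (Some x0) (mrational_mrdiff ri).
have a4 := off_finite_around (Some x0) (mrational_mrdiff (rh (Some x0))).
have [F HF] : exists F : 'I_2 -> 'I_2 -> C -> C, around (Some x0 : pt L1) (fun q => forall x, q = Some x ->
    forall i j, (exists al be, rdiff (F i j) (x - x0) al be) /\
     in_frame E (Some x0) (fun q => f q - dh v (Some x0) q) (Some x) i j = F i j (x - x0)).
  have one i j : exists G : C -> C, around (Some x0 : pt L1) (fun q => forall x, q = Some x ->
     (exists al be, rdiff G (x - x0) al be) /\
     in_frame E (Some x0) (fun q => f q - dh v (Some x0) q) (Some x) i j = G (x - x0)).
    have [G [U [oU U0 sG HG]]] := sm i j; exists (fun z => G (ofC z)).
    apply: around_mono HG => q _ _ [Uq Eq] x qx; subst q; split => //.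
    have := csmooth_rdiff oU Uq sG; by do 2 eexists; eassumption.
  have [G00 h00] := one 0 0; have [G01 h01] := one 0 1.
  have [G10 h10] := one 1 0; have [G11 h11] := one 1 1.
  exists (fun i j => if i == 0 then (if j == 0 then G00 else G01) else (if j == 0 then G10 else G11)).
  apply: around_mono (around_and (around_and h00 h01) (around_and h10 h11)).
  by move=> q _ _ [[k1 k2] [k3 k4]] x qx; apply: mfall => /=; [exact: k1|exact: k2|exact: k3|exact: k4].
have [e e0 He] := around_pdisc (around_and (around_and a1 HF) (around_and a2 (around_and a3 a4))).
apply/aroundP; exists e => // u u0 ue x; rewrite /= => -[<-] {x}.
have Du : pdisc x0 e (x0 + u) by rewrite /pdisc /= [x0 + u]addrC addrK normc_gt0 u0.
have [[_ HFu] [g1 [g2 g3]]] := He _ Du.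
have [d d0 Hd] := pdisc_open Du.
pose Fm w : 'M[C]_2 := \matrix_(i, j) F i j (w - x0).
apply: (@mrd_near (fun w => cg E (Some x0) (Some w) *m Fm w *m invmx (cg E (Some x0) (Some w)) + dh v (Some x0) (Some w)) _ _ d) => //.
  move=> h hd; have [[dgh HFh] _] := He _ (Hd _ hd).
  have -> : Fm (x0 + u + h) = in_frame E (Some x0) (fun q => f q - dh v (Some x0) q) (Some (x0 + u + h)).
    by apply/matrixP => i j; rewrite mxE -(HFh _ erefl i j).2.
  rewrite /in_frame; set g := cg E _ _ in dgh *.
  have ug : g \in unitmx by rewrite unitmxE unitfE.
  by rewrite !mulmxA mulmxV// mul1mx -mulmxA mulmxV// mulmx1 subrK.
have mF : mrd Fm (x0 + u).
  move=> i j; have [[al [be dF]] _] := HFu _ erefl i j.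
  have := rdiff_comp (rdiffB (rdiff_id (x0 + u)) (rdiff_cst x0 (x0 + u))) dF.
  move=> /(rdiff_ext (G := fun w => Fm w i j)) H; do 2 eexists; apply: H => w; rewrite mxE//.
apply: mrdD; last exact: mrdiff_mrd (g3 _ erefl).
apply: mrd_mul; last exact: mrdiff_mrd (g2 _ erefl).
apply: mrd_mul => //; exact: mrdiff_mrd (g1 _ erefl).
Qed.

(** Where the form vanishes, [f] solves a differential equation with rational
    coefficients. *)
Definition ode_rhs (Y : C -> 'M[C]_2) (x : C) : 'M[C]_2 :=
  - dB v (Some x) - comm (cA E (Some x)) (Y x).

Definition regpt (x : C) := [/\ (Some x : pt L1) \notin D,
  a.1 (Some x) = dB v (Some x) + nabla10 E f (Some x) /\ a.2 (Some x) = mdbar f (Some x),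
  exists2 e : R, 0 < e & forall k, mnice [set s | normc (s - x) < e] k (fun w => dB v (Some w)) &
  exists2 e : R, 0 < e & forall k, mnice [set s | normc (s - x) < e] k (fun w => cA E (Some w))].

Lemma regpt_off_finite : off_finite (fun q : pt L1 => forall x, q = Some x -> regpt x).
Proof.
have oD : off_finite (fun q : pt L1 => q \notin D) by exists D.
have := off_finite_and (off_finite_and oD eqf) (off_finite_and (mrational_nice rB) (mrational_nice rA)).
apply: off_finite_mono => q _ [[h1 h2] [h3 h4]] x qx; subst q; split => //; [exact: h3|exact: h4].
Qed.

Lemma nice_rdiff (Dm : set C) u : (forall k, nice Dm k u) -> forall x, Dm x -> exists u', rdiff u x u' 0.
Proof. by move=> /(_ 1%N)[_ [u' [H _]]] x Dx; exists (u' x); exact: H. Qed.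

(** By [ode_removal], since [f] solves the equation on a punctured disc.  Nothing is
    known of the value of [f] at [x0] itself, whence the extension [Fm]. *)
Lemma local_ext x0 : regpt x0 -> flat x0 -> exists2 e : R, 0 < e & exists Fm : C -> 'M[C]_2,
  (forall s, pdisc x0 e s -> Fm s = f (Some s) /\ mrd (fun w => f (Some w)) s) /\
  (forall s, normc (s - x0) < e -> mrdiff Fm s (ode_rhs Fm s)).
Proof.
move=> [x0D _ [e1 e10 n1] [e2 e20 n2]] [e3 e30 fl].
have [e4 e40 He4] := around_pdisc (represents_rd x0D).
have [e5 e50 He5] := around_pdisc (off_finite_around (Some x0) eqf).
pose e := Num.min (Num.min e1 e2) (Num.min e3 (Num.min e4 e5)).
have e0 : 0 < e by rewrite !lt_min e10 e20 e30 e40.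
have ee1 : e <= e1 by rewrite !ge_min lexx.
have ee2 : e <= e2 by rewrite !ge_min lexx orbT.
have ee3 : e <= e3 by rewrite !ge_min lexx !orbT.
have ee4 : e <= e4 by rewrite !ge_min lexx !orbT.
have ee5 : e <= e5 by rewrite !ge_min lexx !orbT.
have ode s : pdisc x0 e s -> mrdiff (fun w => f (Some w)) s (ode_rhs (fun w => f (Some w)) s).
  move=> Ds; have rd := He4 _ (pdisc_sub ee4 Ds) _ erefl.
  have [q1 q2] := He5 _ (pdisc_sub ee5 Ds).
  have [z1 z2] : a.1 (Some s) = 0 /\ a.2 (Some s) = 0.
    have := fl (s - x0); rewrite (_ : x0 + (s - x0) = s); last by ring.
    apply.
    by case/andP: Ds => _ se; apply: lt_le_trans se ee3.
  move=> i j; have [al [be dij]] := rd i j.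
  have [del1 dbar1] := @del_rdiff R (fun q => f q i j) s _ _ dij.
  apply: rdiff_eqpq dij; last first.
    have := congr1 (fun M : 'M[C]_2 => M i j) q2; rewrite z2 !mxE => ->; exact: esym.
  have -> : ode_rhs (fun w => f (Some w)) s = mdel f (Some s).
    move: q1; rewrite z1 /nabla10 /ode_rhs; set X := mdel _ _; set Y := comm _ _ => q1.
    apply/eqP; rewrite -subr_eq0; apply/eqP; transitivity (- (dB v (Some s) + (X + Y))).
      by rewrite -addrA -!opprD; congr (- (_ + _)); exact: addrC.
    by rewrite -q1 oppr0.
  by rewrite mxE del1.
have nN k : mnice (pdisc x0 e) k (fun s => - dB v (Some s)).
  move=> i j; have := nice_sub (subset_trans (pdisc_sub ee1) (@pdisc_disc x0 e1)) (n1 k i j).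
  move=> /(niceN (@pdisc_open R x0 e)); apply: nice_eq => [|s _]; [exact: pdisc_open|by rewrite mxE].
have nL k : mnice (pdisc x0 e) k (fun s => cA E (Some s)).
  by move=> i j; have := nice_sub (subset_trans (pdisc_sub ee2) (@pdisc_disc x0 e2)) (n2 k i j).
have rhsE Y s : ode_rhs Y s = - dB v (Some s) + (Y s *m cA E (Some s) - cA E (Some s) *m Y s).
  by rewrite /ode_rhs /comm opprB.
have ext := ode_removal e0 nN nL (Y := fun s => f (Some s)).
have {}ext : forall i j, exists F, (forall s, pdisc x0 e s -> F s = f (Some s) i j) /\ holo x0 e F.
  by apply: ext => s i j Ds; have := ode s Ds i j; rewrite rhsE.
have [F00 [h00 k00]] := ext 0 0; have [F01 [h01 k01]] := ext 0 1.
have [F10 [h10 k10]] := ext 1 0; have [F11 [h11 k11]] := ext 1 1.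
pose Fm s : 'M[C]_2 := \matrix_(i, j)
  if i == 0 then (if j == 0 then F00 s else F01 s) else (if j == 0 then F10 s else F11 s).
have FmE s : pdisc x0 e s -> Fm s = f (Some s).
  by move=> Ds; apply/matrixP; apply: mfall; rewrite mxE /=; [exact: h00|exact: h01|exact: h10|exact: h11].
have hFm i j : holo x0 e (fun s => Fm s i j).
  by move: i j; apply: mfall; [move: k00|move: k01|move: k10|move: k11] => -[G [G0 HG]];
    exists G; split => //; rewrite G0; apply/funext => s; rewrite mxE.
exists e => //; exists Fm; split.
  by move=> s Ds; split; [exact: FmE|exact: He4 (pdisc_sub ee4 Ds) _ erefl].
have punct s : pdisc x0 e s -> mrdiff Fm s (ode_rhs Fm s).
  move=> Ds; have [d d0 Hd] := pdisc_open Ds.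
  rewrite /ode_rhs FmE//; apply: mrdiff_near (ode s Ds) => [|h /Hd/FmE->//]; exact: d0.
move=> s se; have [->|sx0] := eqVneq s x0; last first.
  by apply: punct; rewrite /pdisc /= normc_gt0 subr_eq0 sx0.
move=> i j; have [G [G0 HG]] := hFm i j.
have c0 : normc (x0 - x0) < e by rewrite subrr normc0.
have D0 := HG 0%N x0 c0; rewrite G0 in D0.
suff <- : G 1%N x0 = ode_rhs Fm x0 i j by exact: D0.
have dFm : mrd Fm x0.
  by move=> k l; have [G' [G'0 HG']] := hFm k l; exists (G' 1%N x0), 0; rewrite -G'0; exact: HG'.
have dBm : mrd (fun s => - dB v (Some s)) x0.
  move=> k l; have cc : normc (x0 - x0) < e1 by rewrite subrr normc0.
  have [u' du] := nice_rdiff (fun m => n1 m k l) cc.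
  by exists (- u'), 0; have := rdiffN du; rewrite oppr0; apply: rdiff_ext => w; rewrite mxE.
have dAm : mrd (fun s => cA E (Some s)) x0.
  move=> k l; have cc : normc (x0 - x0) < e2 by rewrite subrr normc0.
  by have [u' du] := nice_rdiff (fun m => n2 m k l) cc; exists u', 0.
have dNA : mrd (fun s => - cA E (Some s)) x0.
  by move=> k l; have [u' [b' du]] := dAm k l; exists (- u'), (- b'); apply: rdiff_ext (rdiffN du) => w; rewrite mxE.
have dR : mrd (fun s => - dB v (Some s) + (Fm s *m cA E (Some s) + (- cA E (Some s)) *m Fm s)) x0.
  by apply: mrdD => //; apply: mrdD; apply: mrd_mul.
have [p' [q' dRij]] := dR i j.
have := @rdiff_eq_at (G 1%N) (fun s => ode_rhs Fm s i j) x0 e _ _ p' q' e0 _ (HG 1%N x0 c0).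
apply.
  move=> s' Ds'; have D1 := HG 0%N s' (pdisc_disc Ds'); rewrite G0 in D1.
  by have [] := rdiff_uniq D1 (punct s' Ds' i j).
by apply: rdiff_ext dRij => w; rewrite rhsE mulNmx.
Qed.

Definition lim_at x (N : 'M[C]_2) := forall i j (e : R), 0 < e -> exists2 d : R, 0 < d &
  forall h, h != 0 -> normc h < d -> normc (f (Some (x + h)) i j - N i j) < e.

Lemma lim_at_uniq x N N' : lim_at x N -> lim_at x N' -> N = N'.
Proof.
move=> LN LN'; apply/matrixP => i j; apply/eqP; rewrite -subr_eq0 -normc_eq0 eq_le normc_ge0 andbT.
apply/ler_addgt0Pr => e e0; rewrite add0r; have e2 : 0 < e / 2 by rewrite divr_gt0.
have [d d0 Hd] := LN i j _ e2; have [d' d'0 Hd'] := LN' i j _ e2.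
pose m := Num.min d d' / 2.
have M0 : 0 < Num.min d d' by rewrite !lt_min d0.
have m0 : 0 < m by rewrite divr_gt0.
have : m < Num.min d d' by rewrite /m ltr_pdivrMr// ltr_pMr// ltr1n.
have nm : normc m%:C = m by rewrite normcR gtr0_norm.
have mn0 : m%:C != 0 by rewrite -normc_gt0 nm.
rewrite !lt_min => /andP[md md'].
have := Hd _ mn0; rewrite nm => /(_ md); have := Hd' _ mn0; rewrite nm => /(_ md').
set F := f _ i j => h1 h2.
rewrite [N i j - N' i j](_ : _ = (F - N' i j) - (F - N i j)); last by ring.
have := ler_normcB (F - N' i j) (F - N i j); lra.
Qed.

Lemma mrd_lim x : mrd (fun w => f (Some w)) x -> lim_at x (f (Some x)).
Proof.
move=> rd i j e e0; have [al [be dij]] := rd i j.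
by have [d d0 Hd] := rdiff_continuous dij e0; exists d => // h _ /Hd.
Qed.

(** A function with the required properties may take wrong values at isolated points
    that accumulate at a marked point.  [repair] takes the limits instead. *)
Definition repair : mfct := fun q =>
  if q is Some x then xget (f q) [set N | (regpt x /\ flat x) /\ lim_at x N] else f q.

Lemma repair_rd x : mrd (fun w => f (Some w)) x -> repair (Some x) = f (Some x).
Proof.
move=> /mrd_lim L; rewrite /repair; case: xgetP => // N _ [_ LN].
exact: lim_at_uniq LN L.
Qed.

Lemma repair_not x : ~ flat x -> repair (Some x) = f (Some x).
Proof. by move=> nf; rewrite /repair; case: xgetP => // N _ [[_ /nf]]. Qed.

Lemma repair_ext x0 : regpt x0 -> flat x0 -> exists2 e : R, 0 < e & exists Fm : C -> 'M[C]_2,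
  [/\ forall s, pdisc x0 e s -> Fm s = f (Some s),
      forall s, normc (s - x0) < e -> repair (Some s) = Fm s &
      forall s, normc (s - x0) < e -> mrdiff Fm s (ode_rhs Fm s)].
Proof.
move=> rx fx; have [e e0 [Fm [H1 H2]]] := local_ext rx fx; exists e => //; exists Fm; split => //.
  by move=> s /H1[].
move=> s se; have [sx|sx] := eqVneq s x0; last first.
  have [-> rd] : Fm s = f (Some s) /\ mrd (fun w => f (Some w)) s.
    by apply: H1; rewrite /pdisc /= normc_gt0 subr_eq0 sx.
  exact: repair_rd.
have L : lim_at x0 (Fm x0).
  have c0 : normc (x0 - x0) < e by rewrite subrr normc0.
  move=> i j d d0; have [r r0 Hr] := rdiff_continuous (H2 _ c0 i j) d0.
  exists (Num.min r e) => [|h h0]; first by rewrite lt_min r0.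
  rewrite lt_min => /andP[hr he].
  have [<- _] : Fm (x0 + h) = f (Some (x0 + h)) /\ mrd (fun w => f (Some w)) (x0 + h).
    by apply: H1; rewrite /pdisc /= [x0 + h]addrC addrK normc_gt0 h0.
  exact: Hr.
rewrite sx /repair; case: xgetP => [N _ [_ LN]|]; first exact: lim_at_uniq LN L.
by move=> H; exfalso; apply: (H (Fm x0)); split.
Qed.

Lemma repair_around p : p \notin D -> around p (fun q => repair q = f q).
Proof.
by move=> pD; apply: around_mono (represents_rd pD) => -[x|//] _ _ H; apply: repair_rd; exact: H.
Qed.

Lemma derive1_near (g h : R -> R) x : (\near x, g x = h x) -> derive1 g x = derive1 h x.
Proof. by move=> gh; rewrite !derive1E; apply: near_eq_derive. Qed.

Lemma der_near (g h : C -> C) x (e : R) : 0 < e ->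
  (forall z, normc z < e -> g (x + z) = h (x + z)) ->
  cpd1 (fun z => g (x + toC z)) (0, 0) = cpd1 (fun z => h (x + toC z)) (0, 0) /\
  cpd2 (fun z => g (x + toC z)) (0, 0) = cpd2 (fun z => h (x + toC z)) (0, 0).
Proof.
move=> e0 gh.
have n1 (k : C -> R) (s : R) : `|s| < e -> k (g (x + toC (s, 0))) = k (h (x + toC (s, 0))).
  by move=> se; rewrite gh// /toC /= expr0n addr0 sqrtr_sqr.
have n2 (k : C -> R) (s : R) : `|s| < e -> k (g (x + toC (0, s))) = k (h (x + toC (0, s))).
  by move=> se; rewrite gh// /toC /= expr0n add0r sqrtr_sqr.
have nr (u w : R -> R) : (forall s : R, `|s| < e -> u s = w s) -> \forall s \near (0 : R), u s = w s.
  move=> uw; apply/nbhs_ballP; exists e => // s; rewrite -ball_normE /= sub0r normrN; exact: uw.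
rewrite /cpd1 /cpd2 /pd1 /pd2 /=; split; congr (_ +i* _); apply: derive1_near; apply: nr => s se.
- exact: n1.
- exact: n1.
- exact: n2.
- exact: n2.
Qed.

Lemma mdel_near (M N : mfct) x (e : R) : 0 < e ->
  (forall z, normc z < e -> M (Some (x + z)) = N (Some (x + z))) ->
  mdel M (Some x : pt L1) = mdel N (Some x) /\ mdbar M (Some x : pt L1) = mdbar N (Some x).
Proof.
move=> e0 MN; have H i j := @der_near (fun w => M (Some w) i j) (fun w => N (Some w) i j) x e e0
  (fun z ze => congr1 (fun A : 'M[C]_2 => A i j) (MN z ze)).
by split; apply/matrixP => i j; have [h1 h2] := H i j; rewrite !mxE /del /dbar /= h1 h2.
Qed.

Lemma repair_off_flat x : regpt x -> ~ flat x -> exists2 e : R, 0 < e &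
  forall z, normc z < e -> repair (Some (x + z)) = f (Some (x + z)).
Proof.
move=> [xD _ _ _] nf; have [e e0 He] := around_pdisc (repair_around xD).
exists e => // z ze; have [->|z0] := eqVneq z 0; first by rewrite addr0 repair_not.
by apply: He; rewrite /pdisc /= [x + z]addrC addrK normc_gt0 z0.
Qed.

(** The repaired function keeps the properties of [f], and outside a finite set it
    solves the differential equation at every point near which the form vanishes. *)
Lemma repairP :
  [/\ off_finite (fun q : pt L1 => \tr (repair q) = 0),
      off_finite (fun q : pt L1 => a.1 q = dB v q + nabla10 E repair q /\ a.2 q = mdbar repair q) &
      off_finite (fun q : pt L1 => forall x, q = Some x -> flat x ->
        mrdiff (fun w => repair (Some w)) x (ode_rhs (fun w => repair (Some w)) x))].
Proof.
have ode x : regpt x -> flat x -> mrdiff (fun w => repair (Some w)) x (ode_rhs (fun w => repair (Some w)) x).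
  move=> rx fx; have [e e0 [Fm [H1 H2 H3]]] := repair_ext rx fx.
  have c0 : normc (x - x) < e by rewrite subrr normc0.
  rewrite /ode_rhs H2//; apply: mrdiff_near (H3 x c0); first exact: e0.
  by move=> h he; rewrite H2// [x + h]addrC addrK.
split.
- have [s Hs] := (off_finiteP _).1 trf.
  have [s' Hs'] := (off_finiteP _).1 regpt_off_finite.
  apply/off_finiteP; exists (s ++ s') => x; rewrite mem_cat negb_or => /andP[/Hs tx /Hs'/(_ _ erefl) rx].
  have [fx|/repair_not->//] := pselect (flat x).
  have [e e0 [Fm [H1 H2 H3]]] := repair_ext rx fx.
  have c0 : normc (x - x) < e by rewrite subrr normc0.
  rewrite H2// tr2E.
  have D00 := H3 x c0 0 0; have D11 := H3 x c0 1 1.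
  have [d d0 Hd] := around_pdisc (off_finite_around (Some x) trf).
  have m0 : 0 < Num.min d e by rewrite lt_min d0.
  apply: (@rdiff_eq_at (fun s => Fm s 0 0 + Fm s 1 1) (fun=> 0) x (Num.min d e) _ _ _ _ m0 _ (rdiffD D00 D11) (rdiff_cst 0 x)).
  move=> w Ds; rewrite -tr2E H1; first by apply: Hd; apply: pdisc_sub Ds; rewrite ge_min lexx.
  by apply: pdisc_sub Ds; rewrite ge_min lexx orbT.
- have [s' Hs'] := (off_finiteP _).1 regpt_off_finite.
  apply/off_finiteP; exists s' => x /Hs'/(_ _ erefl) rx.
  have [fx|nf] := pselect (flat x).
    have [z1 z2] : a.1 (Some x) = 0 /\ a.2 (Some x) = 0.
      by have [e e0 /(_ 0)] := fx; rewrite normc0 addr0; apply.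
    have [E1 E2] := mdel_mrdiff (ode x rx fx).
    by rewrite z1 z2 /nabla10 E1 E2 /ode_rhs subrK subrr.
  have [e e0 He] := repair_off_flat rx nf.
  have [E1 E2] := mdel_near e0 He; have [_ [q1 q2] _ _] := rx.
  by rewrite /nabla10 E1 E2 repair_not.
- by apply: off_finite_mono regpt_off_finite => q _ H x qx fx; apply: ode => //; exact: H.
Qed.

End Repair.

(** * The double cover near a branch point *)

Section Cover.
Variable R : realType.
Local Notation C := (R[i]).

Definition reg (r : C -> C) := exists n d : {poly C}, exists2 e : R, 0 < e &
  d.[0] != 0 /\ forall u, normc u < e -> d.[u] != 0 /\ r u = n.[u] / d.[u].

Lemma reg_quot (n d : {poly C}) : d.[0] != 0 -> reg (fun u => n.[u] / d.[u]).
Proof.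
move=> d0; have [e e0 He] := poly_near d0; exists n, d, e => //; split => // u /He.
by rewrite add0r => -[_].
Qed.

Lemma reg_eq r r' (e : R) : 0 < e -> (forall u, normc u < e -> r u = r' u) -> reg r -> reg r'.
Proof.
move=> e0 rr [n [d [e' e'0 [d0 H]]]]; exists n, d, (Num.min e e'); first by rewrite lt_min e0.
split => // u; rewrite lt_min => /andP[ue ue']; rewrite -rr//; exact: H.
Qed.

Lemma reg_poly (n : {poly C}) : reg (fun u => n.[u]).
Proof.
exists n, 1, 1 => //; rewrite hornerC oner_neq0; split => // u _.
by rewrite hornerC oner_neq0 divr1.
Qed.

Lemma reg_sub r r' : reg r -> reg r' -> reg (fun u => r u - r' u).
Proof.
move=> [n [d [e e0 [d0 H]]]] [n' [d' [e' e'0 [d'0 H']]]].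
exists (n * d' - n' * d), (d * d'), (Num.min e e'); first by rewrite lt_min e0.
rewrite hornerM mulf_neq0//; split => // u; rewrite lt_min => /andP[/H[h1 ->] /H'[h2 ->]].
by rewrite !hornerE mulf_neq0//; split => //; field; rewrite h1 h2.
Qed.

Lemma reg_div r : reg r -> r 0 = 0 -> exists2 r', reg r' & exists2 e : R, 0 < e &
  forall u, normc u < e -> r u = u * r' u.
Proof.
move=> [n [d [e e0 [d0 H]]]] r0.
have n0 : n.[0] = 0.
  have [_] := H 0 ltac:(by rewrite normc0); rewrite r0 => /esym/eqP.
  by rewrite mulf_eq0 invr_eq0 (negbTE d0) orbF => /eqP.
have /factor_theorem[n' nE] : root n 0 by rewrite /root n0.
exists (fun u => n'.[u] / d.[u]); first exact: reg_quot.
exists e => // u /H[_ ->]; by rewrite nE hornerM hornerXsubC subr0 [_ * u]mulrC -mulrA.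
Qed.

Lemma reg_nice (r : C -> C) : reg r -> exists2 e : R, 0 < e &
  forall (D : set C) k xi, opened D -> (forall s, D s -> normc (xi s) < e) ->
    nice D k xi -> nice D k (fun s => r (xi s)).
Proof.
move=> [n [d [e e0 [d0 H]]]]; have [e' e'0 H'] := poly_near d0.
exists (Num.min e e') => [|D k xi oD xie nxi]; first by rewrite lt_min e0.
have xe s : D s -> normc (xi s) < e by move=> /xie; rewrite lt_min => /andP[].
have xe' s : D s -> normc (xi s) < e' by move=> /xie; rewrite lt_min => /andP[].
apply: (@nice_eq R D k (fun s => n.[xi s] * (d.[xi s])^-1)) => //.
  by move=> s Ds; have [_ ->] := H _ (xe _ Ds).
apply: niceM; first exact: nice_poly.
apply: (@niceV R D k _ (normc d.[0] / 2)); first by rewrite divr_gt0// normc_gt0.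
  by move=> s Ds; have [] := H' _ (xe' _ Ds); rewrite add0r.
exact: nice_poly.
Qed.

Variables H1 H2 : {poly C}.
Hypothesis H10 : H1.[0] = 0.
Hypothesis dH10 : H1^`().[0] != 0.
Hypothesis H20 : H2.[0] != 0.
Variables (m L N : C -> 'M[C]_2) (e0 : R).
Variables r01 r10 de s00 s01 s10 s11 : C -> C.
Hypothesis e0_gt0 : 0 < e0.
Hypothesis dm : forall u, u != 0 -> normc u < e0 ->
  mrdiff m u (N u + (m u *m L u - L u *m m u)).
Hypothesis LE : forall u, u != 0 -> normc u < e0 ->
  [/\ u * L u 0 1 = r01 u, L u 1 0 = r10 u & u * (L u 0 0 - L u 1 1) = 2%:R^-1 + u * de u].
Hypothesis NE : forall u, u != 0 -> normc u < e0 ->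
  [/\ N u 0 0 = s00 u, u * N u 0 1 = s01 u, N u 1 0 = s10 u & N u 1 1 = s11 u].
Hypothesis reg_r01 : reg r01.
Hypothesis reg_r10 : reg r10.
Hypothesis reg_de : reg de.
Hypothesis reg_s00 : reg s00.
Hypothesis reg_s01 : reg s01.
Hypothesis reg_s10 : reg s10.
Hypothesis reg_s11 : reg s11.

(** With [H1(u) = s^2 H2(u)], so that [u] is a local parameter below and [s] above the
    branch point, conjugation by the matrix of the elementary transformation turns the
    exponents [1/4, -1/4] of the equation in [u] into an equation in [s] without
    singularity; every solution then extends over [s = 0]. *)
Lemma cover_removal : exists (e rho : R) (F : 'I_2 -> 'I_2 -> C -> C),
  [/\ 0 < e, 0 < rho, forall i j, holo 0 e (F i j) &
    forall s u, s != 0 -> normc s < e -> normc u < rho -> H1.[u] = s ^+ 2 * H2.[u] ->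
      [/\ F 0 0 s = m u 1 1, F 0 1 s = m u 1 0 / s, F 1 0 s = s * m u 0 1 & F 1 1 s = m u 0 0]].
Proof.
have [e1 [rho [B [xi [e10 rho0 xiP xiU [dxi nxi [b b0 Hb]]]]]]] := implicit_root H2 H10 dH10.
have /factor_theorem[H1b H1E] : root H1 0 by rewrite /root H10.
rewrite subr0 in H1E.
have H1b0 : H1b.[0] = H1^`().[0] by rewrite H1E derivM derivX !hornerE.
have H1b00 : H1b.[0] != 0 by rewrite H1b0.
have [a1 a10 n01] := reg_nice reg_r01; have [a2 a20 n10] := reg_nice reg_r10.
have [a3 a30 nde] := reg_nice reg_de; have [a4 a40 ns00] := reg_nice reg_s00.
have [a5 a50 ns01] := reg_nice reg_s01; have [a6 a60 ns10] := reg_nice reg_s10.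
have [a7 a70 ns11] := reg_nice reg_s11.
have [a8 a80 nH2] := reg_nice (reg_quot 1 H20).
have [a9 a90 nH1b] := reg_nice (reg_quot 1 H1b00).
have [a10' a100 hH2] := poly_near H20; have [a11 a110 hH1b] := poly_near H1b00.
pose r := Num.min (Num.min (Num.min e0 a1) (Num.min a2 a3)) (Num.min (Num.min (Num.min a4 a5) (Num.min a6 a7)) (Num.min (Num.min a8 a9) (Num.min a10' a11))).
have r0 : 0 < r by rewrite !lt_min e0_gt0 a10 a20 a30 a40 a50 a60 a70 a80 a90 a100 a110.
pose B' := `|B| + 1.
have B'0 : 0 < B' by rewrite ltr_wpDl.
pose e := Num.min e1 (Num.min (r / B') 1).
have ee0 : 0 < e by rewrite !lt_min e10 ltr01 divr_gt0.
have ee1 : e <= e1 by rewrite ge_min lexx.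
have ee2 : e <= 1 by rewrite !ge_min lexx !orbT.
have xir s : normc s < e -> normc (xi s) < r.
  move=> se; have [_ h _] := xiP s (lt_le_trans se ee1).
  apply: le_lt_trans h _; apply: le_lt_trans (_ : B' * normc s < r).
    by apply: ler_wpM2r; rewrite ?normc_ge0// /B'; apply: le_trans (ler_norm _) _; rewrite lerDl.
  by rewrite mulrC -ltr_pdivlMr//; apply: lt_le_trans se _; rewrite !ge_min lexx orbT.
have xi0 s : s != 0 -> normc s < e -> xi s != 0.
  move=> s0 se; have [_ _ h] := xiP s (lt_le_trans se ee1).
  apply: contra_neq s0 => x0; move: h; rewrite x0 H10 => /esym/eqP.
  by rewrite mulf_eq0 (negbTE H20) orbF expf_eq0 => /eqP.
(* Dl is the derivative of H1 - s^2 H2 at the root, so that xi' = s ka.  Differentiating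
   the factors s and 1 / s of Y brings in 1 / s, which cancels against the pole of
   s ka (L00 - L11) because L00 - L11 has residue 1/2: the difference is s (ka de + th). *)
pose Dl s := H1^`().[xi s] - s ^+ 2 * H2^`().[xi s].
pose ka s := 2%:R * H2.[xi s] * (Dl s)^-1.
pose ta s := ka s * (H1b.[xi s] * (1.[xi s] / H2.[xi s])).
pose th s := (- (H2.[xi s] * H1b^`().[xi s] * (1.[xi s] / H1b.[xi s])) + H2^`().[xi s]) * (Dl s)^-1.
pose Y s : 'M[C]_2 := \matrix_(i, j) if i == 0 then (if j == 0 then m (xi s) 1 1 else m (xi s) 1 0 / s)
  else (if j == 0 then s * m (xi s) 0 1 else m (xi s) 0 0).
pose L' s : 'M[C]_2 := \matrix_(i, j) if i == 0 then (if j == 0 then 0 else ka s * r10 (xi s))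
  else (if j == 0 then ta s * r01 (xi s) else s * ka s * de (xi s) + s * th s).
pose N' s : 'M[C]_2 := \matrix_(i, j) if i == 0 then (if j == 0 then s * ka s * s11 (xi s) else ka s * s10 (xi s))
  else (if j == 0 then ta s * s01 (xi s) else s * ka s * s00 (xi s)).
pose D := pdisc (0 : C) e.
have oD : opened D by exact: pdisc_open.
have De s : D s -> s != 0 /\ normc s < e by move=> /andP[]; rewrite subr0 normc_gt0.
have nx k : nice D k xi.
  apply: nice_sub (nxi k) => s /De[_ se]; rewrite /= subr0; exact: lt_le_trans ee1.
have nid k : nice D k id by apply: (@nice_id R D k e) => s /De[_ /ltW].
have nDl k : nice D k (fun s => (Dl s)^-1).
  apply: (@niceV R D k _ b) => //; first by move=> s /De[_ se]; apply: Hb; exact: lt_le_trans ee1.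
  apply: niceB => //; first exact: nice_poly.
  by apply: niceM; [exact: (niceM (nid k) (nid k))|exact: nice_poly].
have nka k : nice D k ka by apply: niceM => //; apply: niceZ; exact: nice_poly.
have xa a s : r <= a -> D s -> normc (xi s) < a by move=> ra /De[_ /xir h]; exact: lt_le_trans ra.
have rr := @le_trans _ R.
have ra1 : r <= a1 by rewrite !ge_min lexx ?orbT.
have ra2 : r <= a2 by rewrite !ge_min lexx ?orbT.
have ra3 : r <= a3 by rewrite !ge_min lexx ?orbT.
have ra4 : r <= a4 by rewrite !ge_min lexx ?orbT.
have ra5 : r <= a5 by rewrite !ge_min lexx ?orbT.
have ra6 : r <= a6 by rewrite !ge_min lexx ?orbT.
have ra7 : r <= a7 by rewrite !ge_min lexx ?orbT.
have ra8 : r <= a8 by rewrite !ge_min lexx ?orbT.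
have ra9 : r <= a9 by rewrite !ge_min lexx ?orbT.
have ra10 : r <= a10' by rewrite !ge_min lexx ?orbT.
have ra11 : r <= a11 by rewrite !ge_min lexx ?orbT.
have re0 : r <= e0 by rewrite !ge_min lexx ?orbT.
have nta k : nice D k ta.
  apply: niceM => //; apply: niceM; first exact: nice_poly.
  apply: nH2 => // s; exact: xa.
have nth k : nice D k th.
  apply: niceM => //; apply: niceD; last exact: nice_poly.
  apply: niceN => //; apply: niceM; last by apply: nH1b => // s; exact: xa.
  by apply: niceM; exact: nice_poly.
have nL k : mnice D k L'.
  have mE i j (u : C -> C) : (forall s, L' s i j = u s) -> nice D k u -> nice D k (fun s => L' s i j).
    by move=> E; apply: nice_eq => // s _; rewrite E.
  apply: mfall.
  - by apply: mE (nice_cst D k 0) => s; rewrite mxE.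
  - apply: mE (niceM (nka k) (n10 D k xi oD (fun s => xa a2 s ra2) (nx k))) => s; by rewrite mxE.
  - apply: mE (niceM (nta k) (n01 D k xi oD (fun s => xa a1 s ra1) (nx k))) => s; by rewrite mxE.
  - apply: mE (niceD (niceM (niceM (nid k) (nka k)) (nde D k xi oD (fun s => xa a3 s ra3) (nx k))) (niceM (nid k) (nth k))) => s; by rewrite mxE.
have nN k : mnice D k N'.
  have mE i j (u : C -> C) : (forall s, N' s i j = u s) -> nice D k u -> nice D k (fun s => N' s i j).
    by move=> E; apply: nice_eq => // s _; rewrite E.
  apply: mfall.
  - apply: mE (niceM (niceM (nid k) (nka k)) (ns11 D k xi oD (fun s => xa a7 s ra7) (nx k))) => s; by rewrite mxE.
  - apply: mE (niceM (nka k) (ns10 D k xi oD (fun s => xa a6 s ra6) (nx k))) => s; by rewrite mxE.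
  - apply: mE (niceM (nta k) (ns01 D k xi oD (fun s => xa a5 s ra5) (nx k))) => s; by rewrite mxE.
  - apply: mE (niceM (niceM (nid k) (nka k)) (ns00 D k xi oD (fun s => xa a4 s ra4) (nx k))) => s; by rewrite mxE.
have ode s i j : D s -> rdiff (fun z => Y z i j) s ((N' s + (Y s *m L' s - L' s *m Y s)) i j) 0.
  move=> Ds; have [s0 se] := De _ Ds; have se1 := lt_le_trans se ee1.
  have x0 := xi0 _ s0 se.
  have Dl0 : Dl s != 0 by rewrite -normc_gt0; apply: lt_le_trans b0 _; exact: Hb.
  have h2 : H2.[xi s] != 0 by have [_] := hH2 _ (xa _ _ ra10 Ds); rewrite add0r.
  have h1b : H1b.[xi s] != 0 by have [_] := hH1b _ (xa _ _ ra11 Ds); rewrite add0r.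
  have [_ _ root] := xiP s se1; rewrite {1}H1E hornerM hornerX in root.
  have H1'E : H1^`().[xi s] = H1b^`().[xi s] * xi s + H1b.[xi s].
    by rewrite H1E derivM derivX mulr1 !hornerE.
  have dx : rdiff xi s (s * ka s) 0.
    by apply: rdiff_eqpq (dxi s se1) => //; rewrite /ka -/(Dl s); ring.
  have dmx k l := rdiff_holcomp dx (dm x0 (xa _ _ re0 Ds) k l).
  have [l01 l10 l00] := LE x0 (xa _ _ re0 Ds).
  have [nn00 nn01 nn10 nn11] := NE x0 (xa _ _ re0 Ds).
  set u := xi s in x0 h2 h1b root H1'E dmx l01 l10 l00 nn00 nn01 nn10 nn11 *.
  have u2 : s ^+ 2 = H1b.[u] * u / H2.[u] by rewrite root; field.
  have kaE : ka s = 2%:R * H2.[u] / Dl s by [].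
  have taE : ta s = s ^+ 2 * ka s / u by rewrite u2 /ta -/u hornerC; field; rewrite x0.
  have ksE : s * ka s * de u + s * th s = s * ka s * (L u 0 0 - L u 1 1) - s^-1.
    have -> : L u 0 0 - L u 1 1 = 2%:R^-1 / u + de u.
      by apply: (mulfI x0); rewrite l00; field.
    have -> : s^-1 = s * (H2.[u] / (H1b.[u] * u)).
      by apply: (mulfI s0); rewrite divff// mulrA -expr2 u2; field; rewrite x0 h1b.
    have DlE : Dl s = H1b^`().[u] * u + H1b.[u] - H1b.[u] * u / H2.[u] * H2^`().[u].
      by rewrite /Dl -/u H1'E u2.
    rewrite kaE /th -/u hornerC; move: (Dl s) DlE Dl0 => dl dlE dl0.
    have -> : H2^`().[u] = (H1b^`().[u] * u + H1b.[u] - dl) * H2.[u] / (H1b.[u] * u).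
      by rewrite dlE; field; rewrite x0 h1b h2.
    by field; rewrite h1b dl0 x0.
  have rhs k l : (N u + (m u *m L u - L u *m m u)) k l = N u k l + (m u k 0 * L u 0 l + m u k 1 * L u 1 l
     - (L u k 0 * m u 0 l + L u k 1 * m u 1 l)).
    by rewrite [LHS]mxE; congr (_ + _); rewrite mxE mul2E; congr (_ + _); rewrite mxE mul2E.
  have rhs' k l : (N' s + (Y s *m L' s - L' s *m Y s)) k l = N' s k l + (Y s k 0 * L' s 0 l + Y s k 1 * L' s 1 l
     - (L' s k 0 * Y s 0 l + L' s k 1 * Y s 1 l)).
    by rewrite [LHS]mxE; congr (_ + _); rewrite mxE mul2E; congr (_ + _); rewrite mxE mul2E.
  have l11 : L u 1 1 = L u 0 0 - (L u 0 0 - L u 1 1) by ring.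
  have s20 : s ^+ 2 != 0 by rewrite expf_neq0.
  have vE : r01 u = u * L u 0 1 by rewrite l01.
  have v1E : s01 u = u * N u 0 1 by rewrite nn01.
  move: i j; apply: mfall.
  - apply: rdiff_ext (rdiff_eqpq _ _ (dmx 1 1)) => [z||//]; first by rewrite mxE.
    rewrite rhs rhs' !mxE /= -/u taE vE -l10 -nn11; field; by rewrite x0 s0.
  - apply: rdiff_ext (rdiff_eqpq _ _ (rdiffM (dmx 1 0) (rdiffV s0 (rdiff_id s)))) => [z||]; first by rewrite mxE.
    + rewrite rhs rhs' !mxE /= -/u ksE -nn10 -l10; field; by rewrite s0.
    + by rewrite mul0r mulr0 addr0.
  - apply: rdiff_ext (rdiff_eqpq _ _ (rdiffM (rdiff_id s) (dmx 0 1))) => [z||]; first by rewrite mxE.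
    + rewrite rhs rhs' !mxE /= -/u ksE taE vE v1E; field; by rewrite x0 s0.
    + by rewrite mul0r mulr0 addr0.
  - apply: rdiff_ext (rdiff_eqpq _ _ (dmx 0 0)) => [z||//]; first by rewrite mxE.
    rewrite rhs rhs' !mxE /= -/u taE vE -l10 -nn00; field; by rewrite x0 s0.
have ext := ode_removal ee0 nN nL (fun s i j => @ode s i j).
have [F HF] : exists F : 'I_2 * 'I_2 -> C -> C, forall ij, (forall s, D s -> F ij s = Y s ij.1 ij.2) /\ holo 0 e (F ij).
  apply: (@cchoice _ _ (fun ij F => (forall s, D s -> F s = Y s ij.1 ij.2) /\ holo 0 e F)) => ij.
  exact: ext.
exists e, rho, (fun i j => F (i, j)); split => //; first by move=> i j; have [] := HF (i, j).
move=> s u s0 se ur root.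
have -> : u = xi s by apply: xiU => //; exact: lt_le_trans ee1.
have Ds : D s by rewrite /D /pdisc /= subr0 normc_gt0 s0.
have FE i j : F (i, j) s = Y s i j by have [h _] := HF (i, j); exact: h.
by rewrite !FE !mxE.
Qed.

End Cover.

Section FrameOde.
Variable R : realType.
Local Notation C := (R[i]).
Local Notation L1 := (P1 R).
Local Notation mfct := (pt L1 -> 'M[C]_2).
Variables (E : pconn L1) (v : deformation L1) (f : mfct) (w : pt L1).
Hypothesis rA : mrational (cA E).
Hypothesis rB : mrational (dB v).
Hypothesis rh : mrational (dh v w).
Hypothesis rg : mrational (cg E w).
Hypothesis dg : off_finite (fun q => \det (cg E w q) != 0).
Hypothesis odef : around w (fun q : pt L1 => forall x, q = Some x ->
  mrdiff (fun y => f (Some y)) x (ode_rhs E v (fun y => f (Some y)) x)).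

Let M (q : pt L1) := in_frame E w (fun q => f q - dh v w q) q.
Let Q (q : pt L1) := in_frame E w (fun q => dB v q + nabla10 E (dh v w) q) q.

Definition xcoord (u : C) : C := if w is Some a then a + u else u^-1.
Definition dxcoord (u : C) : C := if w is Some a then 1 else - u ^- 2.

Lemma chartE u : chart w u = Some (xcoord u).
Proof. by rewrite /chart /xcoord; case: w. Qed.

Lemma xcoord_rdiff u : u != 0 -> rdiff xcoord u (dxcoord u) 0.
Proof.
rewrite /xcoord /dxcoord; case: w => [a|] u0; last exact: rdiff_inv.
by rewrite -[1]add0r -[0 in X in rdiff _ _ _ X]addr0; exact: rdiffD (rdiff_cst a u) (rdiff_id u).
Qed.

Lemma around_disc (P : pt L1 -> Prop) : around w P -> around w (fun q : pt L1 => forall x, q = Some x ->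
  exists2 d : R, 0 < d & forall h, normc h < d -> P (Some (x + h))).
Proof.
case: w => [x0|].
  move=> /around_pdisc[e e0 H]; apply/aroundP; exists e => // u u0 ue _ [<-].
  have Du : pdisc x0 e (x0 + u) by rewrite /pdisc /= [x0 + u]addrC addrK normc_gt0 u0.
  by have [d d0 Hd] := pdisc_open Du; exists d => // h /Hd/H.
move=> /aroundP[e e0 H]; apply/aroundP; exists e => // u u0 ue _ [<-].
have ui0 : u^-1 != 0 by rewrite invr_eq0.
have nu : e^-1 < normc u^-1 by rewrite normcV ltf_pV2 ?posrE ?normc_gt0.
exists (Num.min (normc u^-1) (normc u^-1 - e^-1)); first by rewrite lt_min normc_gt0 ui0 subr_gt0.
move=> h; rewrite lt_min => /andP[h1 h2].
have lo : normc u^-1 - normc h <= normc (u^-1 + h).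
  by rewrite -(normcN h) -{2}[h]opprK; exact: ler_distc.
have nz : u^-1 + h != 0 by rewrite -normc_gt0; apply: lt_le_trans lo; rewrite subr_gt0.
have := H (u^-1 + h)^-1; rewrite /= invrK invr_eq0; apply => //.
rewrite normcV invf_plt ?posrE ?normc_gt0//; apply: lt_le_trans lo.
by rewrite ltrBrDr addrC -ltrBrDr.
Qed.

(** Conjugation by the frame turns the equation for [f] into one whose coefficients
    are the connection and the deformation read in that frame. *)
Lemma frame_deriv : around w (fun q : pt L1 => forall x, q = Some x ->
  mrdiff (fun y => M (Some y)) x (- Q q + (M q *m conn_in_frame E w q - conn_in_frame E w q *m M q))).
Proof.
have ri := mrational_inv rg dg.
have := around_and (around_and (around_disc (off_finite_around w dg)) odef)
  (around_and (off_finite_around w (mrational_mrdiff rg))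
    (around_and (off_finite_around w (mrational_mrdiff ri)) (off_finite_around w (mrational_mrdiff rh)))).
apply: around_mono => q _ _ [[+ +] [+ [+ +]]] x qx; subst q.
move=> /(_ _ erefl)[d d0 Hd] /(_ _ erefl) df /(_ _ erefl) dgx /(_ _ erefl) dGx /(_ _ erefl) dhx.
set g' := mdel (cg E w) (Some x) in dgx; set G' := mdel _ _ in dGx.
pose g := cg E w (Some x); pose G := invmx g.
have dg0 : g \in unitmx.
  by rewrite unitmxE unitfE; have := Hd 0; rewrite normc0 addr0; apply.
have Gg : G *m g = 1%:M by rewrite mulVmx.
have gG : g *m G = 1%:M by rewrite mulmxV.
have G'E : G' = - (G *m g' *m G).
  have P0 : G' *m g + G *m g' = 0.
    apply: (@mrdiff_uniq _ (fun y => invmx (cg E w (Some y)) *m cg E w (Some y)) x).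
      exact: mrdiff_mul dGx dgx.
    apply: (@mrdiff_near _ (fun=> 1%:M) _ x d) => //; last exact: mrdiff_cst.
    by move=> h /Hd dh; rewrite mulVmx// unitmxE unitfE.
  apply/eqP; rewrite -subr_eq0 opprK; apply/eqP.
  rewrite -[G']mulmx1 -gG !mulmxA -mulmxDl P0 mul0mx//.
have dphi := mrdiffD df (mrdiffN dhx).
have := mrdiff_mul (mrdiff_mul dGx dphi) dgx.
rewrite -/g -/G /M /in_frame -/g -/G; set M' := (_ + _)%R => HM.
suff <- : M' = - Q (Some x) + (G *m (f (Some x) - dh v w (Some x)) *m g *m conn_in_frame E w (Some x) -
    conn_in_frame E w (Some x) *m (G *m (f (Some x) - dh v w (Some x)) *m g)) by [].
rewrite /M' {HM M'} G'E /Q /in_frame /conn_in_frame -/g -/G -/g' /nabla10 /ode_rhs.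
set A := cA E _; set B := dB v _; set h := dh v w _; set h' := mdel _ _; set F := f _.
set K := A *m g + g'.
have e1 : G *m (F - h) *m g *m (G *m K) = G *m ((F - h) *m K) by rewrite -!mulmxA (mulmxA g) gG mul1mx.
have e2 : G *m K *m (G *m (F - h) *m g) = G *m (A *m (F - h) *m g) + G *m g' *m G *m (F - h) *m g.
  rewrite /K mulmxDr mulmxDl -!mulmxA (mulmxA g) gG mul1mx//.
move: e1 e2; set X1 := G *m (F - h) *m g *m _; set X2 := G *m K *m _ => -> -> {X1 X2}.
have key : - B - comm A F - h' = - (B + (h' + comm A h)) + ((F - h) *m A - A *m (F - h)).
  rewrite /comm; apply/matrixP; move: A B h h' F {K dphi df} => A B h h' F.
  have addE (P T : 'M[C]_2) i j : (P + T) i j = P i j + T i j by rewrite mxE.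
  have oppE (P : 'M[C]_2) i j : (- P) i j = - P i j by rewrite mxE.
  by move=> i j; rewrite !(addE, oppE, mul2E); ring.
rewrite key /K; move: (F - h) (B + _) {key dphi df K} => Ph S.
rewrite !(mulmxDl, mulmxDr, mulmxN, mulNmx, mulmxA).
move: (G *m S *m g) (G *m Ph *m A *m g) (G *m A *m Ph *m g) (G *m Ph *m g') (G *m g' *m G *m Ph *m g).
by move=> t1 t2 t3 t4 t5; apply/matrixP => i j; rewrite !mxE; ring.
Qed.

Lemma around_dxdz : around w (fun q : pt L1 => dxdz w q = dxcoord (unif w q)).
Proof.
have [e e0 H] := (aroundP _ _).1 (off_finite_around w (rational_dxdz w)).
apply/aroundP; exists e => // u u0 ue; have := H u u0 ue; rewrite unif_chart//.
by rewrite /chart /dxcoord; case: w => [a|] -> //; rewrite exprVn.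
Qed.

(** Having a limit, the residue is regular in the local parameter, and the
    coefficient has at most a simple pole. *)
Lemma residue_reg (T : mfct) (T0 : 'M[C]_2) i j : mrational T ->
  mtends w (fun q => (unif w q * dxdz w q) *: T q) T0 ->
  exists2 r : C -> C, reg r /\ r 0 = T0 i j & exists2 e : R, 0 < e & forall u, u != 0 -> normc u < e ->
    u * (dxcoord u * T (chart w u) i j) = r u.
Proof.
move=> rT tT; have rf := mrationalZ (rational_zdx w) rT i j.
have [n [d [d0 n0 H]]] := rational_local rf (tT i j).
exists (fun u => n.[u] / d.[u]); first by split; [exact: reg_quot|rewrite n0 mulfK].
have [e e0 He] := (aroundP _ _).1 (around_and H around_dxdz).
exists e => // u u0 ue; have [h1 h2] := He u u0 ue.
by move: h1; rewrite h2 !unif_chart// mxE -mulrA.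
Qed.

Hypothesis logE : exists T : 'M[C]_2,
  [/\ mtends w (fun q => (unif w q * dxdz w q) *: conn_in_frame E w q) T,
      T 0 0 = 4%:R^-1, T 1 1 = - 4%:R^-1 & T 1 0 = 0].
Hypothesis logv : exists T : 'M[C]_2,
  [/\ mtends w (fun q => (unif w q * dxdz w q) *: Q q) T, T 0 0 = 0, T 1 1 = 0 & T 1 0 = 0].

Lemma mrational_conn : mrational (fun q : pt L1 => conn_in_frame E w q).
Proof.
apply: mrational_mul; first exact: mrational_inv.
apply: mrationalD; first exact: mrational_mul.
exact: mrational_del.
Qed.

Lemma mrational_Q : mrational Q.
Proof.
apply: mrational_mul => //; apply: mrational_mul; first exact: mrational_inv.
apply: mrationalD => //; apply: mrationalD; first exact: mrational_del.
apply: mrationalD; first exact: mrational_mul.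
by apply: mrationalN; exact: mrational_mul.
Qed.

(** Residues that are upper triangular, with diagonal 1/4, -1/4 for the connection
    and 0, 0 for the deformation, are what [cover_removal] asks for. *)
Lemma frame_removal (H1 H2 : {poly C}) : H1.[0] = 0 -> H1^`().[0] != 0 -> H2.[0] != 0 ->
  exists (e rho : R) (F : 'I_2 -> 'I_2 -> C -> C),
  [/\ 0 < e, 0 < rho, forall i j, holo 0 e (F i j) &
    forall s u, s != 0 -> normc s < e -> normc u < rho -> H1.[u] = s ^+ 2 * H2.[u] ->
      [/\ F 0 0 s = M (chart w u) 1 1, F 0 1 s = M (chart w u) 1 0 / s,
          F 1 0 s = s * M (chart w u) 0 1 & F 1 1 s = M (chart w u) 0 0]].
Proof.
move=> H10 dH10 H20.
have [T [tT T00 T11 T10]] := logE; have [S [tS S00 S11 S10]] := logv.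
have rr i j := residue_reg i j mrational_conn tT.
have rs i j := residue_reg i j mrational_Q tS.
have [a00 [ra00 a000] [d1 d10 A00]] := rr 0 0; have [a01 [ra01 a010] [d2 d20 A01]] := rr 0 1.
have [a10 [ra10 a100] [d3 d30 A10]] := rr 1 0; have [a11 [ra11 a110] [d4 d40 A11]] := rr 1 1.
have [b00 [rb00 b000] [d5 d50 B00]] := rs 0 0; have [b01 [rb01 b010] [d6 d60 B01]] := rs 0 1.
have [b10 [rb10 b100] [d7 d70 B10]] := rs 1 0; have [b11 [rb11 b110] [d8 d80 B11]] := rs 1 1.
have [r10 rr10 [d9 d90 R10]] := reg_div ra10 (etrans a100 T10).
have [de rde [d10' d100 RDE]] : exists2 de, reg de & exists2 e : R, 0 < e &
    forall u, normc u < e -> a00 u - a11 u - 2%:R^-1 = u * de u.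
  apply: (reg_div (r := fun u => a00 u - a11 u - 2%:R^-1)).
    apply: reg_sub; first exact: reg_sub.
    by apply: reg_eq ltr01 _ (reg_poly (2%:R^-1)%:P) => u _; rewrite hornerC.
  by rewrite a000 a110 T00 T11; field.
have [c00 rc00 [d11 d110 C00]] := reg_div rb00 (etrans b000 S00).
have [c10 rc10 [d12 d120 C10]] := reg_div rb10 (etrans b100 S10).
have [c11 rc11 [d13 d130 C11]] := reg_div rb11 (etrans b110 S11).
have [d14 d140 DM] := (aroundP _ _).1 frame_deriv.
pose d := Num.min (Num.min (Num.min (Num.min d1 d2) (Num.min d3 d4)) (Num.min (Num.min d5 d6) (Num.min d7 d8)))
  (Num.min (Num.min (Num.min d9 d10') (Num.min d11 d12)) (Num.min d13 d14)).
have d0 : 0 < d by rewrite !lt_min d10 d20 d30 d40 d50 d60 d70 d80 d90 d100 d110 d120 d130 d140.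
pose L u := dxcoord u *: conn_in_frame E w (chart w u).
pose N u := - dxcoord u *: Q (chart w u).
have zero : reg (fun _ : C => 0 : C).
  by apply: reg_eq ltr01 _ (reg_poly (0 : {poly C})) => u _; rewrite horner0.
have neg (r : C -> C) : reg r -> reg (fun u => - r u).
  by move=> rr'; apply: reg_eq ltr01 _ (reg_sub zero rr') => u _; rewrite sub0r.
have scE (c : C) (X : 'M[C]_2) k l : (c *: X) k l = c * X k l by rewrite mxE.
have lt u : normc u < d -> [/\ [/\ normc u < d1, normc u < d2, normc u < d3 & normc u < d4],
   [/\ normc u < d5, normc u < d6, normc u < d7 & normc u < d8],
   [/\ normc u < d9, normc u < d10', normc u < d11 & normc u < d12] & normc u < d13 /\ normc u < d14].
  by rewrite !lt_min -!andbA => /and5P[-> -> -> -> /and5P[-> -> -> -> /and5P[-> -> -> -> /andP[-> ->]]]].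
apply: (@cover_removal R H1 H2 H10 dH10 H20 (fun u => M (chart w u)) L N d a01 r10 de
   (fun u => - c00 u) (fun u => - b01 u) (fun u => - c10 u) (fun u => - c11 u)) => //;
  try by apply: neg.
- move=> u u0 /lt[_ _ _ [_ u14]] i j; have dm := DM u u0 u14 _ (chartE u).
  have H : rdiff (fun z => M (chart w z) i j) u ((- Q (chart w u) +
     (M (chart w u) *m conn_in_frame E w (chart w u) - conn_in_frame E w (chart w u) *m M (chart w u))) i j * dxcoord u) 0.
    by apply: rdiff_ext (rdiff_holcomp (xcoord_rdiff u0) (dm i j)) => z; rewrite chartE.
  have -> : N u + (M (chart w u) *m L u - L u *m M (chart w u)) = dxcoord u *: (- Q (chart w u) +
     (M (chart w u) *m conn_in_frame E w (chart w u) - conn_in_frame E w (chart w u) *m M (chart w u))).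
    by rewrite /L /N -scalemxAr -scalemxAl scalerDr scalerBr scaleNr scalerN.
  have -> (X : 'M[C]_2) : (dxcoord u *: X) i j = X i j * dxcoord u by rewrite mxE mulrC.
  exact: H.
- move=> u u0 /lt[[u1 u2 u3 u4] _ [u9 u10 _ _] _].
  have A1 := A01 u u0 u2; have A2 := A10 u u0 u3; have A3 := A00 u u0 u1; have A4 := A11 u u0 u4.
  split.
  + by rewrite scE.
  + by apply: (mulfI u0); rewrite scE A2 R10.
  + by rewrite !scE mulrBr A3 A4 -(RDE u u10); ring.
- move=> u u0 /lt[_ [u5 u6 u7 u8] [_ _ u11 u12] [u13 _]].
  have A1 := B00 u u0 u5; have A2 := B01 u u0 u6; have A3 := B10 u u0 u7; have A4 := B11 u u0 u8.
  split.
  + by apply: (mulfI u0); rewrite scE mulNr mulrN A1 C00// mulrN.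
  + by rewrite scE mulNr mulrN A2.
  + by apply: (mulfI u0); rewrite scE mulNr mulrN A3 C10// mulrN.
  + by apply: (mulfI u0); rewrite scE mulNr mulrN A4 C11// mulrN.
Qed.

End FrameOde.

(** * Pulling back to the elliptic curve *)

Section Pull.
Variables (R : realType) (lam : R[i]).
Local Notation C := (R[i]).
Local Notation L1 := (P1 R).
Local Notation EC := (ell lam).
Local Notation P := (legendre lam).
Local Notation pi := (@piC R lam).

Lemma legendreE x : P.[x] = x * (x - 1) * (x - lam).
Proof. by rewrite /legendre -polyC1 2!hornerM hornerX !hornerXsubC. Qed.

Lemma deriv_legendreE x : P^`().[x] = (x - 1) * (x - lam) + x * (x - lam) + x * (x - 1).
Proof.
rewrite /legendre -polyC1 !derivM derivX !derivXsubC mul1r !mulr1.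
rewrite [LHS]hornerD !hornerM hornerD hornerX !hornerXsubC.
ring.
Qed.

Lemma legendre_eq0 x : (P.[x] == 0) = (x \in [:: 0; 1; lam]).
Proof. by rewrite legendreE !mulf_eq0 !subr_eq0 !inE orbA. Qed.

Lemma points_Some x y : points (Some (x, y) : pt EC) <-> y ^+ 2 = P.[x].
Proof. by []. Qed.

Lemma sheetsP x y : points (Some (x, y) : pt EC) -> (Some (x, y) : pt EC) \in sheets EC x.
Proof.
move=> /points_Some yP; rewrite !inE /=.
have : (y - sqrtc P.[x]) * (y + sqrtc P.[x]) == 0.
  by rewrite -subr_sqr yP sqr_sqrtc subrr.
rewrite mulf_eq0 subr_eq0 addr_eq0 => /orP[]/eqP->; by rewrite eqxx ?orbT.
Qed.

Lemma sheets_points x q : q \in sheets EC x -> points q /\ pi q = Some x.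
Proof.
rewrite !inE => /orP[]/eqP->; split => //; apply/points_Some; rewrite ?sqrrN sqr_sqrtc//.
Qed.

Lemma off_finite_pull (Q : pt L1 -> Prop) : off_finite Q -> off_finite (fun q : pt EC => Q (pi q)).
Proof.
move=> [s H]; exists (None :: flatten [seq (if p is Some x then sheets EC x else [::]) | p <- s]).
case=> [[x y]|] pq; last by rewrite mem_head.
rewrite in_cons /= => qs; apply: H => //; apply: contra qs => xs.
by apply/flatten_mapP; exists (Some x) => //; exact: sheetsP.
Qed.

Lemma around_pull (Q : pt L1 -> Prop) (p : pt EC) : points p -> around (pi p) Q ->
  around p (fun q => Q (pi q)).
Proof.
case: p => [[a b]|] pp [e /gt0_Re[r r0 ->] H].
  have [b0|b0] := eqVneq b 0.
    exists r%:C; first by rewrite ltcR.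
    case=> [[x y]|//] pq /= [h1 h2] qp; apply: H => //=.
    apply: contra qp => /eqP[xa]; apply/eqP; subst x b.
    move: pp pq => /points_Some pp /points_Some pq.
    have /eqP : y ^+ 2 = 0 by rewrite pq -pp expr0n.
    by rewrite expf_eq0 => /eqP->.
  pose m := Num.min r (normc b).
  have m0 : 0 < m by rewrite lt_min r0 normc_gt0.
  exists m%:C; first by rewrite ltcR.
  case=> [[x y]|//] pq /=; rewrite !ltcRE !lt_min => -[/andP[h1 _] /andP[_ h2]] qp.
  apply: H => //=; first by rewrite ltcRE.
  apply: contra qp => /eqP[xa]; apply/eqP; subst x.
  move: pp pq => /points_Some pp /points_Some pq.
  have : (y - b) * (y + b) == 0 by rewrite -subr_sqr pq pp subrr.
  rewrite mulf_eq0 subr_eq0 addr_eq0 => /orP[/eqP->//|/eqP yb].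
  move: h2; rewrite yb -opprD normcN -[b + b]mulr2n -mulr_natl normcM normcn.
  by move=> h; exfalso; move: h; have := normc_ge0 b; lra.
exists r%:C; first by rewrite ltcR.
by case=> [[x y]|] pq //= h1 qp; apply: H.
Qed.

Lemma del_pull (f : pt L1 -> C) (q : pt EC) : del (fun q => f (pi q)) q = del f (pi q).
Proof. by case: q => [[x y]|]. Qed.

Lemma dbar_pull (f : pt L1 -> C) (q : pt EC) : dbar (fun q => f (pi q)) q = dbar f (pi q).
Proof. by case: q => [[x y]|]. Qed.

Lemma mdel_pull (M : pt L1 -> 'M[C]_2) (q : pt EC) : mdel (fun q => M (pi q)) q = mdel M (pi q).
Proof. by apply/matrixP => i j; rewrite !mxE; exact: (del_pull (fun q => M q i j)). Qed.

Lemma mdbar_pull (M : pt L1 -> 'M[C]_2) (q : pt EC) : mdbar (fun q => M (pi q)) q = mdbar M (pi q).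
Proof. by apply/matrixP => i j; rewrite !mxE; exact: (dbar_pull (fun q => M q i j)). Qed.

Definition unbranched (p : pt EC) := if p is Some (a, b) then b != 0 else false.

Lemma unif_pull p : unbranched p -> forall q, unif p q = unif (pi p) (pi q).
Proof. by case: p => [[a b]|//] b0 [[x y]|//] /=; rewrite (negbTE b0). Qed.

Lemma dxdz_pull p q : unbranched p -> dxdz p q = dxdz (pi p) (pi q).
Proof.
move=> up; rewrite /dxdz -del_pull; congr (_^-1); congr (del _ q).
by apply/funext => q'; exact: unif_pull.
Qed.

Lemma smooth_pull f p : points p -> unbranched p -> smooth_at (pi p) f -> smooth_at p (fun q => f (pi q)).
Proof.
move=> pp up [F [U [oU U0 sF H]]]; exists F, U; split => //.
by apply: around_mono (around_pull pp H) => q _ _; rewrite unif_pull.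
Qed.

End Pull.

Section Smooth0.
Variables (R : realType) (X : curve R).
Local Notation C := (R[i]).

(** The hypothesis on intersections holds on both curves, but not for arbitrary
    families of balls. *)
Lemma smooth_at_eq (p : pt X) (f g : pt X -> C) : around p (fun q => f q = g q) ->
  (forall Q Q', around p Q -> around p Q' -> around p (fun q => Q q /\ Q' q)) ->
  smooth_at p f -> smooth_at p g.
Proof.
move=> fg aand [F [U [oU U0 sF H]]]; exists F, U; split => //.
by apply: around_mono (aand _ _ H fg) => q _ _ [[h1 h2] <-].
Qed.

Lemma smooth_at0 (p : pt X) (f : pt X -> C) : around p (fun q => f q = 0) -> smooth_at p f.
Proof.
move=> f0; exists (fun=> 0), setT; split => //; first exact: openT.
  have s0 : smooth_on setT (fun _ : R * R => 0 : R).
    move=> w; cbv zeta.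
    have -> : foldr (fun b f => if b then pd1 f else pd2 f) (fun _ : R * R => 0 : R) w = fun=> 0.
      elim: w => [//|b w /= ->].
      by case: b; apply/funext => z; rewrite /pd1 /pd2 derive1_cst.
    by move=> z _; split; [exact: cst_continuous|exact: derivable_cst|exact: derivable_cst].
  by split; exact: s0.
by apply: around_mono f0 => q.
Qed.
End Smooth0.

Section Frames.
Variables (R : realType) (X : curve R).
Local Notation C := (R[i]).

Definition swap_mx (z : C) : 'M[C]_2 := \matrix_(i, j) (if (i == 0) && (j == 1) then 1
                                  else if (i == 1) && (j == 0) then z else 0).

Lemma cg_foldr_elem_pos s (F : pconn X) p q : uniq s -> cg (foldr (@elem_pos R X) F s) p q =
  if p \in s then ((unif p q)^-1 *: cg F p q) *m swap_mx (unif p q) else cg F p q.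
Proof.
elim: s => [//|p' s IH]; rewrite cons_uniq => /andP[p's us]; rewrite in_cons.
have -> : foldr (@elem_pos R X) F (p' :: s) = elem_pos p' (foldr (@elem_pos R X) F s) by [].
move: (IH us); set G := foldr _ _ _ => {}IH.
rewrite /elem_pos /elem_neg /twist_point; cbn [cg].
case: (p =P p') => [E|/eqP pp]; first by rewrite eqxx -E IH E (negbTE p's).
by rewrite IH.
Qed.

Lemma invmx_uniq (A B : 'M[C]_2) : A *m B = 1%:M -> invmx A = B.
Proof.
move=> AB; have [uA _] := mulmx1_unit AB.
by rewrite -[B]mul1mx -(mulVmx uA) -mulmxA AB mulmx1.
Qed.

(** The scalars cancel; the swap exchanges the diagonal entries and moves a factor
    [z] between the others. *)
Lemma conj_swap (g M : 'M[C]_2) (c z : C) : c != 0 -> z != 0 -> \det g != 0 ->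
  let K := c *: ((z^-1 *: g) *m swap_mx z) in let N := invmx g *m M *m g in
  let Y := invmx K *m M *m K in
  [/\ Y 0 0 = N 1 1, Y 0 1 = N 1 0 / z, Y 1 0 = z * N 0 1 & Y 1 1 = N 0 0].
Proof.
move=> c0 z0 dg K N Y; have ug : g \in unitmx by rewrite unitmxE unitfE.
pose S' : 'M[C]_2 := \matrix_(i, j) (if (i == 0) && (j == 1) then z^-1
                                  else if (i == 1) && (j == 0) then 1 else 0).
have SS : swap_mx z *m S' = 1%:M.
  by apply: mx2P; rewrite mul2E !mxE /= ?mulfV//; ring.
have iK : invmx K = (c^-1 * z) *: (S' *m invmx g).
  apply: invmx_uniq; rewrite /K -!scalemxAl -scalemxAr !scalerA.
  rewrite -mulmxA (mulmxA (swap_mx z)) SS mul1mx mulmxV//.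
  by rewrite (_ : _ * _ = 1) ?scale1r//; field; rewrite z0 c0.
have YE : Y = S' *m N *m swap_mx z.
  rewrite /Y iK /K -!scalemxAl -!scalemxAr !scalerA /N !mulmxA.
  by rewrite (_ : _ * _ = 1) ?scale1r//; field; rewrite z0 c0.
by rewrite YE; split; rewrite !mul2E !mxE /=; field.
Qed.
End Frames.

(** * Pulling back forms and their primitives *)

Section PullPhi.
Variables (R : realType) (lam : R[i]).
Hypotheses (lam0 : lam != 0) (lam1 : lam != 1).
Local Notation C := (R[i]).
Local Notation L1 := (P1 R).
Local Notation EC := (ell lam).
Local Notation P := (legendre lam).
Local Notation pi := (@piC R lam).
Local Notation W := (Wpts lam).

Lemma ell_ball_mono (p : pt EC) (r r' : R) q : 0 < r -> r <= r' -> ball p r%:C q -> ball p r'%:C q.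
Proof.
move=> r0 rr; case: p => [[a b]|]; case: q => [[x y]|] //=.
  by rewrite !ltcRE => -[h1 h2]; split; [exact: lt_le_trans h1 rr|exact: lt_le_trans h2 rr].
rewrite !normc_real -!fmorphV !ltcR; apply: le_lt_trans.
by rewrite lef_pV2 ?posrE//; exact: lt_le_trans rr.
Qed.

Lemma ell_around_and (p : pt EC) Q Q' : around p Q -> around p Q' -> around p (fun q => Q q /\ Q' q).
Proof.
move=> [e /gt0_Re[r r0 ->] H] [e' /gt0_Re[r' r'0 ->] H'].
have m0 : 0 < Num.min r r' by rewrite lt_min r0.
exists (Num.min r r')%:C; first by rewrite ltcR.
move=> q pq qb qp; split; [apply: H|apply: H'] => //; apply: (ell_ball_mono m0) qb.
  by rewrite ge_min lexx.
by rewrite ge_min lexx orbT.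
Qed.

Lemma ell_around_neq (p r : pt EC) : points p -> points r -> around p (fun q => q != r).
Proof.
move=> pp pr; have [->|rp] := eqVneq r p; first by exists 1.
have [E|npi] := eqVneq (pi r) (pi p).
  case: p r pp pr rp E => [[a b]|] [[x y]|] //= pp pr rp [E]; subst x.
  have yb : 0 < normc (y - b).
    by rewrite normc_gt0 subr_eq0; apply: contra rp => /eqP->.
  exists (normc (y - b))%:C; first by rewrite ltcR.
  by case=> [[x' y']|//] _ [_ h2] _; apply: contraTneq h2 => -[_ ->]; rewrite ltcRE ltxx.
apply: around_mono (around_pull pp (around_neq (pi p) (pi r))) => q _ _.
by apply: contra => /eqP->.
Qed.

Lemma uniq_Wpts : uniq W.
Proof.
rewrite /= !inE !negb_or /= !andbT; apply/andP; split; last first.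
  by apply/eqP => -[/esym/eqP]; rewrite (negbTE lam1).
apply/andP; split; first by apply/eqP => -[/esym/eqP]; rewrite oner_eq0.
by apply/eqP => -[/esym/eqP]; rewrite (negbTE lam0).
Qed.

Lemma W_unbranched p : points p -> p \notin W -> unbranched p.
Proof.
case: p => [[a b]|]; last by rewrite !inE.
move=> /points_Some bP bW /=; apply: contraNneq bW => b0; move: bP; rewrite b0 expr0n /= => /esym/eqP.
by rewrite legendre_eq0 !inE => /or3P[]/eqP->; rewrite eqxx ?orbT.
Qed.

Lemma unbranched_W p : p \in W -> unbranched p = false.
Proof. by rewrite !inE => /or4P[]/eqP-> //=; rewrite eqxx. Qed.

Lemma W_points p : p \in W -> points p.
Proof.
rewrite !inE => /or4P[]/eqP-> //; apply/points_Some; rewrite expr0n legendreE /=; ring.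
Qed.

Lemma W_D (t : C) p : p \in W -> pi p \in D_P1 lam t.
Proof. by rewrite !inE => /or4P[]/eqP->/=; rewrite ?eqxx ?orbT. Qed.

Lemma offW_D (t : C) p : points p -> p \notin W -> p \notin T_C lam t -> pi p \notin D_P1 lam t.
Proof.
move=> pp pW pT; have := W_unbranched pp pW.
case: p pp pW pT => [[a b]|//] pp pW pT /= b0.
apply: contra pT; rewrite !inE /=.
move: (pp) => /points_Some bP.
have a0 : P.[a] != 0 by rewrite -bP expf_neq0.
move: a0; rewrite legendre_eq0 !inE !negb_or => /and3P[a0 a1 al].
case/or4P => [/eqP[E]|/eqP[E]|/eqP[E]|/eqP[E]]; first by rewrite E eqxx in a0.
- by rewrite E eqxx in a1.
- by rewrite E eqxx in al.
subst a; have := sheetsP pp; by rewrite !inE.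
Qed.

Lemma T_pi (t : C) p : p \in T_C lam t -> points p /\ pi p = Some t.
Proof. exact: sheets_points. Qed.

(** ** Frames of the image *)

Variable E : pconn L1.
Local Notation F := (Phi lam E).

Lemma cg_offW p q : p \notin W -> cg F p q = cg E (pi p) (pi q).
Proof.
move=> pW; rewrite /Phi /tensor.
rewrite -[LHS]/(lg (xi0 lam) (pi p) (pi q) *: cg (foldr (@elem_pos R EC) (pullback lam E) W) p q).
rewrite cg_foldr_elem_pos ?uniq_Wpts// (negbTE pW).
by case: p pW => [[a b]|]; rewrite ?scale1r// !inE.
Qed.

Lemma cg_W p q : p \in W -> cg F p q = lg (xi0 lam) (pi p) (pi q) *:
  (((unif p q)^-1 *: cg E (pi p) (pi q)) *m swap_mx (unif p q)).
Proof.
move=> pW; rewrite -[LHS]/(lg (xi0 lam) (pi p) (pi q) *: cg (foldr (@elem_pos R EC) (pullback lam E) W) p q).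
by rewrite cg_foldr_elem_pos ?uniq_Wpts// pW.
Qed.

Lemma nabla10_Phi (M : pt L1 -> 'M[C]_2) (q : pt EC) :
  nabla10 F (fun q => M (pi q)) q = nabla10 E M (pi q).
Proof.
rewrite /nabla10 mdel_pull; congr (_ + _).
rewrite -[cA F q]/(cA E (pi q) + (la (xi0 lam) (pi q))%:M) /comm mulmxDl mulmxDr scalar_mxC.
by rewrite opprD addrACA subrr addr0.
Qed.

Lemma in_frame_offW p (M : pt L1 -> 'M[C]_2) q : p \notin W ->
  in_frame F p (fun q => M (pi q)) q = in_frame E (pi p) M (pi q).
Proof. by move=> pW; rewrite /in_frame cg_offW. Qed.

Lemma msmooth_pull (M : pt L1 -> 'M[C]_2) p : points p -> p \notin W -> msmooth_at (pi p) M ->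
  msmooth_at p (fun q => M (pi q)).
Proof. by move=> pp pW s i j; apply: (smooth_pull (f := fun q => M q i j)) => //; exact: W_unbranched. Qed.

Lemma msmooth_eq (X : curve R) (p : pt X) (M N : pt X -> 'M[C]_2) : around p (fun q => M q = N q) ->
  (forall Q Q', around p Q -> around p Q' -> around p (fun q => Q q /\ Q' q)) ->
  msmooth_at p M -> msmooth_at p N.
Proof.
move=> MN aand s i j; apply: smooth_at_eq (s i j) => //.
by apply: around_mono MN => q _ _ ->.
Qed.

Definition pull_form (a : form1 L1) : form1 EC := (fun q => a.1 (pi q), fun q => a.2 (pi q)).

(** The ramification points lie over marked points, near which the form vanishes;
    elsewhere the local parameter and the frame are those of the line. *)
Lemma closed_cs_pull (t : C) a : closed_cs_form (D_P1 lam t) E a ->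
  closed_cs_form (T_C lam t) F (pull_form a).
Proof.
move=> [sm tr cl cs]; split.
- move=> p pp pT; have [pW|pW] := boolP (p \in W).
    have a0 := around_pull pp (cs _ (W_D t pW)).
    by split=> i j; apply: smooth_at0; apply: around_mono a0 => q _ _ [h1 h2];
      rewrite mxE /in_frame /= ?h1 ?h2 mulmx0 mul0mx mxE mulr0.
  have [s1 s2] := sm (pi p) I (offW_D pp pW pT).
  split.
    have := msmooth_pull pp pW s1; apply: msmooth_eq; last exact: ell_around_and.
    exists 1 => [|q _ _ _]; first exact: ltr01.
    by rewrite (dxdz_pull _ (W_unbranched pp pW)) -(in_frame_offW _ _ pW).
  have := msmooth_pull pp pW s2; apply: msmooth_eq; last exact: ell_around_and.
  exists 1 => [|q _ _ _]; first exact: ltr01.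
  by rewrite (dxdz_pull _ (W_unbranched pp pW)) -(in_frame_offW _ _ pW).
- exact: (@off_finite_pull R lam _ tr).
- have := @off_finite_pull R lam _ cl; apply: off_finite_mono => q _.
  by rewrite nabla10_Phi mdbar_pull.
- move=> p /T_pi[pp pt'].
  apply: (around_pull (Q := fun q => a.1 q = 0 /\ a.2 q = 0) pp); rewrite pt'; apply: cs.
  by rewrite !inE eqxx !orbT.
Qed.

(** At a finite branch point this is the equation of the curve, with [u = x - w] and
    [s = y]; at infinity it is the same equation divided by [x y^2], with [u = 1/x]
    and [s = x/y]. *)
Lemma branch_equation p : p \in W -> exists H1 H2 : {poly C}, [/\ H1.[0] = 0, H1^`().[0] != 0, H2.[0] != 0 &
  forall e rho : R, 0 < e -> 0 < rho -> around p (fun q => let s := unif p q in let u := unif (pi p) (pi q) in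
    [/\ s != 0 /\ lg (xi0 lam) (pi p) (pi q) != 0, normc s < e, normc u < rho, chart (pi p) u = pi q &
        H1.[u] = s ^+ 2 * H2.[u]])].
Proof.
move=> pW; have pp := W_points pW.
have Pnz : off_finite (fun q : pt L1 => if q is Some x then P.[x] != 0 else True).
  apply: poly_off_finite; rewrite /legendre -polyC1 !mulf_neq0 ?polyX_eq0 ?polyXsubC_eq0//.
have aP := around_pull pp (off_finite_around (pi p) Pnz).
case: p pW pp aP => [[a b]|] pW pp aP.
  have b0 : b = 0 by move: (unbranched_W pW) => /= /negbFE/eqP.
  subst b; move: (pp) => /points_Some; rewrite expr0n /= => /esym Pa.
  exists (P \Po ('X + a%:P)), 1.
  have cE u : (P \Po ('X + a%:P)).[u] = P.[u + a].
    by rewrite horner_comp hornerD hornerX hornerC.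
  split; first by rewrite cE add0r.
  - rewrite deriv_comp derivD derivX derivC addr0 mulr1 horner_comp hornerD hornerX hornerC add0r.
    rewrite deriv_legendreE; move/eqP: Pa; rewrite legendre_eq0 !inE => /or3P[]/eqP->.
    + by rewrite !(sub0r, mul0r, addr0) mulrNN mul1r.
    + by rewrite subrr !mul0r add0r mul1r mulr0 addr0 subr_eq0 eq_sym.
    + by rewrite subrr !mulr0 !add0r mulf_neq0// subr_eq0.
  - by rewrite hornerC oner_eq0.
  - move=> e rho e0 rho0; have m0 : 0 < Num.min e rho by rewrite lt_min e0.
    have ab : around (Some (a, 0) : pt EC) (fun q => if q is Some (x, y) then
      normc (x - a) < rho /\ normc y < e else False).
      exists (Num.min e rho)%:C; first by rewrite ltcR.
      by case=> [[x y]|//] _ [/= + +] _; rewrite !ltcRE subr0 !lt_min => /andP[_ ->] /andP[->].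
    apply: around_mono (ell_around_and aP ab) => -[[x y]|]; last by move=> _ _ [_ []].
    move=> /points_Some yP _ [/= xP [h1 h2]]; rewrite eqxx; split => //.
    + by split; [apply: contra xP => /eqP y0; rewrite -yP y0 expr0n|exact: oner_neq0].
    + by rewrite /chart addrC subrK.
    + by rewrite cE subrK hornerC mulr1.
exists 'X, ((1 - 'X) * (1 - lam *: 'X)).
have H2E u : ((1 - 'X) * (1 - lam *: 'X)).[u] = (1 - u) * (1 - lam * u).
  by rewrite hornerM !hornerD !hornerN hornerZ hornerX hornerC.
split; first by rewrite hornerX.
- by rewrite derivX hornerC oner_eq0.
- by rewrite H2E mulr0 subr0 mulr1 oner_eq0.
- move=> e rho e0 rho0.
  pose d := Num.min (Num.min rho 2^-1) (Num.min (2 * normc lam)^-1 (e ^+ 2 / 4)).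
  have nl : 0 < normc lam by rewrite normc_gt0.
  have d0 : 0 < d by rewrite !lt_min rho0 !invr_gt0 ltr0n !mulr_gt0 ?invr_gt0 ?exprn_gt0.
  have ab : around (None : pt EC) (fun q => if q is Some (x, y) then normc x^-1 < d else False).
    exists d%:C; first by rewrite ltcR.
    case=> [[x y]|] _ //=; rewrite normc_real -fmorphV ltcR => h _.
    have x0 : 0 < normc x by apply: lt_trans h; rewrite invr_gt0.
    by rewrite normcV invf_plt ?posrE.
  apply: around_mono (ell_around_and aP ab) => -[[x y]|]; last by [].
  move=> /points_Some yP _ [/= xP].
  rewrite !lt_min => /andP[/andP[u1 u2] /andP[u3 u4]].
  move: (xP); rewrite legendreE !mulf_eq0 !negb_or !subr_eq0 => /andP[/andP[x0 x1] xl].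
  have y0 : y != 0 by apply: contra xP => /eqP y0; rewrite -yP y0 expr0n.
  have eqn : x^-1 = (x / y) ^+ 2 * ((1 - x^-1) * (1 - lam * x^-1)).
    rewrite expr_div_n yP legendreE; field.
    by rewrite x0 !subr_eq0 x1 xl.
  split => //.
  + by rewrite x0 !invr_neq0.
  + have n1 : 2^-1 <= normc (1 - x^-1).
      have := ler_distc 1 x^-1; rewrite normc1; move: (normc _) (normc _) u2 => ? ?; lra.
    have n2 : 2^-1 <= normc (1 - lam * x^-1).
      have := ler_distc 1 (lam * x^-1); rewrite normc1 normcM.
      have : normc lam * normc x^-1 <= 2^-1.
        move: u3; rewrite invfM => u3; apply: le_trans (ler_wpM2l (ltW nl) (ltW u3)) _.
        by rewrite mulrCA mulfV ?gt_eqF// mulr1.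
      move: (_ * _) (normc _) => ? ?; lra.
    move: (x / y) (1 - x^-1) (1 - lam * x^-1) eqn n1 n2 => z z1 z2 eqn n1 n2.
    have := congr1 (@normc R) eqn; rewrite normcM normcX normcM.
    move: (normc z) (normc z1) (normc z2) (normc_ge0 z) n1 n2 => S A B S0 n1 n2 H.
    rewrite -(ltr_pXn2r (n := 2)) ?nnegrE ?(ltW e0)//.
    have AB : 4^-1 <= A * B.
      have -> : 4^-1 = 2^-1 * 2^-1 :> R by rewrite -invfM -natrM.
      by apply: ler_pM.
    have S2 : 0 <= S ^+ 2 by rewrite exprn_ge0.
    have := ler_wpM2l S2 AB; rewrite -H; move: (S ^+ 2) (normc _) (e ^+ 2) u4 => p1 p2 p3; lra.
  + by rewrite /chart invrK.
  + by rewrite hornerX H2E.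
Qed.

(** Smoothness is at stake only at the ramification points, where [frame_removal]
    applies to the repaired primitive. *)
Lemma represents_pull (t nu : C) mu v a :
  t != 0 -> t != 1 -> t != lam -> Con (D_P1 lam t) (nu_P1 t nu) (mu_P1 t mu) E ->
  is_deformation (D_P1 lam t) E v -> closed_cs_form (D_P1 lam t) E a ->
  represents (D_P1 lam t) E v a -> represents (T_C lam t) F (dPhi lam v) (pull_form a).
Proof.
move=> t0 t1 tl [[bg1 bg2 _] _ [rA _ res] _] [[rB rh] _ _ _ resv] [_ _ _ cs] [f [trf smf eqf]].
have infD : (None : pt L1) \in D_P1 lam t by rewrite !inE.
have rg p : mrational (cg E p) by exact: bg1.
have dg (p : pt L1) : off_finite (fun q => \det (cg E p q) != 0) by exact: bg2.
have rh' p : mrational (dh v p) by exact: rh.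
have [R1 R2 R3] := repairP infD rA rB rh' rg dg trf smf eqf.
have Ra p (pD : p \notin D_P1 lam t) := repair_around a infD rh' rg dg smf pD.
set f' := repair E (D_P1 lam t) v a f in R1 R2 R3 Ra.
exists (fun q => f' (pi q)); split.
- exact: (@off_finite_pull R lam _ R1).
- move=> p pp pT; have [pW|pW] := boolP (p \in W); last first.
    have pD := offW_D pp pW pT.
    apply: (msmooth_eq (M := fun q => in_frame E (pi p) (fun q => f q - dh v (pi p) q) (pi q))).
    + apply: around_mono (around_pull pp (Ra _ pD)) => q _ _ fq.
      by rewrite -(in_frame_offW _ _ pW) /in_frame /dPhi /= fq.
    + exact: ell_around_and.
    + by apply: (msmooth_pull (M := in_frame E (pi p) _) pp pW); exact: smf.
  have wD := W_D t pW; set w := pi p in wD.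
  have wt : w != Some t.
    by rewrite /w; move: pW; rewrite !inE => /or4P[]/eqP->//=; apply/eqP => -[/esym/eqP]; apply/negP.
  have flw := around_disc (cs _ wD).
  have odef : around w (fun q : pt L1 => forall x, q = Some x ->
    mrdiff (fun y => f' (Some y)) x (ode_rhs E v (fun y => f' (Some y)) x)).
    apply: around_mono (around_and flw (off_finite_around w R3)) => q _ _ [h1 h2] x qx.
    by apply: h2 => //; exact: h1.
  have logE := res _ wD; rewrite /nu_P1 (negbTE wt) in logE.
  have logv := resv _ wD.
  have [H1 [H2 [H10 dH1 H20 Hloc]]] := branch_equation pW.
  have [e [rho [Fm [e0 rho0 hF HF]]]] := frame_removal rA rB (rh' w) (rg w) (dg w) odef logE logv H10 dH1 H20.
  have dgw := around_pull pp (off_finite_around w (dg w)).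
  have key : around p (fun q => normc (unif p q) < e /\
    forall i j, in_frame F p (fun q => f' (pi q) - dh v w (pi q)) q i j = Fm i j (unif p q)).
    apply: around_mono (ell_around_and dgw (Hloc e rho e0 rho0)) => q _ _ [dq] /=.
    rewrite -/w => -[[s0 l0] se ur uq eqn]; split => //.
    have [F00 F01 F10 F11] := HF _ _ s0 se ur eqn.
    rewrite uq in F00 F01 F10 F11.
    have := conj_swap (f' (pi q) - dh v w (pi q)) l0 s0 dq.
    rewrite -cg_W// => -[Y00 Y01 Y10 Y11].
    by apply: mfall; rewrite ?F00 ?F01 ?F10 ?F11.
  move=> i j; exists (fun z => Fm i j (toC z)), [set z | normc (toC z) < e]; split.
  + have -> : [set z : R * R | normc (toC z) < e] = [set z | [set s : C | normc (s - 0) < e] (toC z)].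
      by apply/funext => z; rewrite /mkset subr0.
    by apply: opened_open; exact: disc_opened.
  + by rewrite /mkset (_ : toC (0, 0) = 0) ?normc0.
  + by apply: holo_smooth.
  + apply: around_mono key => q _ _ [h1 h2]; split; last by rewrite ofCK h2.
    by rewrite /mkset ofCK.
- have := @off_finite_pull R lam _ R2; apply: off_finite_mono => q _ [h1 h2].
  by split; rewrite /= ?nabla10_Phi ?mdbar_pull.
Qed.

End PullPhi.

(** * Continuously differentiable functions on the double cover *)

Section C1.
Variable R : realType.
Local Notation C := (R[i]).
Implicit Types (f g F G : C -> C) (x : C).

Definition ccont f x := forall e : R, 0 < e -> exists2 d : R, 0 < d &
  forall h, normc h < d -> normc (f (x + h) - f x) < e.

Lemma ccont_rdiff f x p q : rdiff f x p q -> ccont f x.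
Proof. by move=> df e e0; exact: rdiff_continuous df e e0. Qed.

Lemma ccont_cst c x : ccont (fun=> c) x.
Proof. by apply: ccont_rdiff; exact: rdiff_cst. Qed.

Lemma ccontD f g x : ccont f x -> ccont g x -> ccont (fun z => f z + g z) x.
Proof.
move=> cf cg e e0; have e2 : 0 < e / 2 by rewrite divr_gt0.
have [d d0 H] := cf _ e2; have [d' d'0 H'] := cg _ e2.
exists (Num.min d d'); first by rewrite lt_min d0.
move=> h; rewrite lt_min => /andP[/H h1 /H' h2].
rewrite opprD addrACA [e]splitr; apply: le_lt_trans (le_normcD _ _) _; exact: ltrD.
Qed.

Lemma ccont_bound f x : ccont f x -> exists2 d : R, 0 < d &
  forall h, normc h < d -> normc (f (x + h)) <= normc (f x) + 1.
Proof.
move=> /(_ 1 ltr01)[d d0 H]; exists d => // h /H h1.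
rewrite -[f (x + h)](subrK (f x)) addrC; apply: le_trans (le_normcD _ _) _.
by rewrite lerD2l ltW.
Qed.

Lemma ccontM f g x : ccont f x -> ccont g x -> ccont (fun z => f z * g z) x.
Proof.
move=> cf cg e e0; have [d1 d10 B] := ccont_bound cf.
set M := normc (f x) + 1 in B; set N := normc (g x) + 1.
have M0 : 0 < M by rewrite ltr_wpDl// normc_ge0.
have N0 : 0 < N by rewrite ltr_wpDl// normc_ge0.
have [d2 d20 H2] := cf (e / 2 / N) ltac:(by rewrite !divr_gt0).
have [d3 d30 H3] := cg (e / 2 / M) ltac:(by rewrite !divr_gt0).
exists (Num.min d1 (Num.min d2 d3)); first by rewrite !lt_min d10 d20.
move=> h; rewrite !lt_min => /and3P[/B h1 /H2 h2 /H3 h3].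
have -> : f (x + h) * g (x + h) - f x * g x = f (x + h) * (g (x + h) - g x) + (f (x + h) - f x) * g x by ring.
rewrite [e]splitr; apply: le_lt_trans (le_normcD _ _) _; rewrite !normcM; apply: ltr_leD.
  apply: (@le_lt_trans _ _ (M * normc (g (x + h) - g x))); first by rewrite ler_wpM2r ?normc_ge0.
  by rewrite mulrC -ltr_pdivlMr.
apply: (@le_trans _ _ (normc (f (x + h) - f x) * N)).
  by rewrite ler_wpM2l ?normc_ge0// lerDl.
by rewrite -ler_pdivlMr// ltW.
Qed.

Lemma ccontJ f x : ccont f x -> ccont (fun z => (f z)^*%C) x.
Proof.
move=> cf e /cf[d d0 H]; exists d => // h /H.
by rewrite -rmorphB normc_conj.
Qed.

Lemma ccont_comp F f x : ccont f x -> ccont F (f x) -> ccont (fun z => F (f z)) x.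
Proof.
move=> cf cF e /cF[d d0 H]; have [d' d'0 H'] := cf _ d0; exists d' => // h /H'/H.
by rewrite [f x + _]addrC subrK.
Qed.

Lemma ccont_near f g x : near_eq x f g -> ccont f x -> ccont g x.
Proof.
move=> [d d0 H] cf e /cf[d' d'0 H']; exists (Num.min d d'); first by rewrite lt_min d0.
move=> h; rewrite lt_min => /andP[h1 /H']; rewrite (H _ h1).
by have := H 0; rewrite normc0 addr0 => ->.
Qed.

(** The increment of F^2 is that of F times a factor that tends to 2 F(x). *)
Lemma rdiff_root F x (g : C) : ccont F x -> F x != 0 -> rdiff (fun z => F z ^+ 2) x g 0 ->
  rdiff F x (g / (2%:R * F x)) 0.
Proof.
move=> cF F0 dF; have n0 : 0 < normc (F x) by rewrite normc_gt0.
have [M M0 [d1 d10 L]] := rdiff_lip dF.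
have [d2 d20 H2] := cF _ n0.
have lip h : normc h < d1 -> normc h < d2 -> normc (F (x + h) - F x) <= M / normc (F x) * normc h.
  move=> /L h1 /H2 h2.
  have s : normc (F x) <= normc (F (x + h) + F x).
    have := ler_distc (2%:R * F x) (F x - F (x + h)); rewrite normcM normcn normcB.
    have -> : 2%:R * F x - (F x - F (x + h)) = F (x + h) + F x by ring.
    move: (normc _) (normc _) (normc _) h2 => p1 p2 p3; lra.
  move: h1; rewrite subr_sqr normcM => h1.
  rewrite mulrAC ler_pdivlMr//; apply: le_trans h1; rewrite ler_wpM2l ?normc_ge0//.
move=> e e0; have e1 : 0 < e * normc (F x) by rewrite mulr_gt0.
have [d3 d30 H3] := dF _ e1.
set K := M / normc (F x) in lip; have K0 : 0 < K by rewrite divr_gt0.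
have [d4 d40 H4] := cF (e * normc (F x) / K) ltac:(by rewrite divr_gt0).
exists (Num.min (Num.min d1 d2) (Num.min d3 d4)); first by rewrite !lt_min d10 d20 d30.
move=> h; rewrite !lt_min => /andP[/andP[h1 h2] /andP[/H3 h3 /H4 h4]].
have {}lip := lip h h1 h2.
move: h3 h4 lip; rewrite !mul0r !addr0.
set a := F (x + h); set b := F x in F0 n0 e1 *; set k := h; move=> h3 h4 lip.
have -> : a - b - g / (2%:R * b) * k = (2%:R * b)^-1 * ((a ^+ 2 - b ^+ 2 - g * k) - (a - b) ^+ 2).
  by field.
rewrite normcM normcV normcM normcn mulrC ler_pdivrMr ?mulr_gt0//.
apply: le_trans (ler_normcB _ _) _.
have : normc ((a - b) ^+ 2) <= e * normc b * normc k.
  rewrite normcX expr2; apply: (@le_trans _ _ (e * normc b / K * (K * normc k))).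
    by apply: ler_pM; rewrite ?normc_ge0// ltW.
  by rewrite mulrA divfK ?gt_eqF.
move: h3; rewrite (_ : e * normc k * (2 * normc b) = e * normc b * normc k + e * normc b * normc k); last by ring.
by move=> h3 h5; exact: lerD.
Qed.

Definition C1at f x := exists2 d : R, 0 < d & exists fp fq : C -> C, forall h, normc h < d ->
  [/\ rdiff f (x + h) (fp (x + h)) (fq (x + h)), ccont fp (x + h) & ccont fq (x + h)].

Lemma C1_ccont f x : C1at f x -> ccont f x.
Proof.
move=> [d d0 [fp [fq H]]]; have [] := H 0; first by rewrite normc0.
by rewrite addr0 => df _ _; exact: ccont_rdiff df.
Qed.

Lemma C1_cst c x : C1at (fun=> c) x.
Proof.
exists 1 => //; exists (fun=> 0), (fun=> 0) => h _; split; first exact: rdiff_cst; exact: ccont_cst.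
Qed.

Lemma C1D f g x : C1at f x -> C1at g x -> C1at (fun z => f z + g z) x.
Proof.
move=> [d d0 [fp [fq H]]] [d' d'0 [gp [gq H']]].
exists (Num.min d d'); first by rewrite lt_min d0.
exists (fun z => fp z + gp z), (fun z => fq z + gq z) => h; rewrite lt_min => /andP[/H[a1 a2 a3] /H'[b1 b2 b3]].
by split; [exact: rdiffD|exact: ccontD|exact: ccontD].
Qed.

Lemma C1M f g x : C1at f x -> C1at g x -> C1at (fun z => f z * g z) x.
Proof.
move=> [d d0 [fp [fq H]]] [d' d'0 [gp [gq H']]].
exists (Num.min d d'); first by rewrite lt_min d0.
exists (fun z => fp z * g z + f z * gp z), (fun z => fq z * g z + f z * gq z) => h.
rewrite lt_min => /andP[/H[a1 a2 a3] /H'[b1 b2 b3]].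
have ca := ccont_rdiff a1; have cb := ccont_rdiff b1.
by split; [exact: rdiffM|apply: ccontD; exact: ccontM|apply: ccontD; exact: ccontM].
Qed.

Lemma C1J f x : C1at f x -> C1at (fun z => (f z)^*%C) x.
Proof.
move=> [d d0 [fp [fq H]]]; exists d => //; exists (fun z => (fq z)^*%C), (fun z => (fp z)^*%C) => h /H[a1 a2 a3].
by split; [exact: rdiffJ|exact: ccontJ|exact: ccontJ].
Qed.

Lemma C1_near f g x : near_eq x f g -> C1at f x -> C1at g x.
Proof.
move=> [d d0 E] [d' d'0 [fp [fq H]]]; exists (Num.min d d'); first by rewrite lt_min d0.
exists fp, fq => h; rewrite lt_min => /andP[h1 /H[a1 a2 a3]]; split => //.
apply: rdiff_near a1; exists (d - normc h); first by rewrite subr_gt0.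
move=> k kd; rewrite -addrA E//; apply: le_lt_trans (le_normcD _ _) _.
by rewrite addrC -ltrBrDr.
Qed.

End C1.

Section Sqrt.
Variable R : realType.
Local Notation C := (R[i]).

Lemma Re_sqrtc (z : C) : 0 <= complex.Re (sqrtc z).
Proof. by case: z => a b; rewrite /sqrtc /= sqrtr_ge0. Qed.

(** The factor [sqrtc z + 1] of [z - 1] has norm at least 1, the real part of the
    principal root being nonnegative. *)
Lemma sqrtc_near1 (z : C) : normc (sqrtc z - 1) <= normc (z - 1).
Proof.
have h : 1 <= normc (sqrtc z + 1).
  apply: le_trans (Re_le _); apply: le_trans (ler_norm _); rewrite ReD /=.
  by have := Re_sqrtc z; lra.
have -> : z - 1 = (sqrtc z - 1) * (sqrtc z + 1) by rewrite -subr_sqr sqr_sqrtc expr1n.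
by rewrite normcM ler_peMr ?normc_ge0.
Qed.

Lemma sqr_uniq (a b c : C) : a ^+ 2 = b ^+ 2 -> normc (a - c) < normc c -> normc (b - c) < normc c -> a = b.
Proof.
move=> E h1 h2; have : (a - b) * (a + b) == 0 by rewrite -subr_sqr E subrr.
rewrite mulf_eq0 subr_eq0 addr_eq0 => /orP[/eqP//|/eqP ab].
exfalso; have := le_normcD (a - c) (b - c).
have -> : a - c + (b - c) = - (2%:R * c) by rewrite ab; ring.
rewrite normcN normcM normcn; move: (normc _) (normc _) (normc _) h1 h2 => x y z; lra.
Qed.
End Sqrt.

Section Lift.
Variables (R : realType) (lam : R[i]).
Local Notation C := (R[i]).
Local Notation L1 := (P1 R).
Local Notation EC := (ell lam).
Local Notation P := (legendre lam).
Local Notation pi := (@piC R lam).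
Local Notation W := (Wpts lam).
Implicit Types (p q : pt EC) (f g : pt EC -> C).

(** The branch of the square root of [P] that [lift] follows. *)
Definition ybr (x y u : C) : C := y * sqrtc (P.[x + u] / P.[x]).

Lemma liftE x y u : lift (Some (x, y) : pt EC) u = Some (x + u, ybr x y u).
Proof. by []. Qed.

Lemma ybr_sqr x y u : y ^+ 2 = P.[x] -> y != 0 -> ybr x y u ^+ 2 = P.[x + u].
Proof.
move=> yP y0; rewrite /ybr exprMn sqr_sqrtc yP mulrCA mulfV ?mulr1//.
by rewrite -yP expf_neq0.
Qed.

Lemma ybr0 x y : y ^+ 2 = P.[x] -> y != 0 -> ybr x y 0 = y.
Proof. by move=> yP y0; rewrite /ybr addr0 divff -?yP ?expf_neq0// sqrtc1 mulr1. Qed.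

Lemma ybr_near x y u : y ^+ 2 = P.[x] -> y != 0 -> normc (ybr x y u - y) * normc y <= normc (P.[x + u] - P.[x]).
Proof.
move=> yP y0; have P0 : P.[x] != 0 by rewrite -yP expf_neq0.
have -> : ybr x y u - y = y * (sqrtc (P.[x + u] / P.[x]) - 1) by rewrite /ybr; ring.
have -> : P.[x + u] - P.[x] = y ^+ 2 * (P.[x + u] / P.[x] - 1) by rewrite yP; field.
rewrite normcM [X in _ <= X]normcM expr2 [X in _ <= X * _]normcM mulrAC ler_wpM2l ?sqrtc_near1//.
by rewrite mulr_ge0 ?normc_ge0.
Qed.

(** The principal root is discontinuous, but two numbers with the same square that
    are close to the same nonzero number agree ([sqr_uniq]).  So the branch is
    continuous near [u = 0], and restarting it at [x + u] gives the same branch. *)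
Lemma ybr_local x y : y ^+ 2 = P.[x] -> y != 0 -> exists2 d : R, 0 < d & forall u, normc u < d ->
  [/\ normc (ybr x y u - y) < normc y, ybr x y u != 0, rdiff (ybr x y) u (P^`().[x + u] / (2%:R * ybr x y u)) 0 &
   near_eq 0 (fun h => ybr x y (u + h)) (fun h => ybr (x + u) (ybr x y u) h)].
Proof.
move=> yP y0; have n0 : 0 < normc y by rewrite normc_gt0.
have sq u := ybr_sqr u yP y0.
have [d d0 H] := rdiff_continuous (rdiff_poly P x) (mulr_gt0 n0 (divr_gt0 n0 (ltr0n R 2))).
have near u : normc u < d -> normc (ybr x y u - y) < normc y / 2.
  by move=> /H h; have := ybr_near u yP y0; rewrite -(ltr_pM2r n0) [X in _ -> _ < X]mulrC => h'; exact: le_lt_trans h.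
have lt2 u : normc (ybr x y u - y) < normc y / 2 -> normc (ybr x y u - y) < normc y.
  move=> h; apply: lt_trans h _; rewrite ltr_pdivrMr// ltr_pMr// ltr1n//.
have nz u : normc u < d -> ybr x y u != 0.
  by move=> /near/lt2; apply: contraTneq => ->; rewrite sub0r normcN ltxx.
have ce u : normc u < d -> ccont (ybr x y) u.
  move=> ud e e0; have [d' d'0 H'] := rdiff_continuous (rdiff_poly P (x + u)) (mulr_gt0 e0 n0).
  exists (Num.min d' (d - normc u)); first by rewrite lt_min d'0 subr_gt0.
  move=> h; rewrite lt_min => /andP[/H' h1 h2].
  have uh : normc (u + h) < d by apply: le_lt_trans (le_normcD _ _) _; rewrite addrC -ltrBrDr.
  have := near _ uh; have := near _ ud.
  move: h1; rewrite -addrA -!sq subr_sqr normcM.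
  set a := ybr x y (u + h); set b := ybr x y u => h1 h3 h4.
  have s : normc y <= normc (a + b).
    have := ler_distc (2%:R * y) (y - a + (y - b)); rewrite normcM normcn.
    have -> : 2%:R * y - (y - a + (y - b)) = a + b by ring.
    have := le_normcD (y - a) (y - b); rewrite !(normcB y).
    move: (normc _) (normc (a - y)) (normc (b - y)) h3 h4 => p1 p2 p3 h3 h4.
    move: (normc (_ + _)) (normc (_ + _)) => p4 p5; lra.
  rewrite -(ltr_pM2r n0); apply: le_lt_trans h1; by apply: ler_wpM2l s; exact: normc_ge0.
exists d => // u ud; split; [exact: lt2 (near _ ud)|exact: nz| |].
  apply: rdiff_root; [exact: ce|exact: nz|].
  have e1 : near_eq u (fun z => P.[x + z]) (fun z => ybr x y z ^+ 2) by exists 1 => // h _; rewrite sq.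
  apply: rdiff_near e1 _.
  apply: rdiff_eqpq (rdiff_holcomp (F := fun z => x + z) _ (rdiff_poly P (x + u))); [exact: mulr1|by []|].
  by rewrite -[1]add0r -[0 in X in rdiff _ _ _ X]addr0; exact: rdiffD (rdiff_cst x u) (rdiff_id u).
have un := nz _ ud; set b := ybr x y u in un *; have bP : b ^+ 2 = P.[x + u] by exact: sq.
have nb : 0 < normc b by rewrite normc_gt0.
have [d1 d10 H1] := ce _ ud _ nb.
have [d2 d20 H2] := rdiff_continuous (rdiff_poly P (x + u)) (mulr_gt0 nb nb).
exists (Num.min d1 d2); first by rewrite lt_min d10.
move=> h; rewrite lt_min add0r => /andP[/H1 h1 /H2 h2]; apply: (@sqr_uniq _ _ _ b) => //.
  by rewrite sq ybr_sqr// addrA.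
by have := ybr_near h bP un; rewrite -(ltr_pM2r nb) => h3; exact: le_lt_trans h3 h2.
Qed.

Lemma around_unbranched p : points p -> around p (fun q => unbranched q).
Proof.
move=> pp; have a w : w \in W -> around p (fun q => q != w) by move=> /W_points; exact: ell_around_neq.
have := ell_around_and (ell_around_and (a (Some (0, 0)) _) (a (Some (1, 0)) _))
  (ell_around_and (a (Some (lam, 0)) _) (a None _)).
rewrite !inE !eqxx ?orbT => /(_ isT isT isT isT).
apply: around_mono => q pq _ [[h1 h2] [h3 h4]]; apply: W_unbranched => //.
by rewrite !inE !negb_or h1 h2 h3 h4.
Qed.

(** Punctured neighbourhoods are open for the motion along the x-coordinate.
    Through this, equalities that hold around [p] can be differentiated at the
    points near [p]. *)
Lemma around_lift p Q : points p -> around p Q -> around p (fun q => Q q /\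
  exists2 d : R, 0 < d & forall u, normc u < d -> Q (lift q u)).
Proof.
move=> pp aQ.
have aW := around_unbranched pp.
move: aQ => [e /gt0_Re[r r0 ->] HQ].
have aB : around p (fun q => ball p r%:C q /\ q != p) by exists r%:C; rewrite ?ltcR.
apply: around_mono (ell_around_and aW aB) => -[[x y]|]; last by move=> _ _ [].
move=> pq qp [/= y0 [qb _]]; split; first exact: HQ.
move: (pq) => /points_Some yP.
have [d d0 He] := ybr_local yP y0.
have [d1 d10 H1] : exists2 d1 : R, 0 < d1 & forall u, normc u < d1 -> lift (Some (x, y) : pt EC) u != p.
  have [xp|xp] := eqVneq (pi p) (Some x).
    case: (p) qp xp {HQ qb aW pp} => [[a b]|//] qp [E]; subst a.
    have yb : 0 < normc (y - b) by rewrite normc_gt0 subr_eq0; apply: contra qp => /eqP->.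
    have [_ _ dy _] := He 0 ltac:(by rewrite normc0).
    have [d1 d10 H1] := rdiff_continuous dy yb.
    exists d1 => // u /H1; rewrite add0r ybr0// liftE => h; apply/eqP => -[_ E].
    by move: h; rewrite E normcB ltxx.
  case: (p) xp {HQ qb aW pp qp} => [[a b]|] xp; last by exists 1.
  have xa : 0 < normc (a - x) by rewrite normc_gt0 subr_eq0; apply: contra xp => /eqP->.
  exists (normc (a - x)) => // u; rewrite liftE; apply: contraTN => /eqP[<- _].
  by rewrite addrC addKr ltxx.
have [d2 d20 H2] : exists2 d2 : R, 0 < d2 & forall u, normc u < d2 -> ball p r%:C (lift (Some (x, y) : pt EC) u).
  have [_ _ dy _] := He 0 ltac:(by rewrite normc0).
  case: (p) qb {H1 qp pp HQ aW} => [[a b]|] /=.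
    rewrite !ltcRE => -[h1 h2].
    have [d1' d1'0 H1'] := rdiff_continuous dy (e := r - normc (y - b)) ltac:(by rewrite subr_gt0).
    exists (Num.min d1' (r - normc (x - a))); first by rewrite lt_min d1'0 subr_gt0.
    move=> u; rewrite lt_min !ltcRE => /andP[/H1' + k2]; rewrite add0r ybr0// => k1; split.
      rewrite (_ : x + u - a = u + (x - a)); last by ring.
      by apply: le_lt_trans (le_normcD _ _) _; rewrite -ltrBrDr.
    rewrite -/(ybr x y u) (_ : ybr x y u - b = (ybr x y u - y) + (y - b)); last by ring.
    by apply: le_lt_trans (le_normcD _ _) _; rewrite -ltrBrDr.
  rewrite normc_real -fmorphV ltcR => h1.
  exists (normc x - r^-1); first by rewrite subr_gt0.
  move=> u h2; rewrite normc_real ltcR; apply: lt_le_trans (_ : normc x - normc u <= _).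
    by rewrite ltrBrDr addrC -ltrBrDr.
  by have := ler_distc x (- u); rewrite normcN opprK.
exists (Num.min d1 d2); first by rewrite lt_min d10.
move=> u; rewrite lt_min => /andP[/H1 u1 /H2 u2]; apply: HQ => //.
by apply/points_Some; exact: (ybr_sqr u yP y0).
Qed.

End Lift.

(** * Functions of the local parameter *)

Section Good.
Variables (R : realType) (lam : R[i]).
Hypotheses (lam0 : lam != 0) (lam1 : lam != 1).
Local Notation C := (R[i]).
Local Notation L1 := (P1 R).
Local Notation EC := (ell lam).
Local Notation P := (legendre lam).
Local Notation pi := (@piC R lam).
Local Notation W := (Wpts lam).
Implicit Types (p q : pt EC) (f g : pt EC -> C).

Definition lf f q (u : C) := f (lift q u).

Lemma del_lf f q (a b : C) : rdiff (lf f q) 0 a b -> del f q = a /\ dbar f q = b.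
Proof.
move=> df; have [h1 h2] := rdiff_wirtinger df.
have e : (fun u : R * R => lf f q (0 + toC u)) = fun u => f (lift q (toC u)).
  by apply/funext => u; rewrite add0r.
by rewrite e in h1 h2.
Qed.

Lemma lift_shift p Q : points p -> around p Q -> around p (fun q => Q q /\
  exists2 d : R, 0 < d & forall h, normc h < d -> Q (lift q h) /\
    exists2 d' : R, 0 < d' & forall u, normc u < d' -> lift q (h + u) = lift (lift q h) u).
Proof.
move=> pp aQ; have aU := around_unbranched pp.
apply: around_mono (ell_around_and aU (around_lift pp aQ)) => -[[x y]|]; last by move=> _ _ [].
move=> /points_Some yP _ [/= y0 [Qq [d d0 H]]]; split => //.
have [d' d'0 H'] := ybr_local yP y0.
exists (Num.min d d'); first by rewrite lt_min d0.
move=> h; rewrite lt_min => /andP[/H Qh /H'[_ _ _ [d2 d20 E]]]; split => //.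
exists d2 => // u ud2; have := E u; rewrite !add0r => Eu; congr Some; congr pair; first by rewrite addrA.
exact: Eu.
Qed.

Lemma C1_around p f A B : points p ->
  around p (fun q => [/\ rdiff (lf f q) 0 (A q) (B q), ccont (lf A q) 0 & ccont (lf B q) 0]) ->
  around p (fun q => [/\ C1at (lf f q) 0, del f q = A q & dbar f q = B q]).
Proof.
move=> pp /(lift_shift pp); apply: around_mono => q pq _ [[df cA' cB] [d d0 H]].
have [-> ->] := del_lf df; split => //.
exists d => //; exists (lf A q), (lf B q) => h /H[[df' cA'' cB'']].
move=> [d' d'0 E]; rewrite !add0r.
have sh f' : near_eq 0 (lf f' (lift q h)) (fun u => lf f' q (h + u)).
  by exists d' => // u /E; rewrite /lf !add0r => <-.
split.
- move=> e e0; have := rdiff_near (sh f) df'; move=> /(_ e e0)[d2 d20 H2].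
  by exists d2 => // k /H2; rewrite !add0r addr0.
- move=> e e0; have := ccont_near (sh A) cA''; move=> /(_ e e0)[d2 d20 H2].
  by exists d2 => // k /H2; rewrite !add0r addr0.
- move=> e e0; have := ccont_near (sh B) cB''; move=> /(_ e e0)[d2 d20 H2].
  by exists d2 => // k /H2; rewrite !add0r addr0.
Qed.

(** ** Derivatives of the local parameters *)

(** The first and, below, the second derivative of the local parameter at [p] with
    respect to [x]. *)
Definition psi1 p q : C := match q, p with
  | Some (x, y), None => (2%:R * P.[x] - x * P^`().[x]) / (2%:R * y ^+ 3)
  | Some (x, y), Some (a, b) => if b == 0 then P^`().[x] / (2%:R * y) else 1
  | None, _ => 0
  end.

Definition psi2 p q : C := match q, p with
  | Some (x, y), None => - (2%:R * P^`().[x] + x * P^`()^`().[x]) / (2%:R * y ^+ 3)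
      + 3%:R * x * P^`().[x] ^+ 2 / (4%:R * y ^+ 5)
  | Some (x, y), Some (a, b) => if b == 0 then P^`()^`().[x] / (2%:R * y) - P^`().[x] ^+ 2 / (4%:R * y ^+ 3) else 0
  | None, _ => 0
  end.

Lemma rdiff_shift x : rdiff (fun u : C => x + u) 0 1 0.
Proof. by rewrite -[1]add0r -[0 in X in rdiff _ _ _ X]addr0; exact: rdiffD (rdiff_cst x 0) (rdiff_id 0). Qed.

Lemma rdiff_polyshift (Q : {poly C}) x : rdiff (fun u => Q.[x + u]) 0 Q^`().[x] 0.
Proof.
have H : rdiff (fun z => Q.[z]) (x + 0) Q^`().[x] 0 by rewrite addr0; exact: rdiff_poly.
by have := rdiff_holcomp (rdiff_shift x) H; rewrite mulr1.
Qed.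

Lemma rdiffMh F G (x p q : C) : rdiff F x p 0 -> rdiff G x q 0 -> rdiff (fun z => F z * G z) x (p * G x + F x * q) 0.
Proof. by move=> dF dG; apply: rdiff_eqpq (rdiffM dF dG) => //; rewrite mul0r mulr0 addr0. Qed.

Lemma rdiffDh F G (x p q : C) : rdiff F x p 0 -> rdiff G x q 0 -> rdiff (fun z => F z + G z) x (p + q) 0.
Proof. by move=> dF dG; apply: rdiff_eqpq (rdiffD dF dG) => //; rewrite addr0. Qed.

Lemma rdiffZh (c : C) F (x p : C) : rdiff F x p 0 -> rdiff (fun z => c * F z) x (c * p) 0.
Proof. by move=> dF; apply: rdiff_eqpq (rdiffZ c dF) => //; rewrite mulr0. Qed.

Lemma psi_rdiff p q : points q -> unbranched q ->
  rdiff (lf (unif p) q) 0 (psi1 p q) 0 /\ rdiff (lf (psi1 p) q) 0 (psi2 p q) 0.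
Proof.
case: q => [[x y]|//] /points_Some yP /= y0.
have [d d0 /(_ 0)] := ybr_local yP y0; rewrite normc0 addr0 ybr0// => /(_ d0)[_ _ de _].
have e0 := ybr0 yP y0; set Y := ybr lam x y in de e0 *.
have di : rdiff (fun u => (Y u)^-1) 0 (- (P^`().[x] / (2%:R * y)) / y ^+ 2) 0.
  by have := rdiffV (F := Y) _ de; rewrite e0; apply.
have dx := rdiff_shift x.
have dP := rdiff_polyshift P x; have dP' := rdiff_polyshift P^`() x.
have di2 := rdiffMh di di; have di3 := rdiffMh di di2.
have val F G (a b : C) : rdiff F 0 a 0 -> (forall u, F u = G u) -> a = b -> rdiff G 0 b 0.
  by move=> dF E <-; exact: rdiff_ext dF.
case: p => [[a b]|].
  have [b0|b0] := eqVneq b 0.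
    rewrite /lf /= b0 eqxx; split; first exact: de.
    apply: (val _ _ _ _ (rdiffZh 2%:R^-1 (rdiffMh dP' di))) => [u|].
      change (2%:R^-1 * (P^`().[x + u] / Y u) = P^`().[x + u] / (2%:R * Y u)).
      by rewrite mulrCA [(2%:R * Y u)^-1]invfM.
    by rewrite e0 addr0; field.
  rewrite /lf /= (negbTE b0); split; last exact: rdiff_cst.
  apply: (val _ _ _ _ (rdiffDh (rdiff_cst (- a) 0) dx)) => [u|]; last by rewrite add0r.
  by rewrite addrC.
split.
  apply: (val _ _ _ _ (rdiffMh dx di)) => [u|]; first by [].
  by rewrite e0 addr0 -yP; field.
have dN := rdiffDh (rdiffZh 2%:R dP) (rdiffZh (-1) (rdiffMh dx dP')).
apply: (val _ _ _ _ (rdiffZh 2%:R^-1 (rdiffMh dN di3))) => [u|].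
  change (2%:R^-1 * ((2%:R * P.[x + u] + -1 * ((x + u) * P^`().[x + u])) * ((Y u)^-1 * ((Y u)^-1 * (Y u)^-1))) =
    (2%:R * P.[x + u] - (x + u) * P^`().[x + u]) / (2%:R * Y u ^+ 3)).
  by rewrite [(2%:R * Y u ^+ 3)^-1]invfM -exprVn; move: (Y u)^-1 (2%:R^-1) => i j; ring.
by rewrite e0 !addr0 -yP; field.
Qed.

Lemma dxdz_psi p q : points q -> unbranched q -> dxdz p q = (psi1 p q)^-1.
Proof. by move=> pq uq; have [d _] := psi_rdiff p pq uq; rewrite /dxdz (del_lf d).1. Qed.

Lemma unif_small p (e : R) : points p -> 0 < e -> around p (fun q => normc (unif p q) < e).
Proof.
move=> pp e0; have [pW|pW] := boolP (p \in W).
  have [H1 [H2 [_ _ _ H]]] := branch_equation lam0 lam1 pW.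
  by apply: around_mono (H e 1 e0 ltr01) => q _ _ [].
have := W_unbranched pp pW; case: p pp pW => [[a b]|//] pp pW /= b0.
exists e%:C; first by rewrite ltcR.
by case=> [[x y]|//] _ /= [+ _] _; rewrite (negbTE b0) ltcRE.
Qed.

(** ** Functions that are smooth in the local parameter *)

(** What is used of smoothness at [p]: continuous differentiability in [x], with
    derivatives at most of the order of that of the local parameter.  These
    properties are stable under sums, products and conjugation. *)
Definition good p f := exists K : R, around p (fun q => [/\ C1at (lf f q) 0, normc (f q) <= K,
  normc (del f q) <= K * normc (psi1 p q) & normc (dbar f q) <= K * normc (psi1 p q)]).

Lemma good_ge0 p f (pp : points p) : good p f -> exists2 K : R, 0 <= K & around p (fun q => [/\ C1at (lf f q) 0, normc (f q) <= K,
  normc (del f q) <= K * normc (psi1 p q) & normc (dbar f q) <= K * normc (psi1 p q)]).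
Proof.
move=> [K H]; exists (Num.max K 0); first by rewrite le_max lexx orbT.
have KK : K <= Num.max K 0 by rewrite le_max lexx.
apply: around_mono H => q _ _ [h1 h2 h3 h4]; split => //.
- exact: le_trans h2 KK.
- by apply: le_trans h3 _; rewrite ler_wpM2r ?normc_ge0.
- by apply: le_trans h4 _; rewrite ler_wpM2r ?normc_ge0.
Qed.

Lemma C1_rdiff (F : C -> C) x : C1at F x -> exists a b, rdiff F x a b.
Proof.
by move=> [d d0 [fp [fq /(_ 0)]]]; rewrite normc0 addr0 => /(_ d0)[df _ _]; exists (fp x), (fq x).
Qed.

Lemma lf_rdiff f q : C1at (lf f q) 0 -> rdiff (lf f q) 0 (del f q) (dbar f q).
Proof. by move=> /C1_rdiff[a [b df]]; have [-> ->] := del_lf df. Qed.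

Lemma lf0 f q : points q -> unbranched q -> lf f q 0 = f q.
Proof.
case: q => [[x y]|//] /points_Some yP /= y0; rewrite /lf liftE.
by rewrite addr0 (ybr0 yP y0).
Qed.

Lemma goodD p f g : points p -> good p f -> good p g -> good p (fun q => f q + g q).
Proof.
move=> pp [K H] [K' H']; exists (K + K').
apply: around_mono (ell_around_and H H') => q _ _ [[c1 b1 d1 e1] [c2 b2 d2 e2]].
have [-> ->] := del_lf (f := fun q => f q + g q) (rdiffD (lf_rdiff c1) (lf_rdiff c2)).
split; first exact: C1D.
- by apply: le_trans (le_normcD _ _) _; exact: lerD.
- by apply: le_trans (le_normcD _ _) _; rewrite mulrDl; exact: lerD.
- by apply: le_trans (le_normcD _ _) _; rewrite mulrDl; exact: lerD.
Qed.

Lemma goodM p f g : points p -> good p f -> good p g -> good p (fun q => f q * g q).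
Proof.
move=> pp /(good_ge0 pp)[K K0 H] /(good_ge0 pp)[K' K'0 H']; exists (Num.max (K * K') (K * K' + K * K')).
apply: around_mono (ell_around_and (around_unbranched pp) (ell_around_and H H')) => q pq _ [uq [[c1 b1 d1 e1] [c2 b2 d2 e2]]].
have [-> ->] := del_lf (f := fun q => f q * g q) (rdiffM (lf_rdiff c1) (lf_rdiff c2)).
rewrite !lf0//; set m := Num.max _ _.
have m1 : K * K' <= m by rewrite le_max lexx.
have m2 : K * K' + K * K' <= m by rewrite le_max lexx orbT.
have s0 := normc_ge0 (psi1 p q).
have bd (a b c d : C) : normc a <= K * normc (psi1 p q) -> normc b <= K' -> normc c <= K -> normc d <= K' * normc (psi1 p q) ->
    normc (a * b + c * d) <= m * normc (psi1 p q).
  move=> h1 h2 h3 h4; apply: le_trans (le_normcD _ _) _; rewrite !normcM.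
  apply: (@le_trans _ _ ((K * K' + K * K') * normc (psi1 p q))); last by rewrite ler_wpM2r.
  rewrite mulrDl; apply: lerD.
    by rewrite mulrAC; apply: ler_pM; rewrite ?normc_ge0.
  by rewrite -mulrA; apply: ler_pM; rewrite ?normc_ge0.
split; [exact: C1M| |exact: bd|exact: bd].
by rewrite normcM; apply: le_trans m1; apply: ler_pM; rewrite ?normc_ge0.
Qed.

Lemma goodJ p f : points p -> good p f -> good p (fun q => (f q)^*%C).
Proof.
move=> pp [K H]; exists K; apply: around_mono H => q _ _ [c1 b1 d1 e1].
have [-> ->] := del_lf (f := fun q => (f q)^*%C) (rdiffJ (lf_rdiff c1)).
by rewrite !normc_conj; split => //; exact: C1J.
Qed.

Lemma good_eq p f g : points p -> around p (fun q => f q = g q) -> good p f -> good p g.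
Proof.
move=> pp fg [K H]; exists K.
apply: around_mono (ell_around_and (around_lift pp fg) H) => q _ _ [[E [d d0 Ed]] [c1 b1 d1 e1]].
have ne : near_eq 0 (lf f q) (lf g q) by exists d => // u /Ed; rewrite /lf !add0r.
have [D1 D2] := del_lf (rdiff_near ne (lf_rdiff c1)).
by rewrite D1 D2 -E; split => //; exact: C1_near ne c1.
Qed.

Lemma good_cst p c : points p -> good p (fun=> c).
Proof.
move=> pp; exists (normc c); exists 1 => // q _ _ _.
have [-> ->] := del_lf (f := fun=> c) (q := q) (rdiff_cst c 0).
by rewrite normc0 lexx mulr_ge0 ?normc_ge0//; split => //; exact: C1_cst.
Qed.

Lemma ccont_real (u : R * R -> R) (z : C) : {for ofC z, continuous u} -> ccont (fun z => (u (ofC z))%:C) z.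
Proof.
move=> /cvgrPdist_lt cu e e0; have /nbhs_ballP[d /= d0 H] := cu e e0.
have key h : normc h < d -> `|u (ofC (z + h)) - u (ofC z)| < e.
  move=> hd; rewrite distrC; apply: H; split; rewrite -ball_normE /=;
    case: z h hd {cu} => a b [c k] hd; rewrite opprD addNKr normrN.
    exact: le_lt_trans (Re_le _) hd.
  exact: le_lt_trans (Im_le _) hd.
by exists d => // h /key; rewrite subrr expr0n addr0 sqrtr_sqr.
Qed.

Lemma ccont_csmooth (F : R * R -> C) U z : open U -> U (ofC z) -> csmooth_on U F ->
  ccont (fun x => (cpd1 F (ofC x) - 'i * cpd2 F (ofC x)) / 2%:R) z /\
  ccont (fun x => (cpd1 F (ofC x) + 'i * cpd2 F (ofC x)) / 2%:R) z.
Proof.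
move=> oU Uz [s1 s2].
have cpl (u v : R * R -> R) : {for ofC z, continuous u} -> {for ofC z, continuous v} ->
    ccont (fun x => u (ofC x) +i* v (ofC x)) z.
  move=> cu cv; have := ccontD (ccont_real cu) (ccontM (ccont_cst 'i%C z) (ccont_real cv)).
  suff -> : (fun x => (u (ofC x))%:C + 'i%C * (v (ofC x))%:C) = fun x => u (ofC x) +i* v (ofC x) by [].
  by apply/funext => x; simpc.
have c1 : ccont (fun x => cpd1 F (ofC x)) z.
  have [a1 _ _] := s1 [:: true] _ Uz; have [a2 _ _] := s2 [:: true] _ Uz.
  exact: (cpl (pd1 (fun a => complex.Re (F a))) (pd1 (fun a => complex.Im (F a))) a1 a2).
have c2 : ccont (fun x => cpd2 F (ofC x)) z.
  have [a1 _ _] := s1 [:: false] _ Uz; have [a2 _ _] := s2 [:: false] _ Uz.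
  exact: (cpl (pd2 (fun a => complex.Re (F a))) (pd2 (fun a => complex.Im (F a))) a1 a2).
have ci := ccontM (ccont_cst ('i : C) z) c2.
split; apply: ccontM (ccont_cst _ z); apply: ccontD => //.
have := ccontM (ccont_cst (-1 : C) z) ci.
by apply: ccont_near; exists 1 => // h _; rewrite mulN1r.
Qed.

Lemma smooth_good p f : points p -> smooth_at p f -> good p f.
Proof.
move=> pp [F [U [oU U0 sF aF]]].
pose Fc z := F (ofC z); pose Fp z := (cpd1 F (ofC z) - 'i * cpd2 F (ofC z)) / 2%:R.
pose Fq z := (cpd1 F (ofC z) + 'i * cpd2 F (ofC z)) / 2%:R.
have dF z : U (ofC z) -> rdiff Fc z (Fp z) (Fq z) by move=> Uz; exact: csmooth_rdiff Uz sF.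
have cF z : U (ofC z) -> ccont Fp z /\ ccont Fq z by move=> Uz; exact: ccont_csmooth Uz sF.
have [d1 d10 B1] := ccont_bound (ccont_rdiff (dF 0 U0)).
have [d2 d20 B2] := ccont_bound (cF 0 U0).1; have [d3 d30 B3] := ccont_bound (cF 0 U0).2.
set K1 := normc (Fc 0) + 1 in B1; set K2 := normc (Fp 0) + 1 in B2; set K3 := normc (Fq 0) + 1 in B3.
pose K := Num.max K1 (Num.max K2 K3).
have k1 : K1 <= K by rewrite le_max lexx.
have k2 : K2 <= K by rewrite !le_max lexx orbT.
have k3 : K3 <= K by rewrite !le_max lexx !orbT.
exists K; pose d := Num.min d1 (Num.min d2 d3).
have d0 : 0 < d by rewrite !lt_min d10 d20.
pose A q := Fp (unif p q) * psi1 p q; pose B q := Fq (unif p q) * (psi1 p q)^*%C.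
have key : around p (fun q => [/\ rdiff (lf f q) 0 (A q) (B q), ccont (lf A q) 0 & ccont (lf B q) 0]).
  apply: around_mono (ell_around_and (around_unbranched pp) (around_lift pp aF)) => q pq _ [uq [[Uq fq] [e e0 H]]].
  have [du ds] := psi_rdiff p pq uq.
  have u0 : lf (unif p) q 0 = unif p q by rewrite lf0.
  have du' := dF _ Uq; have [cp cq] := cF _ Uq.
  have cu := ccont_rdiff du; have cs := ccont_rdiff ds.
  split.
  - have ne : near_eq 0 (fun u => Fc (lf (unif p) q u)) (lf f q).
      by exists e => // u /H[_]; rewrite /lf !add0r => ->.
    apply: rdiff_near ne _; rewrite -u0 in du'.
    apply: rdiff_eqpq (rdiff_comp du du'); rewrite /A /B u0 ?mulr0 ?add0r//.
    by rewrite conjc0 mulr0 addr0.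
  - by apply: ccontM cs; apply: (ccont_comp cu); rewrite u0.
  - by apply: ccontM (ccontJ cs); apply: (ccont_comp cu); rewrite u0.
have ub := unif_small pp d0.
apply: around_mono (ell_around_and (ell_around_and ub aF) (C1_around pp key)) => q pq _ [[qd [_ fq]] [cf -> ->]].
move: qd; rewrite !lt_min => /and3P[/B1 + /B2 + /B3]; rewrite !add0r => h1 h2 h3; split => //.
- by rewrite fq; apply: le_trans h1 k1.
- by rewrite normcM ler_wpM2r ?normc_ge0//; exact: le_trans h2 k2.
- by rewrite normcM normc_conj ler_wpM2r ?normc_ge0//; exact: le_trans h3 k3.
Qed.

End Good.

(** * Bounds near the branch points and near infinity *)

Section Bounds.
Variables (R : realType) (lam : R[i]).
Hypotheses (lam0 : lam != 0) (lam1 : lam != 1).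
Local Notation C := (R[i]).
Local Notation L1 := (P1 R).
Local Notation EC := (ell lam).
Local Notation P := (legendre lam).
Local Notation pi := (@piC R lam).
Local Notation W := (Wpts lam).
Implicit Types (p q : pt EC) (f g : pt EC -> C).

Lemma q4_le (s t : R) : 0 <= s -> s <= t -> q4 s <= q4 t.
Proof. by move=> s0 st; apply: ge0_ler_powR; rewrite ?nnegrE ?invr_ge0//; exact: le_trans st. Qed.

Lemma kk_gt0 (s : R) : 0 < s -> 0 < kk s.
Proof.
by move=> s0; rewrite kkE invr_gt0 mulr_gt0// exprn_gt0 ?q4_gt0// addr_gt0 ?q4_gt0.
Qed.

Lemma kk_le (s t : R) : 0 < s -> s <= t -> kk t <= kk s.
Proof.
move=> s0 st; have t0 := lt_le_trans s0 st.
have := kk_gt0 s0; have := kk_gt0 t0; rewrite !kkE !invr_gt0 => h1 h2.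
rewrite lef_pV2 ?posrE//; have qq := q4_le (ltW s0) st; have q0 := q4_ge0 s.
apply: ler_pM; rewrite ?exprn_ge0 ?addr_ge0//.
  by rewrite ler_pXn2r ?nnegrE ?q4_ge0.
by rewrite ler_pXn2r ?nnegrE ?addr_ge0 ?q4_ge0// lerD2l.
Qed.

(** The function [kk] decreases, and both coordinates are at most the norm. *)
Lemma kk_prod (n a b : R) : 0 < `|a| -> `|a| <= n -> 0 < `|b| -> `|b| <= n -> kk n ^+ 2 <= kk `|a| * kk `|b|.
Proof.
move=> h1 h2 h3 h4; rewrite expr2.
by apply: ler_pM; [exact: kk_ge0|exact: kk_ge0|exact: kk_le|exact: kk_le].
Qed.

Lemma ler_sum_in (T : eqType) (r : seq T) (F G : T -> R) :
  (forall i, i \in r -> F i <= G i) -> \sum_(i <- r) F i <= \sum_(i <- r) G i.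
Proof.
elim: r => [|a r IH] H; first by rewrite !big_nil.
rewrite !big_cons; apply: lerD; first by apply: H; rewrite mem_head.
by apply: IH => i ir; apply: H; rewrite in_cons ir orbT.
Qed.

Definition wxs : seq C := [:: 0; 1; lam].
Definition kapr (x : C) := \sum_(w <- wxs) kk (normc (x - w)) ^+ 2.
Definition wks := map (@ofC R) wxs.

Lemma kapr_ge0 x : 0 <= kapr x.
Proof. by apply: sumr_ge0 => w _; rewrite exprn_ge0 ?kk_ge0. Qed.

Lemma kapr_ge x w : w \in wxs -> kk (normc (x - w)) ^+ 2 <= kapr x.
Proof.
move=> ww; rewrite /kapr (big_rem w)//= lerDl; apply: sumr_ge0 => v _; rewrite exprn_ge0 ?kk_ge0//.
Qed.

Lemma kapr_kap (z : R * R) : (forall w, w \in wxs -> z.1 != (ofC w).1 /\ z.2 != (ofC w).2) ->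
  kapr (toC z) <= kap wks z.
Proof.
move=> H; rewrite /kap /wks big_map.
have key w : w \in wxs -> kk (normc (toC z - w)) ^+ 2 <= kk2 (ofC w) z.
  move=> /H[h1 h2]; have := Re_le (toC z - w); have := Im_le (toC z - w); rewrite ReB ImB => i1 i2.
  by apply: kk_prod; rewrite ?normr_gt0 ?subr_eq0.
exact: ler_sum_in key.
Qed.

Definition xof q : C := if q is Some (x, y) then x else 0.

Lemma deriv2_legendreE x : P^`()^`().[x] = 6%:R * x - 2%:R - 2%:R * lam.
Proof.
have H : rdiff (fun z : C => P^`().[z]) x (P^`()^`().[x]) 0 by exact: rdiff_poly.
have lin (c : C) : rdiff (fun z : C => z - c) x 1 0.
  by apply: rdiff_eqpq (rdiffB (rdiff_id x) (rdiff_cst c x)); rewrite subr0.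
have l0 := rdiff_id x; have l1 := lin 1; have ll := lin lam.
have H' := rdiffDh (rdiffDh (rdiffMh l1 ll) (rdiffMh l0 ll)) (rdiffMh l0 l1).
have [-> _] := rdiff_uniq H (rdiff_ext (fun z => esym (deriv_legendreE lam z)) H').
by rewrite /=; ring.
Qed.

Lemma psi1_infE x : 2%:R * P.[x] - x * P^`().[x] = - (x * (x ^+ 2 - lam)).
Proof. by rewrite deriv_legendreE legendreE; ring. Qed.

(** With r = |x - w| the root [y] has order r^(1/2), so that psi1^2 and psi2 have at
    most the order r^(-3/2) of kk(r)^2. *)
Lemma branch_bound (w : C) : w \in wxs -> exists2 K : R, 0 <= K & around (Some (w, 0) : pt EC) (fun q =>
  psi1 (Some (w, 0)) q != 0 /\
  normc (psi1 (Some (w, 0)) q) ^+ 2 + normc (psi2 (Some (w, 0)) q) <= K * kapr (xof q)).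
Proof.
move=> ww; have Pw : P.[w] = 0 by apply/eqP; rewrite legendre_eq0.
have dPw : P^`().[w] != 0.
  rewrite deriv_legendreE; move: ww; rewrite !inE => /or3P[]/eqP->.
  - by rewrite !(sub0r, mul0r, addr0) mulrNN mul1r.
  - by rewrite subrr !mul0r add0r mul1r mulr0 addr0 subr_eq0 eq_sym.
  - by rewrite subrr !mulr0 !add0r mulf_neq0// subr_eq0.
have n0 : 0 < normc P^`().[w] by rewrite normc_gt0.
set c := normc P^`().[w] in n0.
have c20 : 0 < c / 2 by rewrite divr_gt0.
have [d1 d10 H1] := poly_near dPw.
have [d2 d20 H2] := rdiff_poly P w c20.
have [d3 d30 B3] := ccont_bound (ccont_rdiff (rdiff_poly P^`() w)).
have [d4 d40 B4] := ccont_bound (ccont_rdiff (rdiff_poly P^`()^`() w)).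
set M3 := _ + 1 in B3; set M4 := _ + 1 in B4.
pose M := M3 ^+ 2 + M4.
have M30 : 0 <= M3 by rewrite addr_ge0 ?normc_ge0.
have M40 : 0 <= M4 by rewrite addr_ge0 ?normc_ge0.
have M0 : 0 <= M by rewrite addr_ge0 ?exprn_ge0.
pose c0 := Num.sqrt (c / 2); have c00 : 0 < c0 by rewrite sqrtr_gt0.
have c0E : c0 ^+ 2 = c / 2 by rewrite sqr_sqrtr ?ltW.
exists (16 * M / c0 ^+ 3); first by rewrite !mulr_ge0 ?invr_ge0 ?exprn_ge0// ltW.
pose d := Num.min (Num.min d1 d2) (Num.min (Num.min d3 d4) 1).
have d0 : 0 < d by rewrite !lt_min d10 d20 d30 d40 ltr01.
have pp : points (Some (w, 0) : pt EC) by apply/points_Some; rewrite Pw expr0n.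
have ab : around (Some (w, 0) : pt EC) (fun q => if q is Some (x, y) then normc (x - w) < d /\ normc y < 1 else False).
  exists (Num.min d 1)%:C; first by rewrite ltcR lt_min d0 ltr01.
  by case=> [[x y]|//] _ [/= + +] _; rewrite !ltcRE subr0 !lt_min => /andP[-> _] /andP[_ ->].
apply: around_mono (ell_around_and (around_unbranched pp) ab) => -[[x y]|]; last by move=> _ _ [].
move=> /points_Some yP _ [/= y0 []]; set h := x - w.
rewrite !lt_min => /andP[/andP[hd1 hd2] /andP[/andP[hd3 hd4] hd5]] y1.
have xE : x = w + h by rewrite /h addrC subrK.
have [h1 h1'] := H1 _ hd1; have := H2 _ hd2; have b3 := B3 _ hd3; have b4 := B4 _ hd4.
rewrite -xE in h1 h1' b3 b4 *; rewrite Pw subr0 mul0r addr0 -yP => h2.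
rewrite eqxx; split; first by rewrite mulf_neq0// invr_neq0// mulf_neq0// pnatr_eq0.
set n := normc h in hd1 hd2 hd3 hd4 hd5 h2 *.
set Y := normc y in y1 *.
have Y0 : 0 < Y by rewrite /Y normc_gt0.
have hn0 : 0 < n.
  rewrite /n normc_gt0; apply: contra y0 => /eqP hh; move: xE; rewrite hh addr0 => xE.
  by move: yP; rewrite xE Pw => /eqP; rewrite expf_eq0.
pose q := q4 n; have q0 : 0 < q by exact: q4_gt0.
have qn : q ^+ 4 = n by exact: q4X (ltW hn0).
have q1 : q <= 1.
  by rewrite -(expr_le1 (n := 4)) ?qn ?ltW//.
have Y2 : c0 ^+ 2 * q ^+ 4 <= Y ^+ 2.
  rewrite qn c0E /Y -normcX.
  have := ler_distc (P^`().[w] * h) (P^`().[w] * h - y ^+ 2).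
  rewrite (_ : P^`().[w] * h - (P^`().[w] * h - y ^+ 2) = y ^+ 2); last by ring.
  apply: le_trans; rewrite normcM -/c -/n lerBrDr; apply: (@le_trans _ _ (c / 2 * n + c / 2 * n)); last first.
    by rewrite -mulrDl -splitr.
  by rewrite lerD2l normcB.
have Yq : c0 * q ^+ 2 <= Y.
  rewrite -(ler_pXn2r (n := 2)) ?nnegrE ?(ltW Y0)// ?mulr_ge0 ?exprn_ge0 ?(ltW c00) ?(ltW q0)//.
  by rewrite exprMn -exprM.
have Y3 : c0 ^+ 3 * q ^+ 6 <= Y ^+ 3.
  have -> : c0 ^+ 3 * q ^+ 6 = (c0 * q ^+ 2) ^+ 3 by rewrite exprMn -exprM.
  by rewrite ler_pXn2r ?nnegrE ?(ltW Y0)// ?mulr_ge0 ?exprn_ge0 ?(ltW c00) ?(ltW q0).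
have Y30 : 0 < Y ^+ 3 by rewrite exprn_gt0.
have step1 : normc (P^`().[x] / (2%:R * y)) ^+ 2 + normc (P^`()^`().[x] / (2%:R * y) - P^`().[x] ^+ 2 / (4%:R * y ^+ 3))
    <= M / Y ^+ 3.
  apply: (@le_trans _ _ (M3 ^+ 2 / (4 * Y ^+ 2) + (M4 / (2 * Y) + M3 ^+ 2 / (4 * Y ^+ 3)))).
    apply: lerD.
      rewrite normcM normcV normcM normcn exprMn exprVn -/Y exprMn (_ : 2 ^+ 2 = 4 :> R); last by ring.
      by rewrite ler_wpM2r ?invr_ge0 ?mulr_ge0 ?exprn_ge0 ?(ltW Y0)// ler_pXn2r ?nnegrE ?normc_ge0.
    apply: le_trans (ler_normcB _ _) _; apply: lerD.
      rewrite normcM normcV normcM normcn -/Y.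
      by rewrite ler_wpM2r ?invr_ge0 ?mulr_ge0 ?(ltW Y0).
    rewrite [normc (_ / _)]normcM normcV [normc (4%:R * _)]normcM normcn !normcX -/Y.
    by rewrite ler_wpM2r ?invr_ge0 ?mulr_ge0 ?exprn_ge0 ?(ltW Y0)// ler_pXn2r ?nnegrE ?normc_ge0.
  rewrite ler_pdivlMr//.
  have -> : (M3 ^+ 2 / (4 * Y ^+ 2) + (M4 / (2 * Y) + M3 ^+ 2 / (4 * Y ^+ 3))) * Y ^+ 3 =
    4^-1 * (M3 ^+ 2 * Y) + 2^-1 * (M4 * Y ^+ 2) + 4^-1 * M3 ^+ 2 by field; rewrite gt_eqF.
  have k1 : M3 ^+ 2 * Y <= M3 ^+ 2 by rewrite ler_piMr ?exprn_ge0 ?(ltW y1).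
  have k2 : M4 * Y ^+ 2 <= M4 by rewrite ler_piMr ?exprn_ile1 ?(ltW y1) ?(ltW Y0).
  have k3 : 0 <= M3 ^+ 2 by rewrite exprn_ge0.
  rewrite /M; move: (M3 ^+ 2 * Y) (M4 * Y ^+ 2) (M3 ^+ 2) k1 k2 k3 => u1 u2 u3 k1 k2 k3.
  by move: M40; clear -k1 k2 k3; move: M4 k2 => m4 k2 M40; lra.
apply: le_trans step1 _.
have kb : (16 * q ^+ 6)^-1 <= kapr x.
  apply: le_trans (kapr_ge x ww); rewrite -/h -/n kkE -/q exprVn.
  rewrite lef_pV2 ?posrE ?mulr_gt0 ?exprn_gt0 ?mulr_gt0 ?exprn_gt0 ?addr_gt0//.
  have -> : 16 * q ^+ 6 = (q ^+ 3 * 2 ^+ 2) ^+ 2 by ring.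
  rewrite ler_pXn2r ?nnegrE ?mulr_ge0 ?exprn_ge0 ?mulr_ge0 ?addr_ge0 ?(ltW q0)//.
  rewrite ler_wpM2l ?exprn_ge0 ?(ltW q0)// ler_pXn2r ?nnegrE ?addr_ge0 ?(ltW q0)//.
  by move: q1; clear; lra.
apply: (@le_trans _ _ (16 * M / c0 ^+ 3 * (16 * q ^+ 6)^-1)); last first.
  by rewrite ler_wpM2l// !mulr_ge0 ?invr_ge0 ?exprn_ge0// ltW.
have -> : 16 * M / c0 ^+ 3 * (16 * q ^+ 6)^-1 = M / (c0 ^+ 3 * q ^+ 6) by field; rewrite !gt_eqF.
by rewrite ler_wpM2l// lef_pV2 ?posrE// mulr_gt0 ?exprn_gt0.
Qed.

(** With r = |x|, psi1 has order r^(-3/2) and psi2 has the order r^(-5/2) of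
    kk(r)^2.  The last bound makes the contribution of infinity vanish in the
    formula of Stokes. *)
Lemma inf_bound : exists2 K : R, 0 <= K & around (None : pt EC) (fun q =>
  [/\ psi1 None q != 0, normc (psi1 None q) ^+ 2 + normc (psi2 None q) <= K * kapr (xof q) &
   normc (psi1 None q) <= 8 / normc (xof q)]).
Proof.
pose K0 : R := 2 ^+ 6 + (13 * 2 ^+ 3 + 48 * 2 ^+ 5).
have K00 : 0 <= K0 by rewrite /K0 !addr_ge0 ?mulr_ge0 ?exprn_ge0 ?ler0n.
exists (16 * K0); first by rewrite mulr_ge0 ?ler0n.
pose A := 2 + 2 * normc lam; have nl : 0 <= normc lam := normc_ge0 _.
have A0 : 0 < A by rewrite /A; lra.
exists (A^-1)%:C; first by rewrite ltcR invr_gt0.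
case=> [[x y]|//] /points_Some yP /=; rewrite normc_real -fmorphV ltcR invrK /A => xA _.
set n := normc x in xA *; set Y := normc y.
have n2 : 2 <= n by move: xA nl; clear; lra.
have nL : 2 * normc lam <= n by move: xA; clear; lra.
have n0 : 0 < n by move: n2; clear; lra.
have u1 : n / 2 <= normc (x - 1) by have := ler_distc x 1; rewrite normc1 -/n; move: n2; clear; lra.
have u2 : n / 2 <= normc (x - lam) by have := ler_distc x lam; rewrite -/n; move: nL; clear; lra.
have v1 : normc (x - 1) <= 2 * n by have := ler_normcB x 1; rewrite normc1 -/n; move: n2; clear; lra.
have v2 : normc (x - lam) <= 2 * n by have := ler_normcB x lam; rewrite -/n; move: nL nl; clear; lra.
have YP : Y ^+ 2 = n * normc (x - 1) * normc (x - lam) by rewrite /Y -normcX yP legendreE !normcM.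
have Y2 : n ^+ 3 / 4 <= Y ^+ 2.
  rewrite YP (_ : n ^+ 3 / 4 = n * (n / 2) * (n / 2)); last by field.
  by apply: ler_pM => //; rewrite ?mulr_ge0 ?divr_ge0 ?(ltW n0)// ler_pM ?(ltW n0) ?divr_ge0 ?(ltW n0).
pose q := q4 n; have q0 : 0 < q by exact: q4_gt0.
have qn : q ^+ 4 = n by exact: q4X (ltW n0).
have q1 : 1 <= q by rewrite -(expr_ge1 (n := 4)) ?(ltW q0)// qn; move: n2; clear; lra.
have Yq : q ^+ 6 / 2 <= Y.
  rewrite -(ler_pXn2r (n := 2)) ?nnegrE ?normc_ge0// ?divr_ge0 ?exprn_ge0 ?(ltW q0)//.
  by apply: le_trans Y2; rewrite exprMn -exprM -qn -exprM exprVn (_ : 2 ^+ 2 = 4 :> R)//; ring.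
have q6 : 0 < q ^+ 6 / 2 by rewrite divr_gt0 ?exprn_gt0.
have Y0 : 0 < Y by exact: lt_le_trans Yq.
have y0 : y != 0 by rewrite -normc_gt0.
have Yk k : Y ^- k <= (q ^+ 6 / 2) ^- k.
  rewrite lef_pV2 ?posrE ?exprn_gt0//; apply: lerXn2r; rewrite ?nnegrE ?(ltW Y0) ?(ltW q6)//.
have dP : normc P^`().[x] <= 8 * n ^+ 2.
  rewrite deriv_legendreE; apply: le_trans (le_normcD _ _) _.
  apply: le_trans (lerD (le_normcD _ _) (lexx _)) _; rewrite !normcM -/n.
  have := ler_pM (normc_ge0 (x - 1)) (normc_ge0 (x - lam)) v1 v2.
  have := ler_wpM2l (ltW n0) v2; have := ler_wpM2l (ltW n0) v1.
  move: (_ * normc (x - lam)) (n * _) (n * _) => a b c' h1 h2 h3.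
  have -> : 8 * n ^+ 2 = (2 * n) * (2 * n) + n * (2 * n) + n * (2 * n) by ring.
  by rewrite !lerD.
have ddP : normc P^`()^`().[x] <= 10 * n.
  have -> : P^`()^`().[x] = 2%:R * (x + ((x - 1) + (x - lam))) by rewrite deriv2_legendreE; ring.
  rewrite normcM normcn (_ : 10 * n = 2 * (n + (2 * n + 2 * n))); last by ring.
  rewrite ler_wpM2l//; apply: le_trans (le_normcD _ _) _; rewrite lerD2l.
  by apply: le_trans (le_normcD _ _) _; exact: lerD.
have nl2 : normc lam < n ^+ 2.
  apply: (@lt_le_trans _ _ (n * n)); last by rewrite -expr2.
  by apply: (@le_lt_trans _ _ (2^-1 * n)); [move: nL; clear; lra|rewrite ltr_pM2r//; move: n2; clear; lra].
have num : normc (2%:R * P.[x] - x * P^`().[x]) <= 2 * n ^+ 3.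
  rewrite psi1_infE normcN normcM -/n (_ : 2 * n ^+ 3 = n * (n ^+ 2 + n ^+ 2)); last by ring.
  rewrite ler_wpM2l ?(ltW n0)//; apply: le_trans (ler_normcB _ _) _; rewrite normcX -/n lerD2l; exact: ltW.
have psi1b : normc ((2%:R * P.[x] - x * P^`().[x]) / (2%:R * y ^+ 3)) <= 8 * q ^- 6.
  rewrite normcM normcV normcM normcn normcX -/Y.
  have := ler_pM (normc_ge0 _) (_ : 0 <= Y ^- 3) num (Yk 3).
  rewrite invr_ge0 exprn_ge0 ?(ltW Y0)// => /(_ isT) h.
  have -> : normc (2%:R * P.[x] - x * P^`().[x]) / (2 * Y ^+ 3) = 2^-1 * (normc (2%:R * P.[x] - x * P^`().[x]) / Y ^+ 3).
    by field; rewrite gt_eqF.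
  apply: le_trans (ler_wpM2l _ h) _; first by rewrite invr_ge0.
  by rewrite le_eqVlt; apply/orP; left; apply/eqP; rewrite -qn; field; rewrite gt_eqF.
have psi2b : normc (- (2%:R * P^`().[x] + x * P^`()^`().[x]) / (2%:R * y ^+ 3)
      + 3%:R * x * P^`().[x] ^+ 2 / (4%:R * y ^+ 5)) <= (13 * 2 ^+ 3 + 48 * 2 ^+ 5) * q ^- 10.
  apply: le_trans (le_normcD _ _) _; rewrite [X in _ <= X]mulrDl.
  apply: lerD.
    rewrite normcM normcV normcN normcM normcn normcX -/Y.
    have k1 : normc (2%:R * P^`().[x] + x * P^`()^`().[x]) <= 26 * n ^+ 2.
      apply: le_trans (le_normcD _ _) _; rewrite !normcM normcn -/n.
      have := ler_wpM2l (ltW n0) ddP; rewrite (_ : n * (10 * n) = 10 * n ^+ 2); last by ring.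
      move: dP; move: (normc _) (n * _) (n ^+ 2); clear => a b c'; lra.
    have := ler_pM (normc_ge0 _) (_ : 0 <= Y ^- 3) k1 (Yk 3).
    rewrite invr_ge0 exprn_ge0 ?(ltW Y0)// => /(_ isT) h.
    move: h; set N := normc _ => h.
    have -> : N / (2 * Y ^+ 3) = 2^-1 * (N / Y ^+ 3) by field; rewrite gt_eqF.
    apply: le_trans (ler_wpM2l _ h) _; first by rewrite invr_ge0.
    by rewrite le_eqVlt; apply/orP; left; apply/eqP; rewrite -qn; field; rewrite gt_eqF.
  rewrite [normc (_ / _)]normcM normcV [normc (4%:R * _)]normcM [normc (_ * P^`().[x] ^+ 2)]normcM [normc (3%:R * x)]normcM !normcn !normcX -/Y -/n.
  have k1 : 3 * n * normc P^`().[x] ^+ 2 <= 3 * 2 ^+ 6 * n ^+ 5.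
    rewrite (_ : 3 * 2 ^+ 6 * n ^+ 5 = 3 * n * (8 * n ^+ 2) ^+ 2); last by ring.
    rewrite ler_wpM2l ?mulr_ge0 ?(ltW n0)// ler_pXn2r ?nnegrE ?normc_ge0// mulr_ge0 ?exprn_ge0 ?(ltW n0)//.
  have := ler_pM _ (_ : 0 <= Y ^- 5) k1 (Yk 5).
  rewrite invr_ge0 !mulr_ge0 ?exprn_ge0 ?normc_ge0 ?(ltW Y0) ?(ltW n0)// => /(_ isT isT).
  set N := 3 * n * _ => h.
  have -> : N / (4 * Y ^+ 5) = 4^-1 * (N / Y ^+ 5) by field; rewrite gt_eqF.
  apply: le_trans (ler_wpM2l _ h) _; first by rewrite invr_ge0.
  by rewrite le_eqVlt; apply/orP; left; apply/eqP; rewrite -qn; field; rewrite gt_eqF.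
split.
- rewrite psi1_infE mulf_neq0 ?invr_neq0 ?mulf_neq0 ?expf_neq0 ?pnatr_eq0// oppr_eq0 mulf_neq0//.
    by rewrite -normc_gt0.
  rewrite subr_eq0; apply: contraTneq nl2 => <-; by rewrite normcX ltxx.
- apply: (@le_trans _ _ (2 ^+ 6 * q ^- 10 + (13 * 2 ^+ 3 + 48 * 2 ^+ 5) * q ^- 10)).
    apply: lerD psi2b.
    apply: (@le_trans _ _ ((8 * q ^- 6) ^+ 2)).
      by rewrite ler_pXn2r ?nnegrE ?normc_ge0// mulr_ge0 ?invr_ge0 ?exprn_ge0 ?(ltW q0).
    rewrite exprMn (_ : 8 ^+ 2 = 2 ^+ 6 :> R); last by ring.
    rewrite ler_wpM2l ?exprn_ge0 ?ler0n// exprVn -exprM lef_pV2 ?posrE ?exprn_gt0//.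
    by apply: ler_weXn2l.
  rewrite -mulrDl -/K0.
  have kb : (16 * q ^+ 10)^-1 <= kapr x.
    apply: le_trans (kapr_ge (w := 0) x _); last by rewrite !inE eqxx.
    rewrite subr0 -/n kkE -/q exprVn.
    rewrite lef_pV2 ?posrE ?mulr_gt0 ?exprn_gt0 ?mulr_gt0 ?exprn_gt0 ?addr_gt0//.
    have -> : 16 * q ^+ 10 = (q ^+ 3 * (2 * q) ^+ 2) ^+ 2 by ring.
    rewrite ler_pXn2r ?nnegrE ?mulr_ge0 ?exprn_ge0 ?mulr_ge0 ?addr_ge0 ?(ltW q0)//.
    rewrite ler_wpM2l ?exprn_ge0 ?(ltW q0)// ler_pXn2r ?nnegrE ?mulr_ge0 ?addr_ge0 ?(ltW q0)//.
    by move: q1; clear; lra.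
  have -> : K0 * q ^- 10 = 16 * K0 * (16 * q ^+ 10)^-1 by field; rewrite gt_eqF.
  by rewrite ler_wpM2l// mulr_ge0 ?ler0n.
- apply: le_trans psi1b _; rewrite ler_wpM2l// lef_pV2 ?posrE ?exprn_gt0//.
  by rewrite -qn; apply: ler_weXn2l.
Qed.
End Bounds.

(** * Stokes' formula on the curve *)

Section Stokes.
Variables (R : realType) (lam : R[i]).
Hypotheses (lam0 : lam != 0) (lam1 : lam != 1).
Local Notation C := (R[i]).
Local Notation L1 := (P1 R).
Local Notation EC := (ell lam).
Local Notation P := (legendre lam).
Local Notation pi := (@piC R lam).
Local Notation W := (Wpts lam).
Local Notation kapr := (kapr lam).
Implicit Types (p q : pt EC) (f g : pt EC -> C).

Lemma psi_bound p : points p -> exists2 K : R, 0 <= K & around p (fun q => psi1 p q != 0 /\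
  normc (psi1 p q) ^+ 2 + normc (psi2 p q) <= K * kapr (xof q)).
Proof.
move=> pp; have [pW|pW] := boolP (p \in W).
  have inf : exists2 K : R, 0 <= K & around (None : pt EC) (fun q => psi1 None q != 0 /\
      normc (psi1 None q) ^+ 2 + normc (psi2 None q) <= K * kapr (xof q)).
    have [K K0 H] := inf_bound lam; exists K => //.
    by apply: around_mono H => q _ _ [].
  have fin w : w \in wxs lam -> exists2 K : R, 0 <= K & around (Some (w, 0) : pt EC) (fun q => psi1 (Some (w, 0)) q != 0 /\
      normc (psi1 (Some (w, 0)) q) ^+ 2 + normc (psi2 (Some (w, 0)) q) <= K * kapr (xof q)) by exact: branch_bound.
  move: pW; rewrite !inE => /or4P[]/eqP->; [| | |exact: inf]; apply: fin; by rewrite !inE eqxx ?orbT.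
have up := W_unbranched pp pW.
case: p pp pW up => [[a b]|//] pp pW /= b0.
pose M := normc a + 1; have M0 : 0 < M by rewrite ltr_wpDl ?normc_ge0.
have k0 : 0 < kk M ^+ 2 by rewrite exprn_gt0 ?kk_gt0.
exists (kk M ^- 2); first by rewrite invr_ge0 ltW.
have ab : around (Some (a, b) : pt EC) (fun q => normc (xof q) <= M).
  exists 1 => // -[[x y]|//] _ /= [+ _] _; rewrite -[1]/(1%:C) ltcRE => h.
  rewrite -[x](subrK a); apply: le_trans (le_normcD _ _) _.
  by rewrite /M addrC lerD2l ltW.
apply: around_mono (ell_around_and (around_unbranched pp) ab) => -[[x y]|]; last by move=> _ _ [].
move=> /points_Some yP _ [/= y0 xM]; rewrite (negbTE b0); split; first exact: oner_neq0.
rewrite normc1 normc0 addr0 expr1n mulrC ler_pdivlMr// mul1r.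
have x0 : x != 0.
  by apply: contra y0 => /eqP x0; move: yP; rewrite x0 legendreE !mul0r => /eqP; rewrite expf_eq0.
apply: le_trans (kapr_ge (w := 0) x _); last by rewrite !inE eqxx.
rewrite subr0; have nx : 0 < normc x by rewrite normc_gt0.
have := kk_le nx xM; have := kk_gt0 M0 => h1 h2.
by rewrite ler_pXn2r ?nnegrE ?kk_ge0.
Qed.

Lemma psi2_ccont p q : points q -> unbranched q -> ccont (lf (psi2 p) q) 0.
Proof.
case: q => [[x y]|//] /points_Some yP /= y0.
have [d d0 /(_ 0)] := ybr_local yP y0; rewrite normc0 addr0 ybr0// => /(_ d0)[_ _ de _].
have e0 := ybr0 yP y0.
have cY := ccont_rdiff de.
have ci : ccont (fun u => (ybr lam x y u)^-1) 0.
  have := rdiffV (F := ybr lam x y) _ de; rewrite e0 => /(_ y0) H; exact: ccont_rdiff H.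
have cx := ccont_rdiff (rdiff_shift x).
have cp (Q : {poly C}) : ccont (fun u => Q.[x + u]) 0 by exact: ccont_rdiff (rdiff_polyshift Q x).
have cX (f : C -> C) n : ccont f 0 -> ccont (fun u => f u ^+ n) 0.
  move=> cf; elim: n => [|n IH].
    by apply: ccont_near (ccont_cst 1 0); exists 1 => // h _; rewrite expr0.
  by apply: ccont_near (ccontM cf IH); exists 1 => // h _; rewrite exprS.
have cZ (c : C) (f : C -> C) : ccont f 0 -> ccont (fun u => c * f u) 0 by move=> cf; exact: ccontM (ccont_cst c 0) cf.
have ext (f g : C -> C) : (forall u, f u = g u) -> ccont f 0 -> ccont g 0.
  by move=> fg; apply: ccont_near; exists 1 => // h _.
case: p => [[a b]|].
  have [b0|b0] := eqVneq b 0.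
    have H := ccontD (cZ 2%:R^-1 _ (ccontM (cp P^`()^`()) ci)) (cZ (- 4%:R^-1) _ (ccontM (cX _ 2 (cp P^`())) (cX _ 3 ci))).
    apply: ext H => u; rewrite /lf /psi2 liftE b0 eqxx.
    by rewrite [(2%:R * _)^-1]invfM [(4%:R * _)^-1]invfM -exprVn; move: (ybr _ _ _ _)^-1 => i; ring.
  by rewrite /lf /psi2 /= (negbTE b0); exact: ccont_cst.
have H := ccontD (cZ (- 2%:R^-1) _ (ccontM (ccontD (cZ 2%:R _ (cp P^`())) (ccontM cx (cp P^`()^`()))) (cX _ 3 ci)))
  (cZ (3%:R / 4%:R) _ (ccontM (ccontM cx (cX _ 2 (cp P^`()))) (cX _ 5 ci))).
apply: ext H => u; rewrite /lf /psi2 liftE.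
rewrite [(2%:R * ybr _ _ _ _ ^+ 3)^-1]invfM [(4%:R * ybr _ _ _ _ ^+ 5)^-1]invfM -!exprVn.
by move: (ybr _ _ _ _)^-1 => i; ring.
Qed.

Lemma psi1_C1 p p' : points p' -> around p' (fun q => C1at (lf (psi1 p) q) 0).
Proof.
move=> pp; have H : around p' (fun q => [/\ rdiff (lf (psi1 p) q) 0 (psi2 p q) ((fun=> 0) q),
    ccont (lf (psi2 p) q) 0 & ccont (lf (fun=> 0) q) 0]).
  apply: around_mono (around_unbranched pp) => q pq _ uq.
  by split; [exact: (psi_rdiff p pq uq).2|exact: psi2_ccont|exact: ccont_cst].
by apply: around_mono (C1_around pp H) => q _ _ [].
Qed.

(** Writing G as the product of a good function and psi1, its derivatives are
    bounded by psi1^2 and psi2. *)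
Lemma form_good p G : points p -> good p (fun q => dxdz p q * G q) -> exists2 K : R, 0 <= K & around p (fun q =>
  [/\ unbranched q, C1at (lf G q) 0, normc (G q) <= K * normc (psi1 p q) &
   normc (del G q) <= K * kapr (xof q) /\ normc (dbar G q) <= K * kapr (xof q)]).
Proof.
move=> pp /(good_ge0 pp)[K K0 H]; have [K' K'0 Hb] := psi_bound pp.
have key : around p (fun q => [/\ unbranched q, psi1 p q != 0 & G q = (dxdz p q * G q) * psi1 p q]).
  apply: around_mono (ell_around_and (around_unbranched pp) Hb) => q pq _ [uq [n0 _]].
  by rewrite dxdz_psi//; split => //; field.
exists (Num.max K (K * K')); first by rewrite le_max K0.
set m := Num.max _ _; have m1 : K <= m by rewrite le_max lexx.
have m2 : K * K' <= m by rewrite le_max lexx orbT.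
apply: around_mono (ell_around_and (ell_around_and (ell_around_and H Hb) (psi1_C1 p pp)) (around_lift pp key)).
move=> q pq _ [[[[c1 b1 d1 e1] [n0 bb]] cs] [[uq _ GE] [d d0 Hd]]].
have [ds dss] := psi_rdiff p pq uq.
have ne : near_eq 0 (fun u => lf (fun q => dxdz p q * G q) q u * lf (psi1 p) q u) (lf G q).
  by exists d => // u /Hd[_ _]; rewrite !add0r /lf => <-.
have dG := rdiff_near ne (rdiffM (lf_rdiff c1) dss).
have [-> ->] := del_lf dG; rewrite mulr0 addr0 !lf0//.
move: (del (fun q => dxdz p q * G q) q) (dbar (fun q => dxdz p q * G q) q) d1 e1 => D1 D2 d1 e1.
move: (dxdz p q * G q) b1 GE => g0 b1 GE.
split => //; first by apply: C1_near ne _; exact: C1M.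
  by rewrite GE normcM ler_wpM2r ?normc_ge0//; exact: le_trans b1 m1.
have s1 := normc_ge0 (psi1 p q); have s2 := normc_ge0 (psi2 p q).
have bound X : X <= K * (normc (psi1 p q) ^+ 2 + normc (psi2 p q)) -> X <= m * kapr (xof q).
  move=> h; apply: le_trans h _; apply: le_trans (ler_wpM2l K0 bb) _.
  by rewrite mulrA ler_wpM2r ?kapr_ge0.
split; apply: bound.
  apply: le_trans (le_normcD _ _) _; rewrite !normcM mulrDr; apply: lerD.
    by rewrite expr2 mulrA ler_wpM2r.
  exact: ler_wpM2r s2 _ _ b1.
rewrite normcM; apply: le_trans (ler_wpM2r s1 e1) _; rewrite -mulrA -expr2.
by rewrite ler_wpM2l// lerDl.
Qed.

(** ** Compactness *)

(** Compactness of the curve, seen from the x-plane: a neighbourhood of infinity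
    covers the complement of a square, and finitely many pairs of neighbourhoods
    cover the square.  Only the centres of these are excluded. *)
Lemma ell_uniform (Q : R -> pt EC -> Prop) : (forall K K' q, K <= K' -> Q K q -> Q K' q) ->
  (forall p, points p -> exists K, around p (Q K)) ->
  exists K (s : seq C), forall x, x \notin s -> forall q, q \in sheets EC x -> Q K q.
Proof.
move=> mono H.
have [K0 [e0 /gt0_Re[r0 r00 ->] H0]] := H None I.
pose A := r0^-1; have A0 : 0 < A by rewrite invr_gt0.
have far x : A < normc x -> forall q, q \in sheets EC x -> Q K0 q.
  move=> xA q qs; have [qp qx] := sheets_points qs; case: q qp qx {qs} => [[x' y]|//] qp [xE]; subst x'.
  by apply: H0 => //=; rewrite normc_real -fmorphV ltcR.
have loc (z : R * R) : exists ke : R * R, 0 < ke.2 /\ forall x, x != toC z -> normc (x - toC z) < ke.2 ->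
    forall q, q \in sheets EC x -> Q ke.1 q.
  pose b := sqrtc P.[toC z].
  have b2 : b ^+ 2 = P.[toC z] by rewrite sqr_sqrtc.
  have p1 : points (Some (toC z, b) : pt EC) by exact/points_Some.
  have p2 : points (Some (toC z, - b) : pt EC) by apply/points_Some; rewrite sqrrN.
  have [K1 [e1 /gt0_Re[r1 r10 ->] H1]] := H _ p1; have [K2 [e2 /gt0_Re[r2 r20 ->] H2]] := H _ p2.
  pose r := Num.min r1 r2; have rp : 0 < r by rewrite lt_min r10.
  have [d d0 Hd] := rdiff_continuous (rdiff_poly P (toC z)) (exprn_gt0 2 rp).
  exists (Num.max K1 K2, Num.min r d) => /=; split; first by rewrite lt_min rp.
  move=> x xx0; rewrite !lt_min => /andP[/andP[xr1 xr2] xd] q qs.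
  have [qp qx] := sheets_points qs; case: q qp qx {qs} => [[x' y]|//] /[dup] qp /points_Some yP [xE]; subst x'.
  have := Hd _ xd; rewrite [toC z + _]addrC subrK -yP -b2 subr_sqr normcM expr2 => prod.
  have [h|h] := ltP (normc (y - b)) r.
    apply: (mono K1); first by rewrite le_max lexx.
    apply: H1 => //=.
      by rewrite !ltcRE; split => //; move: h; rewrite lt_min => /andP[].
    by apply: contra xx0 => /eqP[->].
  have h' : normc (y + b) < r.
    rewrite -(ltr_pM2l rp); apply: le_lt_trans prod; rewrite ler_wpM2r ?normc_ge0//.
  apply: (mono K2); first by rewrite le_max lexx orbT.
  apply: H2 => //=.
    by rewrite !ltcRE opprK; split => //; move: h'; rewrite lt_min => /andP[].
  by apply: contra xx0 => /eqP[->].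
have [ke Hke] := cchoice loc.
pose box : set (R * R) := `[- A, A]%classic `*` `[- A, A]%classic.
pose fine (S : set (R * R)) := exists K (s : seq C), forall z, S z -> toC z \notin s -> forall q, q \in sheets EC (toC z) -> Q K q.
have fineU S S' : fine S -> fine S' -> fine (S `|` S').
  move=> [K [s h]] [K' [s' h']]; exists (Num.max K K'), (s ++ s') => z [] Sz; rewrite mem_cat negb_or => /andP[zs zs'] q qs.
    by apply: (mono K) (h _ Sz zs _ qs); rewrite le_max lexx.
  by apply: (mono K') (h' _ Sz zs' _ qs); rewrite le_max lexx orbT.
have fineS S S' : S `<=` S' -> fine S' -> fine S.
  by move=> sub [K [s h]]; exists K, s => z /sub; exact: h.
have : fine box.
  apply: contrapT => nf; pose F (S : set (R * R)) := fine (box `\` S).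
  have FF : ProperFilter F.
    apply: Build_ProperFilter; first by apply: contra_not nf => h; apply: fineS h => z; split.
    split.
    - by exists 0, [::] => z [_ []].
    - move=> S S' h h'; apply: fineS (fineU _ _ h h') => z [bz /not_andP[nS|nS]]; [by left|by right].
    - by move=> S S' sub h; apply: fineS h => z [bz nS]; split => // /sub.
  have Fb : F box by exists 0, [::] => z [].
  have [z [zb cz]] := @compact_setX R R _ _ (@segment_compact R (- A) A) (@segment_compact R (- A) A) F FF Fb.
  have oD : opened [set s | normc (s - toC z) < (ke z).2] by exact: disc_opened.
  have oU := opened_open oD; set U := [set w | _] in oU.
  have Uz : nbhs z U by apply: open_nbhs_nbhs; split => //; rewrite /U /mkset subrr normc0; exact: (Hke z).1.
  have FU : F (~` U).
    exists (ke z).1, [:: toC z] => w [_ /contrapT Uw]; rewrite inE => wz q qs.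
    exact: (Hke z).2 wz Uw q qs.
  by have [w [nw Uw]] := cz _ _ FU Uz.
move=> [K [s h]]; exists (Num.max K0 K), s => x xs q qs.
have [xA|xA] := ltP A (normc x).
  by apply: (mono K0) (far _ xA _ qs); rewrite le_max lexx.
apply: (mono K); first by rewrite le_max lexx orbT.
apply: (h (ofC x)); rewrite ?ofCK//.
by split; rewrite /= in_itv /= -ler_norml; apply: le_trans xA; [exact: Re_le|exact: Im_le].
Qed.

(** ** Sums over the sheets *)

Definition psum f (x : C) : C := \sum_(q <- sheets EC x) f q.

(** The sum is symmetric in the two sheets, so the discontinuity of the root chosen
    by [sheets] does not matter. *)
Lemma psum_lift f x0 u : P.[x0] != 0 -> psum f (x0 + u) = \sum_(q <- sheets EC x0) lf f q u.
Proof.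
move=> P0; rewrite /psum !big_cons !big_nil !addr0 /lf !liftE.
set s := sqrtc P.[x0]; set s' := sqrtc P.[x0 + u].
have s2 : s ^+ 2 = P.[x0] by rewrite sqr_sqrtc.
have s0 : s != 0 by apply: contra P0 => /eqP h; rewrite -s2 h expr0n.
have -> : ybr lam x0 (- s) u = - ybr lam x0 s u by rewrite /ybr mulNr.
have : (s' - ybr lam x0 s u) * (s' + ybr lam x0 s u) == 0.
  by rewrite -subr_sqr sqr_sqrtc ybr_sqr// subrr.
by rewrite mulf_eq0 subr_eq0 addr_eq0 => /orP[]/eqP->; rewrite ?opprK// addrC.
Qed.

Lemma sheets_unbranched x q : q \in sheets EC x -> unbranched q -> P.[x] != 0.
Proof.
move=> qs; have [pq] := sheets_points qs; case: q pq {qs} => [[x' y]|//] /points_Some yP [<-] /= y0.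
by rewrite -yP expf_neq0.
Qed.

Lemma mem_sheets x : (Some (x, sqrtc P.[x]) : pt EC) \in sheets EC x.
Proof. exact: mem_head. Qed.

Lemma ccont_psum f x0 : (forall q, q \in sheets EC x0 -> unbranched q /\ ccont (lf f q) 0) -> ccont (psum f) x0.
Proof.
move=> H; have P0 := sheets_unbranched (mem_sheets x0) (H _ (mem_sheets x0)).1.
have : ccont (fun u => \sum_(q <- sheets EC x0) lf f q u) 0.
  have : forall q, q \in sheets EC x0 -> ccont (lf f q) 0 by move=> q /H[].
  elim: (sheets EC x0) => [|q s IH] h.
    by apply: ccont_near (ccont_cst 0 0); exists 1 => // u _; rewrite big_nil.
  have h1 := h q (mem_head _ _); have h2 : ccont (fun u => \sum_(q <- s) lf f q u) 0.
    by apply: IH => q' qs; apply: h; rewrite in_cons qs orbT.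
  by apply: ccont_near (ccontD h1 h2); exists 1 => // u _; rewrite big_cons.
move=> c e /c[d d0 Hd]; exists d => // h /Hd.
by rewrite -!psum_lift// add0r addr0.
Qed.

Lemma rdiff_psum f x0 : (forall q, q \in sheets EC x0 -> unbranched q /\ C1at (lf f q) 0) ->
  rdiff (psum f) x0 (psum (del f) x0) (psum (dbar f) x0).
Proof.
move=> H; have P0 := sheets_unbranched (mem_sheets x0) (H _ (mem_sheets x0)).1.
have : rdiff (fun u => \sum_(q <- sheets EC x0) lf f q u) 0 (psum (del f) x0) (psum (dbar f) x0).
  rewrite /psum.
  have : forall q, q \in sheets EC x0 -> C1at (lf f q) 0 by move=> q /H[].
  elim: (sheets EC x0) => [|q s IH] h.
    by rewrite !big_nil; apply: rdiff_ext (rdiff_cst 0 0) => u; rewrite big_nil.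
  have h1 := lf_rdiff (h q (mem_head _ _)).
  rewrite !big_cons; apply: rdiff_ext (rdiffD h1 (IH _)) => [u|q' qs]; first by rewrite big_cons.
  by apply: h; rewrite in_cons qs orbT.
move=> c e /c[d d0 Hd]; exists d => // h /Hd.
by rewrite -!psum_lift// add0r addr0.
Qed.

Lemma C1_del_ccont f q : points q -> unbranched q -> C1at (lf f q) 0 ->
  ccont (lf (del f) q) 0 /\ ccont (lf (dbar f) q) 0.
Proof.
case: q => [[x y]|//] /points_Some yP /= y0 [d d0 [fp [fq H]]].
have [d' d'0 He] := ybr_local yP y0.
have key h : normc h < d -> normc h < d' -> lf (del f) (Some (x, y)) h = fp h /\ lf (dbar f) (Some (x, y)) h = fq h.
  move=> /H + /He[_ _ _ [d2 d20 E]]; rewrite !add0r => -[df _ _].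
  apply: del_lf; move=> e /df[d3 d30 H3]; exists (Num.min d2 d3); first by rewrite lt_min d20.
  have E' u : normc u < d2 -> lf f (lift (Some (x, y) : pt EC) h) u = lf f (Some (x, y)) (h + u).
    move=> /E; rewrite /lf !liftE !add0r => ->; by rewrite addrA.
  move=> u; rewrite lt_min => /andP[u2 /H3]; rewrite !add0r E'// E' ?normc0//.
  by rewrite addr0.
have [_ c1 c2] := H 0 ltac:(by rewrite normc0); rewrite addr0 in c1 c2.
split; [apply: ccont_near c1|apply: ccont_near c2]; exists (Num.min d d'); rewrite ?lt_min ?d0// => h;
  by rewrite lt_min add0r => /andP[h1 h2]; have [k1 k2] := key _ h1 h2; rewrite ?k1 ?k2.
Qed.

(** ** Dominated functions on the curve *)

Definition tamef f := exists K (s : seq C), forall x, x \notin s -> forall q, q \in sheets EC x ->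
  [/\ unbranched q, ccont (lf f q) 0 & normc (f q) <= K * kapr (xof q)].

Notation leb2 := (@lebesgue_measure R \x @lebesgue_measure R)%E.
Definition rpart f (z : R * R) := complex.Re (psum f (toC z)).
Definition ipart f (z : R * R) := complex.Im (psum f (toC z)).

Definition coords (s : seq C) : seq R := map (@complex.Re R) s ++ map (@complex.Im R) s.

Lemma coords_off (s : seq C) z : ~~ ongrid (coords s) z -> toC z \notin s.
Proof.
apply: contra => zs; rewrite /ongrid !mem_cat; apply/andP; split; apply/orP.
  by left; apply/mapP; exists (toC z).
by right; apply/mapP; exists (toC z).
Qed.

Lemma coords_neq (s : seq C) r w : r \notin coords s -> w \in s -> r != complex.Re w /\ r != complex.Im w.
Proof.
rewrite mem_cat negb_or => /andP[r1 r2] ws; split; [apply: contra r1|apply: contra r2] => /eqP->; exact: map_f.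
Qed.

Lemma normc_psum f x K : (forall q, q \in sheets EC x -> normc (f q) <= K) -> normc (psum f x) <= 2 * K.
Proof.
move=> H; rewrite /psum !big_cons big_nil addr0 mulr_natl mulr2n.
by apply: le_trans (le_normcD _ _) _; apply: lerD; apply: H; rewrite !inE eqxx ?orbT.
Qed.

Lemma pcont_ccont (F : C -> C) z : ccont F (toC z) -> pcont (fun z => complex.Re (F (toC z))) z /\
  pcont (fun z => complex.Im (F (toC z))) z.
Proof.
move=> cF; suff H e : 0 < e -> exists2 d : R, 0 < d & forall w : R * R, `|w.1 - z.1| < d -> `|w.2 - z.2| < d ->
    normc (F (toC w) - F (toC z)) < e.
  split=> e /H[d d0 Hd]; exists d => // w w1 w2; apply: le_lt_trans (Hd w w1 w2).
    by rewrite -ReB; exact: Re_le.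
  by rewrite -ImB; exact: Im_le.
move=> /cF[d d0 Hd]; exists (d / 2); first by rewrite divr_gt0.
move=> w w1 w2; have -> : toC w = toC z + (toC w - toC z) by rewrite addrC subrK.
apply: Hd; apply: le_lt_trans (normc_le _) _; rewrite ReB ImB /= [d]splitr; exact: ltrD.
Qed.

Lemma tamef_tame f : tamef f -> tame (wks lam) (rpart f) /\ tame (wks lam) (ipart f).
Proof.
move=> [K [s H]]; pose S := coords s ++ coords (wxs lam).
have c z : ~~ ongrid S z -> pcont (rpart f) z /\ pcont (ipart f) z.
  move=> /ongrid_cat[/coords_off zs _]; apply: pcont_ccont; apply: ccont_psum => q qs.
  by have [] := H _ zs _ qs.
have b z : z.1 \notin S -> z.2 \notin S -> normc (psum f (toC z)) <= 2 * `|K| * kap (wks lam) z.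
  have sp r : r \notin S -> r \notin coords s /\ r \notin coords (wxs lam).
    by move=> h; apply/andP; rewrite -negb_or -mem_cat.
  move=> /sp[z1 z1'] /sp[z2 z2'].
  have zs : toC z \notin s by apply: coords_off; rewrite /ongrid negb_and z1.
  apply: le_trans (normc_psum (K := `|K| * kap (wks lam) z) _) _; last by rewrite mulrA.
  move=> q qs; have [_ _ h] := H _ zs _ qs; apply: le_trans h _.
  have -> : xof q = toC z by have [_] := sheets_points qs; case: q {qs} => [[x y]|//] [->].
  apply: le_trans (ler_wpM2r (kapr_ge0 _ _) (ler_norm K)) _; apply: ler_wpM2l => //.
  apply: kapr_kap => w ww.
  by split; [exact: (coords_neq z1' ww).1|exact: (coords_neq z2' ww).2].
split; exists S, (2 * `|K|); split=> z; [by move=> /c[]| |by move=> /c[]|].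
  by move=> z1 z2; apply: le_trans (Re_le _) _; exact: b.
by move=> z1 z2; apply: le_trans (Im_le _) _; exact: b.
Qed.

(** ** Integrals over the curve *)

Definition intg f : C := plane_integral (fun u => psum f (toC u)).

Lemma psumD f g x : psum (fun q => f q + g q) x = psum f x + psum g x.
Proof. by rewrite /psum big_split. Qed.

Lemma psumZ (c : C) f x : psum (fun q => c * f q) x = c * psum f x.
Proof. by rewrite /psum big_distrr. Qed.

Lemma tamefD f g : tamef f -> tamef g -> tamef (fun q => f q + g q).
Proof.
move=> [K [s H]] [K' [s' H']]; exists (K + K'), (s ++ s') => x; rewrite mem_cat negb_or => /andP[xs xs'] q qs.
have [u c b] := H _ xs _ qs; have [_ c' b'] := H' _ xs' _ qs; split => //; first exact: ccontD.
by apply: le_trans (le_normcD _ _) _; rewrite mulrDl lerD.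
Qed.

Lemma tamefZ (c : C) f : tamef f -> tamef (fun q => c * f q).
Proof.
move=> [K [s H]]; exists (normc c * K), s => x xs q qs.
have [u cf b] := H _ xs _ qs; split => //; first exact: ccontM (ccont_cst c 0) cf.
by rewrite normcM -mulrA ler_wpM2l ?normc_ge0.
Qed.

Lemma intgD f g : tamef f -> tamef g -> intg (fun q => f q + g q) = intg f + intg g.
Proof.
move=> /tamef_tame[f1 f2] /tamef_tame[g1 g2]; rewrite /intg /plane_integral.
have -> : (fun z => complex.Re (psum (fun q => f q + g q) (toC z))) = fun z => rpart f z + rpart g z.
  by apply/funext => z; rewrite psumD ReD.
have -> : (fun z => complex.Im (psum (fun q => f q + g q) (toC z))) = fun z => ipart f z + ipart g z.
  by apply/funext => z; rewrite psumD ImD.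
by rewrite (tame_intD f1 g1) (tame_intD f2 g2).
Qed.

Lemma intgN f : tamef f -> intg (fun q => -1 * f q) = - intg f.
Proof.
move=> /tamef_tame[f1 f2]; rewrite /intg /plane_integral.
have -> : (fun z => complex.Re (psum (fun q => -1 * f q) (toC z))) = fun z => -1 * rpart f z.
  by apply/funext => z; rewrite psumZ !mulN1r ReN.
have -> : (fun z => complex.Im (psum (fun q => -1 * f q) (toC z))) = fun z => -1 * ipart f z.
  by apply/funext => z; rewrite psumZ !mulN1r ImN.
by rewrite (tame_intZ _ f1) (tame_intZ _ f2) !mulN1r.
Qed.

Lemma intg_eq f g : tamef f -> tamef g -> off_finite (fun q => f q = g q) -> intg f = intg g.
Proof.
move=> /tamef_tame[f1 f2] /tamef_tame[g1 g2] [s fg].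
pose S := coords [seq xof q | q <- s].
have E z : ~~ ongrid S z -> psum f (toC z) = psum g (toC z).
  move=> /coords_off zs; rewrite /psum big_seq [RHS]big_seq; apply: eq_bigr => q qs.
  have [pq px] := sheets_points qs; apply: fg => //; apply: contra zs => qs'.
  by apply/mapP; exists q => //; move: px; case: (q) => [[x y]|//] [->].
rewrite /intg /plane_integral; congr (_ +i* _).
  by apply: (tame_eq_integral f1 g1 (s := S)) => z /E; rewrite /rpart => ->.
by apply: (tame_eq_integral f2 g2 (s := S)) => z /E; rewrite /ipart => ->.
Qed.

Lemma intg0 f : tamef f -> Rintegral leb2 setT (rpart f) = 0 -> Rintegral leb2 setT (ipart f) = 0 -> intg f = 0.
Proof. by move=> _ h1 h2; rewrite /intg /plane_integral -/(rpart f) -/(ipart f) [X in X +i* _]h1 [X in _ +i* X]h2. Qed.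

Lemma toC1 (t b : R) : toC (t, b) = b%:C * 'i%C + t%:C * 1.
Proof. by rewrite /toC; simpc. Qed.

Lemma toC2 (a t : R) : toC (a, t) = a%:C + t%:C * 'i%C.
Proof. by rewrite /toC; simpc. Qed.

Lemma line_derive1 (F : C -> C) (a b : R) (p q : C) : rdiff F (toC (a, b)) p q ->
  is_derive a 1 (fun t => complex.Re (F (toC (t, b)))) (complex.Re p + complex.Re q) /\
  is_derive a 1 (fun t => complex.Im (F (toC (t, b)))) (complex.Im p + complex.Im q).
Proof.
rewrite toC1 => d; have h1 := rdiff_line d; have h2 := rdiff_lineIm d.
rewrite conjc1 !mulr1 ReD in h1; rewrite conjc1 !mulr1 ImD in h2.
have -> : (fun t => complex.Re (F (toC (t, b)))) = fun t => complex.Re (F (b%:C * 'i%C + t%:C * 1)).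
  by apply/funext => t; rewrite toC1.
have -> : (fun t => complex.Im (F (toC (t, b)))) = fun t => complex.Im (F (b%:C * 'i%C + t%:C * 1)).
  by apply/funext => t; rewrite toC1.
by [].
Qed.

Lemma line_derive2 (F : C -> C) (a b : R) (p q : C) : rdiff F (toC (a, b)) p q ->
  is_derive b 1 (fun t => complex.Re (F (toC (a, t)))) (-1 * complex.Im p + complex.Im q) /\
  is_derive b 1 (fun t => complex.Im (F (toC (a, t)))) (complex.Re p + -1 * complex.Re q).
Proof.
rewrite toC2 => d; have h1 := rdiff_line d; have h2 := rdiff_lineIm d.
have Ei : p * 'i%C + q * 'i^*%C = (- complex.Im p + complex.Im q) +i* (complex.Re p - complex.Re q).
  by case: p {d h1 h2} => p1 p2; case: q => q1 q2; rewrite /=; simpc.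
rewrite Ei /= in h1; rewrite Ei /= in h2; rewrite !mulN1r.
have -> : (fun t => complex.Re (F (toC (a, t)))) = fun t => complex.Re (F (a%:C + t%:C * 'i%C)).
  by apply/funext => t; rewrite toC2.
have -> : (fun t => complex.Im (F (toC (a, t)))) = fun t => complex.Im (F (a%:C + t%:C * 'i%C)).
  by apply/funext => t; rewrite toC2.
by [].
Qed.

(** The integrals of [del G] and [dbar G] are combinations of integrals of partial
    derivatives, in the x-plane, of the sum of [G] over the sheets.  By [form_good]
    these are dominated, and the sum tends to 0 at infinity by [inf_bound]. *)
Lemma stokes_ell G : (forall p, points p -> good p (fun q => dxdz p q * G q)) ->
  [/\ tamef (del G), tamef (dbar G), intg (del G) = 0 & intg (dbar G) = 0].
Proof.
move=> gG.
have [K [s H]] := @ell_uniform (fun K q => [/\ points q -> unbranched q, points q -> C1at (lf G q) 0,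
    normc (del G q) <= K * kapr (xof q) & normc (dbar G q) <= K * kapr (xof q)])
  ltac:(move=> K K' q KK [u c b1 b2]; split => //; [apply: le_trans b1 _|apply: le_trans b2 _]; rewrite ler_wpM2r ?kapr_ge0//)
  ltac:(move=> p pp; have [K K0 H] := form_good pp (gG p pp); exists K; apply: around_mono H => q _ _ [u c _ [b1 b2]]; by split).
have H' x : x \notin s -> forall q, q \in sheets EC x -> [/\ points q, unbranched q & C1at (lf G q) 0].
  by move=> xs q qs; have [pq _] := sheets_points qs; have [u c _ _] := H x xs q qs; split; [|exact: u|exact: c].
have tD : tamef (del G).
  exists K, s => x xs q qs; have [pq u c] := H' x xs q qs; have [_ _ b1 _] := H x xs q qs.
  by split => //; exact: (C1_del_ccont pq u c).1.
have tB : tamef (dbar G).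
  exists K, s => x xs q qs; have [pq u c] := H' x xs q qs; have [_ _ _ b2] := H x xs q qs.
  by split => //; exact: (C1_del_ccont pq u c).2.
have [tD1 tD2] := tamef_tame tD; have [tB1 tB2] := tamef_tame tB.
have dG x : x \notin s -> rdiff (psum G) x (psum (del G) x) (psum (dbar G) x).
  by move=> xs; apply: rdiff_psum => q /(H' x xs)[].
have [K1 K10 Hinf] := form_good (p := None) I (gG None I).
have [K2 K20 Hi] := inf_bound lam.
have vanish e : 0 < e -> exists A : R, forall z : R * R, A < `|z.1| \/ A < `|z.2| -> normc (psum G (toC z)) < e.
  move=> e0; have [r /gt0_Re[r0 r00 ->] Hr] := ell_around_and Hinf Hi.
  pose M := K1 * 8; have M0 : 0 <= M by rewrite mulr_ge0.
  exists (Num.max r0^-1 ((2 * M + 1) / e)) => z zA.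
  have zn : Num.max r0^-1 ((2 * M + 1) / e) < normc (toC z).
    by case: zA => h; apply: lt_le_trans h _; [exact: (Re_le (toC z))|exact: (Im_le (toC z))].
  move: zn; rewrite gt_max => /andP[n1 n2].
  have n0 : 0 < normc (toC z) by apply: lt_trans n1; rewrite invr_gt0.
  have b q : q \in sheets EC (toC z) -> normc (G q) <= M / normc (toC z).
    move=> qs; have [pq px] := sheets_points qs.
    case: q pq px {qs} => [[x y]|//] pq [xE]; subst x.
    have [|//|[_ _ h1 _] [_ _ h2]] := Hr (Some (toC z, y)) pq.
      by rewrite /= normc_real -fmorphV ltcR.
    by apply: le_trans h1 _; rewrite /M -mulrA; apply: ler_wpM2l.
  apply: le_lt_trans (normc_psum b) _.
  rewrite mulrA ltr_pdivrMr//; move: n2; rewrite ltr_pdivrMr// [_ * e]mulrC.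
  by apply: lt_trans; rewrite ltrDl.
have v1 : vanishes (rpart G).
  by move=> e /vanish[A HA]; exists A => z /HA; apply: le_lt_trans; exact: Re_le.
have v2 : vanishes (ipart G).
  by move=> e /vanish[A HA]; exists A => z /HA; apply: le_lt_trans; exact: Im_le.
pose S := coords s.
have cS f : tamef f -> exists S', forall z, ~~ ongrid S' z -> pcont (rpart f) z /\ pcont (ipart f) z.
  move=> tf; have [[S1 [_ [c1 _]]] [S2 [_ [c2 _]]]] := tamef_tame tf.
  by exists (S1 ++ S2) => z /ongrid_cat[/c1 h1 /c2 h2].
have [SD cD] := cS _ tD; have [SB cB] := cS _ tB.
(* The real and imaginary parts of both partial derivatives of psum G. *)
have e1 : Rintegral leb2 setT (fun z => rpart (del G) z + rpart (dbar G) z) = 0.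
  apply: (stokes1 (g := rpart G) (s := S ++ (SD ++ SB)) (tameD tD1 tB1)) => // z /ongrid_cat[/coords_off zs /ongrid_cat[/cD[c1 _] /cB[c2 _]]].
  split; first exact: pcontD.
  by have := dG _ zs; case: z {zs c1 c2} => a b /line_derive1[].
have e2 : Rintegral leb2 setT (fun z => ipart (del G) z + ipart (dbar G) z) = 0.
  apply: (stokes1 (g := ipart G) (s := S ++ (SD ++ SB)) (tameD tD2 tB2)) => // z /ongrid_cat[/coords_off zs /ongrid_cat[/cD[_ c1] /cB[_ c2]]].
  split; first exact: pcontD.
  by have := dG _ zs; case: z {zs c1 c2} => a b /line_derive1[].
have e3 : Rintegral leb2 setT (fun z => -1 * ipart (del G) z + ipart (dbar G) z) = 0.
  apply: (stokes2 (g := rpart G) (s := S ++ (SD ++ SB)) (tameD (tameZ (-1) tD2) tB2)) => // z /ongrid_cat[/coords_off zs /ongrid_cat[/cD[_ c1] /cB[_ c2]]].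
  split; first by apply: pcontD => //; exact: pcontZ.
  by have := dG _ zs; case: z {zs c1 c2} => a b /line_derive2[].
have e4 : Rintegral leb2 setT (fun z => rpart (del G) z + -1 * rpart (dbar G) z) = 0.
  apply: (stokes2 (g := ipart G) (s := S ++ (SD ++ SB)) (tameD tD1 (tameZ (-1) tB1))) => // z /ongrid_cat[/coords_off zs /ongrid_cat[/cD[c1 _] /cB[c2 _]]].
  split; first by apply: pcontD => //; exact: pcontZ.
  by have := dG _ zs; case: z {zs c1 c2} => a b /line_derive2[].
rewrite (tame_intD tD1 tB1) in e1; rewrite (tame_intD tD2 tB2) in e2.
rewrite (tame_intD (tameZ (-1) tD2) tB2) (tame_intZ _ tD2) in e3.
rewrite (tame_intD tD1 (tameZ (-1) tB1)) (tame_intZ _ tB1) in e4.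
have solve (x y : R) : x + y = 0 -> x + -1 * y = 0 -> x = 0 /\ y = 0 by move=> h1 h2; split; move: h1 h2; clear; lra.
have solve' (x y : R) : x + y = 0 -> -1 * x + y = 0 -> x = 0 /\ y = 0 by move=> h1 h2; split; move: h1 h2; clear; lra.
have [z1 z2] := solve _ _ e1 e4; have [z3 z4] := solve' _ _ e2 e3.
by split => //; apply: intg0.
Qed.

End Stokes.

(** * Exterior products of forms *)

Section Uniqueness.
Variables (R : realType) (lam : R[i]).
Hypotheses (lam0 : lam != 0) (lam1 : lam != 1).
Local Notation C := (R[i]).
Local Notation L1 := (P1 R).
Local Notation EC := (ell lam).
Local Notation P := (legendre lam).
Local Notation mfct := (pt EC -> 'M[C]_2).
Implicit Types (p q : pt EC) (f g : pt EC -> C).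

Lemma tamefJ f : tamef f -> tamef (fun q => (f q)^*%C).
Proof.
move=> [K [s H]]; exists K, s => x xs q qs; have [u c b] := H _ xs _ qs.
by split => //; [exact: ccontJ c|rewrite normc_conj].
Qed.

Notation leb2 := (@lebesgue_measure R \x @lebesgue_measure R)%E.

Lemma intgZ (c : C) f : tamef f -> intg (fun q => c * f q) = c * intg f.
Proof.
move=> /tamef_tame[f1 f2]; rewrite /intg /plane_integral; case: c => c1 c2.
have -> : (fun z => complex.Re (psum (fun q => (c1 +i* c2) * f q) (toC z))) = fun z => c1 * rpart f z + - c2 * ipart f z.
  by apply/funext => z; rewrite psumZ /rpart /ipart; case: (psum f _) => a b; rewrite /=; ring.
have -> : (fun z => complex.Im (psum (fun q => (c1 +i* c2) * f q) (toC z))) = fun z => c1 * ipart f z + c2 * rpart f z.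
  by apply/funext => z; rewrite psumZ /rpart /ipart; case: (psum f _) => a b; rewrite /=; ring.
rewrite (tame_intD (tameZ _ f1) (tameZ _ f2)) (tame_intD (tameZ _ f2) (tameZ _ f1)).
rewrite !(tame_intZ _ f1) !(tame_intZ _ f2).
have cmulE (a b c d : R) : (a +i* b) * (c +i* d) = (a * c - b * d) +i* (a * d + b * c) by [].
by rewrite mulNr; exact: esym (cmulE _ _ _ _).
Qed.

Lemma intgJ f : tamef f -> intg f = 0 -> intg (fun q => (f q)^*%C) = 0.
Proof.
move=> tf; have [f1 f2] := tamef_tame tf; rewrite /intg /plane_integral.
rewrite -/(rpart f) -/(ipart f) => -[h1 h2].
have pJ x : psum (fun q => (f q)^*%C) x = (psum f x)^*%C by rewrite /psum rmorph_sum.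
have -> : (fun z => complex.Re (psum (fun q => (f q)^*%C) (toC z))) = rpart f.
  by apply/funext => z; rewrite pJ /rpart; case: (psum f _).
have -> : (fun z => complex.Im (psum (fun q => (f q)^*%C) (toC z))) = fun z => -1 * ipart f z.
  by apply/funext => z; rewrite pJ /ipart mulN1r; case: (psum f _).
by rewrite (tame_intZ _ f2) [X in X +i* _]h1 [X in _ +i* (_ * X)]h2 mulr0.
Qed.

(** A special case of [ell_uniform], with a condition that does not depend on the
    constant. *)
Lemma ell_off_finite (Q : pt EC -> Prop) : (forall p, points p -> around p Q) -> off_finite Q.
Proof.
move=> H; have [_ [s Hs]] := @ell_uniform R lam (fun _ => Q) (fun _ _ _ _ h => h) (fun p pp => ex_intro _ 0 (H p pp)).
exists (None :: flatten [seq sheets EC x | x <- s]); case=> [[x y]|]; last by rewrite mem_head.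
move=> pq; rewrite in_cons /= => qs; apply: (Hs x _ _ (sheetsP pq)).
by apply: contra qs => xs; apply/flatten_mapP; exists x => //; exact: sheetsP.
Qed.

(** ** The Leibniz rule *)

Definition mlf (M : mfct) q (u : C) := M (lift q u).

Lemma mrd_del (M : mfct) q i j : mrd (mlf M q) 0 ->
  rdiff (lf (fun q => M q i j) q) 0 (mdel M q i j) (mdbar M q i j).
Proof.
move=> /(_ i j)[a [b d]]; have [h1 h2] := del_lf (f := fun q => M q i j) d.
by rewrite !mxE h1 h2.
Qed.

Lemma tr_scale (c d : C) (M N : 'M[C]_2) : \tr ((c *: M) *m (d *: N)) = c * d * \tr (M *m N).
Proof. by rewrite -scalemxAl -scalemxAr scalerA mxtraceZ. Qed.

(** The factor [s conj(s)] relates dx /\ d(conj x) to the area form of the local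
    parameter. *)
Lemma wedge_scale (s : C) (A1 A2 B1 B2 : 'M[C]_2) : s != 0 -> \tr (A1 *m B2) - \tr (A2 *m B1) =
  (\tr ((s^-1 *: A1) *m ((s^-1)^*%C *: B2)) + -1 * \tr (((s^-1)^*%C *: A2) *m (s^-1 *: B1))) * (s * s^*%C).
Proof.
move=> s0; have cs0 : s^*%C != 0 by rewrite conjc_eq0.
rewrite !tr_scale fmorphV; move: (\tr _) (\tr _) => t1 t2.
by rewrite /=; field; rewrite s0 cs0.
Qed.

Lemma tr_leibniz (K L M N : 'M[C]_2) : \tr (K *m L + M *m N) =
  K 0 0 * L 0 0 + M 0 0 * N 0 0 + (K 0 1 * L 1 0 + M 0 1 * N 1 0) +
  (K 1 0 * L 0 1 + M 1 0 * N 0 1 + (K 1 1 * L 1 1 + M 1 1 * N 1 1)).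
Proof.
have addE (S T : 'M[C]_2) i j : (S + T) i j = S i j + T i j by rewrite mxE.
by rewrite tr2E !addE !mul2E; ring.
Qed.

Lemma leibniz (M N : mfct) q : points q -> unbranched q -> mrd (mlf M q) 0 -> mrd (mlf N q) 0 ->
  rdiff (lf (fun q => \tr (M q *m N q)) q) 0 (\tr (mdel M q *m N q + M q *m mdel N q))
    (\tr (mdbar M q *m N q + M q *m mdbar N q)).
Proof.
move=> pq uq dM dN.
have pr i k := rdiffM (mrd_del i k dM) (mrd_del k i dN).
have := rdiffD (rdiffD (pr 0 0) (pr 0 1)) (rdiffD (pr 1 0) (pr 1 1)).
rewrite !lf0// => H; apply: rdiff_eqpq (rdiff_ext _ H) => [||u].
- by rewrite tr_leibniz.
- by rewrite tr_leibniz.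
- by rewrite /lf tr2E !mul2E.
Qed.

Lemma mrdN (M : C -> 'M[C]_2) x : mrd M x -> mrd (fun w => - M w) x.
Proof.
move=> d i j; have [a [b dij]] := d i j; exists (- a), (- b).
by apply: rdiff_ext (rdiffN dij) => w; rewrite mxE.
Qed.

Lemma mdelB (M N : mfct) q : mrd (mlf M q) 0 -> mrd (mlf N q) 0 ->
  mdel (fun q => M q - N q) q = mdel M q - mdel N q /\ mdbar (fun q => M q - N q) q = mdbar M q - mdbar N q.
Proof.
move=> dM dN.
have E i j : rdiff (lf (fun q => (M q - N q) i j) q) 0 (mdel M q i j - mdel N q i j) (mdbar M q i j - mdbar N q i j).
  by apply: rdiff_ext (rdiffB (mrd_del i j dM) (mrd_del i j dN)) => u; rewrite /lf !mxE.
split; apply/matrixP => i j; have [h1 h2] := del_lf (f := fun q => (M q - N q) i j) (E i j).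
  by rewrite mxE h1 [RHS]mxE; congr (_ + _); rewrite [RHS]mxE.
by rewrite mxE h2 [RHS]mxE; congr (_ + _); rewrite [RHS]mxE.
Qed.

(** ** Functions read in a frame *)

Variables (F : pconn EC) (T : seq (pt EC)).
Hypothesis frameF : forall p, points p -> around p (fun q => \det (cg F p q) != 0 /\
  exists K', mrdiff (mlf (cg F p) q) 0 K').

Lemma mrdZ (c : C -> C) (M : C -> 'M[C]_2) x a b : rdiff c x a b -> mrd M x -> mrd (fun u => c u *: M u) x.
Proof.
move=> dc dM i j; have [a' [b' d']] := dM i j; eexists; eexists.
by apply: rdiff_ext (rdiffM dc d') => u; rewrite mxE.
Qed.

Lemma unframe p (M : mfct) : points p ->
  around p (fun q => mrd (mlf (in_frame F p M) q) 0) -> around p (fun q => mrd (mlf M q) 0).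
Proof.
move=> pp dM; have aF := around_lift pp (frameF pp).
apply: around_mono (ell_around_and dM (ell_around_and (around_unbranched pp) aF)) => q pq _ [dN [uq [[dg [K' dK]] [d d0 H]]]].
pose K := mlf (cg F p) q.
have lift0 : lift q 0 = q.
  case: q pq uq {dN dg dK H K} => [[x y]|//] /points_Some yP /= y0.
  by rewrite -/(ybr lam x y 0) ybr0// addr0.
have dd : rdiff (fun u => \det (K u)) 0 (K' 0 0 * K 0 1 1 + K 0 0 0 * K' 1 1 - (K' 0 1 * K 0 1 0 + K 0 0 1 * K' 1 0)) 0.
  have := rdiffDh (rdiffMh (dK 0 0) (dK 1 1)) (rdiffZh (-1) (rdiffMh (dK 0 1) (dK 1 0))).
  by rewrite mulN1r; apply: rdiff_ext => u; rewrite det2E mulN1r.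
have K0 : \det (K 0) != 0 by rewrite /K /mlf lift0.
have di := rdiffV K0 dd; set e := _ / _ in di.
have dI : mrd (fun u => invmx (K u)) 0.
  apply: (@mrd_near _ (fun u => (\det (K u))^-1 *: adj2 (K u)) _ 0 d) => //.
    by move=> u /H[h _]; rewrite add0r inv2E.
  apply: (mrdZ di); apply: mfall; eexists; eexists.
  - by apply: rdiff_ext (dK 1 1) => u; have [-> _ _ _] := adj2E (K u).
  - by apply: rdiff_ext (rdiffN (dK 0 1)) => u; have [_ -> _ _] := adj2E (K u).
  - by apply: rdiff_ext (rdiffN (dK 1 0)) => u; have [_ _ -> _] := adj2E (K u).
  - by apply: rdiff_ext (dK 0 0) => u; have [_ _ _ ->] := adj2E (K u).
apply: (@mrd_near _ (fun u => K u *m mlf (in_frame F p M) q u *m invmx (K u)) _ 0 d) => //.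
  move=> u /H[h _]; have uK : K u \in unitmx by rewrite unitmxE unitfE.
  by rewrite add0r /mlf /in_frame -/(K u) !mulmxA mulmxV// mul1mx -mulmxA mulmxV// mulmx1.
by apply: mrd_mul => //; apply: mrd_mul => //; exact: mrdiff_mrd dK.
Qed.

Lemma good_mrd p (M : mfct) : (forall i j, good p (fun q => M q i j)) -> around p (fun q => mrd (mlf M q) 0).
Proof.
move=> gM; have H i j : around p (fun q => exists a b, rdiff (lf (fun q => M q i j) q) 0 a b).
  by have [K HK] := gM i j; apply: around_mono HK => q _ _ [/C1_rdiff].
apply: around_mono (ell_around_and (ell_around_and (H 0 0) (H 0 1)) (ell_around_and (H 1 0) (H 1 1))).
by move=> q _ _ [[h1 h2] [h3 h4]]; exact: mfall.
Qed.

Lemma psi1_neq0 p : points p -> around p (fun q => [/\ unbranched q, psi1 p q != 0 & dxdz p q = (psi1 p q)^-1]).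
Proof.
move=> pp; have [K _ H] := psi_bound lam0 lam1 pp.
by apply: around_mono (ell_around_and (around_unbranched pp) H) => q pq _ [uq [n0 _]]; split => //; exact: dxdz_psi.
Qed.

(** Near [p] the factor [dxdz] is the inverse of [psi1], hence can be removed. *)
Lemma form_mrd p (a : form1 EC) : points p -> form_smooth_at F p a ->
  around p (fun q => mrd (mlf a.1 q) 0 /\ mrd (mlf a.2 q) 0).
Proof.
move=> pp [s1 s2].
have g1 := good_mrd (fun i j => smooth_good lam0 lam1 pp (s1 i j)).
have g2 := good_mrd (fun i j => smooth_good lam0 lam1 pp (s2 i j)).
have aP := around_lift pp (psi1_neq0 pp).
apply: ell_around_and; apply: (unframe pp).
  apply: around_mono (ell_around_and g1 aP) => q pq _ [dM [[uq n0 _] [d d0 H]]].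
  have [_ dp] := psi_rdiff p pq uq.
  apply: (@mrd_near _ (fun u => lf (psi1 p) q u *: mlf (fun q => dxdz p q *: in_frame F p a.1 q) q u) _ 0 d) => //.
    by move=> u /H[_ n1 E]; rewrite add0r /mlf /lf scalerA E mulfV// scale1r.
  exact: mrdZ dp dM.
apply: around_mono (ell_around_and g2 aP) => q pq _ [dM [[uq n0 _] [d d0 H]]].
have [_ dp] := psi_rdiff p pq uq.
apply: (@mrd_near _ (fun u => (lf (psi1 p) q u)^*%C *: mlf (fun q => (dxdz p q)^*%C *: in_frame F p a.2 q) q u) _ 0 d) => //.
  move=> u /H[_ n1 E]; rewrite add0r /mlf /lf scalerA E -rmorphM mulfV// rmorph1 scale1r//.
exact: mrdZ (rdiffJ dp) dM.
Qed.

Lemma tr_frame p (M N : mfct) q : \det (cg F p q) != 0 -> \tr (M q *m N q) = \tr (in_frame F p M q *m in_frame F p N q).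
Proof.
move=> dg; have uK : cg F p q \in unitmx by rewrite unitmxE unitfE.
rewrite /in_frame !mulmxA -[_ *m cg F p q *m invmx _]mulmxA mulmxV// mulmx1.
by rewrite [RHS]mxtrace_mulC !mulmxA mulmxV// mul1mx.
Qed.

Lemma good_tr p (M N : mfct) : points p -> (forall i j, good p (fun q => M q i j)) -> (forall i j, good p (fun q => N q i j)) ->
  good p (fun q => \tr (M q *m N q)).
Proof.
move=> pp gM gN; have m i j k l := goodM pp (gM i j) (gN k l).
have := goodD pp (goodD pp (m 0 0 0 0) (m 0 1 1 0)) (goodD pp (m 1 0 0 1) (m 1 1 1 1)).
by apply: good_eq => //; exists 1 => // q _ _ _; rewrite tr2E !mul2E.
Qed.

Definition wedge (a b : form1 EC) q : C := \tr (a.1 q *m b.2 q - a.2 q *m b.1 q).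

(** The product is smooth in the local parameter, and passing to [x] multiplies it
    by |psi1|^2. *)
Lemma wedge_tame a b : closed_cs_form T F a -> closed_cs_form T F b -> tamef (wedge a b).
Proof.
move=> [sa _ _ ca] [sb _ _ cb].
pose Q (K : R) q := points q -> [/\ unbranched q, ccont (lf (wedge a b) q) 0 & normc (wedge a b q) <= K * kapr lam (xof q)].
have mono K K' q : K <= K' -> Q K q -> Q K' q.
  move=> KK h /h[u c b1]; split => //; apply: le_trans b1 _; by rewrite ler_wpM2r ?kapr_ge0.
suff loc p : points p -> exists K, around p (Q K).
  have [K [s H]] := ell_uniform mono loc.
  exists K, s => x xs q qs; exact: H x xs q qs (sheets_points qs).1.
move=> pp; have [pT|pT] := boolP (p \in T).
  have z : around p (fun q => wedge a b q = 0).
    apply: around_mono (ca p pT) => q _ _ [h1 h2]; by rewrite /wedge h1 h2 !mul0mx subrr mxtrace0.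
  exists 0; apply: around_mono (ell_around_and (around_unbranched pp) (around_lift pp z)) => q pq _ [uq [z0 [d d0 H]]] _.
  split => //; last by rewrite z0 normc0 mul0r.
  by apply: ccont_near (ccont_cst 0 0); exists d => [//|u /H]; rewrite add0r.
have [s1 s2] := sa p pp pT; have [r1 r2] := sb p pp pT.
have g1 i j := smooth_good lam0 lam1 pp (s1 i j); have g2 i j := smooth_good lam0 lam1 pp (s2 i j).
have h1 i j := smooth_good lam0 lam1 pp (r1 i j); have h2 i j := smooth_good lam0 lam1 pp (r2 i j).
pose N q := \tr ((dxdz p q *: in_frame F p a.1 q) *m ((dxdz p q)^*%C *: in_frame F p b.2 q))
  + -1 * \tr (((dxdz p q)^*%C *: in_frame F p a.2 q) *m (dxdz p q *: in_frame F p b.1 q)).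
have gN : good p N by apply: goodD => //; [exact: good_tr|apply: goodM => //; [exact: good_cst|exact: good_tr]].
have [K K0 HN] := good_ge0 pp gN; have [K' K'0 Hb] := psi_bound lam0 lam1 pp.
have E : around p (fun q => [/\ unbranched q, psi1 p q != 0 & wedge a b q = N q * (psi1 p q * (psi1 p q)^*%C)]).
  apply: around_mono (ell_around_and (frameF pp) (psi1_neq0 pp)) => q _ _ [[dg _] [uq n0 Ed]]; split => //.
  rewrite /wedge raddfB /= (tr_frame _ _ dg) (tr_frame a.2 b.1 dg) /N Ed.
  exact: (wedge_scale (in_frame F p a.1 q) (in_frame F p a.2 q) (in_frame F p b.1 q) (in_frame F p b.2 q) n0).
exists (K * K'); apply: around_mono (ell_around_and (ell_around_and HN Hb) (ell_around_and (psi1_C1 p pp) (around_lift pp E))).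
move=> q pq _ [[[cN bN _ _] [_ bb]] [cs [[uq n0 E0] [d d0 H]]]] _; split => //.
  have cc := C1_ccont (C1M cN (C1M cs (C1J cs))).
  by apply: ccont_near cc; exists d => // u /H[_ _]; rewrite add0r /lf => ->.
rewrite E0 !normcM normc_conj -expr2 -mulrA; apply: ler_pM => //; rewrite ?normc_ge0 ?exprn_ge0 ?normc_ge0//.
by apply: le_trans bb; rewrite lerDl normc_ge0.
Qed.

End Uniqueness.

(** * Independence of the representatives *)

Section Final.
Variables (R : realType) (lam : R[i]).
Hypotheses (lam0 : lam != 0) (lam1 : lam != 1).
Local Notation C := (R[i]).
Local Notation L1 := (P1 R).
Local Notation EC := (ell lam).
Local Notation P := (legendre lam).
Local Notation W := (Wpts lam).
Local Notation pi := (@piC R lam).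
Implicit Types (p q : pt EC) (f g : pt EC -> C).

Lemma tr_comm (A X Y : 'M[C]_2) : \tr (comm A X *m Y) = - \tr (X *m comm A Y).
Proof.
have cyc : \tr (A *m X *m Y) = \tr (X *m Y *m A) by rewrite -mulmxA mxtrace_mulC.
have trB (M N : 'M[C]_2) : \tr (M - N) = \tr M - \tr N by exact: raddfB.
by rewrite /comm mulmxBl mulmxBr !trB !mulmxA opprB cyc.
Qed.

Lemma conj_swapM (x y : C) : (x^*%C * y)^*%C = x * y^*%C.
Proof. by case: x y => [a b] [c d]; congr (_ +i* _); rewrite /=; ring. Qed.

Lemma commB (A X Y : 'M[C]_2) : comm A (X - Y) = comm A X - comm A Y.
Proof. by rewrite /comm mulmxBr mulmxBl !opprB addrACA [RHS]addrACA [_ + - (X *m A)]addrC -!addrA. Qed.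

(** By [tr_comm] the commutator with the connection matrix moves from [f - f'] to
    [b2], where closedness, the hypothesis, absorbs it. *)
Lemma stokes_algebra (B A f f' Df Df' a2' Z b1 b2 Db2 Eb1 : 'M[C]_2) : Db2 + comm A b2 - Eb1 = 0 ->
  \tr ((B + (Df + comm A f)) *m b2 - (a2' + Z) *m b1) = \tr ((B + (Df' + comm A f')) *m b2 - a2' *m b1) +
  (\tr ((Df - Df') *m b2 + (f - f') *m Db2) + -1 * \tr (Z *m b1 + (f - f') *m Eb1)).
Proof.
move=> /eqP; rewrite subr_eq0 => /eqP <-.
have -> : B + (Df + comm A f) = B + (Df' + comm A f') + (Df - Df') + comm A (f - f').
  rewrite commB; apply/matrixP => i j; rewrite !mxE.
  by move: (B i j) (Df i j) (Df' i j) (comm A f i j) (comm A f' i j) => ? ? ? ? ?; ring.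
have := tr_comm A (f - f') b2.
move: (B + _) (Df - Df') (f - f') (comm A (f - f')) (comm A b2) => a1 X ph Cph Cb e.
have trD (M N : 'M[C]_2) : \tr (M + N) = \tr M + \tr N by exact: raddfD.
have trB (M N : 'M[C]_2) : \tr (M - N) = \tr M - \tr N by exact: raddfB.
rewrite trB (mulmxDl _ Cph) (mulmxDl a1) (mulmxDl a2') trD trD trD e.
rewrite trB trD trD (mulmxDr ph) trD.
move: (\tr (a1 *m b2)) (\tr (X *m b2)) (\tr (ph *m Cb)) (\tr (a2' *m b1)) (\tr (Z *m b1)) (\tr (ph *m Db2)).
by clear; move=> x1 x2 x3 x4 x5 x6; ring.
Qed.

Section Half.
Variables (F : pconn EC) (T : seq (pt EC)) (v : deformation EC).
Hypothesis frameF : forall p, points p -> around p (fun q => \det (cg F p q) != 0 /\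
  exists K', mrdiff (mlf (cg F p) q) 0 K').
Hypothesis smoothh : forall p, points p -> around p (fun q => exists K', mrdiff (mlf (dh v p) q) 0 K').

Lemma in_frameB p (M N : pt EC -> 'M[C]_2) q : in_frame F p (fun q => M q - N q) q = in_frame F p M q - in_frame F p N q.
Proof. by rewrite /in_frame mulmxBr mulmxBl. Qed.

(** Two representatives differ by the covariant derivative of [ph = f - f'], and its
    product with the closed form [b] is the differential of tr(ph b).  The part of
    type (0,1) of the latter is brought to type (1,0) by conjugation, and
    [stokes_ell] applies to both. *)
Lemma wedge_class a a' b : closed_cs_form T F a -> represents T F v a -> closed_cs_form T F a' -> represents T F v a' ->
  closed_cs_form T F b -> intg (wedge a b) = intg (wedge a' b).
Proof.
move=> ca [f [_ sf ef]] ca' [f' [_ sf' ef']] cb.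
have ta := wedge_tame lam0 lam1 frameF ca cb; have ta' := wedge_tame lam0 lam1 frameF ca' cb.
case: cb => sb _ clb zb.
pose ph q := f q - f' q.
have gY p : points p -> p \notin T -> forall i j, good p (fun q => in_frame F p ph q i j).
  move=> pp pT i j.
  have g1 := smooth_good lam0 lam1 pp (sf p pp pT i j); have g2 := smooth_good lam0 lam1 pp (sf' p pp pT i j).
  have := goodD pp g1 (goodM pp (good_cst (-1) pp) g2); apply: good_eq => //; exists 1 => // q _ _ _.
  rewrite mulN1r /ph !in_frameB.
  have addE (S U : 'M[C]_2) : (S - U) i j = S i j - U i j by rewrite !mxE.
  move: (in_frame F p f q) (in_frame F p f' q) (in_frame F p (dh v p) q) => x1 x2 x3 in addE *.
  rewrite 3!addE; move: (x1 i j) (x2 i j) (x3 i j).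
  by clear; move=> y1 y2 y3; ring.
(* Near T the form b vanishes; elsewhere both factors are smooth in the frame at p. *)
pose G1 q := \tr (ph q *m b.1 q); pose G2 q := \tr (ph q *m b.2 q); pose cG2 q := (G2 q)^*%C.
have zero p (pp : points p) : good p (fun=> 0 : C) by exact: good_cst.
have gG1 p : points p -> good p (fun q => dxdz p q * G1 q).
  move=> pp; have [pT|pT] := boolP (p \in T).
    apply: good_eq (zero p pp) => //; apply: around_mono (zb p pT) => q _ _ [h1 _].
    by rewrite /G1 h1 mulmx0 mxtrace0 mulr0.
  have [s1 _] := sb p pp pT.
  have gB i j := smooth_good lam0 lam1 pp (s1 i j).
  apply: good_eq (good_tr pp (gY p pp pT) gB) => //.
  apply: around_mono (frameF pp) => q _ _ [dg _].
  by rewrite /G1 (tr_frame ph b.1 dg) -scalemxAr mxtraceZ.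
have gG2 p : points p -> good p (fun q => dxdz p q * cG2 q).
  move=> pp; have [pT|pT] := boolP (p \in T).
    apply: good_eq (zero p pp) => //; apply: around_mono (zb p pT) => q _ _ [_ h2].
    by rewrite /cG2 /G2 h2 mulmx0 mxtrace0 conjc0 mulr0.
  have [_ s2] := sb p pp pT.
  have gB i j := smooth_good lam0 lam1 pp (s2 i j).
  apply: good_eq (goodJ pp (good_tr pp (gY p pp pT) gB)) => //.
  apply: around_mono (frameF pp) => q _ _ [dg _].
  by rewrite /cG2 /G2 (tr_frame ph b.2 dg) -scalemxAr mxtraceZ; exact: conj_swapM.
have [_ t1 _ i1] := stokes_ell lam0 lam1 gG1; have [_ t2 _ i2] := stokes_ell lam0 lam1 gG2.
have t3 := tamefJ t2; have i3 := intgJ t2 i2.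
have t4 := tamefD t3 (tamefZ (-1) t1).
suff E : off_finite (fun q => wedge a b q = wedge a' b q + ((dbar cG2 q)^*%C + -1 * dbar G1 q)).
  rewrite (intg_eq ta (tamefD ta' t4) E) (intgD ta' t4) (intgD t3 (tamefZ (-1) t1)) (intgN t1).
  by rewrite i3 i1 subr0 addr0.
(* Near T nothing is known of f, but there b vanishes. *)
have RR : off_finite (fun q => [/\ b.1 q = 0, b.2 q = 0, dbar G1 q = 0 & dbar cG2 q = 0] \/
    [/\ points q, unbranched q, mrd (mlf f q) 0 /\ mrd (mlf f' q) 0 & mrd (mlf b.1 q) 0 /\ mrd (mlf b.2 q) 0]).
  apply: ell_off_finite => p pp; have [pT|pT] := boolP (p \in T).
    apply: around_mono (around_lift pp (zb p pT)) => q _ _ [[h1 h2] [d d0 H]]; left.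
    have z1 : near_eq 0 (fun=> 0) (lf G1 q).
      by exists d => [//|u /H[k1 _]]; rewrite /lf /G1 add0r k1 mulmx0 mxtrace0.
    have z2 : near_eq 0 (fun=> 0) (lf cG2 q).
      by exists d => [//|u /H[_ k2]]; rewrite /lf /cG2 /G2 add0r k2 mulmx0 mxtrace0 conjc0.
    have [_ d1] := del_lf (rdiff_near z1 (rdiff_cst 0 0)); have [_ d2] := del_lf (rdiff_near z2 (rdiff_cst 0 0)).
    by split.
  have fm := form_mrd lam0 lam1 frameF pp (sb p pp pT).
  have fr (k : pt EC -> 'M[C]_2) : msmooth_at p (in_frame F p (fun q => k q - dh v p q)) -> around p (fun q => mrd (mlf k q) 0).
    move=> sk; have := unframe frameF pp (good_mrd (fun i j => smooth_good lam0 lam1 pp (sk i j))).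
    move=> dk; apply: around_mono (ell_around_and dk (smoothh pp)) => q _ _ [h1 [K' h2]].
    apply: (@mrd_near _ _ _ 0 1 ltr01 _ (mrdD h1 (mrdiff_mrd h2))) => u _.
    by rewrite add0r /mlf subrK.
  have d1 := fr f (sf p pp pT); have d2 := fr f' (sf' p pp pT).
  apply: around_mono (ell_around_and (ell_around_and d1 d2) (ell_around_and fm (around_unbranched pp))) => q pq _ [[h1 h2] [h3 uq]].
  by right.
apply: off_finite_mono (off_finite_and RR (off_finite_and (off_finite_and ef ef') clb)) => q _.
move=> [[[b10 b20 g10 g20]|[pq uq [df df'] [db1 db2]]] [[[a1E a2E] [a1E' a2E']] clE]].
  by rewrite /wedge b10 b20 g10 g20 !mulmx0 conjc0 mulr0 !addr0.
have dph : mrd (mlf ph q) 0 by exact: mrdD df (mrdN df').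
have [phE phE'] := mdelB df df'.
have [_ ->] := del_lf (leibniz pq uq dph db1).
have [_ ->] := del_lf (f := cG2) (rdiffJ (leibniz pq uq dph db2)).
rewrite conjcK -/ph in phE phE' *; rewrite phE phE' /wedge a1E a2E a1E' a2E' /nabla10.
have := stokes_algebra (dB v q) (f q) (f' q) (mdel f q) (mdel f' q) (mdbar f' q) (mdbar f q - mdbar f' q) (b.1 q) clE.
by rewrite [mdbar f' q + _]addrC subrK.
Qed.

End Half.

Lemma wedgeC (a b : form1 EC) q : wedge a b q = -1 * wedge b a q.
Proof.
rewrite /wedge !raddfB /= (mxtrace_mulC (a.1 q)) (mxtrace_mulC (a.2 q)); ring.
Qed.

(** By [wedge_class] in each argument, the product being antisymmetric. *)
Lemma wedge_unique (F : pconn EC) (T : seq (pt EC)) (v w : deformation EC) a a' b b' :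
  (forall p, points p -> around p (fun q => \det (cg F p q) != 0 /\ exists K', mrdiff (mlf (cg F p) q) 0 K')) ->
  (forall p, points p -> around p (fun q => exists K', mrdiff (mlf (dh v p) q) 0 K')) ->
  (forall p, points p -> around p (fun q => exists K', mrdiff (mlf (dh w p) q) 0 K')) ->
  closed_cs_form T F a -> represents T F v a -> closed_cs_form T F a' -> represents T F v a' ->
  closed_cs_form T F b -> represents T F w b -> closed_cs_form T F b' -> represents T F w b' ->
  int_tr_wedge a b = int_tr_wedge a' b'.
Proof.
move=> fF hv hw ca ra ca' ra' cb rb cb' rb'.
have E (c d : form1 EC) : closed_cs_form T F c -> closed_cs_form T F d ->
    int_tr_wedge c d = (- 2%:R * 'i) * intg (wedge c d).
  by move=> cc cd; rewrite -(intgZ _ (wedge_tame lam0 lam1 fF cc cd)).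
rewrite (E a b ca cb) (E a' b' ca' cb'); apply: congr1.
rewrite (wedge_class fF hv ca ra ca' ra' cb).
have sw (c d : form1 EC) : closed_cs_form T F c -> closed_cs_form T F d -> intg (wedge c d) = - intg (wedge d c).
  move=> cc cd; rewrite -(intgN (wedge_tame lam0 lam1 fF cd cc)); congr intg.
  by apply/funext => q; exact: wedgeC.
by rewrite (sw a' b ca' cb) (sw a' b' ca' cb') (wedge_class fF hw cb rb cb' rb' ca').
Qed.

(** * The factor 2 *)

Lemma pull_mrdiff (M : pt L1 -> 'M[C]_2) p : points p -> mrational M ->
  around p (fun q => exists K', mrdiff (mlf (fun q => M (pi q)) q) 0 K').
Proof.
move=> pp rM; have := around_pull pp (off_finite_around (pi p) (mrational_mrdiff rM)) => H.
apply: around_mono (ell_around_and (around_unbranched pp) H) => -[[x y]|]; last by move=> _ _ [].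
move=> pq _ [uq /(_ x erefl) dM]; exists (mdel M (Some x)) => i j.
have dM' : rdiff (fun z => M (Some z) i j) (x + 0) (mdel M (Some x) i j) 0 by rewrite addr0; exact: dM.
by have := rdiff_holcomp (rdiff_shift x) dM'; rewrite mulr1.
Qed.

Lemma Phi_frames (E : pconn L1) : (forall p : pt L1, mrational (cg E p)) ->
  (forall p : pt L1, off_finite (fun q : pt L1 => \det (cg E p q) != 0)) -> forall p, points p ->
  around p (fun q => \det (cg (Phi lam E) p q) != 0 /\ exists K', mrdiff (mlf (cg (Phi lam E) p) q) 0 K').
Proof.
move=> rg dg p pp; have dgp := around_pull pp (off_finite_around (pi p) (dg (pi p))).
have dK := pull_mrdiff pp (rg (pi p)).
have [pW|pW] := boolP (p \in W); last first.
  apply: around_mono (ell_around_and dgp dK) => q pq _ [h1 [K' h2]]; rewrite cg_offW//; split => //.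
  by exists K' => i j; apply: rdiff_ext (h2 i j) => u; rewrite /mlf cg_offW.
have [H1 [H2 [_ _ _ Hloc]]] := branch_equation lam0 lam1 pW.
apply: around_mono (ell_around_and (ell_around_and dgp dK) (ell_around_and (around_unbranched pp) (Hloc 1 1 ltr01 ltr01))).
move=> q pq _ [[h1 [K' h2]] [uq [[s0 l0] _ _ _ _]]].
split.
  rewrite cg_W//; rewrite detZ det_mulmx detZ.
  have -> : \det (swap_mx (unif p q)) = - unif p q by rewrite det2E !mxE /=; ring.
  by rewrite !mulf_neq0 ?expf_neq0 ?invr_neq0// oppr_eq0.
have [ds _] := psi_rdiff p pq uq.
have s0' : lf (unif p) q 0 != 0 by rewrite lf0.
have di := rdiffV s0' ds; set e := _ / _ in di.
have [l' dl] : exists l', rdiff (fun u => lg (xi0 lam) (pi p) (pi (lift q u))) 0 l' 0.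
  case: (p) l0 => [[a b]|] /=; first by move=> _; exists 0; exact: rdiff_cst.
  case: (q) pq uq => [[x y]|//] /points_Some yP /= y0 xi.
  have x0 : x + 0 != 0 by rewrite addr0; move: xi; rewrite invr_eq0.
  exists (- 1 / (x + 0) ^+ 2); exact: rdiffV x0 (rdiff_shift x).
have dsw i j : exists k, rdiff (fun u => swap_mx (lf (unif p) q u) i j) 0 k 0.
  move: i j; apply: mfall; [exists 0|exists 0|eexists|exists 0].
  - by apply: rdiff_ext (rdiff_cst 0 0) => u; rewrite mxE.
  - by apply: rdiff_ext (rdiff_cst 1 0) => u; rewrite mxE.
  - by apply: rdiff_ext ds => u; rewrite mxE.
  - by apply: rdiff_ext (rdiff_cst 0 0) => u; rewrite mxE.
suff key i j : exists k, rdiff (fun u => cg (Phi lam E) p (lift q u) i j) 0 k 0.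
  have [k00 d00] := key 0 0; have [k01 d01] := key 0 1; have [k10 d10] := key 1 0; have [k11 d11] := key 1 1.
  exists (\matrix_(i, j) (if i == 0 then (if j == 0 then k00 else k01) else (if j == 0 then k10 else k11))).
  by apply: mfall; rewrite mxE.
have [k0 e0] := dsw 0 j; have [k1 e1] := dsw 1 j.
eexists; apply: rdiff_ext (rdiffMh dl (rdiffDh (rdiffMh (rdiffMh di (h2 i 0)) e0) (rdiffMh (rdiffMh di (h2 i 1)) e1))) => u.
have scE (c : C) (X : 'M[C]_2) k l : (c *: X) k l = c * X k l by rewrite mxE.
by rewrite cg_W// scE mul2E !scE.
Qed.

Local Notation leb2 := (@lebesgue_measure R \x @lebesgue_measure R)%E.

(** The two sheets contribute equally. *)
Lemma int_pull (E : pconn L1) (t : C) (a b : form1 L1) :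
  (forall p : pt L1, mrational (cg E p)) -> (forall p : pt L1, off_finite (fun q : pt L1 => \det (cg E p q) != 0)) ->
  closed_cs_form (D_P1 lam t) E a -> closed_cs_form (D_P1 lam t) E b ->
  int_tr_wedge (pull_form lam a) (pull_form lam b) = 2%:R * int_tr_wedge a b.
Proof.
move=> rg dg ca cb.
have tw := wedge_tame lam0 lam1 (Phi_frames rg dg) (closed_cs_pull lam0 lam1 ca) (closed_cs_pull lam0 lam1 cb).
pose k := - 2%:R * 'i : C.
have [f1 f2] := tamef_tame (tamefZ k tw).
pose h (z : R * R) := k * \tr (a.1 (Some (toC z)) *m b.2 (Some (toC z)) - a.2 (Some (toC z)) *m b.1 (Some (toC z))).
pose pw q := k * wedge (pull_form lam a) (pull_form lam b) q.
have E2 z : psum pw (toC z) = 2%:R * h z.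
  by rewrite /psum big_cons big_seq1 mulr_natl mulr2n.
have -> : int_tr_wedge a b = plane_integral h.
  rewrite /int_tr_wedge; apply: (congr1 (@plane_integral R)); apply/funext => z.
  by rewrite big_seq1.
have rE : (fun z => complex.Re (h z)) = fun z => 2^-1 * rpart pw z.
  apply/funext => z; rewrite /rpart E2; case: (h z) => x y.
  by rewrite mulr_natl mulr2n /=; field.
have iE : (fun z => complex.Im (h z)) = fun z => 2^-1 * ipart pw z.
  apply/funext => z; rewrite /ipart E2; case: (h z) => x y.
  by rewrite mulr_natl mulr2n /=; field.
rewrite /plane_integral rE iE (tame_intZ _ f1) (tame_intZ _ f2).
rewrite mulr_natl mulr2n -[LHS]/(Rintegral leb2 setT (rpart pw) +i* Rintegral leb2 setT (ipart pw)).
move: (Rintegral leb2 setT (rpart pw)) (Rintegral leb2 setT (ipart pw)) => x y.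
by congr (_ +i* _); rewrite [RHS]/=; field.
Qed.

End Final.

Local Close Scope classical_set_scope.

Theorem corollary4p5 (R : realType) (lam t nu : R[i]) (mu : R)
    (lam_neq : lam != 0 /\ lam != 1)
    (t_neq : [/\ t != 0, t != 1 & t != lam])
    (nu_nonint : forall m : int, 2%:R * nu != m%:~R)
    (mu_bounds : 0 < mu /\ mu < 1)
    (E : pconn (P1 R))
    (E_Con : Con (D_P1 lam t) (nu_P1 t nu) (mu_P1 t mu) E)
    (v w : deformation (P1 R))
    (v_tangent : tangent (D_P1 lam t) E v)
    (w_tangent : tangent (D_P1 lam t) E w) :
  omegaAB (T_C lam t) (Phi lam E) (dPhi lam v) (dPhi lam w)
  = 2%:R * omegaAB (D_P1 lam t) E v w.
Proof.
have [lam0 lam1] := lam_neq; have [t0 t1 tl] := t_neq.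
have [[bg1 bg2 _] _ _ _] := E_Con.
have rg (p : pt (P1 R)) : mrational (cg E p) by exact: bg1.
have dg (p : pt (P1 R)) : off_finite (fun q : pt (P1 R) => \det (cg E p q) != 0) by exact: bg2.
have [dv [a0 [ca0 ra0]]] := v_tangent; have [dw [b0 [cb0 rb0]]] := w_tangent.
have smv (u : deformation (P1 R)) : is_deformation (D_P1 lam t) E u -> forall p : pt (ell lam), points p ->
    around p (fun q => exists K', mrdiff (mlf (dh (dPhi lam u) p) q) 0 K').
  move=> [[_ rh] _ _ _ _] p pp; exact: (pull_mrdiff pp (rh (piC p) I)).
have pc := closed_cs_pull lam0 lam1.
have pr := represents_pull lam0 lam1 t0 t1 tl E_Con.
rewrite {2}/omegaAB; set S := (X in xget 0 X).
have [a [b [ca ra cb rb ->]]] : S (xget 0 S).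
  by apply: xgetPex; exists (int_tr_wedge a0 b0), a0, b0.
rewrite -(int_pull lam0 lam1 rg dg ca cb).
apply: xget_unique => [|c [a' [b' [ca' ra' cb' rb' ->]]]].
  exists (pull_form lam a), (pull_form lam b); split=> //.
  - exact: pc.
  - exact: pr dv ca ra.
  - exact: pc.
  - exact: pr dw cb rb.
apply: (wedge_unique lam0 lam1 (Phi_frames lam0 lam1 rg dg) (smv v dv) (smv w dw)
  ca' ra' (pc _ _ _ ca) (pr _ _ dv ca ra) cb' rb' (pc _ _ _ cb) (pr _ _ dw cb rb)).
Qed.
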